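(* Let $t\in\{1,\dots,4\}$. Let $Z=\{z_1,\dots,z_t\}\subset\mathbb{P}^2$ be a set of general points and let $\mu: X=\mathrm{Bl}_Z\mathbb{P}^2\to\mathbb{P}^2$ be the del Pezzo surface embedded in $\mathbb{P}^{9-t}$ by the anticanonical linear system. Let $E_1,\dots,E_t$ be the exceptional divisors, and for $i\in\{1,\dots,t\}$ set \[Y_i=\{\{p_1,p_2\}\in X^{(2)}\mid p_1,p_2\notin E_1\cup\cdots\cup E_t\text{ and } z_i\in\langle \mu(p_1),\mu(p_2)\rangle\},\] \[U=\{\{p_1,p_2\}\in X^{(2)}\mid p_1,p_2\notin E_1\cup\cdots\cup E_t\text{ and } h^0(I_{Z\cup\{\mu(p_1),\mu(p_2)\}}(2))>0\}.\] Closures below are taken in $X^{(2)}$. \begin{enumerate} \item If $t=1$, then $\mathrm{Ter}_2(X)=\overline{Y_1}\cup E_1^{(2)}$ has a component of dimension $3$ and a component of dimension $2$. \item If $t\in\{2,3\}$, then $\mathrm{Ter}_2(X)=\overline{Y_1}\cup\cdots\cup\overline{Y_t}$ has $t$ components of dimension $3$. \item If $t=4$, then $\mathrm{Ter}_2(X)=\overline{Y_1}\cup\cdots\cup\overline{Y_4}\cup\overline{U}$ has five components of dimension $3$. \end{enumerate}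
   Context: The base field $\mathbb{K}$ is algebraically closed of characteristic $0$. $\mathrm{Bl}_Z\mathbb{P}^2$ is the blow-up of $\mathbb{P}^2$ at $Z$, and $E_i$ is the exceptional divisor over $z_i$. The anticanonical linear system is $3\mu^*(\ell)-E_1-\cdots-E_t$, where $\ell$ is the class of a line; it is the pullback of the system of plane cubics containing $Z$ and embeds $X$ in $\mathbb{P}^{9-t}$. $I_W(2)$ denotes the ideal sheaf of $W\subset\mathbb{P}^2$ twisted by $\mathcal{O}_{\mathbb{P}^2}(2)$, so $h^0(I_W(2))$ is the dimension of the vector space of conics containing $W$. For a variety $V$, $V^{(r)}$ denotes the variety of unordered sets of $r$ distinct points of $V$. For a nondegenerate irreducible variety $X\subset\mathbb{P}^N$ with set of smooth points $X_{sm}$ and embedded tangent spaces $T_pX$, the $r$-Terracini locus is \[\mathrm{Ter}_r(X)=\overline{\{\{p_1,\ldots,p_r\}\in X_{sm}^{(r)}\mid \dim\langle T_{p_1}X,\ldots,T_{p_r}X\rangle<r(\dim X+1)-1\}},\] where $\langle\cdot\rangle$ denotes linear span and the closure is taken in $X_{sm}^{(r)}$. ''Component'' means irreducible component. *)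

(* Defs.v *)
From HB Require Import structures.
From mathcomp Require Import all_boot all_order all_algebra finmap.
From mathcomp Require Import boolp classical_sets functions cardinality.
From mathcomp Require Import topology.
(* the notations of mpoly clash with those of the analysis library *)
From mathcomp.multinomials Require Import -(notations) mpoly.

Set Implicit Arguments.
Unset Strict Implicit.
Unset Printing Implicit Defensive.

Import GRing.Theory.
Local Open Scope classical_set_scope.
Local Open Scope ring_scope.

Section Dimension.
Variable T : topologicalType.
Implicit Types S A C D : set T.

Definition irreducible_set A :=
  A !=set0 /\ forall C D, closed C -> closed D ->
    A `<=` C `|` D -> A `<=` C \/ A `<=` D.

(* Maximality among irreducible subsets of S forces C to be closed in S. *)
Definition irr_component S C :=
  [/\ C `<=` S, irreducible_set C &
      forall D, D `<=` S -> irreducible_set D -> C `<=` D -> D = C].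

(* c 0 < c 1 < ... < c d, irreducible and closed in the subspace S *)
Definition irr_chain S (c : nat -> set T) (d : nat) :=
  (forall i, (i <= d)%N ->
     irreducible_set (c i) /\ c i = S `&` closure (c i)) /\
  (forall i, (i < d)%N -> c i `<` c i.+1).

(* Krull dimension of the subspace S *)
Definition has_dim S (d : nat) :=
  forall e, (exists c, irr_chain S c e) <-> (e <= d)%N.

End Dimension.

(* Lines through the origin in K^(n+1). *)
Definition projsp (K : fieldType) (n : nat) :=
  {L : {vspace 'rV[K]_n.+1} | \dim L == 1%N}.
HB.instance Definition _ K n := Choice.on (projsp K n).

(* Homogeneous coordinates; all uses below are invariant under rescaling. *)
Definition hcoord (K : fieldType) n (p : projsp K n) : 'I_n.+1 -> K :=
  fun i => vpick (val p) 0 i.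

Section ProjTopology.
Variables (K : fieldType) (n : nat).

Definition homogeneous (f : mpoly n.+1 K) := exists d, f \is ishomog1 d mdeg.

Definition projsp_zeros (S : set (mpoly n.+1 K)) : set (projsp K n) :=
  [set p | forall f, S f -> meval (hcoord p) f = 0].

Definition projsp_open (U : set (projsp K n)) :=
  exists2 S : set (mpoly n.+1 K), S `<=` homogeneous & ~` U = projsp_zeros S.

Lemma projsp_openT : projsp_open setT.
Proof.
exists [set 1]; first by move=> _ ->; exists 0%N; exact: dhomog1.
rewrite setCT; apply/seteqP; split=> // p /(_ 1 erefl).
by rewrite meval1 => /eqP; rewrite oner_eq0.
Qed.

Lemma projsp_openI : setI_closed projsp_open.
Proof.
move=> U V [S hS US] [S' hS' VS'].
exists [set h | exists f g, [/\ S f, S' g & h = f * g]].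
  move=> _ [f [g [/hS[d hf] /hS'[e hg] ->]]]; exists (d + e)%N.
  exact: dhomogM.
rewrite setCI US VS'; apply/seteqP; split=> p.
  move=> [] hp _ [f [g [Sf Sg ->]]]; rewrite mevalM.
    by rewrite (hp f Sf) mul0r.
  by rewrite (hp g Sg) mulr0.
move=> hp; have [|/existsNP[f /not_implyP[Sf fp]]] := pselect (projsp_zeros S p).
  by left.
right=> g Sg; have /eqP := hp (f * g) (ex_intro _ f (ex_intro _ g (And3 Sf Sg erefl))).
by rewrite mevalM mulf_eq0 => /orP[/eqP//|/eqP].
Qed.

Lemma projsp_open_bigU (J : Type) (F : J -> set (projsp K n)) :
  (forall j, projsp_open (F j)) -> projsp_open (\bigcup_j F j).
Proof.
move=> oF; exists [set f | exists j S, [/\ S `<=` homogeneous,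
    ~` F j = projsp_zeros S & S f]].
  by move=> f [j [S [hS _ /hS]]].
rewrite setC_bigcup; apply/seteqP; split=> p.
  by move=> hp f [j [S [_ FS Sf]]]; have := hp j I; rewrite FS; exact.
move=> hp j _; have [S hS FS] := oF j; rewrite FS => f Sf.
by apply: hp; exists j, S.
Qed.

(* Zariski topology of P^n *)
HB.instance Definition _ := isOpenTopological.Build (projsp K n)
  projsp_openT projsp_openI projsp_open_bigU.

End ProjTopology.

(* The product of the projective spaces P^(n i). *)
Definition mproj (K : fieldType) (I : finType) (n : I -> nat) :=
  forall i, projsp K (n i).
HB.instance Definition _ K I n := gen_eqMixin (@mproj K I n).
HB.instance Definition _ K I n := gen_choiceMixin (@mproj K I n).

Section MProjTopology.
Variables (K : fieldType) (I : finType) (n : I -> nat).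

(* One variable for each homogeneous coordinate of each factor. *)
Definition mvar := {i : I & 'I_(n i).+1}.

Local Notation poly_ring := (mpoly #|{: mvar}| K).

Definition mcoord (p : mproj K n) : 'I_#|{: mvar}| -> K :=
  fun k => hcoord (p (tag (enum_val k))) (tagged (enum_val k)).

Definition multihomogeneous (f : poly_ring) :=
  exists d : I -> nat, forall m, m \in msupp f -> forall i,
    (\sum_(k < #|{: mvar}| | tag (enum_val k) == i) m k = d i)%N.

Definition mproj_zeros (S : set poly_ring) : set (mproj K n) :=
  [set p | forall f, S f -> meval (mcoord p) f = 0].

Definition mproj_open (U : set (mproj K n)) :=
  exists2 S : set poly_ring, S `<=` multihomogeneous & ~` U = mproj_zeros S.

Lemma multihomogeneousM f g :
  multihomogeneous f -> multihomogeneous g -> multihomogeneous (f * g).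
Proof.
move=> [d hd] [e he]; exists (fun i => d i + e i)%N => m /msuppM_le.
move=> /allpairsP[[m1 m2] /= [/hd h1 /he h2 ->]] i.
rewrite -h1 -h2 -big_split /=; apply: eq_bigr => k _; exact: mnmDE.
Qed.

Lemma mproj_openT : mproj_open setT.
Proof.
exists [set 1].
  move=> _ ->; exists (fun=> 0%N) => m; rewrite msupp1 inE => /eqP-> i.
  by apply: big1 => k _; rewrite mnm0E.
rewrite setCT; apply/seteqP; split=> // p /(_ 1 erefl).
by rewrite meval1 => /eqP; rewrite oner_eq0.
Qed.

Lemma mproj_openI : setI_closed mproj_open.
Proof.
move=> U V [S hS US] [S' hS' VS'].
exists [set h | exists f g, [/\ S f, S' g & h = f * g]].
  by move=> _ [f [g [/hS hf /hS' hg ->]]]; exact: multihomogeneousM.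
rewrite setCI US VS'; apply/seteqP; split=> p.
  move=> [] hp _ [f [g [Sf Sg ->]]]; rewrite mevalM.
    by rewrite (hp f Sf) mul0r.
  by rewrite (hp g Sg) mulr0.
move=> hp; have [|/existsNP[f /not_implyP[Sf fp]]] := pselect (mproj_zeros S p).
  by left.
right=> g Sg; have /eqP := hp (f * g) (ex_intro _ f (ex_intro _ g (And3 Sf Sg erefl))).
by rewrite mevalM mulf_eq0 => /orP[/eqP//|/eqP].
Qed.

Lemma mproj_open_bigU (J : Type) (F : J -> set (mproj K n)) :
  (forall j, mproj_open (F j)) -> mproj_open (\bigcup_j F j).
Proof.
move=> oF; exists [set f | exists j S, [/\ S `<=` multihomogeneous,
    ~` F j = mproj_zeros S & S f]].
  by move=> f [j [S [hS _ /hS]]].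
rewrite setC_bigcup; apply/seteqP; split=> p.
  by move=> hp f [j [S [_ FS Sf]]]; have := hp j Logic.I; rewrite FS; exact.
move=> hp j _; have [S hS FS] := oF j; rewrite FS => f Sf.
by apply: hp; exists j, S.
Qed.

(* Zariski topology of the product, finer than the product topology *)
HB.instance Definition _ := isOpenTopological.Build (mproj K n)
  mproj_openT mproj_openI mproj_open_bigU.

End MProjTopology.

(* Unordered sets of r distinct points of P^n. *)
Definition uset (K : fieldType) (n r : nat) :=
  {A : {fset projsp K n} | #|` A| == r}.
HB.instance Definition _ K n r := Choice.on (uset K n r).

Definition points_of (K : fieldType) n r (p : mproj K (fun _ : 'I_r => n)) :
  {fset projsp K n} := [fset p i | i : 'I_r]%fset.

Section UsetTopology.
Variables (K : fieldType) (n r : nat).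

(* The quotient topology from the r-tuples of distinct points, an open subset
   of (P^n)^r. *)
Definition uset_open (U : set (uset K n r)) :=
  exists2 O : set (mproj K (fun _ : 'I_r => n)), open O &
    forall p A, points_of p = val A -> (O p <-> U A).

Lemma uset_openT : uset_open setT.
Proof. by exists setT; first exact: openT. Qed.

Lemma uset_openI : setI_closed uset_open.
Proof.
move=> U V [O oO OU] [O' oO' OV]; exists (O `&` O'); first exact: openI.
by move=> p A pA; split=> -[/(OU _ _ pA) ? /(OV _ _ pA)].
Qed.

Lemma uset_open_bigU (J : Type) (F : J -> set (uset K n r)) :
  (forall j, uset_open (F j)) -> uset_open (\bigcup_j F j).
Proof.
move=> oF; have /choice[O hO] j : exists O : set (mproj K (fun _ : 'I_r => n)),
    open O /\ forall p A, points_of p = val A -> (O p <-> F j A).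
  by have [O] := oF j; exists O.
exists (\bigcup_j O j); first by apply: bigcup_open => j _; case: (hO j).
by move=> p A pA; split=> -[j _ /((hO j).2 _ _ pA)]; exists j.
Qed.

HB.instance Definition _ := isOpenTopological.Build (uset K n r)
  uset_openT uset_openI uset_open_bigU.

(* V^(r), with the topology induced from (P^n)^(r) *)
Definition usets_in (V : set (projsp K n)) : set (uset K n r) :=
  [set A | forall p, p \in val A -> V p].

End UsetTopology.
Arguments usets_in {K n} r V.

Section Tangent.
Variables (K : fieldType) (n : nat) (X : set (projsp K n)) (p : projsp K n).

Definition tangent_eqs (v : 'rV[K]_n.+1) :=
  forall f : mpoly n.+1 K, homogeneous f ->
    (forall q, X q -> meval (hcoord q) f = 0) ->
    \sum_i meval (hcoord p) (mderiv i f) * v 0 i = 0.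

(* The linear subspace of K^(n+1) whose projectivization is the embedded
   tangent space of X at p. *)
Definition tangent : {vspace 'rV[K]_n.+1} :=
  xget 0%VS [set W | forall v, v \in W <-> tangent_eqs v].

Lemma tangentP v : v \in tangent <-> tangent_eqs v.
Proof.
rewrite /tangent; move: v.
suff [W hW] : exists W : {vspace 'rV[K]_n.+1}, forall v, v \in W <-> tangent_eqs v.
  by case: xgetP => [U _ //|/(_ W)].
pose P k := `[< exists W : {vspace 'rV[K]_n.+1},
  \dim W = k /\ forall v, v \in W -> tangent_eqs v >].
have P0 : exists k, P k.
  exists 0%N; apply/asboolP; exists 0%VS; split; first exact: dimv0.
  move=> v; rewrite memv0 => /eqP-> f _ _.
  by apply: big1 => i _; rewrite mxE mulr0.
have Pb k : P k -> (k <= \dim {:'rV[K]_n.+1})%N.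
  by move=> /asboolP[W [<- _]]; exact: dimvS (subvf W).
case: (ex_maxnP P0 Pb) => k /asboolP[W [dW hW]] kmax.
exists W => v; split; first exact: hW.
move=> hv; have WS : (W <= W + <[v]>)%VS := addvSl _ _.
suff : (W + <[v]> == W)%VS.
  by move=> /eqP <-; apply: (subvP (addvSr W <[v]>)); exact: memv_line.
rewrite eq_sym eqEdim WS dW; apply: kmax; apply/asboolP.
exists (W + <[v]>)%VS; split=> // _ /memv_addP[w /hW hw [_ /vlineP[a ->] ->]].
move=> f hf fX; under eq_bigr do rewrite !mxE mulrDr mulrCA.
by rewrite big_split /= -mulr_sumr hw // hv // mulr0 addr0.
Qed.

End Tangent.

Section Terracini.
Variables (K : fieldType) (n : nat).

Definition smooth_locus (X : set (projsp K n)) : set (projsp K n) :=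
  [set p | X p /\ has_dim X (\dim (tangent X p)).-1].

(* The linear span of the T_p X has dimension one less than the sum of the
   corresponding linear subspaces of K^(n+1). *)
Definition terracini (r : nat) (X : set (projsp K n)) : set (uset K n r) :=
  usets_in r (smooth_locus X) `&` closure
    [set A | usets_in r (smooth_locus X) A /\
       exists2 d, has_dim X d &
         ((\dim (\sum_(p <- val A) tangent X p)%VS).-1 < (r * d.+1).-1)%N].

End Terracini.
Arguments terracini {K n} r X.

Section LinearSystems.
Variables (K : fieldType) (n d : nat).

Definition forms_through (W : seq (projsp K n)) : {vspace dhomog n.+1 K d} :=
  (\bigcap_(x <- W)
     lker (linfun (fun f : dhomog n.+1 K d => meval (hcoord x) f : K^o)))%VS.

(* h^0(I_W(d)) for a finite reduced W *)
Definition h0_ideal (W : seq (projsp K n)) := \dim (forms_through W).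

Lemma forms_throughP (W : seq (projsp K n)) (f : dhomog n.+1 K d) :
  reflect (forall x, x \in W -> meval (hcoord x) f = 0)
    (f \in forms_through W).
Proof.
rewrite /forms_through.
have E x : (f \in lker (linfun (fun f : dhomog n.+1 K d =>
    meval (hcoord x) f : K^o))) = (meval (hcoord x) f == 0).
  pose ev (g : dhomog n.+1 K d) : K^o := meval (hcoord x) g.
  have lin : linear ev by move=> a g h; rewrite /ev [X in meval _ X](_ : _ =
      a *: mpoly_of_dhomog g + mpoly_of_dhomog h) // mevalD mevalZ.
  pose L : {linear dhomog n.+1 K d -> K^o} :=
    HB.pack ev (GRing.isLinear.Build _ _ _ _ ev lin).
  by rewrite memv_ker (lfunE L).
elim: W => [|x W IH]; first by rewrite big_nil memvf; left.
rewrite big_cons memv_cap E; apply: (iffP andP).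
  by move=> [/eqP fx /IH fW] y; rewrite inE => /orP[/eqP->|/fW].
move=> h; split; first by apply/eqP/h; rewrite mem_head.
by apply/IH => y yW; apply: h; rewrite inE yW orbT.
Qed.

End LinearSystems.
Arguments forms_through {K n} d W.
Arguments h0_ideal {K n} d W.

Section DelPezzo.
Variables (K : fieldType) (t N : nat).
Variables (z : 'I_t -> projsp K 2) (phi : N.+1.-tuple (dhomog 3 K 3)).

(* P^2 x P^N *)
Definition plane_times := mproj K (fun b : bool => if b then N else 2%N).

Definition pair_pt (x : projsp K 2) (p : projsp K N) : plane_times :=
  fun b => if b return projsp K (if b then N else 2%N) then p else x.

(* The blow-up of P^2 along the ideal generated by the forms phi, as the closure
   of the graph of x |-> [phi_0(x) : ... : phi_N(x)].  When phi is a basis of the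
   cubics through z_1, ..., z_t and these cubics generate the ideal sheaf of
   {z_1, ..., z_t}, as for general points with t <= 4, this is Bl_Z P^2; the
   first projection is the blow-down and the second one is the map given by the
   anticanonical system. *)
Definition blowup : set plane_times :=
  closure [set w : plane_times | (forall i, w false <> z i) /\
    val (w true) =
      <[\row_j meval (hcoord (w false : projsp K 2)) (tnth phi j)]>%VS].

(* the anticanonical image of the blow-up *)
Definition del_pezzo : set (projsp K N) :=
  [set p | exists x, blowup (pair_pt x p)].

(* x is the image of p under the blow-down map del_pezzo -> P^2 *)
Definition blows_down (p : projsp K N) (x : projsp K 2) := blowup (pair_pt x p).

Definition exceptional (i : 'I_t) : set (projsp K N) :=
  [set p | blows_down p (z i)].

Definition off_exceptional : set (projsp K N) :=
  [set p | del_pezzo p /\ forall i, ~ exceptional i p].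

Definition Yset (i : 'I_t) : set (uset K N 2) :=
  [set A | exists p1 p2 x1 x2,
    [/\ val A = [fset p1; p2]%fset,
        off_exceptional p1 /\ off_exceptional p2,
        blows_down p1 x1 /\ blows_down p2 x2 &
        (val (z i) <= val x1 + val x2)%VS]].

Definition Uset : set (uset K N 2) :=
  [set A | exists p1 p2 x1 x2,
    [/\ val A = [fset p1; p2]%fset,
        off_exceptional p1 /\ off_exceptional p2,
        blows_down p1 x1 /\ blows_down p2 x2 &
        (0 < h0_ideal 2 (x1 :: x2 :: codom z))%N]].

(* closure in X^(2) *)
Definition closure2 (S : set (uset K N 2)) : set (uset K N 2) :=
  usets_in 2 del_pezzo `&` closure S.

End DelPezzo.

(* Main.v *)
Require Import Defs.
From Stdlib Require Import Ring.
From HB Require Import structures.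
From mathcomp Require Import all_boot all_order all_algebra finmap zify.
From mathcomp Require Import boolp classical_sets functions cardinality.
From mathcomp Require Import topology.
From mathcomp.multinomials Require Import -(notations) mpoly.

Set Implicit Arguments.
Unset Strict Implicit.
Unset Printing Implicit Defensive.

Import GRing.Theory.
Local Open Scope classical_set_scope.
Local Open Scope ring_scope.

(** The open condition on Z is that no three of its points are collinear. Let [tau] be the symmetric
    trilinear polarization of the basis cubics, so that the anticanonical map is x |-> tau x x x.
    Linear forms on the target are cubics through Z, and almost every argument evaluates a cubic
    that is a product of three lines covering Z ([three_lines]). To treat all t at once, Z is
    completed to four points in general position ([frame_at]).

    The points of X are the tau x x x with x outside Z and the tau a a w with a = z_i and w a
    direction at z_i ([del_pezzoP]). Their tangent spaces consist of the vectors tau x x b,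
    respectively tau a a b + k tau a w w ([tangent_off], [tangent_exc]). Hence X is smooth of
    dimension 2, and its Terracini locus is the closure of the pairs whose tangent spaces share a
    nonzero vector ([terraciniE]).

    Suppose tau x x a = tau y y b. The cubics made of the line xy and a conic q through Z give
    [x,y,a] q(x) = [x,y,b] q(y), with determinants in brackets. If the conics through Z separate x
    and y, both brackets vanish, and if moreover no z_i lies on xy, further triples of lines show
    that the vector is 0 ([nondeg_off]). For t <= 3 the conics always separate such points; for t =
    4 they fail to do so only if a conic through Z contains both. Conversely, if z_i = a x + b y,
    the relation tau z_i z_i z_i = 0 splits into a vector tangent at both points ([Y_degenerate]).
    If a conic through Z contains x and y, its union with the line xy is singular at both, so the
    two tangent planes lie in a hyperplane of P^5 and meet ([U_degenerate]).

    The same test applies to pairs with exceptional points, derivatives of conics replacing their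
    values. The degenerate ones among them are limits, along polynomial curves, of pairs of some Y_i
    or of U. In particular E_i^(2) lies in the closure of Y_j for every j other than i ([exc_same]),
    so it survives as a component only for t = 1.

    Up to closure, Y_i and U are images of polynomial families with three parameters (two points on
    a line through z_i, two points on a conic of the pencil), and E_i^(2) of one with two. Such
    images are irreducible. Their dimension is bounded above because a chain of length d + 1 yields
    d + 1 algebraically independent functions while d + 1 rational functions of d parameters are
    dependent ([param_chain_le]), and below by explicit chains ([ruled_pairs_dim],
    [curve_pairs_dim]). The closed sets of [separating_set], together with a comparison of
    dimensions for U, show that no component contains another. *)

Section PolynomialFunctions.
Variable K : comNzRingType.

(** * Polynomial functions and generic parameters *)

Definition subalg (X : Type) (A : set (X -> K)) :=
  [/\ forall c, A (fun=> c),
      forall f g, A f -> A g -> A (fun x => f x + g x) &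
      forall f g, A f -> A g -> A (fun x => f x * g x)].

Section Closure.
Variables (X : Type) (A : set (X -> K)).
Hypothesis sA : subalg A.

Lemma subalg_cst c : A (fun=> c). Proof. by case: sA. Qed.

Lemma subalg_add f g : A f -> A g -> A (fun x => f x + g x).
Proof. by case: sA => _ + _; apply. Qed.

Lemma subalg_mul f g : A f -> A g -> A (fun x => f x * g x).
Proof. by case: sA => _ _; apply. Qed.

Lemma subalg_ext (f g : X -> K) : A f -> f =1 g -> A g.
Proof. by move=> Af /funext <-. Qed.

Lemma subalg_opp f : A f -> A (fun x => - f x).
Proof.
move=> Af; apply: (@subalg_ext (fun x => -1 * f x)) => [|x]; last by rewrite mulN1r.
by apply: subalg_mul => //; apply: subalg_cst.
Qed.

Lemma subalg_sub f g : A f -> A g -> A (fun x => f x - g x).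
Proof. by move=> Af Ag; apply: subalg_add => //; apply: subalg_opp. Qed.

Lemma subalg_exp f k : A f -> A (fun x => f x ^+ k).
Proof.
move=> Af; elim: k => [|k IH]; first exact: subalg_cst.
apply: (@subalg_ext (fun x => f x * f x ^+ k)) => [|x]; last by rewrite exprS.
exact: (@subalg_mul f (fun x => f x ^+ k)).
Qed.

Lemma subalg_sum (I : Type) (r : seq I) (P : pred I) (F : I -> X -> K) :
  (forall i, P i -> A (F i)) -> A (fun x => \sum_(i <- r | P i) F i x).
Proof.
move=> AF; elim: r => [|i r IH].
  by apply: (@subalg_ext (fun=> 0)) => [|x]; [exact: subalg_cst|rewrite big_nil].
apply: (@subalg_ext (fun x => if P i then
    F i x + \sum_(j <- r | P j) F j x else \sum_(j <- r | P j) F j x)) => [|x].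
  case Pi: (P i) => //; apply: subalg_add => //; exact: AF.
by rewrite big_cons.
Qed.

Lemma subalg_prod (I : Type) (r : seq I) (P : pred I) (F : I -> X -> K) :
  (forall i, P i -> A (F i)) -> A (fun x => \prod_(i <- r | P i) F i x).
Proof.
move=> AF; elim: r => [|i r IH].
  by apply: (@subalg_ext (fun=> 1)) => [|x]; [exact: subalg_cst|rewrite big_nil].
apply: (@subalg_ext (fun x => if P i then
    F i x * \prod_(j <- r | P j) F j x else \prod_(j <- r | P j) F j x)) => [|x].
  case Pi: (P i) => //; apply: subalg_mul => //; exact: AF.
by rewrite big_cons.
Qed.

Lemma subalg_meval n (g : 'I_n -> X -> K) (P : mpoly n K) :
  (forall i, A (g i)) -> A (fun x => meval (fun i => g i x) P).
Proof.
move=> Ag; apply: (@subalg_ext (fun x => \sum_(m <- msupp P)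
    mcoeff m P * \prod_i g i x ^+ m i)) => [|x]; last by rewrite mevalE.
apply: subalg_sum => m _; apply: subalg_mul; first exact: subalg_cst.
by apply: subalg_prod => i _; apply: subalg_exp.
Qed.

End Closure.

(** Functions instead of polynomials: maps given by formulas are then handled by closure properties
    alone and never expanded. *)
Definition mpolyfun d : set (('I_d -> K) -> K) :=
  [set h | exists P : mpoly d K, forall s, h s = meval s P].

Lemma subalg_mpolyfun d : subalg (@mpolyfun d).
Proof.
split=> [c|f g [P fP] [Q gQ]|f g [P fP] [Q gQ]].
- by exists (mpolyC d c) => s; rewrite mevalC.
- by exists (P + Q) => s; rewrite mevalD fP gQ.
- by exists (P * Q) => s; rewrite mevalM fP gQ.
Qed.

Lemma mpolyfun_var d i : @mpolyfun d (fun s => s i).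
Proof. by exists (mpolyX K (mnm1 i)) => s; rewrite mevalXU. Qed.

Definition polyfun : set (K -> K) :=
  [set h | exists p : {poly K}, forall s, h s = p.[s]].

Lemma subalg_polyfun : subalg polyfun.
Proof.
split=> [c|f g [P fP] [Q gQ]|f g [P fP] [Q gQ]].
- by exists c%:P => s; rewrite hornerC.
- by exists (P + Q) => s; rewrite hornerD fP gQ.
- by exists (P * Q) => s; rewrite hornerM fP gQ.
Qed.

Lemma polyfun_var : polyfun id.
Proof. by exists 'X => s; rewrite hornerX. Qed.

End PolynomialFunctions.
Arguments mpolyfun {K d}.
Arguments polyfun {K}.

(* The residual goals [A (fun x => e x)] left by this tactic are for atoms e. *)
Ltac subalg_tac sA := repeat first
  [ exact: (subalg_cst sA) | assumption
  | apply: (subalg_add sA) | apply: (subalg_sub sA) | apply: (subalg_opp sA)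
  | apply: (subalg_mul sA) | apply: (subalg_exp sA) ].

Section Generic.
Variable K : fieldType.
Hypothesis infK : forall s : seq K, exists x, x \notin s.

(* P holds for all but finitely many parameters. *)
Definition generic (P : K -> Prop) :=
  exists2 h : {poly K}, h != 0 & forall s, h.[s] != 0 -> P s.

(** Otherwise the infinite field would supply lists of distinct roots of every length, beyond the
    degree. *)
Lemma poly_nonroot (h : {poly K}) : h != 0 -> exists s, h.[s] != 0.
Proof.
move=> h0; pose Q (l : seq K) := uniq l && all (root h) l.
have H n : (exists l, Q l && (size l == n)) \/ exists s, h.[s] != 0.
  elim: n => [|n [[l /andP[/andP[ul rl] /eqP sl]]|]]; [by left; exists [::]| |by right].
  have [x xl] := infK l; have [hx|hx] := eqVneq h.[x] 0; last by right; exists x.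
  by left; exists (x :: l); rewrite /Q /= xl ul rl /root hx eqxx sl eqxx.
have [[l /andP[/andP[ul rl] /eqP sl]]|//] := H (size h).
by have := max_poly_roots h0 rl ul; rewrite sl ltnn.
Qed.

Lemma generic_ex P : generic P -> exists s, P s.
Proof. by move=> [h /poly_nonroot[s hs] /(_ s hs)]; exists s. Qed.

Lemma genericT (P : K -> Prop) : (forall s, P s) -> generic P.
Proof. by move=> hP; exists 1; rewrite ?oner_neq0. Qed.

Lemma genericW (P Q : K -> Prop) : generic P -> (forall s, P s -> Q s) -> generic Q.
Proof. by move=> [h h0 hP] PQ; exists h => // s /hP/PQ. Qed.

Lemma genericI (P Q : K -> Prop) :
  generic P -> generic Q -> generic (fun s => P s /\ Q s).
Proof.
move=> [h h0 hP] [g g0 gQ]; exists (h * g); first by rewrite mulf_neq0.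
by move=> s; rewrite hornerM mulf_eq0 negb_or => /andP[/hP ? /gQ ?].
Qed.

Lemma generic_all (I : finType) (P : I -> K -> Prop) :
  (forall i, generic (P i)) -> generic (fun s => forall i, P i s).
Proof.
move=> hP; suff: generic (fun s => forall i, i \in enum I -> P i s).
  by move/genericW; apply=> s Ps i; apply: Ps; rewrite mem_enum.
elim: (enum I) => [|i l IH]; first by apply: genericT.
apply: genericW (genericI (hP i) IH) _ => s [Pi Pl] j.
by rewrite inE => /orP[/eqP->|/Pl].
Qed.

Lemma generic_neq0 h s0 : polyfun h -> h s0 != 0 -> generic (fun s => h s != 0).
Proof.
move=> [p hp] h0; exists p => [|s]; last by rewrite hp.
by apply: contraNneq h0 => p0; rewrite hp p0 horner0.
Qed.

Lemma generic_neq c : generic (fun s => s != c).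
Proof.
exists ('X - c%:P); first by rewrite polyXsubC_eq0.
by move=> s; rewrite hornerXsubC subr_eq0.
Qed.

(** The principle of all specializations below: a polynomial condition known for general parameters
    passes to the special ones. *)
Lemma polyfun_eq0 h : polyfun h -> generic (fun s => h s = 0) -> forall s, h s = 0.
Proof.
move=> [p hp] gh s; rewrite hp; have [->|p0] := eqVneq p 0; first exact: horner0.
have gp : generic (fun s => h s != 0) by exists p => // r; rewrite hp.
by have [r [-> /eqP]] := generic_ex (genericI gh gp).
Qed.

Lemma mpolyfun_line d (h : ('I_d -> K) -> K) (a b : 'I_d -> K) : mpolyfun h ->
  polyfun (fun r => h (fun i => a i + r * b i)).
Proof.
move=> [P hP].
apply: (@subalg_ext _ _ _ (fun r => meval (fun i => a i + r * b i) P)) => [|r //].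
apply: (subalg_meval (subalg_polyfun K)) => i.
by subalg_tac (subalg_polyfun K); exact: polyfun_var.
Qed.

(** On the line through the two points, both restrictions are nonzero polynomials in one parameter,
    so a general point of this line works. *)
Lemma mpolyfun_mul_neq0 d (f g : ('I_d -> K) -> K) s1 s2 : mpolyfun f ->
  mpolyfun g -> f s1 != 0 -> g s2 != 0 -> exists s, f s * g s != 0.
Proof.
move=> pf pg fs gs; pose L r i := s1 i + r * (s2 i - s1 i).
have L0 : L 0 = s1 by apply/funext => i; rewrite /L mul0r addr0.
have L1 : L 1 = s2 by apply/funext => i; rewrite /L mul1r addrC subrK.
have gf : generic (fun r => f (L r) != 0).
  by apply: (@generic_neq0 (f \o L) 0); [exact: mpolyfun_line|rewrite /= L0].
have gg : generic (fun r => g (L r) != 0).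
  by apply: (@generic_neq0 (g \o L) 1); [exact: mpolyfun_line|rewrite /= L1].
have [r [fr gr]] := generic_ex (genericI gf gg).
by exists (L r); rewrite mulf_neq0.
Qed.

End Generic.

(** * Irreducible components and Krull dimension *)

Section Irreducible.
Variable T : topologicalType.
Implicit Types S B C D : set T.

Lemma irreducible_between B S :
  irreducible_set B -> B `<=` S -> S `<=` closure B -> irreducible_set S.
Proof.
move=> [[x Bx] irrB] BS SB; split; first by exists x; apply: BS.
move=> C D cC cD SCD; have [BC|BD] := irrB C D cC cD (subset_trans BS SCD).
  by left; apply: subset_trans SB _; rewrite closureE => y; apply.
by right; apply: subset_trans SB _; rewrite closureE => y; apply.
Qed.

Lemma irreducible_finite_cover (I : finType) (F : I -> set T) B :
  irreducible_set B -> (forall i, closed (F i)) -> B `<=` \bigcup_i F i ->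
  exists i, B `<=` F i.
Proof.
move=> [[x Bx] irrB] cF BF.
have: B `<=` \bigcup_(i in [set` enum I]) F i.
  by move=> y /BF[i _ Fi]; exists i => //=; rewrite mem_enum.
elim: (enum I) => [|i l IH] BU; first by have [] := BU x Bx.
have: B `<=` F i `|` \bigcup_(j in [set` l]) F j.
  move=> y /BU[j /=]; rewrite inE => /orP[/eqP->|jl] Fj; first by left.
  by right; exists j.
have cl : closed (\bigcup_(j in [set` l]) F j) by apply: closed_bigcup.
by case/(irrB _ _ (cF i) cl) => [?|/IH//]; exists i.
Qed.

(** An irreducible subset of S is covered by the finitely many closures of the F i, hence lies in
    one of them. As the F i are pairwise incomparable, they are exactly the maximal irreducible
    subsets. *)
Lemma irr_component_finite (I : finType) (F : I -> set T) S :
  S = \bigcup_i F i -> (forall i, irreducible_set (F i)) ->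
  (forall i, F i = S `&` closure (F i)) ->
  (forall i j, F i `<=` F j -> i = j) ->
  irr_component S = range F.
Proof.
move=> SF irrF clF antiF; have FS i : F i `<=` S by rewrite SF; exact: bigcup_sup.
have cover D : D `<=` S -> irreducible_set D -> exists i, D `<=` F i.
  move=> DS irrD; have [||i Di] := @irreducible_finite_cover I (closure \o F) D irrD.
  - by move=> i; exact: closed_closure.
  - move=> y /DS; rewrite SF => -[i _ Fi]; exists i => //.
    exact: subset_closure.
  by exists i => y Dy; rewrite clF; split; [exact: DS|exact: Di].
apply/seteqP; split=> [C [CS irrC maxC]|_ [i _ <-]].
  by have [i Ci] := cover C CS irrC; exists i => //; apply: maxC.
split=> // D DS irrD FD; have [j Dj] := cover D DS irrD.
apply/seteqP; split=> //; suff -> : i = j by [].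
exact/antiF/(subset_trans FD).
Qed.

End Irreducible.

Section DimensionTheory.
Variable T : topologicalType.
Implicit Types S U C D : set T.

Lemma has_dim_uniq S d e : has_dim S d -> has_dim S e -> d = e.
Proof.
move=> hd he; apply/eqP; rewrite eqn_leq.
by apply/andP; split; [apply/he/hd|apply/hd/he].
Qed.

(** Truncating a longest chain gives chains of all smaller lengths. *)
Lemma has_dimI S d : (forall c e, irr_chain S c e -> (e <= d)%N) ->
  (exists c, irr_chain S c d) -> has_dim S d.
Proof.
move=> ub [c [irrc ltc]] e; split=> [[c' /ub//]|led]; exists c; split=> i ie.
  by apply: irrc; exact: leq_trans led.
by apply: ltc; exact: leq_trans led.
Qed.

(** Strictness is certified by auxiliary closed sets, so that the closures of the J i never have to
    be computed. *)
Lemma irr_chain_closure S (J : nat -> set T) d :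
  (forall i, (i <= d)%N -> irreducible_set (J i) /\ J i `<=` S) ->
  (forall i, (i < d)%N -> J i `<=` J i.+1 /\
     exists C, [/\ closed C, J i `<=` C & ~ (J i.+1 `<=` C)]) ->
  irr_chain S (fun i => S `&` closure (J i)) d.
Proof.
move=> irrJ ltJ; split=> i id.
  have [irr JS] := irrJ i id; split.
    apply: (irreducible_between irr); last by move=> x [].
    by move=> x Jx; split; [exact: JS|exact: subset_closure].
  apply/seteqP; split=> x [Sx cx]; first by split=> //; apply: subset_closure.
  split=> //; have : closure (closure (J i)) x.
    by apply: closure_subset cx => y [].
  by rewrite -(proj1 (closure_id _))//; exact: closed_closure.
have [JJ [C [cC JC nJC]]] := ltJ i id; have [_ JS] := irrJ i.+1 id; split.
  by apply: setIS; exact: closure_subset.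
move=> h; apply: nJC => x Jx.
have [_ cx] := h x (conj (JS x Jx) (subset_closure Jx)).
by rewrite (proj1 (closure_id C) cC); exact: closure_subset cx.
Qed.

End DimensionTheory.

(** * Chains of irreducible sets and algebraic independence *)

Section ChainBound.
Variables (K : fieldType) (n : nat).

Section SplitVariable.
Variables (k : 'I_n) (P : mpoly n K).

(** Remainder and quotient of the division of P by the variable X_k are [const_part] and
    [quot_part]. *)
Definition const_part : mpoly n K :=
  \sum_(m <- msupp P | m k == 0%N) mcoeff m P *: mpolyX K m.

Definition quot_part : mpoly n K :=
  \sum_(m <- msupp P | m k != 0%N) mcoeff m P *: mpolyX K (mnm_sub m (mnm1 k)).

Lemma split_part : P = const_part + mpolyX K (mnm1 k) * quot_part.
Proof.
rewrite {1}(mpolyE P) (bigID (fun m : multinom n => m k == 0%N)) /=; congr (_ + _).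
rewrite /quot_part big_distrr /=; apply: eq_bigr => m mk.
rewrite -scalerAr -mpolyXD; congr (_ *: mpolyX K _); apply/mnmP => i.
rewrite mnmDE mnmBE mnm1E; case: eqP => [<-|_]; last by rewrite subn0.
by rewrite addnC subnK // lt0n.
Qed.

Lemma const_part_coeff (m : multinom n) : m k = 0%N -> mcoeff m const_part = mcoeff m P.
Proof.
move=> mk; rewrite [in RHS](split_part) mcoeffD [X in _ + X](_ : _ = 0) ?addr0 //.
apply/eqP; rewrite mcoeff_eq0; apply/negP.
rewrite mulrC => /msuppM_le /allpairsP[[m1 m2] /= [_]].
by rewrite msuppX inE => /eqP-> mE; move: mk; rewrite mE mnmDE mnm1E eqxx addn1.
Qed.

Lemma msupp_const_part (m : multinom n) : m \in msupp const_part -> m \in msupp P /\ m k = 0%N.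
Proof.
move=> /msupp_sum_le /flattenP[_ /mapP[m' + ->]].
rewrite mem_filter => /andP[/eqP m'k m'P] /msuppZ_le.
by rewrite msuppX inE => /eqP->.
Qed.

Lemma msupp_quot_part (m : multinom n) : m \in msupp quot_part ->
  exists m', [/\ m' \in msupp P, m' k != 0%N & m = mnm_sub m' (mnm1 k)].
Proof.
move=> /msupp_sum_le /flattenP[_ /mapP[m' + ->]].
rewrite mem_filter => /andP[m'k m'P] /msuppZ_le.
by rewrite msuppX inE => /eqP->; exists m'.
Qed.

Lemma msize_quot_part : quot_part != 0 -> (msize quot_part < msize P)%N.
Proof.
move=> q0; rewrite -(mlead_deg q0).
have [m' [m'P m'k ->]] := msupp_quot_part (mlead_supp q0).
apply: leq_trans (msize_mdeg_lt m'P); rewrite ltnS.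
rewrite -[X in (_ < mdeg X)%N](_ : mnm_add (mnm_sub m' (mnm1 k)) (mnm1 k) = m').
  by rewrite mdegD mdeg1 addn1.
apply/mnmP => i; rewrite mnmDE mnmBE mnm1E; case: eqP => [<-|_].
  by rewrite subnK // lt0n.
by rewrite subn0 addn0.
Qed.

End SplitVariable.

Variables (T : topologicalType) (U : set T) (A : set (T -> K)).
Implicit Types (c S : set T) (P : mpoly n K).

(* The ring of regular functions of a chart U of T. *)
Definition chart :=
  [/\ open U, subalg A,
      forall g, A g -> exists2 C, closed C & forall x, U x -> (C x <-> g x = 0) &
      forall C x, closed C -> U x -> ~ C x ->
        exists g, [/\ A g, g x != 0 & forall y, U y -> C y -> g y = 0]].

Hypothesis chartU : chart.

(* g_0, ..., g_(k-1) are algebraically independent on c *)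
Definition indep k c (g : 'I_n -> T -> K) :=
  forall P, P != 0 -> (forall m, m \in msupp P -> forall i : 'I_n, (k <= i)%N -> m i = 0%N) ->
  exists y, [/\ c y, U y & meval (fun i => g i y) P != 0].

Lemma meval_mnm1_mul (v : 'I_n -> K) (k : 'I_n) P :
  meval v (mpolyX K (mnm1 k) * P) = v k * meval v P.
Proof. by rewrite mevalM mevalXU. Qed.

(** Induction on the size of P. If X_k does not divide P, evaluate on c, where g0 = 0 and only the
    remainder is left, to which independence on c applies. If P = X_k Q, then Q is nonzero somewhere
    on c' by induction and g0 is nonzero somewhere on c', so both are nonzero at a common point
    because c' is irreducible. *)
Lemma indep_step (k : 'I_n) c c' g g0 : c `<=` c' -> irreducible_set c' ->
  (forall i, A (g i)) -> A g0 -> indep k c g ->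
  (forall y, c y -> U y -> g0 y = 0) -> (exists y, [/\ c' y, U y & g0 y != 0]) ->
  indep k.+1 c' (fun i => if i == k then g0 else g i).
Proof.
case: chartU => oU sA zA _ cc' [_ irr] Ag Ag0 indc g0c [y0 [cy0 Uy0 gy0]].
set g' := fun i => _; have Ag' i : A (g' i) by rewrite /g'; case: eqP.
move=> P; elim: {P}_.+1 {-2}P (ltnSn (msize P)) => // N IH P.
rewrite ltnS => sP P0 suppP.
have PE y : meval (fun i => g' i y) P =
    meval (fun i => g' i y) (const_part k P) + g0 y * meval (fun i => g' i y) (quot_part k P).
  by rewrite {1}(split_part k P) mevalD meval_mnm1_mul {2}/g' eqxx.
have [c0|c0] := eqVneq (const_part k P) 0; last first.
  have [|y [cy Uy gy]] := indc (const_part k P) c0.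
    move=> m /msupp_const_part[mP mk] i; rewrite leq_eqVlt => /orP[/eqP ki|ki].
      by rewrite (_ : i = k) //; exact/esym/val_inj.
    exact: suppP.
  exists y; split=> //; first exact: cc'.
  rewrite PE g0c // mul0r addr0; move: gy; rewrite !mevalE.
  rewrite (eq_big_seq (fun m => mcoeff m (const_part k P) * \prod_i g' i y ^+ m i)) //.
  move=> m /msupp_const_part[mP mk]; congr (_ * _); apply: eq_bigr => i _.
  by rewrite /g'; case: eqP => // ->; rewrite mk !expr0.
have q0 : quot_part k P != 0.
  by apply: contraNneq P0 => q0; rewrite (split_part k P) c0 q0 mulr0 addr0.
have [||y1 [cy1 Uy1 gy1]] := IH (quot_part k P) _ q0.
- exact: leq_trans (msize_quot_part q0) sP.
- move=> m /msupp_quot_part[m' [m'P _ ->]] i ki.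
  by rewrite mnmBE (suppP _ m'P).
have [C1 cC1 C1E] := zA _ (subalg_meval sA (quot_part k P) Ag').
have [C0 cC0 C0E] := zA _ Ag0.
have cU C : closed C -> closed (C `|` ~` U).
  by move=> cC; apply: closedU => //; exact: open_closedC.
apply: contrapT => noy.
have [|h|h] := irr _ _ (cU _ cC1) (cU _ cC0).
- move=> y cy; have [Uy|nUy] := pselect (U y); last by left; right.
  have [/(C1E _ Uy)|h1] := pselect (C1 y); first by left; left; exact/C1E.
  have [/(C0E _ Uy)|h0] := pselect (C0 y); first by right; left; exact/C0E.
  case: noy; exists y; split=> //.
  rewrite PE c0 meval0 add0r mulf_neq0 //.
    by apply/eqP => /(C0E _ Uy).
  by apply/eqP => /(C1E _ Uy).
- by case: (h _ cy1) => // /(C1E _ Uy1)/eqP; rewrite (negbTE gy1).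
- by case: (h _ cy0) => // /(C0E _ Uy0)/eqP; rewrite (negbTE gy0).
Qed.

(** Each strict inclusion of the chain supplies a regular function that vanishes on c k but not on c
    k.+1, hence one more independent function. *)
Lemma chain_indep S (c : nat -> set T) e : irr_chain S c e -> c 0%N `&` U !=set0 ->
  forall k, (k <= e)%N -> (k <= n)%N ->
  [/\ c k `&` U !=set0 & exists g, (forall i, A (g i)) /\ indep k (c k) g].
Proof.
case: chartU => oU sA zA sepA [irrc ltc] c0U; elim=> [|k IH] ke kn.
  split=> //; exists (fun=> fun=> 0); split=> [i|P P0 suppP]; first exact: subalg_cst.
  have [y [cy Uy]] := c0U; exists y; split=> //.
  have supp0 m : m \in msupp P -> m = mnm0 by move=> mP; apply/mnmP => i; rewrite mnm0E (suppP m).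
  have lead0 := supp0 _ (mlead_supp P0).
  have := mleadc_eq0 P; rewrite (negbTE P0) lead0 => c0.
  have -> : P = mpolyC n (mcoeff mnm0 P).
    apply/mpolyP => m; rewrite mcoeffC; case: eqP => [<-|/eqP m0]; first by rewrite mulr1.
    by rewrite mulr0; apply/eqP; rewrite mcoeff_eq0; apply/negP => /supp0 mE; rewrite mE eqxx in m0.
  by rewrite mevalC c0.
have [[x [cx Ux]] [g [Ag indg]]] := IH (ltnW ke) (ltnW kn).
have [irrk ck] := irrc k (ltnW ke); have [irrk1 ck1] := irrc k.+1 ke.
have [sub nsub] := ltc k ke.
split; first by exists x; split=> //; exact: sub.
(* Otherwise the irreducible set c k.+1 would lie in the closure of c k, against strictness, or in
   the complement of U, which it meets. *)
have [y [cy Uy ny]] : exists y, [/\ c k.+1 y, U y & ~ closure (c k) y].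
  apply: contrapT => noy.
  have [|||h|h] := (proj2 irrk1) (closure (c k)) (~` U).
  - exact: closed_closure.
  - exact: open_closedC.
  - move=> y cy; have [Uy|] := pselect (U y); last by right.
    by left; apply: contrapT => ny; apply: noy; exists y.
  - by apply: nsub => y cy; rewrite ck; split; [move: cy; rewrite ck1 => -[]|exact: h].
  - exact: h (sub _ cx) Ux.
have [g0 [Ag0 g0y g0c]] := sepA (closure (c k)) y (@closed_closure _ _) Uy ny.
exists (fun i => if i == Ordinal kn then g0 else g i).
split=> [i|]; first by case: eqP.
apply: (@indep_step (Ordinal kn) (c k)) => //.
- by move=> z cz Uz; apply: g0c => //; exact: subset_closure.
- by exists y.
Qed.

End ChainBound.

Section AlgebraicDependence.
Variables (K : fieldType) (d : nat).

(** Monomials with bounded exponents, indexed by a finite type so that they can be counted and can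
    index a matrix. *)
Definition mnm_ord n m (f : {ffun 'I_n -> 'I_m}) : multinom n :=
  Multinom [tuple (f i : nat) | i < n].

Lemma mnm_ord_inj n m : injective (@mnm_ord n m).
Proof.
move=> f g /mnmP fg; apply/ffunP => i; apply/val_inj.
by have := fg i; rewrite !mnmE.
Qed.

Lemma msizeM_leq n (p q : mpoly n K) a b :
  (msize p <= a.+1)%N -> (msize q <= b.+1)%N -> (msize (p * q) <= (a + b).+1)%N.
Proof.
move=> pa qb; have [->|p0] := eqVneq p 0; first by rewrite mul0r msize0.
have [->|q0] := eqVneq q 0; first by rewrite mulr0 msize0.
rewrite msizeM //; move: (msize p) (msize q) pa qb => x y; lia.
Qed.

Lemma msizeX_leq n (p : mpoly n K) a k :
  (msize p <= a.+1)%N -> (msize (p ^+ k) <= (k * a).+1)%N.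
Proof.
move=> pa; elim: k => [|k IH]; first by rewrite expr0 msize1.
by rewrite exprS mulSn; exact: msizeM_leq.
Qed.

Lemma msize_prod_leq n (I : finType) (p : I -> mpoly n K) a :
  (forall i, (msize (p i) <= (a i).+1)%N) ->
  (msize (\prod_i p i) <= (\sum_i a i).+1)%N.
Proof.
move=> pa; elim/big_rec2: _ => [|i k q _ kq]; first by rewrite msize1.
exact: msizeM_leq.
Qed.

(* More polynomials than monomials of their degree: a linear relation. *)
Lemma mpoly_family_dependent (I : finType) (F : I -> mpoly d K) B :
  (forall i, (msize (F i) <= B.+1)%N) -> (B.+1 ^ d < #|I|)%N ->
  exists2 u : I -> K, (exists i, u i != 0) & \sum_i u i *: F i = 0.
Proof.
move=> FB cardI; pose J := {ffun 'I_d -> 'I_B.+1}.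
have cardJ : #|{: J}| = (B.+1 ^ d)%N by rewrite card_ffun !card_ord.
pose M : 'M[K]_(#|I|, #|{: J}|) :=
  \matrix_(i, j) mcoeff (mnm_ord (enum_val j)) (F (enum_val i)).
have : kermx M != 0.
  rewrite -mxrank_eq0 mxrank_ker subn_eq0 -ltnNge.
  by apply: leq_ltn_trans (rank_leq_col M) _; rewrite cardJ.
case/rowV0Pn => u /sub_kermxP uM u0; exists (fun i => u 0 (enum_rank i)).
  case/rV0Pn: u0 => k uk; exists (enum_val k); by rewrite enum_valK.
apply/mpolyP => m; rewrite mcoeff0 raddf_sum /=.
have [mB|mB] := boolP [forall i, m i < B.+1]%N; last first.
  apply: big1 => i _; rewrite mcoeffZ memN_msupp_eq0 ?mulr0 //.
  apply: msize_mdeg_ge; apply: leq_trans (FB i) _.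
  case/forallPn: mB => k; rewrite -leqNgt => /leq_trans; apply.
  by rewrite mdegE (bigD1 k) //= leq_addr.
pose f : J := [ffun i => Ordinal (forallP mB i)].
have mf : mnm_ord f = m by apply/mnmP => i; rewrite mnmE ffunE.
transitivity ((u *m M) 0 (enum_rank f)); last by rewrite uM mxE.
rewrite mxE.
rewrite (reindex (@enum_val I I)) /=; last first.
  by exists enum_rank => x _; rewrite ?enum_valK ?enum_rankK.
by apply: eq_bigr => i _; rewrite mcoeffZ !mxE enum_rankK mf enum_valK.
Qed.

(** Counting: multiplied by a fixed power of the common denominator b, the monomials in the d + 1
    fractions with exponents at most m are polynomials in d variables of degree at most (d + 1) m D.
    For large m they outnumber the monomials of that degree, and a linear relation among them is the
    wanted P. *)
Lemma rational_functions_dependent (f : 'I_d.+1 -> mpoly d K) (b : mpoly d K) :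
  exists2 P : mpoly d.+1 K, P != 0 &
    forall s, meval s b != 0 -> meval (fun i => meval s (f i) / meval s b) P = 0.
Proof.
pose D := (msize b + \sum_i msize (f i))%N.
have fD i : (msize (f i) <= D.+1)%N by rewrite /D (bigD1 i) //=; lia.
have bD : (msize b <= D.+1)%N by rewrite /D; lia.
(* Chosen so that ((m + 1) c)^d = (m + 1)^d m < (m + 1)^(d + 1), the number of products. *)
pose c := (d.+1 * D + 1)%N; pose m := (c ^ d)%N.
pose I := {ffun 'I_d.+1 -> 'I_m.+1}.
pose wt (a : I) := (\sum_i a i)%N.
have wtm a : (wt a <= d.+1 * m)%N.
  apply: leq_trans (leq_sum _ (fun i _ => leq_ord (a i))) _.
  by rewrite sum_nat_const card_ord.
pose F (a : I) := (\prod_i f i ^+ a i) * b ^+ (d.+1 * m - wt a).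
have [||u [a0 ua0] uF] := @mpoly_family_dependent I F (d.+1 * m * D).
- move=> a; rewrite /F -{2}(subnKC (wtm a)) mulnDl; apply: msizeM_leq.
    rewrite /wt big_distrl /=; apply: msize_prod_leq => i; exact: msizeX_leq.
  exact: msizeX_leq.
- rewrite card_ffun !card_ord expnS.
  apply: (@leq_ltn_trans ((m.+1 * c) ^ d)).
    have le_exp x y k : (x <= y -> x ^ k <= y ^ k)%N.
      by move=> xy; elim: k => // k IH; rewrite !expnS leq_mul.
    by apply: le_exp; rewrite /c; nia.
  by rewrite expnMn -/m mulnC ltn_mul2r expn_gt0 /=.
exists (\sum_a u a *: mpolyX K (mnm_ord a)).
  apply: contraNneq ua0 => /(congr1 (mcoeff (mnm_ord a0))).
  rewrite mcoeff0 raddf_sum /= (bigD1 a0) //= big1 => [|a aa0].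
    by rewrite addr0 mcoeffZ mcoeffX eqxx mulr1 => ->.
  by rewrite mcoeffZ mcoeffX (inj_eq (@mnm_ord_inj _ _)) (negbTE aa0) mulr0.
move=> s bs; apply: (mulfI (expf_neq0 (d.+1 * m) bs)); rewrite mulr0.
have := congr1 (meval s) uF; rewrite meval0 => <-.
rewrite raddf_sum [RHS]raddf_sum /= big_distrr /=; apply: eq_bigr => a _.
rewrite !mevalZ mulrCA; congr (_ * _); rewrite mevalX /F mevalM.
rewrite -{1}(subnK (wtm a)) exprD -mulrA mulrC rmorphXn /=; congr (_ * _).
rewrite (rmorph_prod (meval s)) -prodrXr -big_split /=; apply: eq_bigr => i _.
by rewrite mnmE rmorphXn expr_div_n mulrC divfK // expf_neq0.
Qed.

End AlgebraicDependence.

(** * Images of polynomial parametrizations *)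

Section ParametrizedSets.
Variables (K : fieldType) (T : topologicalType) (d : nat).
Hypothesis infK : forall s : seq K, exists x, x \notin s.
Variables (h : ('I_d -> K) -> K) (R : ('I_d -> K) -> T -> Prop).
Hypothesis polyh : mpolyfun h.

(* The image of the parametrization R of a subset of T by the principal open
   subset h <> 0 of the affine space. *)
Definition param_image : set T := [set y | exists2 s, h s != 0 & R s y].

Hypothesis tot : forall s, h s != 0 -> exists y, R s y.

(** If neither of two closed sets contains the image, each is pulled back into the zeros of a
    nonzero polynomial. The product of these two polynomials with h is nonzero at some parameter,
    whose image lies in neither set. *)
Lemma param_irreducible s0 : h s0 != 0 ->
  (forall C s y, closed C -> h s != 0 -> R s y -> ~ C y ->
     exists g, [/\ mpolyfun g, g s != 0 &
                   forall s y, h s != 0 -> R s y -> C y -> g s = 0]) ->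
  irreducible_set param_image.
Proof.
move=> hs0 pull; split; first by have [y Ry] := tot hs0; exists y, s0.
move=> C D cC cD imCD; apply: contrapT => /not_orP[].
move=> /existsNP[y /not_implyP[[s hs Rs] nC]] /existsNP[y' /not_implyP[[s' hs' Rs'] nD]].
have [g [pg gs gC]] := pull _ _ _ cC hs Rs nC.
have [g' [pg' gs' gD]] := pull _ _ _ cD hs' Rs' nD.
have [r] := mpolyfun_mul_neq0 infK pg pg' gs gs'.
have pgg : mpolyfun (fun s => g s * g' s) by apply: (subalg_mul (subalg_mpolyfun K d)).
move=> /(mpolyfun_mul_neq0 infK pgg polyh) /(_ hs0)[r'].
rewrite !mulf_eq0 !negb_or => /andP[/andP[gr gr'] hr].
have [z Rz] := tot hr; have [Cz|Dz] := imCD z (ex_intro2 _ _ r' hr Rz).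
  by move: gr; rewrite (gC _ _ hr Rz Cz) eqxx.
by move: gr'; rewrite (gD _ _ hr Rz Dz) eqxx.
Qed.

(** A chain of length d + 1 gives d + 1 independent functions on a chart. Pulled back to the
    parameters they are fractions with powers of one denominator, hence satisfy a polynomial
    relation. The relation holds on the image, therefore on its closure, which contradicts
    independence. *)
Lemma param_chain_le (S : set T) :
  (forall x, exists U (A : set (T -> K)) b, [/\ chart U A, U x, mpolyfun b,
     forall s y, h s != 0 -> R s y -> U y -> b s != 0 &
     forall g, A g -> exists e f, mpolyfun f /\
       forall s y, h s != 0 -> R s y -> U y -> g y = f s / b s ^+ e]) ->
  S `<=` closure param_image -> forall c e, irr_chain S c e -> (e <= d)%N.
Proof.
move=> charts Scl c e chainc; rewrite leqNgt; apply/negP => de.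
have [[[x cx] _] c0] := proj1 chainc 0%N (leq0n _).
have [U [A [b [chU Ux [pb pbE] bU pull]]]] := charts x.
have [|_ [g [Ag indg]]] := chain_indep (n := d.+1) chU chainc _ de (leqnn _).
  by exists x.
have /choice[E hE] i : exists ef : nat * (('I_d -> K) -> K), mpolyfun ef.2 /\
    forall s y, h s != 0 -> R s y -> U y -> g i y = ef.2 s / b s ^+ ef.1.
  by have [e' [f hf]] := pull _ (Ag i); exists (e', f).
pose N := (\sum_i (E i).1)%N.
have EN i : ((E i).1 <= N)%N by rewrite /N (bigD1 i) //= leq_addr.
have /choice[f fE] i : exists f : mpoly d K, forall s, meval s f = (E i).2 s * b s ^+ (N - (E i).1).
  have [[p pE] _] := hE i; exists (p * pb ^+ (N - (E i).1)) => s.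
  by rewrite mevalM rmorphXn pE pbE.
have [P P0 PE] := rational_functions_dependent f (pb ^+ N).
have [_ sA zA _] := chU.
have [C cC CE] := zA _ (subalg_meval sA P Ag).
have [|y [cy Uy /eqP]] := indg P P0.
  by move=> m _ i; rewrite leqNgt ltn_ord.
apply; apply/(CE _ Uy).
have Sy : S y by move: cy; rewrite (proj2 (proj1 chainc _ de)) => -[].
(* The relation is known at parametrized points of the chart only; adding the complement of U makes
   it a closed condition on the whole image. *)
have : closure (C `|` ~` U) y.
  apply: closure_subset (Scl _ Sy) => z [s hs Rs].
  have [Uz|] := pselect (U z); last by right.
  left; apply/(CE _ Uz); rewrite -[RHS](PE s).
    apply: meval_eq => i; rewrite fE rmorphXn /= -pbE.
    have bs := bU _ _ hs Rs Uz.
    rewrite (proj2 (hE i) s z hs Rs Uz).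
    have -> : b s ^+ N = b s ^+ (N - (E i).1) * b s ^+ (E i).1 by rewrite -exprD subnK.
    by rewrite invfM mulrA mulfK // expf_neq0.
  by rewrite rmorphXn /= -pbE expf_neq0 // (bU s z).
have cCU : closed (C `|` ~` U) by apply: closedU => //; apply: open_closedC; case: chU.
by rewrite -(proj1 (closure_id _) cCU) => -[].
Qed.

End ParametrizedSets.

(** * Representatives of points, forms and multihomogeneous forms *)

Section ProjectivePoints.
Variables (K : fieldType) (n : nat).
Implicit Types (x y : 'rV[K]_n.+1) (p : projsp K n).

Lemma vline_dim1 x : x != 0 -> \dim <[x]> == 1%N.
Proof. by move=> x0; rewrite dim_vline x0. Qed.

Lemma const1_neq0 : (const_mx 1 : 'rV[K]_n.+1) != 0.
Proof.
by apply/eqP => /matrixP/(_ 0 0); rewrite !mxE => /eqP; rewrite oner_eq0.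
Qed.

(* Opaque, so that conversion never compares points by unfolding them. *)
Lemma point_of_vector : {f : 'rV[K]_n.+1 -> projsp K n |
  forall x, x != 0 -> val (f x) = <[x]>%VS}.
Proof.
exists (fun x => insubd (exist (fun L : {vspace 'rV[K]_n.+1} => \dim L == 1%N) _
    (vline_dim1 const1_neq0) : projsp K n) <[x]>%VS) => x x0.
by rewrite val_insubd vline_dim1.
Qed.

Definition Pt x : projsp K n := sval point_of_vector x.

Definition pvec p : 'rV[K]_n.+1 := vpick (val p).

Lemma val_Pt x : x != 0 -> val (Pt x) = <[x]>%VS.
Proof. exact: (svalP point_of_vector). Qed.

Lemma pvec_neq0 p : pvec p != 0.
Proof. by rewrite vpick0 -dimv_eq0 (eqP (valP p)). Qed.

Lemma val_pvec p : val p = <[pvec p]>%VS.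
Proof.
apply/eqP; rewrite eq_sym eqEdim dim_vline pvec_neq0 (eqP (valP p)) leqnn andbT.
exact: memv_pick.
Qed.

Lemma PtK p : Pt (pvec p) = p.
Proof. by apply: val_inj; rewrite val_Pt ?pvec_neq0 // -val_pvec. Qed.

Lemma Pt_eqP x y : x != 0 -> y != 0 -> Pt x = Pt y <-> exists c, y = c *: x.
Proof.
move=> x0 y0; split=> [/(congr1 val)|[c yE]].
  by rewrite !val_Pt // => xy; apply/vlineP; rewrite xy memv_line.
apply/val_inj; rewrite !val_Pt //; apply/eqP.
rewrite eq_sym eqEdim !dim_vline x0 y0 leqnn andbT.
by apply/vlineP; exists c.
Qed.

Lemma PtZ c x : c != 0 -> x != 0 -> Pt (c *: x) = Pt x.
Proof.
move=> c0 x0; apply/esym/Pt_eqP => //; first by rewrite scaler_eq0 negb_or c0.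
by exists c.
Qed.

Lemma pvec_Pt x : x != 0 -> exists2 c, c != 0 & pvec (Pt x) = c *: x.
Proof.
move=> x0; have := memv_pick (val (Pt x)); rewrite -/(pvec _) val_Pt //.
move=> /vlineP[c xE]; exists c => //; apply: contraNneq (pvec_neq0 (Pt x)) => c0.
by rewrite xE c0 scale0r.
Qed.

Lemma hcoordE p : hcoord p = fun i => pvec p 0 i. Proof. by []. Qed.

End ProjectivePoints.

Section WeightedForms.
Variables (K : fieldType) (k : nat) (J : finType) (cl : 'I_k -> J).
Implicit Types (d e : J -> nat) (g h : ('I_k -> K) -> K).

(** The map [cl] sorts the variables into blocks and d prescribes the degree in each block. One
    block gives homogeneous forms, one block per factor gives forms on a product of projective
    spaces. *)
Definition weighted d (f : mpoly k K) := forall m, m \in msupp f -> forall j,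
  (\sum_(i < k | cl i == j) m i = d j)%N.

Definition wform d h := exists2 f, weighted d f & forall v, h v = meval v f.

Lemma wform_ext d g h : wform d g -> g =1 h -> wform d h.
Proof. by move=> [f wf gE] gh; exists f => // v; rewrite -gh. Qed.

Lemma wform_deg d e h : wform d h -> d =1 e -> wform e h.
Proof.
by move=> [f wf hE] de; exists f => // m mf j; rewrite -de; exact: wf.
Qed.

Lemma wform_cst c : wform (fun=> 0%N) (fun=> c).
Proof.
exists (mpolyC k c) => [m|v]; last by rewrite mevalC.
rewrite msuppC; case: eqP => // _; rewrite inE => /eqP-> j.
by apply: big1 => i _; rewrite mnm0E.
Qed.

Lemma wform_var i : wform (fun j => cl i == j) (fun v => v i).
Proof.
exists (mpolyX K (mnm1 i)) => [m|v]; last by rewrite mevalXU.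
rewrite msuppX inE => /eqP-> j.
have [ij|ij] := eqVneq (cl i) j.
  rewrite (bigD1 i) ?ij //= mnm1E eqxx big1 ?addn0 // => l /andP[_ li].
  by rewrite mnm1E eq_sym (negbTE li).
apply: big1 => l /eqP lj; rewrite mnm1E; case: eqP => // il.
by rewrite il lj eqxx in ij.
Qed.

Lemma wform_add d g h : wform d g -> wform d h -> wform d (fun v => g v + h v).
Proof.
move=> [f wf gE] [f' wf' hE]; exists (f + f') => [m|v]; last by rewrite mevalD gE hE.
by move=> /msuppD_le; rewrite mem_cat => /orP[/wf|/wf'].
Qed.

Lemma wform_mul d e g h : wform d g -> wform e h ->
  wform (fun j => d j + e j)%N (fun v => g v * h v).
Proof.
move=> [f wf gE] [f' wf' hE]; exists (f * f') => [m|v]; last by rewrite mevalM gE hE.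
move=> /msuppM_le /allpairsP[[m1 m2] /= [/wf h1 /wf' h2 ->]] j.
by rewrite -h1 -h2 -big_split /=; apply: eq_bigr => i _; exact: mnmDE.
Qed.

Lemma wform_scale d c h : wform d h -> wform d (fun v => c * h v).
Proof. by move=> wh; apply: (wform_deg (wform_mul (wform_cst c) wh)). Qed.

Lemma wform_opp d h : wform d h -> wform d (fun v => - h v).
Proof.
by move=> wh; apply: (wform_ext (wform_scale (-1) wh)) => v; rewrite mulN1r.
Qed.

Lemma wform_sub d g h : wform d g -> wform d h -> wform d (fun v => g v - h v).
Proof. by move=> wg wh; apply: wform_add => //; apply: wform_opp. Qed.

Lemma wform_exp d h r : wform d h -> wform (fun j => r * d j)%N (fun v => h v ^+ r).
Proof.
move=> wh; elim: r => [|r IH]; first by apply: (wform_ext (wform_cst 1)).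
apply: (@wform_ext _ (fun v => h v * h v ^+ r)) => [|v]; last by rewrite exprS.
by apply: (wform_deg (wform_mul wh IH)) => j; rewrite mulSn.
Qed.

Lemma wform_prod (I : finType) (d : I -> J -> nat) (F : I -> ('I_k -> K) -> K) :
  (forall i, wform (d i) (F i)) ->
  wform (fun j => \sum_i d i j)%N (fun v => \prod_i F i v).
Proof.
move=> wF; elim: (index_enum I) => [|i r IH].
  apply: (wform_deg (wform_ext (wform_cst 1) _)) => [v|j]; by rewrite big_nil.
apply: (wform_deg (wform_ext (wform_mul (wF i) IH) _)) => [v|j]; by rewrite big_cons.
Qed.

Lemma wform_sum (I : finType) d (F : I -> ('I_k -> K) -> K) :
  (forall i, wform d (F i)) -> wform d (fun v => \sum_i F i v).
Proof.
move=> wF; have /choice[f fP] i : exists f, weighted d f /\ forall v, F i v = meval v f.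
  by have [f ? ?] := wF i; exists f.
exists (\sum_i f i) => [m|v].
  by move=> /msupp_sum_le/flattenP[_ /mapP[i _ ->]]; apply: (proj1 (fP i)).
by rewrite raddf_sum; apply: eq_bigr => i _; rewrite (proj2 (fP i)).
Qed.

Lemma wform_scaling d h (c : J -> K) v : wform d h ->
  h (fun i => c (cl i) * v i) = (\prod_j c j ^+ d j) * h v.
Proof.
move=> [f wf hE]; rewrite !hE !mevalE big_distrr /=; apply: eq_big_seq => m /wf mf.
rewrite mulrCA; congr (_ * _); under eq_bigr do rewrite exprMn.
rewrite big_split /=; congr (_ * _).
rewrite (partition_big cl xpredT) //=; apply: eq_bigr => j _.
by rewrite -mf -prodrXr; apply: eq_bigr => i /eqP->.
Qed.

Lemma wform_subalg (X : Type) (A : set (X -> K)) d h (v : X -> 'I_k -> K) :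
  subalg A -> wform d h -> (forall i, A (fun x => v x i)) -> A (fun x => h (v x)).
Proof.
move=> sA [f _ hE] Av; apply: (subalg_ext (subalg_meval sA f Av)) => x.
by rewrite hE.
Qed.

End WeightedForms.

(** Renaming of variables: used to read a form on one factor as a form on the product, and to
    exchange the two factors of a square. *)
Lemma wform_comp (K : fieldType) k k' (J J' : finType) (cl : 'I_k -> J)
    (cl' : 'I_k' -> J') (X : 'I_k -> 'I_k') (sigma : J -> J') d (g : ('I_k -> K) -> K) :
  (forall i, cl' (X i) = sigma (cl i)) -> wform cl d g ->
  wform cl' (fun j' => \sum_(j | sigma j == j') d j)%N (fun v => g (v \o X)).
Proof.
move=> clX [f wf gE].
apply: (@wform_ext _ _ _ _ _ (fun v => \sum_(m : 'I_(size (msupp f)))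
    mcoeff (nth mnm0 (msupp f) m) f * \prod_i v (X i) ^+ nth mnm0 (msupp f) m i)); last first.
  by move=> v; rewrite gE mevalE (big_nth mnm0) big_mkord.
apply: wform_sum => m; apply: wform_scale.
have mf : nth mnm0 (msupp f) m \in msupp f by rewrite mem_nth.
apply: (@wform_deg _ _ _ _
    (fun j => \sum_i nth mnm0 (msupp f) m i * (cl' (X i) == j))%N).
  by apply: wform_prod => i; apply: wform_exp; exact: wform_var.
move=> j'; under [RHS]eq_bigr => j do rewrite -(wf _ mf j).
rewrite (eq_bigr (fun i => if sigma (cl i) == j' then nth mnm0 (msupp f) m i else 0%N)).
  rewrite -big_mkcond /= (partition_big cl (fun j => sigma j == j')) //=.
  apply: eq_bigr => j /eqP sj; apply: eq_bigl => i.
  by case: (eqVneq (cl i) j) => [->|]; rewrite ?andbF // sj eqxx.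
by move=> i _; rewrite clX; case: eqP; rewrite ?muln1 ?muln0.
Qed.

Section ProjForms.
Variables (K : fieldType) (n : nat).
Implicit Types (x y : 'rV[K]_n.+1) (p : projsp K n) (h g : 'rV[K]_n.+1 -> K).

Definition form (d : nat) h :=
  exists2 g, wform (fun _ : 'I_n.+1 => tt) (fun=> d) g & forall x, h x = g (x 0).

Lemma homogeneousP (f : mpoly n.+1 K) : homogeneous f <->
  exists d, weighted (fun=> tt) (fun=> d) f.
Proof.
split=> -[d hd]; exists d.
  by move=> m /(dhomog_mf hd) <- j; rewrite /= mdegE.
by apply/dhomogP => m /hd/(_ tt) <-; rewrite /= mdegE.
Qed.

Lemma form_ext d g h : form d g -> g =1 h -> form d h.
Proof. by move=> [f wf gE] gh; exists f => // v; rewrite -gh. Qed.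

Lemma form_coord i : form 1 (fun x => x 0 i).
Proof.
exists (fun v => v i) => //; apply: wform_deg (@wform_var _ _ _ _ i) _ => -[].
by rewrite eqxx.
Qed.

Lemma form_cst c : form 0 (fun=> c).
Proof. by exists (fun=> c) => //; exact: wform_cst. Qed.

Lemma form_add d g h : form d g -> form d h -> form d (fun v => g v + h v).
Proof.
move=> [g' wg gE] [h' wh hE]; exists (fun v => g' v + h' v) => [|x].
  exact: wform_add.
by rewrite gE hE.
Qed.

Lemma form_mul d e g h : form d g -> form e h -> form (d + e) (fun v => g v * h v).
Proof.
move=> [g' wg gE] [h' wh hE]; exists (fun v => g' v * h' v) => [|x].
  exact: (wform_mul wg wh).
by rewrite gE hE.
Qed.

Lemma form_exp d h r : form d h -> form (r * d) (fun v => h v ^+ r).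
Proof.
move=> [h' wh hE]; exists (fun v => h' v ^+ r) => [|x]; last by rewrite hE.
exact: (wform_exp r wh).
Qed.

Lemma form_scale d c h : form d h -> form d (fun v => c * h v).
Proof. by move=> fh; apply: (form_mul (form_cst c) fh). Qed.

Lemma form_opp d h : form d h -> form d (fun v => - h v).
Proof.
by move=> fh; apply: (form_ext (form_scale (-1) fh)) => v; rewrite mulN1r.
Qed.

Lemma form_sub d g h : form d g -> form d h -> form d (fun v => g v - h v).
Proof. by move=> fg fh; apply: form_add => //; apply: form_opp. Qed.

Lemma form_linear (c : 'I_n.+1 -> K) : form 1 (fun x => \sum_i c i * x 0 i).
Proof.
exists (fun v => \sum_i c i * v i) => //; apply: wform_sum => i.
apply: wform_scale; apply: wform_deg (@wform_var _ _ _ _ i) _ => -[].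
by rewrite eqxx.
Qed.

Lemma form_scaling d h c x : form d h -> h (c *: x) = c ^+ d * h x.
Proof.
move=> [g wg hE]; rewrite !hE.
transitivity (g (fun i => c * x 0 i)).
  by congr g; apply/funext => i; rewrite mxE.
rewrite (wform_scaling (fun=> c) _ wg); congr (_ * _).
by rewrite (eq_bigr (fun=> c ^+ d)) // prodr_const cardT /= enumT unlock.
Qed.

Lemma form_subalg (X : Type) (A : set (X -> K)) d h (v : X -> 'rV[K]_n.+1) :
  subalg A -> form d h -> (forall i, A (fun z => v z 0 i)) -> A (fun z => h (v z)).
Proof.
move=> sA [g wg hE] Av; apply: (@subalg_ext _ _ _ (fun z : X => g (v z 0))) => [|z]; last by rewrite hE.
exact: (wform_subalg sA wg).
Qed.

Lemma form_Pt d h x : form d h -> x != 0 -> (h (pvec (Pt x)) == 0) = (h x == 0).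
Proof.
move=> fh /pvec_Pt[c c0 ->]; rewrite (form_scaling _ _ fh) mulf_eq0.
by rewrite expf_eq0 (negbTE c0) andbF.
Qed.

Lemma closed_form d h : form d h -> closed [set p | h (pvec p) = 0].
Proof.
move=> [g [f wf gE] hE]; rewrite -[X in closed X]setCK; apply: open_closedC.
exists [set f]; first by move=> _ ->; apply/homogeneousP; exists d.
rewrite setCK; apply/seteqP; split=> p /=.
  by rewrite hE gE => hp _ ->.
by move=> /(_ f erefl); rewrite hE gE.
Qed.

Lemma closed_formP (C : set (projsp K n)) p : closed C -> ~ C p ->
  exists d h, [/\ form d h, h (pvec p) != 0 & forall q, C q -> h (pvec q) = 0].
Proof.
move=> /closed_openC[S hS]; rewrite setCK => -> /existsNP[f /not_implyP[Sf fp]].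
have /homogeneousP[d wf] := hS _ Sf; exists d, (fun x => meval (x 0) f).
split; first by exists (fun v => meval v f) => //; exists f.
  exact/eqP.
by move=> q /(_ f Sf).
Qed.

End ProjForms.

Section MultiForms.
Variables (K : fieldType) (I : finType) (n : I -> nat).

Definition vecs := forall i, 'rV[K]_(n i).+1.

Definition vars (u : vecs) : 'I_#|{: mvar n}| -> K :=
  fun k => u (tag (enum_val k)) 0 (tagged (enum_val k)).

Definition pvecs (p : mproj K n) : vecs := fun i => pvec (p i).

Definition mpt (u : vecs) : mproj K n := fun i => Pt (u i).

Implicit Types (d e : I -> nat) (g h : vecs -> K) (u : vecs) (p q : mproj K n).

Definition cls (k : 'I_#|{: mvar n}|) : I := tag (enum_val k).

Definition mform d h := exists2 g, wform cls d g & forall u, h u = g (vars u).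

Lemma mform_ext d g h : mform d g -> g =1 h -> mform d h.
Proof. by move=> [f wf gE] gh; exists f => // v; rewrite -gh. Qed.

Lemma mform_deg d e h : mform d h -> d =1 e -> mform e h.
Proof. by move=> [g wg hE] de; exists g => //; exact: wform_deg de. Qed.

Lemma mform_coord i k : mform (fun j => i == j) (fun u => u i 0 k).
Proof.
exists (fun v => v (enum_rank (Tagged (fun i => 'I_(n i).+1) k : mvar n))).
  apply: wform_deg (@wform_var _ _ _ _ _) _ => j.
  by rewrite /cls enum_rankK.
by move=> u; rewrite /vars enum_rankK.
Qed.

Lemma mform_cst c : mform (fun=> 0%N) (fun=> c).
Proof. by exists (fun=> c) => //; exact: wform_cst. Qed.

Lemma mform_add d g h : mform d g -> mform d h -> mform d (fun v => g v + h v).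
Proof.
move=> [g' wg gE] [h' wh hE]; exists (fun v => g' v + h' v) => [|x].
  exact: wform_add.
by rewrite gE hE.
Qed.

Lemma mform_mul d e g h : mform d g -> mform e h ->
  mform (fun j => d j + e j)%N (fun v => g v * h v).
Proof.
move=> [g' wg gE] [h' wh hE]; exists (fun v => g' v * h' v) => [|x].
  exact: (wform_mul wg wh).
by rewrite gE hE.
Qed.

Lemma mform_exp d h r : mform d h -> mform (fun j => r * d j)%N (fun v => h v ^+ r).
Proof.
move=> [h' wh hE]; exists (fun v => h' v ^+ r) => [|x]; last by rewrite hE.
exact: (wform_exp r wh).
Qed.

Lemma mform_scale d c h : mform d h -> mform d (fun v => c * h v).
Proof. by move=> fh; apply: (mform_deg (mform_mul (mform_cst c) fh)). Qed.

Lemma mform_opp d h : mform d h -> mform d (fun v => - h v).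
Proof.
by move=> fh; apply: (mform_ext (mform_scale (-1) fh)) => v; rewrite mulN1r.
Qed.

Lemma mform_sub d g h : mform d g -> mform d h -> mform d (fun v => g v - h v).
Proof. by move=> fg fh; apply: mform_add => //; apply: mform_opp. Qed.

Lemma mform_form i r (h : 'rV[K]_(n i).+1 -> K) : form r h ->
  mform (fun j => r * (i == j))%N (fun u => h (u i)).
Proof.
move=> [g wg hE]; pose X (k : 'I_(n i).+1) := enum_rank (Tagged (fun i => 'I_(n i).+1) k : mvar n).
exists (fun v => g (v \o X)) => [|u]; last first.
  by rewrite hE; congr g; apply/funext => k; rewrite /X /vars /= enum_rankK.
apply: (wform_deg (wform_comp (sigma := fun=> i) (cl' := cls) (X := X) _ wg)) => [k|j].
  by rewrite /cls enum_rankK.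
case: eqP => _; last by rewrite muln0 big_pred0.
by rewrite muln1 (big_pred1 tt) // => -[].
Qed.

Lemma closed_mform d h : mform d h -> closed [set p | h (pvecs p) = 0].
Proof.
move=> [g [f wf gE] hE]; rewrite -[X in closed X]setCK; apply: open_closedC.
exists [set f]; first by move=> _ ->; exists d.
rewrite setCK; apply/seteqP; split=> p /=.
  by rewrite hE gE => hp _ ->.
by move=> /(_ f erefl); rewrite hE gE.
Qed.

Lemma closed_mformP (C : set (mproj K n)) p : closed C -> ~ C p ->
  exists d h, [/\ mform d h, h (pvecs p) != 0 & forall q, C q -> h (pvecs q) = 0].
Proof.
move=> /closed_openC[S hS]; rewrite setCK => -> /existsNP[f /not_implyP[Sf fp]].
have [d wf] := hS _ Sf; exists d, (fun u => meval (vars u) f).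
split; first by exists (fun v => meval v f) => //; exists f.
  exact/eqP.
by move=> q /(_ f Sf).
Qed.

Lemma mform_scaling d h (c : I -> K) u : mform d h ->
  h (fun i => c i *: u i) = (\prod_j c j ^+ d j) * h u.
Proof.
move=> [g wg hE]; rewrite !hE -(wform_scaling c _ wg); congr g.
by apply/funext => k; rewrite /vars mxE.
Qed.

Lemma mform_mpt d h u : mform d h -> (forall i, u i != 0) ->
  (h (pvecs (mpt u)) == 0) = (h u == 0).
Proof.
move=> fh u0; have /choice[c cP] i : exists c, c != 0 /\ pvec (Pt (u i)) = c *: u i.
  by have [c ? ?] := pvec_Pt (u0 i); exists c.
rewrite (_ : pvecs _ = fun i => c i *: u i); last first.
  by apply: functional_extensionality_dep => i; rewrite /pvecs /mpt (proj2 (cP i)).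
rewrite (mform_scaling _ _ fh) mulf_eq0 [X in X || _](_ : _ = false) //.
by apply/negbTE/prodf_neq0 => j _; rewrite expf_neq0 // (proj1 (cP j)).
Qed.

Lemma mpt_pvecs p : mpt (pvecs p) = p.
Proof. by apply: functional_extensionality_dep => i; rewrite /mpt PtK. Qed.

Lemma mform_subalg (X : Type) (A : set (X -> K)) d h (u : X -> vecs) :
  subalg A -> mform d h -> (forall i k, A (fun x => u x i 0 k)) -> A (fun x => h (u x)).
Proof.
move=> sA [g wg hE] Au; apply: (@subalg_ext _ _ _ (fun z : X => g (vars (u z)))) => [|z]; last by rewrite hE.
by apply: (wform_subalg sA wg) => k; exact: Au.
Qed.

End MultiForms.

Section Curves.
Variables (K : fieldType).
Hypothesis infK : forall s : seq K, exists x, x \notin s.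

(** Limits along polynomial curves: a form vanishing on C becomes a polynomial in s that is zero for
    general s, hence also at s0. *)
Lemma curve_mproj (I : finType) (n : I -> nat) (C : set (mproj K n))
    (u : K -> vecs K n) s0 : closed C ->
  (forall i k, polyfun (fun s => u s i 0 k)) -> (forall i, u s0 i != 0) ->
  generic (fun s => (forall i, u s i != 0) /\ C (mpt (u s))) -> C (mpt (u s0)).
Proof.
move=> cC pu u0 gC; apply: contrapT => nC.
have [d [h [fh]]] := closed_mformP cC nC.
rewrite (mform_mpt fh) // => /eqP hu0 hC; apply: hu0.
apply: (polyfun_eq0 infK (h := fun s => h (u s)) _ _ s0).
  exact: (mform_subalg (subalg_polyfun K) fh).
apply: genericW gC _ => s [us /hC/eqP].
by rewrite (mform_mpt fh) // => /eqP.
Qed.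

Lemma curve_projsp n (C : set (projsp K n)) (u : K -> 'rV[K]_n.+1) s0 : closed C ->
  (forall k, polyfun (fun s => u s 0 k)) -> u s0 != 0 ->
  generic (fun s => u s != 0 /\ C (Pt (u s))) -> C (Pt (u s0)).
Proof.
move=> cC pu u0 gC; apply: contrapT => nC.
have [d [h [fh]]] := closed_formP cC nC.
rewrite (form_Pt fh) // => /eqP hu0 hC; apply: hu0.
apply: (polyfun_eq0 infK (h := fun s => h (u s)) _ _ s0).
  exact: (form_subalg (subalg_polyfun K) fh).
apply: genericW gC _ => s [us /hC/eqP].
by rewrite (form_Pt fh) // => /eqP.
Qed.

End Curves.

(** * Unordered pairs of points *)

Lemma ord2P (i : 'I_2) : i = 0 \/ i = 1.
Proof. by case: i => -[|[|//]] i2; [left|right]; exact/val_inj. Qed.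

Lemma two_points (T : Type) (a b a' b' : T) : a <> b ->
  a' = a \/ a' = b -> b' = a \/ b' = b -> a = a' \/ a = b' -> b = a' \/ b = b' ->
  (a' = a /\ b' = b) \/ (a' = b /\ b' = a).
Proof. by move=> ab [] -> [] -> [] ea [] eb; tauto || (case: ab; congruence). Qed.

Section Pairs.
Variables (K : fieldType) (n : nat).
Implicit Types (x y : 'rV[K]_n.+1) (A : uset K n 2).
Local Notation two := (fun _ : 'I_2 => n).
Implicit Types (h g : vecs K two -> K).

Definition pairv x y : vecs K two := fun i => if i == 0 then x else y.

(* x and y are homogeneous coordinates of the two points of A *)
Variant spans A x y : Prop :=
  Spans of x != 0 & y != 0 & val A = [fset Pt x; Pt y]%fset.

Lemma pairvE (u : vecs K two) : u = pairv (u 0) (u 1).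
Proof.
apply: functional_extensionality_dep => i; rewrite /pairv.
by case: (ord2P i) => ->.
Qed.

Lemma points_ofE (p : mproj K two) : points_of p = [fset p 0; p 1]%fset.
Proof.
apply/fsetP => q; apply/imfsetP/fset2P => /= [[i _ ->]|].
  by case: (ord2P i) => ->; [left|right].
by case=> ->; [exists 0|exists 1].
Qed.

Lemma spansC A x y : spans A x y -> spans A y x.
Proof.
move=> [x0 y0 AE]; split; [exact: y0|exact: x0|rewrite AE].
by apply/fsetP => p; apply/fset2P/fset2P => -[->|->]; [right|left|right|left].
Qed.

Lemma spans_neq A x y : spans A x y -> Pt x <> Pt y.
Proof.
move=> [x0 y0 AE] xy; have := valP A; rewrite AE xy fsetUid cardfs1.
by [].
Qed.

Lemma spans_ex x y : x != 0 -> y != 0 -> Pt x <> Pt y -> exists A, spans A x y.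
Proof.
move=> x0 y0 /eqP xy.
have c2 : #|` [fset Pt x; Pt y]%fset| == 2%N by rewrite cardfs2 xy.
exists (exist (fun B : {fset projsp K n} => #|` B| == 2%N) _ c2).
by split; [exact: x0|exact: y0|].
Qed.

Lemma spansP A : exists x y, spans A x y.
Proof.
have : size (enum_fset (val A)) == 2%N := valP A.
case E: (enum_fset (val A)) => [|p [|q []]] // _; exists (pvec p), (pvec q).
split; [exact: pvec_neq0|exact: pvec_neq0|rewrite !PtK].
apply/fsetP => r; transitivity ((r == p) || (r == q)).
  by rewrite -mem_seq2 -E.
by apply/orP/fset2P => -[]; [move/eqP->; left|move/eqP->; right|move->; left|move->; right].
Qed.

Lemma spans_uniq A A' x y : spans A x y -> spans A' x y -> A = A'.
Proof. by move=> [_ _ AE] [_ _ AE']; apply: val_inj; rewrite AE AE'. Qed.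

Lemma spans_points A x y (p : mproj K two) : spans A x y ->
  points_of p = val A -> (p 0 = Pt x /\ p 1 = Pt y) \/ (p 0 = Pt y /\ p 1 = Pt x).
Proof.
move=> sA; have := spans_neq sA; case: sA => x0 y0 ->; rewrite points_ofE => xy pE.
have /fset2P p0 : p 0 \in [fset Pt x; Pt y]%fset by rewrite -pE; apply/fset2P; left.
have /fset2P p1 : p 1 \in [fset Pt x; Pt y]%fset by rewrite -pE; apply/fset2P; right.
have /fset2P px : Pt x \in [fset p 0; p 1]%fset by rewrite pE; apply/fset2P; left.
have /fset2P py : Pt y \in [fset p 0; p 1]%fset by rewrite pE; apply/fset2P; right.
exact: two_points xy p0 p1 px py.
Qed.

Lemma spans_pvecs A (p : mproj K two) : points_of p = val A ->
  spans A (pvecs p 0) (pvecs p 1).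
Proof.
move=> pA; split; [exact: pvec_neq0|exact: pvec_neq0|].
by rewrite /pvecs !PtK -pA points_ofE.
Qed.

Lemma points_of_mpt A x y : spans A x y -> points_of (mpt (pairv x y)) = val A.
Proof. by move=> [_ _ ->]; rewrite points_ofE. Qed.

Lemma mform_pairv d h x y : mform d h -> x != 0 -> y != 0 ->
  (h (pvecs (mpt (pairv x y))) == 0) = (h (pairv x y) == 0).
Proof. by move=> fh x0 y0; apply: (mform_mpt fh) => i; rewrite /pairv; case: ifP. Qed.

Lemma closed_pairs d h (C : set (uset K n 2)) : mform d h ->
  (forall A x y, spans A x y -> (C A <-> h (pairv x y) = 0)) -> closed C.
Proof.
move=> fh CE; rewrite -[X in closed X]setCK; apply: open_closedC.
exists (~` [set p | h (pvecs p) = 0]); first exact/closed_openC/(closed_mform fh).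
move=> p A /spans_pvecs/CE; rewrite -pairvE => -[CA AC].
by split=> nC ?; apply: nC; [exact: CA|exact: AC].
Qed.

Lemma closed_pairsP (C : set (uset K n 2)) A x y : closed C -> ~ C A -> spans A x y ->
  exists d h, [/\ mform d h, h (pairv x y) != 0 &
    forall A' x' y', spans A' x' y' -> C A' -> h (pairv x' y') = 0].
Proof.
move=> /closed_openC[O oO OE] nC sA.
have nO : ~ (~` O) (mpt (pairv x y)) by apply; exact/(OE _ _ (points_of_mpt sA)).
have [d [h [fh hA hO]]] := closed_mformP (open_closedC oO) nO.
exists d, h; split=> //; first by rewrite -(mform_pairv fh) //; case: sA.
move=> A' x' y' sA' CA'; apply/eqP; rewrite -(mform_pairv fh); try by case: sA'.
by apply/eqP/hO => /(OE _ _ (points_of_mpt sA')).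
Qed.

Lemma mform_swap d h : mform d h ->
  exists d', mform d' (fun u => h (pairv (u (1 : 'I_2)) (u (0 : 'I_2)))) /\ (d' (0 : 'I_2) = d (1 : 'I_2) /\ d' (1 : 'I_2) = d (0 : 'I_2)).
Proof.
move=> [g wg hE]; pose sw (i : 'I_2) : 'I_2 := if i == 0 then 1 else 0.
pose X (k : 'I_#|{: mvar two}|) : 'I_#|{: mvar two}| := enum_rank
  (existT (fun _ : 'I_2 => 'I_n.+1) (sw (tag (enum_val k))) (tagged (enum_val k)) : mvar two).
exists (fun j' => \sum_(j | sw j == j') d j)%N; split.
  exists (fun v => g (v \o X)) => [|u].
    by apply: (@wform_comp K _ _ _ _ (@cls _ two) (@cls _ two) X sw d g _ wg) => k; rewrite /cls enum_rankK.
  rewrite hE; congr g; apply/funext => k; rewrite /X /vars /= enum_rankK /pairv /sw /=.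
  by case: ifP.
split; [rewrite (big_pred1 1) // | rewrite (big_pred1 0) //] => j; by case: (ord2P j) => ->.
Qed.

End Pairs.

(** * Linear forms, charts of projective space and of the space of pairs *)

Section LinearForms.
Variables (K : fieldType) (n : nat).
Implicit Types (c : 'cV[K]_n) (x y : 'rV[K]_n).

Definition lf c y : K := (y *m c) 0 0.

Lemma lfE c y : lf c y = \sum_i y 0 i * c i 0. Proof. by rewrite /lf mxE. Qed.

Lemma lfD c x y : lf c (x + y) = lf c x + lf c y.
Proof. by rewrite /lf mulmxDl mxE. Qed.

Lemma lfZ c a x : lf c (a *: x) = a * lf c x.
Proof. by rewrite /lf -scalemxAl mxE. Qed.

Lemma lfN c x : lf c (- x) = - lf c x.
Proof. by rewrite -scaleN1r lfZ mulN1r. Qed.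

Lemma lfB c x y : lf c (x - y) = lf c x - lf c y.
Proof. by rewrite lfD lfN. Qed.

Lemma lf0 c : lf c 0 = 0. Proof. by rewrite /lf mul0mx mxE. Qed.

Lemma lf_coord i x : lf (delta_mx i 0) x = x 0 i.
Proof.
rewrite lfE (bigD1 i) //= !mxE !eqxx mulr1 big1 ?addr0 // => j ji.
by rewrite mxE (negbTE ji) mulr0.
Qed.

Lemma lf_comb a b (c c' : 'cV[K]_n) x : lf (a *: c + b *: c') x = a * lf c x + b * lf c' x.
Proof. by rewrite /lf mulmxDr -!scalemxAr !mxE. Qed.

Lemma subalg_lf (X : Type) (A : set (X -> K)) c (y : X -> 'rV[K]_n) :
  subalg A -> (forall i, A (fun s => y s 0 i)) -> A (fun s => lf c (y s)).
Proof.
move=> sA Ay; apply: (@subalg_ext _ _ _ (fun s => \sum_i y s 0 i * c i 0)).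
  by apply: (subalg_sum sA) => i _; apply: (subalg_mul sA) => //; exact: (subalg_cst sA).
by move=> s; rewrite lfE.
Qed.

End LinearForms.

Lemma form_lf (K : fieldType) n (c : 'cV[K]_n.+1) : form 1 (lf c).
Proof.
apply: form_ext (form_linear (fun i => c i 0)) _ => x; rewrite lfE.
by apply: eq_bigr => i _; rewrite mulrC.
Qed.

Lemma lf_neq0 (K : fieldType) n (x : 'rV[K]_n) : x != 0 -> exists c, lf c x != 0.
Proof. by case/rV0Pn => i xi; exists (delta_mx i 0); rewrite lf_coord. Qed.

Lemma lf_neq0_2 (K : fieldType) n (x y : 'rV[K]_n) :
  (forall s : seq K, exists x, x \notin s) ->
  x != 0 -> y != 0 -> exists c, lf c x != 0 /\ lf c y != 0.
Proof.
move=> infK /lf_neq0[c cx] /lf_neq0[c' cy].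
have pol z : polyfun (fun s => lf (1 *: c + s *: c') z).
  apply: (@subalg_ext _ _ _ (fun s => lf c z + s * lf c' z)) => [|s].
    by subalg_tac (subalg_polyfun K); exact: polyfun_var.
  by rewrite lf_comb mul1r.
have [c'x|c'x] := eqVneq (lf c' x) 0; last by exists c'.
have [s [s0 sy]] : exists s, lf (1 *: c + s *: c') y != 0 /\ True.
  have [cy0|cy0] := eqVneq (lf c y) 0.
    by exists 1; rewrite lf_comb cy0 mulr0 add0r mul1r.
  by exists 0; rewrite lf_comb mul0r addr0 mul1r.
by exists (1 *: c + s *: c'); rewrite lf_comb c'x mulr0 addr0 mul1r.
Qed.

Section ProjCharts.
Variables (K : fieldType) (n : nat).
Variable (c : 'cV[K]_n.+1).

Definition proj_dom : set (projsp K n) := [set p | lf c (pvec p) != 0].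

Definition proj_ring : set (projsp K n -> K) :=
  [set g | exists e F, form e F /\ forall p, proj_dom p ->
    g p = F (pvec p) / lf c (pvec p) ^+ e].

Lemma fraction_add (a b l : K) d e : l != 0 ->
  a / l ^+ d + b / l ^+ e = (a * l ^+ e + b * l ^+ d) / l ^+ (d + e).
Proof.
move=> l0; rewrite exprD mulrDl; congr (_ + _).
  by rewrite [l ^+ d * _]mulrC invfM mulrA mulfK // expf_neq0.
by rewrite invfM mulrA mulfK // expf_neq0.
Qed.

Lemma fraction_mul (a b l : K) d e :
  (a / l ^+ d) * (b / l ^+ e) = (a * b) / l ^+ (d + e).
Proof. by rewrite exprD mulrACA invfM. Qed.

Lemma form_lf_exp e : form e (fun x => lf c x ^+ e).
Proof. by rewrite -[X in form X _]muln1; apply: form_exp; exact: form_lf. Qed.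

Lemma chart_proj : chart proj_dom proj_ring.
Proof.
split.
- rewrite -[proj_dom]setCK; apply: closed_openC.
  rewrite (_ : ~` proj_dom = [set p | lf c (pvec p) = 0]).
    exact: closed_form (form_lf c).
  by apply/seteqP; split=> p /=; [move/negP; rewrite negbK => /eqP|move=> + /eqP].
- split=> [a|f g [d [F [fF fE]]] [e [G [fG gE]]]|f g [d [F [fF fE]]] [e [G [fG gE]]]].
  + exists 0%N, (fun=> a); split; first exact: form_cst.
    by move=> p _; rewrite expr0 divr1.
  + exists (d + e)%N, (fun x => F x * lf c x ^+ e + G x * lf c x ^+ d); split.
      apply: form_add; first exact: (form_mul fF (form_lf_exp e)).
      by rewrite addnC; exact: (form_mul fG (form_lf_exp d)).
    by move=> p Up; rewrite fE // gE // fraction_add.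
  + exists (d + e)%N, (fun x => F x * G x); split; first exact: form_mul.
    by move=> p Up; rewrite fE // gE // fraction_mul.
- move=> g [e [F [fF gE]]]; exists [set p | F (pvec p) = 0]; first exact: closed_form fF.
  move=> p Up; rewrite gE //=; split=> [->|/eqP]; first by rewrite mul0r.
  by rewrite mulf_eq0 invr_eq0 expf_eq0 (negbTE Up) andbF orbF => /eqP.
- move=> C p cC Up nC; have [d [F [fF Fp FC]]] := closed_formP cC nC.
  exists (fun p => F (pvec p) / lf c (pvec p) ^+ d); split.
  + by exists d, F.
  + by rewrite mulf_neq0 // invr_eq0 expf_neq0.
  + by move=> q _ /FC ->; rewrite mul0r.
Qed.

End ProjCharts.

Section PairCharts.
Variables (K : fieldType) (n : nat).
Variable (c : 'cV[K]_n.+1).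
Local Notation two := (fun _ : 'I_2 => n).

Definition pair_lf (u : vecs K two) : K := lf c (u 0) * lf c (u 1).

Definition pair_dom : set (uset K n 2) :=
  [set A | forall x y, spans A x y -> pair_lf (pairv x y) != 0].

(** Fractions of the same degree e in both points. Symmetry in the two points is not imposed on F:
    it is implied by the equation, which has to hold for every ordered choice of representatives. *)
Definition pair_ring : set (uset K n 2 -> K) :=
  [set g | exists e (F : vecs K two -> K), mform (fun=> e) F /\
    forall A x y, pair_dom A -> spans A x y ->
      g A = F (pairv x y) / pair_lf (pairv x y) ^+ e].

Lemma mform_pair_lf e : mform (fun=> e) (fun u => pair_lf u ^+ e).
Proof.
have := mform_exp e (mform_mul (mform_form (n := two) (i := 0 : 'I_2) (form_lf c))
  (mform_form (n := two) (i := 1 : 'I_2) (form_lf c))).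
move/mform_deg; apply=> j; by case: (ord2P j) => -> /=; rewrite ?muln1.
Qed.

Lemma mform_pair_lf1 : mform (fun=> 1%N) pair_lf.
Proof. by apply: mform_ext (mform_pair_lf 1) _ => u; rewrite expr1. Qed.

Lemma pair_ratio e (G : vecs K two -> K) A x y x' y' : mform (fun=> e) G ->
  (forall u, G (pairv (u (1 : 'I_2)) (u (0 : 'I_2))) = G u) ->
  spans A x y -> spans A x' y' -> pair_lf (pairv x y) != 0 ->
  G (pairv x y) / pair_lf (pairv x y) ^+ e = G (pairv x' y') / pair_lf (pairv x' y') ^+ e.
Proof.
move=> fG symG sA sA' l0.
suff scal z w : spans A z w -> Pt x = Pt z -> Pt y = Pt w ->
    G (pairv x y) / pair_lf (pairv x y) ^+ e = G (pairv z w) / pair_lf (pairv z w) ^+ e.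
  have := spans_points sA' (points_of_mpt sA); rewrite /mpt /= => -[[ex ey]|[ex ey]].
    exact: scal sA' ex ey.
  rewrite (scal _ _ (spansC sA') ex ey).
  have -> : pair_lf (pairv y' x') = pair_lf (pairv x' y') by exact: mulrC.
  by congr (_ * _); exact: symG (pairv x' y').
move=> [z0 w0 _]; case: sA => x0 y0 _ /(Pt_eqP x0 z0)[a zE] /(Pt_eqP y0 w0)[b wE].
pose ab (i : 'I_2) := if i == 0 then a else b.
have E : pairv z w = fun i => ab i *: pairv x y i.
  by apply: functional_extensionality_dep => i; rewrite /pairv /ab; case: ifP.
have H : \prod_j ab j ^+ e = (a * b) ^+ e.
  by rewrite big_ord_recl big_ord1 /ab /= exprMn.
have ab0 : a * b != 0.
  rewrite mulf_neq0 //; [apply: contraNneq z0 => a0|apply: contraNneq w0 => b0].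
    by rewrite zE a0 scale0r.
  by rewrite wE b0 scale0r.
rewrite E (mform_scaling _ _ fG) H (mform_scaling _ _ mform_pair_lf1).
rewrite big_ord_recl big_ord1 /ab /= !expr1 [in RHS](exprMn e (a * b)) -mulf_div.
by rewrite divff ?mul1r // expf_neq0.
Qed.

Lemma pair_domP A x y : spans A x y -> pair_dom A <-> pair_lf (pairv x y) != 0.
Proof.
move=> sA; split=> [|h x' y' sA']; first exact.
have lfP (z w : 'rV[K]_n.+1) : z != 0 -> w != 0 -> Pt z = Pt w -> lf c z != 0 -> lf c w != 0.
  move=> z0 w0 /(Pt_eqP z0 w0)[k wE] lz; rewrite wE lfZ mulf_neq0 //.
  by apply: contraNneq w0 => k0; rewrite wE k0 scale0r.
move: h; rewrite /pair_lf /pairv /= !mulf_eq0 !negb_or => /andP[lx ly].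
have pA' := points_of_mpt sA'.
have := spans_points sA pA'; rewrite /mpt /pairv /= => -[[e0 e1]|[e0 e1]].
  by apply/andP; split; [apply: (lfP x) => //|apply: (lfP y) => //];
    case: (sA) => //; case: (sA') => //.
by apply/andP; split; [apply: (lfP y) => //|apply: (lfP x) => //];
  case: (sA) => //; case: (sA') => //.
Qed.

Lemma closed_pair_zero e (g : uset K n 2 -> K) (F : vecs K two -> K) :
  mform (fun=> e) F ->
  (forall A x y, pair_dom A -> spans A x y ->
      g A = F (pairv x y) / pair_lf (pairv x y) ^+ e) ->
  exists2 C, closed C & forall A, pair_dom A -> (C A <-> g A = 0).
Proof.
(* The extra factor [pair_lf] makes H vanish outside the chart, so that the condition H = 0 depends
   on A only and defines a closed set. *)
move=> fF gE; pose H (u : vecs K two) := F u * pair_lf u.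
pose C := [set A | forall x y, spans A x y -> H (pairv x y) = 0].
have HE A x y : pair_dom A -> spans A x y -> H (pairv x y) = 0 <-> g A = 0.
  move=> UA sA; have l0 := UA _ _ sA; rewrite (gE _ _ _ UA sA) /H.
  split=> /eqP; rewrite mulf_eq0 ?invr_eq0 ?expf_eq0 (negbTE l0) ?andbF orbF => /eqP->;
  by rewrite mul0r.
have nU A x y : ~ pair_dom A -> spans A x y -> H (pairv x y) = 0.
  move=> nUA sA; apply/eqP; rewrite /H mulf_eq0; apply/orP; right.
  by apply/negPn/negP => /(pair_domP sA).
exists C.
  apply: (@closed_pairs _ _ _ H C).
    exact: mform_mul fF mform_pair_lf1.
  move=> A x y sA; split=> [|Hxy x' y' sA']; first exact.
  have [UA|nUA] := pselect (pair_dom A); last exact: nU nUA sA'.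
  by apply/(HE _ _ _ UA sA'); apply/(HE _ _ _ UA sA).
move=> A UA; split=> [|gA x y sA]; last exact/(HE _ _ _ UA sA).
by have [x [y sA]] := spansP A; move=> /(_ _ _ sA)/(HE _ _ _ UA sA).
Qed.

Lemma chart_pair : chart pair_dom pair_ring.
Proof.
split.
- rewrite -[pair_dom]setCK; apply: closed_openC.
  apply: (closed_pairs mform_pair_lf1).
  move=> A x y sA; split=> [nUA|l0 /(pair_domP sA)]; last by rewrite l0 eqxx.
  by apply/eqP/negPn/negP => /(pair_domP sA).
- split=> [a|f g [d [F [fF fE]]] [e [G [fG gE]]]|f g [d [F [fF fE]]] [e [G [fG gE]]]].
  + exists 0%N, (fun=> a); split; first exact: mform_cst.
    by move=> A x y _ _; rewrite expr0 divr1.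
  + exists (d + e)%N, (fun u => F u * pair_lf u ^+ e + G u * pair_lf u ^+ d); split.
      apply: mform_add; first exact: (mform_mul fF (mform_pair_lf e)).
      by rewrite addnC; exact: (mform_mul fG (mform_pair_lf d)).
    move=> A x y UA sA; rewrite (fE _ _ _ UA sA) (gE _ _ _ UA sA) fraction_add //.
    exact: UA.
  + exists (d + e)%N, (fun x => F x * G x); split; first exact: mform_mul.
    by move=> A x y UA sA; rewrite (fE _ _ _ UA sA) (gE _ _ _ UA sA) fraction_mul.
- by move=> g [e [F [fF gE]]]; exact: closed_pair_zero fF gE.
- move=> C A cC UA nC; have [x [y sA]] := spansP A.
  have [d [f [ff fA fC]]] := closed_pairsP cC nC sA.
  (* Powers of the linear form give F the same degree in both points. *)
  pose d0 := d (0 : 'I_2); pose d1 := d (1 : 'I_2); pose e := (d0 + d1)%N.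
  pose F (u : vecs K two) := f u * (lf c (u 0) ^+ d1 * lf c (u 1) ^+ d0).
  have fF : mform (fun=> e) F.
    apply: mform_deg (mform_mul ff (mform_mul
      (mform_form (n := two) (i := 0 : 'I_2) (form_lf_exp c d1))
      (mform_form (n := two) (i := 1 : 'I_2) (form_lf_exp c d0)))) _ => j.
    by case: (ord2P j) => -> /=; rewrite ?muln1 ?muln0 /e ?addn0 // addnC.
  have [d' [fF' [d'0 d'1]]] := mform_swap fF.
  have fFs : mform (fun=> e) (fun u : vecs K two => F (pairv (u (1 : 'I_2)) (u (0 : 'I_2)))).
    by apply: mform_deg fF' _ => j; case: (ord2P j) => ->.
  have l0 : pair_lf (pairv x y) != 0 by exact: UA.
  have [lx ly] : lf c x != 0 /\ lf c y != 0.
    by move: l0; rewrite /pair_lf mulf_eq0 negb_or => /andP[].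
  have Fxy : F (pairv x y) != 0 by rewrite /F !mulf_neq0 // expf_neq0.
  have FC A' x' y' : spans A' x' y' -> C A' -> F (pairv x' y') = 0.
    by move=> sA' CA'; rewrite /F (fC _ _ _ sA' CA') mul0r.
  (* F is made symmetric without losing its nonvanishing at A: add the swapped form if that one
     vanishes at (x, y), multiply by it otherwise. *)
  have [e' [G [fG symG Gxy GC]]] : exists e' (G : vecs K two -> K), [/\ mform (fun=> e') G,
      forall u : vecs K two, G (pairv (u (1 : 'I_2)) (u (0 : 'I_2))) = G u, G (pairv x y) != 0 &
      forall A' x' y', spans A' x' y' -> C A' -> G (pairv x' y') = 0].
    have [Fs0|Fs0] := eqVneq (F (pairv y x)) 0.
      exists e, (fun u : vecs K two => F u + F (pairv (u (1 : 'I_2)) (u (0 : 'I_2)))); split.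
      - exact: mform_add.
      - by move=> u; rewrite addrC /= -(pairvE u).
      - by rewrite [X in _ + X]Fs0 addr0.
      - move=> A' x' y' sA' CA'; rewrite (FC _ _ _ sA' CA') add0r.
        exact: FC (spansC sA') CA'.
    exists (e + e)%N, (fun u : vecs K two => F u * F (pairv (u (1 : 'I_2)) (u (0 : 'I_2)))); split.
    - exact: mform_mul.
    - by move=> u; rewrite mulrC /= -(pairvE u).
    - by rewrite mulf_neq0.
    - by move=> A' x' y' sA' CA'; rewrite (FC _ _ _ sA' CA') mul0r.
  have /choice[sp spP] : forall A' : uset K n 2,
      exists u : 'rV[K]_n.+1 * 'rV[K]_n.+1, spans A' u.1 u.2.
    by move=> A'; have [x' [y' sA']] := spansP A'; exists (x', y').
  pose v A' := pairv (sp A').1 (sp A').2.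
  pose g A' := G (v A') / pair_lf (v A') ^+ e'.
  have gE A' x' y' : pair_dom A' -> spans A' x' y' ->
      g A' = G (pairv x' y') / pair_lf (pairv x' y') ^+ e'.
    move=> UA' sA'; rewrite /g.
    apply: (pair_ratio (e := e') fG symG (spP A') sA'); exact: UA' (spP A').
  exists g; split.
  + by exists e', G.
  + by rewrite (gE _ _ _ UA sA) mulf_neq0 // invr_eq0 expf_neq0.
  + move=> A' UA' CA'; have [x' [y' sA']] := spansP A'.
    by rewrite (gE _ _ _ UA' sA') (GC _ _ _ sA' CA') mul0r.
Qed.

End PairCharts.

Lemma polyfun_comp (K : comNzRingType) (X : Type) (A : set (X -> K)) h f :
  subalg A -> polyfun h -> A f -> A (fun x => h (f x)).
Proof.
move=> sA [p hp] Af.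
apply: (@subalg_ext _ _ _ (fun x => \sum_(i < size p) p`_i * f x ^+ i)).
  apply: (subalg_sum sA) => i _; apply: (subalg_mul sA); first exact: (subalg_cst sA).
  exact: (subalg_exp sA).
by move=> x; rewrite hp horner_coef.
Qed.

(** * Closed sets of pairs *)

Section ClosedPairSets.
Variables (K : fieldType) (n : nat).
Implicit Types (x y : 'rV[K]_n.+1) (A : uset K n 2).

Lemma closed_point (q : projsp K n) : closed [set q].
Proof.
rewrite (_ : [set q] = \bigcap_(ij in [set: 'I_n.+1 * 'I_n.+1])
    [set p | pvec p 0 ij.1 * pvec q 0 ij.2 - pvec p 0 ij.2 * pvec q 0 ij.1 = 0]).
  apply: closed_bigI => -[i j] _ /=; apply: (closed_form (d := 1)
    (h := fun v => v 0 i * pvec q 0 j - v 0 j * pvec q 0 i)).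
  by apply: form_sub; apply: (form_ext (form_scale (pvec q 0 _) (form_coord K _))) => v;
    rewrite mulrC.
apply/seteqP; split=> [p -> ij _|p hp]; first by rewrite /= mulrC subrr.
have /rV0Pn[j qj] := pvec_neq0 q.
rewrite /set1 /= -(PtK p) -(PtK q).
apply/Pt_eqP; rewrite ?pvec_neq0 //.
have pj : pvec p 0 j != 0.
  apply: contraNneq (pvec_neq0 p) => pj; apply/eqP/rowP => i; rewrite mxE.
  have /= := hp (i, j) Logic.I; rewrite pj mul0r subr0 => /eqP.
  by rewrite mulf_eq0 (negbTE qj) orbF => /eqP.
exists (pvec q 0 j / pvec p 0 j); apply/rowP => i; rewrite mxE mulrAC.
apply: (mulIf pj); rewrite divfK //.
by have /= /eqP := hp (i, j) Logic.I; rewrite subr_eq0 mulrC => /eqP ->; rewrite mulrC.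
Qed.

Lemma spansE A x y p : spans A x y -> p \in val A <-> p = Pt x \/ p = Pt y.
Proof. by move=> [_ _ ->]; split=> /fset2P. Qed.

Lemma usets_inP (C : set (projsp K n)) A x y : spans A x y ->
  usets_in 2 C A <-> C (Pt x) /\ C (Pt y).
Proof.
move=> sA; split=> [CA|[Cx Cy] p /(spansE _ sA)[->//|->//]].
by split; apply: CA; apply/(spansE _ sA); [left|right].
Qed.

Lemma closed_component (I : finType) (m : I -> nat) i (C : set (projsp K (m i))) :
  closed C -> closed [set p : mproj K m | C (p i)].
Proof.
move=> cC; rewrite (_ : [set p : mproj K m | C (p i)] =
    \bigcap_(h in [set h : 'rV[K]_(m i).+1 -> K |
      (exists d, form d h) /\ forall q, C q -> h (pvec q) = 0])
    [set p : mproj K m | h (pvecs p i) = 0]).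
  apply: closed_bigI => h [[d fh] _]; exact: closed_mform (mform_form fh).
apply/seteqP; split=> [p Cp h [_ hC]|p hp]; first exact: hC.
apply: contrapT => /(closed_formP cC)[d [h [fh /eqP hpi hC]]]; apply: hpi.
by apply: (hp h); split=> //; exists d.
Qed.

Lemma closed_pair_set (D : set (mproj K (fun _ : 'I_2 => n))) (C : set (uset K n 2)) :
  closed D -> (forall A x y, spans A x y -> (C A <-> D (mpt (pairv x y)))) -> closed C.
Proof.
move=> cD CE; rewrite -[X in closed X]setCK; apply: open_closedC.
exists (~` D); first exact: closed_openC.
move=> p A /spans_pvecs/CE; rewrite -pairvE mpt_pvecs => -[CA AC].
by split=> nC ?; apply: nC; [exact: CA|exact: AC].
Qed.

Lemma closed_usets_in (C : set (projsp K n)) : closed C -> closed (usets_in 2 C).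
Proof.
move=> cC; apply: (@closed_pair_set
    ([set p | C (p (0 : 'I_2))] `&` [set p | C (p (1 : 'I_2))])).
  by apply: closedI; exact: (closed_component (m := fun _ : 'I_2 => n)).
by move=> A x y sA; exact: (usets_inP C sA).
Qed.

Lemma closed_contains (q : projsp K n) : closed [set A : uset K n 2 | q \in val A].
Proof.
apply: (@closed_pair_set
    ([set p | [set q] (p (0 : 'I_2))] `|` [set p | [set q] (p (1 : 'I_2))])).
  by apply: closedU; apply: (closed_component (m := fun _ : 'I_2 => n)); exact: closed_point.
by move=> A x y sA /=; rewrite (spansE q sA) /mpt /pairv /=; split=> -[]; by [left|right].
Qed.

End ClosedPairSets.

Lemma irreducible_set1 (T : topologicalType) (x : T) : irreducible_set [set x].
Proof.
split=> [|C D _ _ CD]; first by exists x.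
by case: (CD x erefl) => [Cx|Dx]; [left|right] => _ ->.
Qed.

(** * Parametrized families of points and pairs, and their dimension *)

Section ParamFamilies.
Variables (K : fieldType) (n : nat).
Hypothesis infK : forall s : seq K, exists x, x \notin s.

Section Proj.
Variables (d : nat) (h : ('I_d -> K) -> K) (G : ('I_d -> K) -> 'rV[K]_n.+1).
Hypotheses (ph : mpolyfun h) (pG : forall i, mpolyfun (fun s => G s 0 i))
  (nzG : forall s, h s != 0 -> G s != 0).

Definition proj_param s (p : projsp K n) := p = Pt (G s).

Lemma proj_param_irreducible s0 : h s0 != 0 -> irreducible_set (param_image h proj_param).
Proof.
move=> hs0; apply: (param_irreducible infK ph _ hs0).
  by move=> s _; exists (Pt (G s)).
move=> C s _ cC hs -> nC.
have [e [f [ff fs fC]]] := closed_formP cC nC.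
exists (fun s => f (G s)); split.
- exact: (form_subalg (subalg_mpolyfun K d) ff).
- by rewrite -(form_Pt ff) // nzG.
- by move=> r _ hr -> /fC/eqP; rewrite (form_Pt ff) ?nzG // => /eqP.
Qed.

Lemma proj_param_chain_le S : S `<=` closure (param_image h proj_param) ->
  forall c e, irr_chain S c e -> (e <= d)%N.
Proof.
apply: param_chain_le => x.
have [c cx] := lf_neq0 (pvec_neq0 x).
exists (proj_dom c), (proj_ring c), (fun s => lf c (G s)); split.
- exact: chart_proj.
- exact: cx.
- exact: (subalg_lf c (subalg_mpolyfun K d)).
- move=> s _ hs ->; rewrite /proj_dom /=.
  by rewrite (form_Pt (form_lf c)) ?nzG.
move=> g [e [F [fF gE]]]; exists e, (fun s => F (G s)); split.
  exact: (form_subalg (subalg_mpolyfun K d) fF).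
move=> s _ hs -> Up; rewrite gE //.
have [k k0 ->] := pvec_Pt (nzG hs).
by rewrite (form_scaling _ _ fF) lfZ exprMn -mulf_div divff ?mul1r // expf_neq0.
Qed.

End Proj.

Section Pair.
Variables (d : nat) (h : ('I_d -> K) -> K) (G1 G2 : ('I_d -> K) -> 'rV[K]_n.+1).
Hypotheses (ph : mpolyfun h) (pG1 : forall i, mpolyfun (fun s => G1 s 0 i))
  (pG2 : forall i, mpolyfun (fun s => G2 s 0 i))
  (nzG : forall s, h s != 0 -> [/\ G1 s != 0, G2 s != 0 & Pt (G1 s) <> Pt (G2 s)]).

Definition pair_param s (A : uset K n 2) := spans A (G1 s) (G2 s).

Lemma pair_param_subalg (f : vecs K (fun _ : 'I_2 => n) -> K) e : mform e f ->
  mpolyfun (fun s => f (pairv (G1 s) (G2 s))).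
Proof.
move=> ff; apply: (mform_subalg (subalg_mpolyfun K d) ff) => i k.
by rewrite /pairv; case: (i == 0).
Qed.

Lemma pair_param_irreducible s0 : h s0 != 0 -> irreducible_set (param_image h pair_param).
Proof.
move=> hs0; apply: (param_irreducible infK ph _ hs0).
  by move=> s /nzG[g1 g2 g12]; exact: spans_ex.
move=> C s A cC hs sA nC.
have [e [f [ff fs fC]]] := closed_pairsP cC nC sA.
exists (fun s => f (pairv (G1 s) (G2 s))); split=> //; first exact: pair_param_subalg ff.
by move=> r A' hr sA' /(fC _ _ _ sA').
Qed.

Lemma pair_param_chain_le S : S `<=` closure (param_image h pair_param) ->
  forall c e, irr_chain S c e -> (e <= d)%N.
Proof.
apply: param_chain_le => A.
have [x [y sA]] := spansP A; have [x0 y0 _] := sA.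
have [c [cx cy]] := lf_neq0_2 infK x0 y0.
exists (pair_dom c), (pair_ring c), (fun s => pair_lf c (pairv (G1 s) (G2 s))); split.
- exact: chart_pair.
- by apply/(pair_domP _ sA); rewrite /pair_lf mulf_neq0.
- exact: pair_param_subalg (mform_pair_lf1 c).
- by move=> s A' hs sA' UA'; exact: UA' sA'.
move=> g [e [F [fF gE]]]; exists e, (fun s => F (pairv (G1 s) (G2 s))); split.
  exact: pair_param_subalg fF.
by move=> s A' hs sA' UA'; rewrite (gE _ _ _ UA' sA').
Qed.

End Pair.

(* A polynomial in two variables, seen through all its substitutions. *)
Definition bipoly (h : K -> K -> K) := forall d f g, mpolyfun f -> mpolyfun g ->
  @mpolyfun K d (fun s => h (f s) (g s)).

Section CurvePairs.
Variables (h : K -> K) (G : K -> 'rV[K]_n.+1).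
Hypotheses (ph : polyfun h) (pG : forall i, polyfun (fun s => G s 0 i))
  (nzG : forall a, h a != 0 -> G a != 0)
  (injG : forall a b, h a != 0 -> h b != 0 -> a != b -> Pt (G a) <> Pt (G b)).
Variable a0 : K.
Hypothesis ha0 : h a0 != 0.

Definition curve_pairs : set (uset K n 2) := [set A | exists a b,
  [/\ h a != 0, h b != 0, a != b & spans A (G a) (G b)]].

Let h2 (s : 'I_2 -> K) := h (s 0) * h (s 1) * (s 0 - s 1).

Let curve_pairsE :
  curve_pairs = param_image h2 (pair_param (fun s => G (s 0)) (fun s => G (s 1))).
Proof.
apply/seteqP; split=> [A [a [b [ha hb ab sA]]]|A [s]].
  exists (fun i : 'I_2 => if i == 0 then a else b) => //.
  by rewrite /h2 /= !mulf_neq0 // subr_eq0.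
rewrite /h2 !mulf_eq0 !negb_or subr_eq0 => /andP[/andP[ha hb] ab] sA.
by exists (s 0), (s 1).
Qed.

Let ph2 : mpolyfun h2.
Proof.
have sA := subalg_mpolyfun K 2.
apply: (subalg_mul sA); last by apply: (subalg_sub sA); exact: mpolyfun_var.
by apply: (subalg_mul sA); apply: (polyfun_comp sA ph); exact: mpolyfun_var.
Qed.

Let nz2 s : h2 s != 0 -> [/\ G (s 0) != 0, G (s 1) != 0 & Pt (G (s 0)) <> Pt (G (s 1))].
Proof.
rewrite /h2 !mulf_eq0 !negb_or subr_eq0 => /andP[/andP[ha hb] ab].
by split; [exact: nzG|exact: nzG|exact: injG].
Qed.

Let pG2 (j : 'I_2) i : mpolyfun (fun s => G (s j) 0 i).
Proof.
exact: (polyfun_comp (subalg_mpolyfun K 2) (pG i) (mpolyfun_var _ j)).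
Qed.

Lemma curve_generic : generic (fun a => h a != 0).
Proof. exact: generic_neq0 ph ha0. Qed.

(** The flag consists of one pair, the pairs containing a fixed point of the curve, and all pairs on
    the curve. It is stated apart because it also begins the longer chain of [ruled_pairs_dim]. *)
Lemma curve_pairs_flag : exists b0 J0 J1 C0,
  [/\ h b0 != 0,
    [/\ irreducible_set J0, irreducible_set J1 & irreducible_set curve_pairs],
    [/\ J0 `<=` J1, J1 `<=` curve_pairs & forall A, J1 A -> Pt (G b0) \in val A],
    [/\ closed C0, J0 `<=` C0 & ~ (J1 `<=` C0)] &
    ~ (curve_pairs `<=` [set A | Pt (G b0) \in val A])].
Proof.
have gen := genericI curve_generic (generic_neq _).
have [b0 [hb0 b0a0]] := generic_ex infK (gen a0).
have [a1 [ha1 /andP[a1a0 a1b0]]] : exists a, h a != 0 /\ (a != a0) && (a != b0).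
  have [a [[ha aa0] ab0]] := generic_ex infK (genericI (gen a0) (generic_neq b0)).
  by exists a; rewrite ha aa0 ab0.
pose h1 (s : 'I_1 -> K) := h (s 0) * (s 0 - b0).
have sA := subalg_mpolyfun K 1.
have ph1 : mpolyfun h1.
  apply: (subalg_mul sA); first by apply: (polyfun_comp sA ph); exact: mpolyfun_var.
  by apply: (subalg_sub sA); [exact: mpolyfun_var|exact: (subalg_cst sA)].
have nz1 s : h1 s != 0 -> [/\ G (s 0) != 0, G b0 != 0 & Pt (G (s 0)) <> Pt (G b0)].
  rewrite /h1 !mulf_eq0 !negb_or subr_eq0 => /andP[ha ab].
  by split; [exact: nzG|exact: nzG|exact: injG].
pose J1 := param_image h1 (pair_param (fun s => G (s 0)) (fun=> G b0)).
have b0a0' : b0 != a0 by [].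
have a0b0 : a0 != b0 by rewrite eq_sym.
have [A0 sA0] := spans_ex (nzG ha0) (nzG hb0) (injG ha0 hb0 a0b0).
have [A1 sA1] := spans_ex (nzG ha1) (nzG hb0) (injG ha1 hb0 a1b0).
have [A2 sA2] := spans_ex (nzG ha1) (nzG ha0) (injG ha1 ha0 a1a0).
exists b0, [set A0], J1, (usets_in 2 ([set Pt (G a0)] `|` [set Pt (G b0)])); split.
- exact: hb0.
- split; first exact: irreducible_set1.
    apply: (@pair_param_irreducible 1 h1 _ _ ph1 _ _ nz1 (fun=> a0)).
    + by move=> i; exact: (polyfun_comp sA (pG i) (mpolyfun_var _ 0)).
    + by move=> i; exact: (subalg_cst sA).
    + by rewrite /h1 mulf_neq0 // subr_eq0.
  rewrite curve_pairsE.
  apply: (@pair_param_irreducible 2 h2 _ _ ph2 _ _ nz2 (fun i => if i == 0 then a0 else b0)).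
  + exact: pG2.
  + exact: pG2.
  + by rewrite /h2 /= !mulf_neq0 // subr_eq0.
- split.
  + move=> _ ->; exists (fun=> a0); last exact: sA0.
    by rewrite /h1 mulf_neq0 // subr_eq0.
  + move=> A [s]; rewrite /h1 mulf_eq0 negb_or subr_eq0 => /andP[hs sb] sA'.
    by exists (s 0), b0.
  + by move=> A [s _ sA']; apply/(spansE _ sA'); right.
- split.
  + by apply: closed_usets_in; apply: closedU; exact: closed_point.
  + by move=> _ ->; apply/(usets_inP _ sA0); split; [left|right].
  + move=> /(_ A1) J1C; have /J1C/(usets_inP _ sA1)[+ _] : J1 A1.
      exists (fun=> a1); last exact: sA1.
      by rewrite /h1 mulf_neq0 // subr_eq0.
    by case; apply: injG.
- move=> /(_ A2) sub; have /sub/(spansE _ sA2) : curve_pairs A2.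
    by exists a1, a0; split=> //; exact: sA2.
  by case=> /esym; apply: injG.
Qed.

Lemma curve_pairs_dim S : curve_pairs `<=` S -> S `<=` closure curve_pairs ->
  irreducible_set S /\ has_dim S 2.
Proof.
move=> WS SW; have [b0 [J0 [J1 [C0 [hb0 [i0 i1 i2] [J01 J12 J1b] [cC0 J0C J1C] nW]]]]] :=
  curve_pairs_flag.
split; first exact: irreducible_between i2 WS SW.
apply: has_dimI.
  apply: (@pair_param_chain_le 2 h2 (fun s => G (s 0)) (fun s => G (s 1)));
    [exact: pG2|exact: pG2|].
  by rewrite -curve_pairsE.
exists (fun i => S `&` closure (nth set0 [:: J0; J1; curve_pairs] i)).
apply: irr_chain_closure => -[|[|[|//]]] _ //=.
- by split=> //; exact: subset_trans (subset_trans J01 J12) WS.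
- by split=> //; exact: subset_trans J12 WS.
- by split=> //; exists C0.
- split=> //; exists [set A | Pt (G b0) \in val A]; split=> //.
  exact: closed_contains.
Qed.

End CurvePairs.
Section RuledPairs.
Variables (h : K -> K -> K) (G : K -> K -> 'rV[K]_n.+1).
Hypotheses (ph : bipoly h) (pG : forall i, bipoly (fun a c => G a c 0 i))
  (nzG : forall a c, h a c != 0 -> G a c != 0)
  (injG : forall a b c, h a c != 0 -> h b c != 0 -> a != b -> Pt (G a c) <> Pt (G b c)).
Variables (a0 c0 a1 c1 : K) (l : 'cV[K]_n.+1).
Hypotheses (h0 : h a0 c0 != 0) (h1 : h a1 c1 != 0)
  (l0 : forall a, lf l (G a c0) = 0) (l1 : lf l (G a1 c1) != 0).

(** The parameter c selects a curve of a one-parameter family, and a, b are two points on this same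
    curve. The family will be that of the lines through z_i or that of the conics through Z. *)
Definition ruled_pairs : set (uset K n 2) := [set A | exists a b c,
  [/\ h a c != 0, h b c != 0, a != b & spans A (G a c) (G b c)]].

Let i0 : 'I_3 := 0.
Let i1 : 'I_3 := 1.
Let i2 : 'I_3 := 2%:R.

Let h3 (s : 'I_3 -> K) := h (s i0) (s i2) * h (s i1) (s i2) * (s i0 - s i1).

Let ruled_pairsE : ruled_pairs =
  param_image h3 (pair_param (fun s => G (s i0) (s i2)) (fun s => G (s i1) (s i2))).
Proof.
apply/seteqP; split=> [A [a [b [c [ha hb ab sA]]]]|A [s]].
  exists (fun i : 'I_3 => if i == i0 then a else if i == i1 then b else c) => //.
  by rewrite /h3 /= !mulf_neq0 // subr_eq0.
rewrite /h3 !mulf_eq0 !negb_or subr_eq0 => /andP[/andP[ha hb] ab] sA.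
by exists (s i0), (s i1), (s i2).
Qed.

Let ph3 : mpolyfun h3.
Proof.
have sA := subalg_mpolyfun K 3.
apply: (subalg_mul sA); last by apply: (subalg_sub sA); exact: mpolyfun_var.
by apply: (subalg_mul sA); apply: ph; exact: mpolyfun_var.
Qed.

Let nz3 s : h3 s != 0 -> [/\ G (s i0) (s i2) != 0, G (s i1) (s i2) != 0 &
  Pt (G (s i0) (s i2)) <> Pt (G (s i1) (s i2))].
Proof.
rewrite /h3 !mulf_eq0 !negb_or subr_eq0 => /andP[/andP[ha hb] ab].
by split; [exact: nzG|exact: nzG|exact: injG].
Qed.

Lemma bipoly_polyfun (f : K -> K -> K) x y : bipoly f -> polyfun x -> polyfun y ->
  polyfun (fun r => f (x r) (y r)).
Proof.
move=> pf px py; have sA := subalg_mpolyfun K 1.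
have [P fP] : @mpolyfun K 1 (fun s => f (x (s 0)) (y (s 0))).
  by apply: pf; [apply: (polyfun_comp sA px)|apply: (polyfun_comp sA py)]; exact: mpolyfun_var.
apply: (@subalg_ext _ _ _ (fun r => meval (fun _ : 'I_1 => r) P)) => [|r].
  by apply: (subalg_meval (subalg_polyfun K)) => _; exact: polyfun_var.
by rewrite -fP.
Qed.

(** Three parameters bound the dimension above. Below, the flag of pairs on the single curve c = c0
    is prolonged by the whole family; the hyperplane l contains this curve but not all the others,
    which makes the last inclusion strict. *)
Lemma ruled_pairs_dim S : ruled_pairs `<=` S -> S `<=` closure ruled_pairs ->
  irreducible_set S /\ has_dim S 3.
Proof.
move=> WS SW; have sA := subalg_mpolyfun K 3.
have pG0 i : mpolyfun (fun s => G (s i0) (s i2) 0 i) by apply: pG; exact: mpolyfun_var.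
have pG1 i : mpolyfun (fun s => G (s i1) (s i2) 0 i) by apply: pG; exact: mpolyfun_var.
have phc c : polyfun (h^~ c).
  by apply: (bipoly_polyfun (x := id)) => //; [exact: polyfun_var|exact: (subalg_cst (subalg_polyfun K))].
have irrW : irreducible_set ruled_pairs.
  rewrite ruled_pairsE.
  have [b0 [hb0 b0a0]] := generic_ex infK
    (genericI (generic_neq0 (phc c0) h0) (generic_neq a0)).
  apply: (@pair_param_irreducible 3 h3 _ _ ph3 pG0 pG1 nz3
    (fun i => if i == i0 then b0 else if i == i1 then a0 else c0)).
  by rewrite /h3 /= !mulf_neq0 // subr_eq0.
split; first exact: irreducible_between irrW WS SW.
apply: has_dimI.
  apply: (@pair_param_chain_le 3 h3 _ _ pG0 pG1).
  by rewrite -ruled_pairsE.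
have [|||b0 [J0 [J1 [C0 [hb0 [r0 r1 r2] [J01 J12 J1b] [cC0 J0C J1C] nW]]]]] :=
  @curve_pairs_flag (h^~ c0) (G^~ c0) (phc c0) _ _ _ a0 h0.
- move=> i; apply: (bipoly_polyfun (f := fun a c => G a c 0 i) (x := id)) => //.
    exact: polyfun_var.
  exact: (subalg_cst (subalg_polyfun K)).
- by move=> a; exact: nzG.
- by move=> a b; exact: injG.
set J2 := curve_pairs _ _ in r2 J12 nW.
have J23 : J2 `<=` ruled_pairs by move=> A [a [b [ha hb ab sA']]]; exists a, b, c0.
exists (fun i => S `&` closure (nth set0 [:: J0; J1; J2; ruled_pairs] i)).
have J2S : J2 `<=` S by exact: subset_trans J23 WS.
have J1S : J1 `<=` S by exact: subset_trans J12 J2S.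
apply: irr_chain_closure => -[|[|[|[|//]]]] _ //=.
- by split=> //; exact: subset_trans J01 J1S.
- by split=> //; exists C0.
- split=> //; exists [set A | Pt (G b0 c0) \in val A]; split=> //.
  exact: closed_contains.
split=> //; exists (usets_in 2 [set p | lf l (pvec p) = 0]); split.
- by apply: closed_usets_in; apply: closed_form (form_lf l).
- move=> A [a [b [ha hb _ sA']]]; apply/(usets_inP _ sA') => /=.
  by split; apply/eqP; rewrite (form_Pt (form_lf l)) ?nzG // l0.
have [b1 [hb1 b1a1]] := generic_ex infK
    (genericI (generic_neq0 (phc c1) h1) (generic_neq a1)).
have a1b1 : a1 != b1 by rewrite eq_sym.
have [A sA'] := spans_ex (nzG h1) (nzG hb1) (injG h1 hb1 a1b1).
move=> /(_ A) sub; have /sub/(usets_inP _ sA')[/= /eqP] : ruled_pairs A.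
  by exists a1, b1, c1.
by rewrite (form_Pt (form_lf l)) ?nzG // (negbTE l1).
Qed.

End RuledPairs.

End ParamFamilies.

(** * Determinants of three vectors of the plane *)

Section RingTactic.
Variable K : comNzRingType.

Definition kcar : Type := K.
Definition kadd (x y : kcar) : kcar := (x : K) + y.
Definition kmul (x y : kcar) : kcar := (x : K) * y.
Definition ksub (x y : kcar) : kcar := (x : K) - y.
Definition kopp (x : kcar) : kcar := - (x : K).
Definition kzero : kcar := 0 : K.
Definition kone : kcar := 1 : K.

Lemma kring_theory : @Ring_theory.ring_theory kcar kzero kone kadd kmul ksub kopp eq.
Proof.
rewrite /kcar /kzero /kone /kadd /kmul /kopp /ksub.
by split=> //= *; rewrite ?add0r ?mul1r ?mulrDl ?subrr //;
  first [exact: addrC|exact: addrA|exact: mulrC|exact: mulrA].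
Qed.

End RingTactic.

(* Stdlib's ring, after folding the mathcomp operations of K into constants
   that do not depend on the canonical structures they were inferred from. *)
Ltac kring K :=
  rewrite ?(exprS, expr0, mulr1, mulrS, mulr0n, addr0);
  repeat match goal with
  | |- context [ @GRing.add ?S ?x ?y ] => change (@GRing.add S x y) with (@kadd K x y)
  | |- context [ @GRing.mul ?S ?x ?y ] => change (@GRing.mul S x y) with (@kmul K x y)
  | |- context [ @GRing.opp ?S ?x ] => change (@GRing.opp S x) with (@kopp K x)
  | |- context [ @GRing.zero ?S ] => change (@GRing.zero S) with (@kzero K)
  | |- context [ @GRing.one ?S ] => change (@GRing.one S) with (@kone K)
  end;
  match goal with |- @eq _ ?a ?b => change (@eq (kcar K) a b) end;
  ring.

Section Brackets.
Variable K : fieldType.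
Local Notation V := 'rV[K]_3.
Implicit Types (u v w x y : V).
Add Ring K_ring : (kring_theory K).

Definition e0 : 'I_3 := 0.
Definition e1 : 'I_3 := 1.
Definition e2 : 'I_3 := 2%:R.

Lemma ord3P (i : 'I_3) : [\/ i = e0, i = e1 | i = e2].
Proof.
case: i => -[|[|[|//]]] i3; [apply: Or31|apply: Or32|apply: Or33]; exact/val_inj.
Qed.

Definition co n (x : 'rV[K]_n) i : K := x 0 i.

Lemma coD n (x y : 'rV[K]_n) i : co (x + y) i = co x i + co y i.
Proof. by rewrite /co mxE. Qed.

Lemma coZ n a (x : 'rV[K]_n) i : co (a *: x) i = a * co x i.
Proof. by rewrite /co mxE. Qed.

Lemma coN n (x : 'rV[K]_n) i : co (- x) i = - co x i.
Proof. by rewrite /co mxE. Qed.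

Lemma co0 n i : co (0 : 'rV[K]_n) i = 0.
Proof. by rewrite /co mxE. Qed.

Definition coE := (coD, coZ, coN, co0).

Lemma row3P x y : co x e0 = co y e0 -> co x e1 = co y e1 -> co x e2 = co y e2 -> x = y.
Proof. by move=> h0 h1 h2; apply/rowP => i; case: (ord3P i) => ->. Qed.

(** The determinant of u, v, w: it vanishes exactly when the three vectors are dependent, that is
    when the points are collinear. It is written out in coordinates so that identities reduce to
    [ring]. *)
Definition br u v w : K :=
  co u e0 * (co v e1 * co w e2 - co v e2 * co w e1)
  - co u e1 * (co v e0 * co w e2 - co v e2 * co w e0)
  + co u e2 * (co v e0 * co w e1 - co v e1 * co w e0).

Lemma br_lin3 u v a w w' : br u v (a *: w + w') = a * br u v w + br u v w'.
Proof. rewrite /br ?coE; kring K. Qed.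

Lemma br_lin2 u v a w v' : br u (a *: v + v') w = a * br u v w + br u v' w.
Proof. rewrite /br ?coE; kring K. Qed.

Lemma br_lin1 u u' a v w : br (a *: u + u') v w = a * br u v w + br u' v w.
Proof. rewrite /br ?coE; kring K. Qed.

Lemma brC12 u v w : br v u w = - br u v w.
Proof. rewrite /br; kring K. Qed.

Lemma brC23 u v w : br u w v = - br u v w.
Proof. rewrite /br; kring K. Qed.

Lemma br_rot u v w : br v w u = br u v w.
Proof. rewrite /br; kring K. Qed.

Lemma br_uu u w : br u u w = 0. Proof. rewrite /br; kring K. Qed.
Lemma br_ww u w : br u w w = 0. Proof. rewrite /br; kring K. Qed.
Lemma br_uwu u w : br u w u = 0. Proof. rewrite /br; kring K. Qed.

Lemma cramer u v w x :
  br u v w *: x = br x v w *: u + br u x w *: v + br u v x *: w.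
Proof. apply: row3P; rewrite /br ?coE; kring K. Qed.

Lemma cramer_coord u v w x : br u v w != 0 ->
  exists a b c, x = a *: u + b *: v + c *: w.
Proof.
move=> d0; exists (br x v w / br u v w), (br u x w / br u v w), (br u v x / br u v w).
apply: (scalerI d0); rewrite cramer !scalerDr !scalerA.
by rewrite ![br u v w * (_ / _)]mulrC !divfK.
Qed.

Lemma brZ1 a u v w : br (a *: u) v w = a * br u v w.
Proof. by rewrite -[a *: u]addr0 br_lin1 /br ?coE; kring K. Qed.

Lemma brZ2 a u v w : br u (a *: v) w = a * br u v w.
Proof. rewrite /br ?coE; kring K. Qed.

Lemma brZ3 a u v w : br u v (a *: w) = a * br u v w.
Proof. rewrite /br ?coE; kring K. Qed.

Lemma brD1 u u' v w : br (u + u') v w = br u v w + br u' v w.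
Proof. rewrite /br ?coE; kring K. Qed.

Lemma brD2 u v v' w : br u (v + v') w = br u v w + br u v' w.
Proof. rewrite /br ?coE; kring K. Qed.

Lemma brD3 u v w w' : br u v (w + w') = br u v w + br u v w'.
Proof. rewrite /br ?coE; kring K. Qed.

Definition brE := (brD1, brD2, brD3, brZ1, brZ2, brZ3, br_uu, br_ww, br_uwu).

(** Linear independence of u and v, or distinctness of their points, in the form that determinants
    use: a third vector completes them to a basis. *)
Definition free2 u v := exists w, br u v w != 0.

Lemma free2C u v : free2 u v -> free2 v u.
Proof. by move=> [w h]; exists w; rewrite brC12 oppr_eq0. Qed.

Lemma free2_neq0 u v : free2 u v -> u != 0 /\ v != 0.
Proof.
move=> [w h]; split; apply: contraNneq h => ->.
  by rewrite -(scale0r 0) brZ1 mul0r.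
by rewrite -(scale0r 0) brZ2 mul0r.
Qed.

Lemma nfree2 u v : u != 0 -> ~ free2 u v -> exists c, v = c *: u.
Proof.
move=> u0 nf; have h w : br u v w = 0.
  by apply/eqP/negPn/negP => uvw; apply: nf; exists w.
case/rV0Pn: u0 => i ui; exists (v 0 i / u 0 i).
pose d (k : 'I_3) : V := delta_mx 0 k.
have dE k l : co (d k) l = (l == k)%:R by rewrite /co /d mxE eqxx eq_sym.
(* The brackets with the unit vectors are, up to sign, the 2 by 2 minors of u and v. *)
have := h (d e0); have := h (d e1); have := h (d e2); rewrite /br !dE /=.
rewrite !(mulr0, mulr1, subr0, sub0r, addr0, add0r, oppr0).
move=> h2 h1 h0; have minor j k : co u j * co v k = co u k * co v j.
  case: (ord3P j) => ->; case: (ord3P k) => -> //; apply/eqP; rewrite -subr_eq0; apply/eqP.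
  - exact: h2.
  - by apply: oppr_inj; rewrite oppr0 -h1; kring K.
  - by apply: oppr_inj; rewrite oppr0 -h2; kring K.
  - by rewrite -h0; kring K.
  - by rewrite -h1; kring K.
  - by apply: oppr_inj; rewrite oppr0 -h0; kring K.
apply/rowP => j; rewrite mxE; apply: (mulfI ui).
rewrite [RHS]mulrA [u 0 i * (_ / _)]mulrC divfK // [RHS]mulrC; exact: minor.
Qed.

Lemma nfreeP u v : u != 0 -> free2 u v \/ exists c, v = c *: u.
Proof.
by move=> u0; have [|/(nfree2 u0)] := pselect (free2 u v); [left|right].
Qed.

Lemma free2_scale u v a : free2 u v -> v <> a *: u.
Proof. by move=> [w +] vE; rewrite vE brZ2 br_uu mulr0 eqxx. Qed.

Lemma free2_comb u v a b : free2 u v -> b != 0 -> free2 u (a *: u + b *: v).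
Proof. by move=> [w h] b0; exists w; rewrite !brE mulr0 add0r mulf_neq0. Qed.

Lemma br0_comb u v x : free2 u v -> br u v x = 0 -> exists a b, x = a *: u + b *: v.
Proof.
move=> [w h] hx; exists (br x v w / br u v w), (br u x w / br u v w).
apply: (scalerI h); rewrite cramer hx scale0r addr0 scalerDr !scalerA.
by rewrite ![br u v w * (_ / _)]mulrC !divfK.
Qed.

Lemma br_neq0_free u v w : br u v w != 0 -> [/\ free2 u v, free2 u w & free2 v w].
Proof.
move=> h; split; first by exists w.
  by exists v; rewrite brC23 oppr_eq0.
by exists u; rewrite br_rot.
Qed.

End Brackets.

(** * Polarization of cubics and the anticanonical map *)

Section Polarization.
Variable K : fieldType.
Hypothesis char0 : forall n, n.+1%:R != 0 :> K.
Local Notation V := 'rV[K]_3.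
Implicit Types (u v w x y : V) (F : V -> K) (T : V -> V -> V -> K).
Add Ring K_ring : (kring_theory K).

Definition trilinear T :=
  [/\ forall a u u' v w, T (a *: u + u') v w = a * T u v w + T u' v w,
      forall u v w, T v u w = T u v w & forall u v w, T u w v = T u v w].

Lemma trilinear_comb a T T' : trilinear T -> trilinear T' ->
  trilinear (fun u v w => a * T u v w + T' u v w).
Proof.
move=> [l c d] [l' c' d']; split=> [b u u' v w|u v w|u v w].
- by rewrite l l'; kring K.
- by rewrite c c'.
- by rewrite d d'.
Qed.

Lemma mono_split n r (m : 'I_n -> nat) : (\sum_i m i = r.+1)%N ->
  exists i m', (\sum_i m' i = r)%N /\
    forall v : 'I_n -> K, \prod_j v j ^+ m j = v i * \prod_j v j ^+ m' j.
Proof.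
move=> mr; have [i mi] : exists i, (m i != 0)%N.
  apply: contrapT => nm; move: mr; rewrite big1 // => i _.
  by apply/eqP/negPn/negP => mi; apply: nm; exists i.
exists i, (fun j => if j == i then (m i).-1 else m j); split.
  apply: succn_inj; rewrite -mr (bigD1 i) //= [in RHS](bigD1 i) //= eqxx.
  rewrite -addSn prednK ?lt0n //; congr (_ + _)%N.
  by apply: eq_bigr => j /negbTE ->.
move=> v; rewrite (bigD1 i) //= [in RHS](bigD1 i) //= eqxx mulrA -exprS.
rewrite prednK ?lt0n //; congr (_ * _).
by apply: eq_bigr => j /negbTE ->.
Qed.

(** Average the product of three coordinates over the six permutations of the arguments; dividing by
    6 uses characteristic 0. *)
Lemma trilinear_mono i j k :
  exists2 T, trilinear T & forall x, T x x x = co x i * co x j * co x k.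
Proof.
have n6 : (6%:R : K) != 0 by exact: char0.
exists (fun u v w => 6%:R^-1 * (co u i * co v j * co w k + co u i * co w j * co v k
  + co v i * co u j * co w k + co v i * co w j * co u k
  + co w i * co u j * co v k + co w i * co v j * co u k)).
  by split=> *; rewrite ?coE; kring K.
move=> x; apply: (mulfI n6); rewrite mulrA divff // mul1r; kring K.
Qed.

Lemma form3_trilinear F : form 3 F ->
  exists2 T, trilinear T & forall x, F x = T x x x.
Proof.
move=> [g [f wf gE] FE].
suff [T tT TE] : exists2 T, trilinear T & forall x, T x x x =
    \sum_(m <- msupp f) mcoeff m f * \prod_i x 0 i ^+ m i.
  by exists T => // x; rewrite FE gE mevalE TE.
have : forall m, m \in msupp f -> (\sum_(i < 3) m i)%N = 3%N.
  by move=> m /wf/(_ tt) wm; apply: etrans wm; apply: eq_bigl.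
elim: (msupp f) => [_|m s IH hs].
  exists (fun _ _ _ => 0) => [|x]; last by rewrite big_nil.
  by split=> *; rewrite ?mulr0 ?addr0.
have [m' ms|T tT TE] := IH; first by apply: hs; rewrite inE ms orbT.
have m3 := hs m (mem_head _ _).
have [i [m1 [/mono_split[j [m2 [/mono_split[k [m4 [m40 kE]]] jE]]] iE]]] := mono_split m3.
have [T' tT' T'E] := trilinear_mono i j k.
exists (fun u v w => mcoeff m f * T' u v w + T u v w); first exact: trilinear_comb.
move=> x; rewrite big_cons TE T'E; congr (_ * _ + _).
rewrite iE jE kE big1 ?mulr1 ?mulrA // => l _.
by move/eqP: m40; rewrite sum_nat_eq0 => /forallP/(_ l)/eqP->; rewrite expr0.
Qed.

Section Trilinear.
Variable T : V -> V -> V -> K.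
Hypothesis tT : trilinear T.

Lemma triC12 u v w : T v u w = T u v w. Proof. by case: tT. Qed.
Lemma triC23 u v w : T u w v = T u v w. Proof. by case: tT. Qed.

Lemma triD1 u u' v w : T (u + u') v w = T u v w + T u' v w.
Proof. by case: tT => l _ _; rewrite -[u]scale1r l mul1r scale1r. Qed.

Lemma tri01 v w : T 0 v w = 0.
Proof.
by have := triD1 0 0 v w; rewrite addr0 => /(congr1 (fun z => z - T 0 v w));
  rewrite addrK subrr.
Qed.

Lemma triZ1 a u v w : T (a *: u) v w = a * T u v w.
Proof. by case: tT => l _ _; rewrite -[a *: u]addr0 l tri01 addr0. Qed.

Lemma triD2 u v v' w : T u (v + v') w = T u v w + T u v' w.
Proof. by rewrite -triC12 triD1 triC12 [T v' u w]triC12. Qed.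

Lemma triZ2 a u v w : T u (a *: v) w = a * T u v w.
Proof. by rewrite -triC12 triZ1 triC12. Qed.

Lemma triD3 u v w w' : T u v (w + w') = T u v w + T u v w'.
Proof. by rewrite -triC23 triD2 triC23 [T u w' v]triC23. Qed.

Lemma triZ3 a u v w : T u v (a *: w) = a * T u v w.
Proof. by rewrite -triC23 triZ2 triC23. Qed.

Definition triE := (triD1, triD2, triD3, triZ1, triZ2, triZ3).

Lemma tri_comb2 a b x y : T (a *: x + b *: y) (a *: x + b *: y) (a *: x + b *: y) =
  a ^+ 3 * T x x x + 3%:R * a ^+ 2 * b * T x x y + 3%:R * a * b ^+ 2 * T x y y
  + b ^+ 3 * T y y y.
Proof.
rewrite !triE [T x y x]triC23 [T y x x]triC12 [T x y x]triC23 [T y x y]triC12.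
by rewrite [T y y x]triC23 [T y x y]triC12; kring K.
Qed.

Lemma tri_sum3 u v w : T (u + v + w) (u + v + w) (u + v + w) - T (u + v) (u + v) (u + v)
  - T (u + w) (u + w) (u + w) - T (v + w) (v + w) (v + w) + T u u u + T v v v + T w w w
  = 6%:R * T u v w.
Proof.
have p1 : T u w v = T u v w by rewrite triC23.
have p2 : T v u w = T u v w by rewrite triC12.
have p3 : T v w u = T u v w by rewrite triC23.
have p4 : T w u v = T u v w by rewrite triC12.
have p5 : T w v u = T u v w by rewrite triC23.
by rewrite !triE p1 p2 p3 p4 p5; kring K.
Qed.

End Trilinear.

(* By polarization, a product of three linear forms determines the symmetric
   trilinear form of which it is the diagonal. *)
Lemma tri_product T (l1 l2 l3 : V -> K) : trilinear T ->
  (forall u v, l1 (u + v) = l1 u + l1 v) -> (forall u v, l2 (u + v) = l2 u + l2 v) ->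
  (forall u v, l3 (u + v) = l3 u + l3 v) ->
  (forall x, T x x x = l1 x * l2 x * l3 x) -> forall u v w,
  6%:R * T u v w = l1 u * l2 v * l3 w + l1 u * l2 w * l3 v + l1 v * l2 u * l3 w
    + l1 v * l2 w * l3 u + l1 w * l2 u * l3 v + l1 w * l2 v * l3 u.
Proof.
move=> tT h1 h2 h3 TE u v w; rewrite -(tri_sum3 tT) !TE !h1 !h2 !h3; kring K.
Qed.

End Polarization.

Lemma form_dhomog (K : fieldType) n d (f : dhomog n.+1 K d) :
  form d (fun x : 'rV[K]_n.+1 => meval (x 0) f).
Proof.
exists (fun v => meval v f) => //; exists (mpoly_of_dhomog f) => // m mf j.
have md : mdeg m = d by exact: dhomog_mf (dhomog_is_dhomog f) m mf.
by rewrite -md mdegE; apply: eq_bigl.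
Qed.

Lemma dhomog_form (K : fieldType) n d (F : 'rV[K]_n.+1 -> K) : form d F ->
  exists f : dhomog n.+1 K d, forall x, F x = meval (x 0) f.
Proof.
move=> [g [f wf gE] FE]; have hf : f \is ishomog1 d mdeg.
  by apply/dhomogP => m /wf/(_ tt) <-; rewrite /= mdegE; apply: eq_bigl.
by exists (DHomog hf) => x; rewrite FE gE.
Qed.

Lemma lf_inj (K : fieldType) n (x y : 'rV[K]_n) : (forall c, lf c x = lf c y) -> x = y.
Proof. by move=> h; apply/rowP => i; rewrite -!lf_coord h. Qed.

(* The anticanonical map and the polarization of its cubic coordinates. *)
Definition cubic_map (K : fieldType) t N (z : 'I_t -> 'rV[K]_3)
    (tau : 'rV[K]_3 -> 'rV[K]_3 -> 'rV[K]_3 -> 'rV[K]_N.+1) :=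
  [/\ forall c, trilinear (fun u v w => lf c (tau u v w)),
      forall i, tau (z i) (z i) (z i) = 0 &
      forall F, form 3 F -> (forall i, F (z i) = 0) ->
        exists c, forall x, F x = lf c (tau x x x)].

(** Polarize each basis cubic. The extension clause of [cubic_map] is the fact that phi spans all
    cubics through Z: the coordinates of F in this basis form the covector c. *)
Lemma cubic_map_exists (K : fieldType) t N (z : 'I_t -> projsp K 2)
    (phi : N.+1.-tuple (dhomog 3 K 3)) :
  (forall n, n.+1%:R != 0 :> K) -> basis_of (forms_through 3 (codom z)) phi ->
  exists2 tau, cubic_map (fun i => pvec (z i)) tau &
    forall x : 'rV[K]_3, \row_j meval (x 0) (tnth phi j) = tau x x x.
Proof.
move=> char0 bphi.
have /choice[T TP] j : exists T, trilinear T /\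
    forall x : 'rV[K]_3, meval (x 0) (tnth phi j) = T x x x.
  by have [T tT TE] := form3_trilinear char0 (form_dhomog (tnth phi j)); exists T.
pose tau u v w := \row_j T j u v w.
have tauE (x : 'rV[K]_3) : \row_j meval (x 0) (tnth phi j) = tau x x x.
  by apply/rowP => j; rewrite !mxE (proj2 (TP j)).
exists tau => //; split.
- move=> c; split=> [a u u' v w|u v w|u v w]; rewrite !lfE.
  + rewrite mulr_sumr -big_split /=; apply: eq_bigr => j _; rewrite !mxE.
    by have [[l _ _] _] := TP j; rewrite l mulrDl mulrA.
  + apply: eq_bigr => j _; rewrite !mxE; by have [[_ -> _] _] := TP j.
  + apply: eq_bigr => j _; rewrite !mxE; by have [[_ _ ->] _] := TP j.
- move=> i; rewrite -tauE; apply/rowP => j; rewrite !mxE.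
  have /forms_throughP h : tnth phi j \in forms_through 3 (codom z).
    exact/(basis_mem bphi)/mem_tnth.
  by apply: (h (z i)); exact: codom_f.
move=> F /dhomog_form[f FE] Fz; exists (\col_j coord phi j f) => x.
have fV : f \in forms_through 3 (codom z).
  by apply/forms_throughP => _ /codomP[i ->]; rewrite -[RHS](Fz i) FE.
rewrite FE {1}(coord_basis bphi fV) lfE.
rewrite [X in meval _ X](raddf_sum (@mpoly_of_dhomog 3 K 3)) raddf_sum /=.
apply: eq_bigr => j _; rewrite -tauE !mxE [X in meval _ X](_ : _ =
  coord phi j f *: mpoly_of_dhomog (phi`_j)) // mevalZ mulrC.
by rewrite (tnth_nth 0).
Qed.

Section CubicMap.
Variable K : fieldType.
Hypothesis char0 : forall n, n.+1%:R != 0 :> K.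
Variables (t N : nat) (z : 'I_t -> 'rV[K]_3).
Variable tau : 'rV[K]_3 -> 'rV[K]_3 -> 'rV[K]_3 -> 'rV[K]_N.+1.
Hypothesis tauP : cubic_map z tau.
Local Notation V := 'rV[K]_3.
Implicit Types (u v w x y : V) (c : 'cV[K]_N.+1).
Add Ring K_ring : (kring_theory K).

Lemma tau_tri c : trilinear (fun u v w => lf c (tau u v w)).
Proof. by case: tauP. Qed.

Lemma tau_z i : tau (z i) (z i) (z i) = 0. Proof. by case: tauP. Qed.

Lemma tauC12 u v w : tau v u w = tau u v w.
Proof. by apply: lf_inj => c; case: (tau_tri c). Qed.

Lemma tauC23 u v w : tau u w v = tau u v w.
Proof. by apply: lf_inj => c; case: (tau_tri c). Qed.

Lemma tauD1 u u' v w : tau (u + u') v w = tau u v w + tau u' v w.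
Proof. by apply: lf_inj => c; rewrite lfD; exact: (triD1 (tau_tri c)). Qed.

Lemma tauZ1 a u v w : tau (a *: u) v w = a *: tau u v w.
Proof. by apply: lf_inj => c; rewrite lfZ; exact: (triZ1 (tau_tri c)). Qed.

Lemma tauD2 u v v' w : tau u (v + v') w = tau u v w + tau u v' w.
Proof. by apply: lf_inj => c; rewrite lfD; exact: (triD2 (tau_tri c)). Qed.

Lemma tauZ2 a u v w : tau u (a *: v) w = a *: tau u v w.
Proof. by apply: lf_inj => c; rewrite lfZ; exact: (triZ2 (tau_tri c)). Qed.

Lemma tauD3 u v w w' : tau u v (w + w') = tau u v w + tau u v w'.
Proof. by apply: lf_inj => c; rewrite lfD; exact: (triD3 (tau_tri c)). Qed.

Lemma tauZ3 a u v w : tau u v (a *: w) = a *: tau u v w.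
Proof. by apply: lf_inj => c; rewrite lfZ; exact: (triZ3 (tau_tri c)). Qed.

Definition tauE := (tauD1, tauD2, tauD3, tauZ1, tauZ2, tauZ3).

Lemma tau_comb2 a b x y : tau (a *: x + b *: y) (a *: x + b *: y) (a *: x + b *: y) =
  a ^+ 3 *: tau x x x + (3%:R * a ^+ 2 * b) *: tau x x y
  + (3%:R * a * b ^+ 2) *: tau x y y + b ^+ 3 *: tau y y y.
Proof.
apply: lf_inj => c; rewrite !(lfD, lfZ); exact: (tri_comb2 (tau_tri c)).
Qed.

Lemma tau_comb3 (a b r : K) u v w :
  let x := a *: u + b *: v + r *: w in
  tau x x x = a ^+ 3 *: tau u u u + b ^+ 3 *: tau v v v + r ^+ 3 *: tau w w w
    + (3%:R * a ^+ 2 * b) *: tau u u v + (3%:R * a ^+ 2 * r) *: tau u u w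
    + (3%:R * a * b ^+ 2) *: tau u v v + (3%:R * b ^+ 2 * r) *: tau v v w
    + (3%:R * a * r ^+ 2) *: tau u w w + (3%:R * b * r ^+ 2) *: tau v w w
    + (6%:R * a * b * r) *: tau u v w.
Proof.
move=> x; apply: lf_inj => c; rewrite /x !tauE !(lfD, lfZ).
have s1 p q : tau p q p = tau p p q by rewrite tauC23.
have s2 p q : tau q p p = tau p p q by rewrite tauC12 s1.
have s3 p q : tau p q p = tau q p p by rewrite tauC12.
have s4 p q : tau p p q = tau q p p by rewrite s2.
rewrite (s1 u v) (s2 u v) (s1 u w) (s2 u w) (s3 v u) (s4 v u) (s1 v w) (s2 v w).
rewrite (s3 w u) (s4 w u) (s3 w v) (s4 w v).
have p1 : tau u w v = tau u v w by rewrite tauC23.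
have p2 : tau v u w = tau u v w by rewrite tauC12.
have p3 : tau v w u = tau u v w by rewrite tauC23.
have p4 : tau w u v = tau u v w by rewrite tauC12.
have p5 : tau w v u = tau u v w by rewrite tauC23.
by rewrite p1 p2 p3 p4 p5; kring K.
Qed.

Lemma tau_diagZ a x : tau (a *: x) (a *: x) (a *: x) = a ^+ 3 *: tau x x x.
Proof. apply: lf_inj => c; rewrite !tauE !lfZ; kring K. Qed.

(* The functional on the space of cubics through the points z given by a product
   of three lines. *)
Lemma three_lines (k1 k2 k3 : 'cV[K]_3) :
  (forall i, lf k1 (z i) * lf k2 (z i) * lf k3 (z i) = 0) ->
  exists c, [/\ forall x, lf c (tau x x x) = lf k1 x * lf k2 x * lf k3 x,
    forall x w, 3%:R * lf c (tau x x w) = lf k1 w * lf k2 x * lf k3 x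
      + lf k1 x * lf k2 w * lf k3 x + lf k1 x * lf k2 x * lf k3 w &
    forall u v w, 6%:R * lf c (tau u v w) = lf k1 u * lf k2 v * lf k3 w
      + lf k1 u * lf k2 w * lf k3 v + lf k1 v * lf k2 u * lf k3 w
      + lf k1 v * lf k2 w * lf k3 u + lf k1 w * lf k2 u * lf k3 v
      + lf k1 w * lf k2 v * lf k3 u].
Proof.
move=> kz; case: tauP => _ _ ext.
have [c cE] := ext (fun x => lf k1 x * lf k2 x * lf k3 x)
  (form_mul (form_mul (form_lf k1) (form_lf k2)) (form_lf k3)) kz.
have pol := tri_product (tau_tri c) (lfD k1) (lfD k2) (lfD k3) (fun x => esym (cE x)).
exists c; split=> // x w; apply: (mulfI (char0 1)).
rewrite mulrA (_ : 2%:R * 3%:R = 6%:R :> K); last by rewrite -natrM.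
by rewrite pol; kring K.
Qed.

(** The equation of the line through u and v, as a covector. *)
Definition brv u v : 'cV[K]_3 := \col_i br u v (delta_mx 0 i).

Lemma lf_brv u v x : lf (brv u v) x = br u v x.
Proof.
rewrite lfE (eq_bigr (fun i => br u v (x 0 i *: delta_mx 0 i))); last first.
  by move=> i _; rewrite mxE brZ3.
have br0 : br u v 0 = 0 by rewrite -(scale0r 0) brZ3 mul0r.
by rewrite -(big_morph (br u v) (brD3 u v) br0) -row_sum_delta.
Qed.

End CubicMap.

(** * Frames: four points in general position containing Z *)

Section GeneralPosition.
Variable K : fieldType.
Hypothesis infK : forall s : seq K, exists x, x \notin s.
Local Notation V := 'rV[K]_3.
Implicit Types (u v w x y : V) (L : seq (V * V)).
Add Ring K_ring : (kring_theory K).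

Definition gp t (z : 'I_t -> V) :=
  [/\ forall i, z i != 0, forall i j, i != j -> free2 (z i) (z j) &
      forall i j k, i != j -> i != k -> j != k -> br (z i) (z j) (z k) != 0].

Definition off_lines L p := forall l, l \in L -> br l.1 l.2 p != 0.

Definition free_lines L := forall l, l \in L -> free2 l.1 l.2.

(** As a function of the coordinates of p, each bracket is a nonzero polynomial, so their product is
    nonzero somewhere. *)
Lemma avoid_lines L : free_lines L -> exists p, off_lines L p.
Proof.
move=> fL; pose r (s : 'I_3 -> K) : V := \row_i s i.
pose f L s := \prod_(l <- L) br l.1 l.2 (r s).
have sA := subalg_mpolyfun K 3.
have pbr u v : mpolyfun (fun s => br u v (r s)).
  have pc i : mpolyfun (fun s : 'I_3 -> K => co (r s) i).
    apply: (subalg_ext (mpolyfun_var K i)) => s.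
    by rewrite /co mxE.
  by rewrite /br; subalg_tac sA; exact: pc.
have pf l : mpolyfun (f l) by apply: (subalg_prod sA) => p _; exact: pbr.
suff [s fs] : exists s, f L s != 0.
  exists (r s) => l; move: fs; rewrite /f => fs lL; apply: contraNneq fs => l0.
  by rewrite (big_rem l) //= l0 mul0r.
elim: L fL => [|l L IH] fL; first by exists (fun=> 0); rewrite /f big_nil oner_neq0.
have [s fs] : exists s, f L s != 0.
  by apply: IH => p pL; apply: fL; rewrite inE pL orbT.
have [w hw] := fL l (mem_head _ _).
have [|r' fr] := mpolyfun_mul_neq0 (s2 := s) (s1 := fun i => w 0 i) infK (pbr l.1 l.2) (pf L) _ fs.
  by rewrite (_ : r _ = w) //; apply/rowP => i; rewrite mxE.
by exists r'; rewrite /f big_cons.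
Qed.

Lemma free2_ex u : u != 0 -> exists v, free2 u v.
Proof.
pose d k : V := delta_mx 0 k; have dE k l : co (d k) l = (l == k)%:R.
  by rewrite /co mxE eqxx.
case/rV0Pn => i; case: (ord3P i) => -> ui;
  [exists (d e1), (d e2)|exists (d e0), (d e2)|exists (d e0), (d e1)];
  rewrite /br !dE /= !(mulr0, mulr1, subr0, sub0r, addr0, add0r, oppr0) //.
by rewrite oppr_eq0.
Qed.

Lemma gp_extend t (z : 'I_t -> V) L : (0 < t)%N -> gp z -> free_lines L ->
  exists z' : 'I_t.+1 -> V, [/\ gp z', forall i, z' (widen_ord (leqnSn t) i) = z i &
    off_lines L (z' ord_max)].
Proof.
move=> t0 [z0 z2 z3] fL; pose i0 := Ordinal t0; have /choice[q hq] i := free2_ex (z0 i).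
pose L' := L ++ [seq (z i, q i) | i : 'I_t] ++
  [seq (z ij.1, z ij.2) | ij <- enum {: 'I_t * 'I_t} & ij.1 != ij.2].
have [|p hp] := @avoid_lines L'.
  move=> l; rewrite !mem_cat => /or3P[/fL//|/codomP[i ->]|/mapP[[i j]]]; first exact: hq.
  by rewrite mem_filter /= => /andP[ij _] ->; exact: z2.
have pq i : br (z i) (q i) p != 0.
  apply: (hp (z i, q i)); rewrite !mem_cat; apply/or3P/Or32.
  by apply/codomP; exists i.
have pz i j : i != j -> br (z i) (z j) p != 0.
  move=> ij; apply: (hp (z i, z j)); rewrite !mem_cat; apply/or3P/Or33.
  by apply/mapP; exists (i, j) => //; rewrite mem_filter /= ij mem_enum.
have pfree i : free2 (z i) p by have [_ ? _] := br_neq0_free (pq i).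
pose z' i := oapp z p (unlift ord_max i).
have zmax : z' ord_max = p by rewrite /z' unlift_none.
have zlift i : z' (lift ord_max i) = z i by rewrite /z' liftK.
exists z'; split.
- split.
  + move=> i; have [j ->|->] := unliftP ord_max i; rewrite ?zlift ?zmax //.
    by case: (free2_neq0 (pfree i0)).
  + move=> i j; have [k ->|->] := unliftP ord_max i; have [l ->|->] := unliftP ord_max j;
      rewrite ?zlift ?zmax ?eqxx //.
    * by rewrite (inj_eq (@lift_inj _ _)) => /z2.
    * by move=> _; apply: free2C.
  + move=> i j k.
    have [i' ->|->] := unliftP ord_max i; have [j' ->|->] := unliftP ord_max j;
    have [k' ->|->] := unliftP ord_max k; rewrite ?zlift ?zmax ?eqxx // ?(inj_eq (@lift_inj _ _)).
    * exact: z3.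
    * by move=> ij _ _; exact: pz.
    * by move=> _ ij _; rewrite brC23 oppr_eq0; exact: pz.
    * by move=> _ _ ij; rewrite -br_rot; exact: pz.
- by move=> i; rewrite -zlift; congr z'; apply/val_inj; rewrite /= /bump leqNgt ltn_ord.
by rewrite zmax => l lL; apply: hp; rewrite !mem_cat lL.
Qed.

(** Completing Z to four points lets the pencil of conics through a frame serve for every t. The
    list L collects lines that the added points have to avoid. *)
Lemma frame_exists t (z : 'I_t -> V) L : (0 < t)%N -> (t <= 4)%N -> gp z -> free_lines L ->
  exists e : 'I_4 -> V, [/\ gp e, forall (i : 'I_t) (j : 'I_4), i = j :> nat -> e j = z i &
    forall j : 'I_4, (t <= j)%N -> off_lines L (e j)].
Proof.
move=> t0 t4; have [k] := ubnP (4 - t).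
elim: k t z t0 t4 => // k IH t z t0 t4 kt gz fL.
have [tE|t4'] := eqVneq t 4%N.
  subst t; exists z; split=> // [i j ij|j]; first by congr z; exact/val_inj.
  by rewrite leqNgt ltn_ord.
have [z' [gz' zz' Lz']] := gp_extend t0 gz fL.
have t14 : (t.+1 <= 4)%N by rewrite ltn_neqAle t4'.
have kt' : (4 - t.+1 < k)%N by lia.
have [e [ge ez Le]] := IH t.+1 z' (ltn0Sn t) t14 kt' gz' fL.
exists e; split=> // [i j ij|j].
  by rewrite -zz'; apply: ez.
rewrite leq_eqVlt => /orP[/eqP tj|]; last exact: Le.
by rewrite (ez ord_max j).
Qed.

Definition gen4 (a b c d : V) : Prop :=
  [/\ br a b c != 0, br a b d != 0, br a c d != 0 & br b c d != 0].

Lemma ord4_pick (i j : 'I_4) : i != j ->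
  exists k l, [/\ uniq [:: i; j; k; l] & forall m, m \in [:: i; j; k; l]].
Proof.
move=> ij.
pose s := enum (~: [set i; j]).
have us : uniq s by exact: enum_uniq.
have ss : size s = 2%N by rewrite -cardE cardsCs finset.setCK cards2 ij card_ord.
move: us ss; case E: s => [|k [|l []]] //= /andP[kl _] _.
have mem m : (m \in [:: k; l]) = (m != i) && (m != j).
  by rewrite -E mem_enum !inE negb_or.
exists k, l; split=> [|m].
  rewrite /= !inE negb_or ij /= !negb_or andbT.
  have := mem k; have := mem l; rewrite !inE !eqxx orbT /= => /esym/andP[li lj] /esym/andP[ki kj].
  rewrite inE in kl.
  by rewrite ![i == _]eq_sym ![j == _]eq_sym ki li kj lj kl.
have := mem m; rewrite !inE; case: (m == i) => //=; case: (m == j) => //= ->.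
Qed.

Lemma gp_gen4 (e : 'I_4 -> V) i j k l : gp e -> uniq [:: i; j; k; l] ->
  gen4 (e i) (e j) (e k) (e l).
Proof.
move=> [_ _ g3]; rewrite /= !inE !negb_or => /and4P[/and3P[ij ik il] /andP[jk jl] kl _].
by split; apply: g3.
Qed.

End GeneralPosition.

Section VectorCurves.
Variables (K : fieldType) (X : Type) (A : set (X -> K)).
Hypothesis sA : subalg A.

Definition regular n (x : X -> 'rV[K]_n) := forall k, A (fun s => x s 0 k).

Lemma regular_cst n (u : 'rV[K]_n) : regular (fun=> u).
Proof. by move=> k; exact: (subalg_cst sA). Qed.

Lemma regularD n (x y : X -> 'rV[K]_n) :
  regular x -> regular y -> regular (fun s => x s + y s).
Proof.
move=> rx ry k; apply: (@subalg_ext _ _ _ (fun s => x s 0 k + y s 0 k)) => [|s].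
  exact: (subalg_add sA).
by rewrite mxE.
Qed.

Lemma regularZ n (a : X -> K) (x : X -> 'rV[K]_n) :
  A a -> regular x -> regular (fun s => a s *: x s).
Proof.
move=> ra rx k; apply: (@subalg_ext _ _ _ (fun s => a s * x s 0 k)) => [|s].
  exact: (subalg_mul sA).
by rewrite mxE.
Qed.

Lemma regularN n (x : X -> 'rV[K]_n) : regular x -> regular (fun s => - x s).
Proof.
move=> rx k; apply: (@subalg_ext _ _ _ (fun s => - x s 0 k)) => [|s].
  exact: (subalg_opp sA).
by rewrite mxE.
Qed.

Lemma regular_co n (x : X -> 'rV[K]_n) k : regular x -> A (fun s => co (x s) k).
Proof. by apply. Qed.

Lemma regular_br (x y w : X -> 'rV[K]_3) : regular x -> regular y -> regular w ->
  A (fun s => br (x s) (y s) (w s)).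
Proof. by move=> rx ry rw; rewrite /br; subalg_tac sA; exact: regular_co. Qed.

Lemma regular_lf n c (x : X -> 'rV[K]_n) : regular x -> A (fun s => lf c (x s)).
Proof. exact: subalg_lf. Qed.

End VectorCurves.

Ltac regular_tac sA := repeat first
  [ exact: (regular_cst sA) | assumption | exact: mpolyfun_var | exact: polyfun_var
  | apply: (regularD sA) | apply: (regularN sA) | apply: (regularZ sA)
  | apply: (regular_br sA) | apply: (regular_lf sA)
  | exact: (subalg_cst sA)
  | apply: (subalg_add sA) | apply: (subalg_sub sA) | apply: (subalg_opp sA)
  | apply: (subalg_mul sA) | apply: (subalg_exp sA) ].

Section DelPezzoPoints.
Variable K : fieldType.
Hypothesis infK : forall s : seq K, exists x, x \notin s.
Hypothesis char0 : forall n, n.+1%:R != 0 :> K.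
Variables (t N : nat) (z : 'I_t -> projsp K 2) (phi : N.+1.-tuple (dhomog 3 K 3)).
Variable tau : 'rV[K]_3 -> 'rV[K]_3 -> 'rV[K]_3 -> 'rV[K]_N.+1.
Hypotheses (t_gt0 : (0 < t)%N) (t_le4 : (t <= 4)%N).
Local Notation zv := (fun i => pvec (z i)).
Hypotheses (tauP : cubic_map zv tau) (gpz : gp zv)
  (phiE : forall x : 'rV[K]_3, \row_j meval (x 0) (tnth phi j) = tau x x x).
Local Notation V := 'rV[K]_3.
Implicit Types (u v w x y : V).
Add Ring K_ring : (kring_theory K).

(** The point of x lies outside Z. Since t > 0, this includes that x is nonzero. *)
Definition off x := forall i, free2 (pvec (z i)) x.

Lemma off_neq0 x : off x -> x != 0.
Proof. by move=> /(_ (Ordinal t_gt0)) /free2_neq0[]. Qed.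

Lemma offP x : off x -> forall i, Pt x <> z i.
Proof.
move=> ox i; rewrite -[z i]PtK => /esym.
move=> /(Pt_eqP (pvec_neq0 _) (off_neq0 ox))[k].
exact: free2_scale (ox i).
Qed.

Lemma not_off x : x != 0 -> (forall i, Pt x <> z i) -> off x.
Proof.
move=> x0 nx i; have [//|[k xE]] := nfreeP x (pvec_neq0 (z i)).
by case: (nx i); rewrite -[z i]PtK; apply/esym/Pt_eqP => //; [exact: pvec_neq0|exists k].
Qed.

Lemma offZ (k : K) x : k != 0 -> off x -> off (k *: x).
Proof. by move=> k0 ox i; have [w h] := ox i; exists w; rewrite brZ2 mulf_neq0. Qed.

Lemma generic_free2 u (x : K -> V) s0 : regular polyfun x -> free2 u (x s0) ->
  generic (fun s => free2 u (x s)).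
Proof.
move=> rx [w h]; have sA := subalg_polyfun K.
apply: (genericW (generic_neq0 (h := fun s => br u (x s) w) (s0 := s0) _ h)).
  by regular_tac sA.
by move=> s hs; exists w.
Qed.

Lemma generic_off (x : K -> V) : regular polyfun x ->
  (forall i, exists s, free2 (pvec (z i)) (x s)) -> generic (fun s => off (x s)).
Proof. by move=> rx h; apply: generic_all => i; have [s /generic_free2] := h i; apply. Qed.

Lemma gp_free2 i j : i != j -> free2 (pvec (z i)) (pvec (z j)).
Proof. by case: gpz => _ + _; apply. Qed.

Lemma generic_off_line i w : free2 (pvec (z i)) w ->
  generic (fun s => off (pvec (z i) + s *: w)).
Proof.
move=> fw; have sA := subalg_polyfun K; apply: generic_off; first by regular_tac sA.
move=> j; have [->|ij] := eqVneq j i.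
  by exists 1; rewrite -[X in X + _]scale1r; apply: free2_comb => //; exact: oner_neq0.
by exists 0; rewrite scale0r addr0; exact: gp_free2.
Qed.

Lemma regular_tau (X : Type) (A : set (X -> K)) (x y w : X -> V) : subalg A ->
  regular A x -> regular A y -> regular A w -> regular A (fun s => tau (x s) (y s) (w s)).
Proof.
move=> sA rx ry rw.
have E (v : V) : v = v 0 e0 *: delta_mx 0 e0 + v 0 e1 *: delta_mx 0 e1 + v 0 e2 *: delta_mx 0 e2.
  by apply: row3P; rewrite /co !mxE /= !(mulr0, mulr1, addr0, add0r).
have L3 u v : regular A (fun s => tau u v (w s)).
  move=> k; apply: (@subalg_ext _ _ _ (fun s => (w s 0 e0 *: tau u v (delta_mx 0 e0)
    + w s 0 e1 *: tau u v (delta_mx 0 e1) + w s 0 e2 *: tau u v (delta_mx 0 e2)) 0 k)).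
    by move: k; rewrite -/(regular _ _); regular_tac sA; exact: rw.
  by move=> s; rewrite [in RHS](E (w s)) !(tauE tauP).
have L2 u : regular A (fun s => tau u (y s) (w s)).
  move=> k; apply: (@subalg_ext _ _ _ (fun s => (y s 0 e0 *: tau u (delta_mx 0 e0) (w s)
    + y s 0 e1 *: tau u (delta_mx 0 e1) (w s) + y s 0 e2 *: tau u (delta_mx 0 e2) (w s)) 0 k)).
    by move: k; rewrite -/(regular _ _); regular_tac sA; first [exact: ry|exact: L3].
  by move=> s; rewrite [in RHS](E (y s)) !(tauE tauP).
move=> k; apply: (@subalg_ext _ _ _ (fun s => (x s 0 e0 *: tau (delta_mx 0 e0) (y s) (w s)
    + x s 0 e1 *: tau (delta_mx 0 e1) (y s) (w s)
    + x s 0 e2 *: tau (delta_mx 0 e2) (y s) (w s)) 0 k)).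
  by move: k; rewrite -/(regular _ _); regular_tac sA; first [exact: rx|exact: L2].
by move=> s; rewrite [in RHS](E (x s)) !(tauE tauP).
Qed.

(* z is contained in the set of the four points a, b, c, d. *)
Definition covered (a b c d : V) := forall i, [\/ pvec (z i) = a, pvec (z i) = b,
  pvec (z i) = c | pvec (z i) = d].

Definition frame (a b c d : V) := gen4 a b c d /\ covered a b c d.

(** Puts a chosen z_i in front. Each remaining frame vector either was added and avoids L, or is
    another point of Z, where incidences are known from the context. *)
Lemma frame_at i L : free_lines L -> exists b c d, [/\ frame (pvec (z i)) b c d &
  forall p, p \in [:: b; c; d] -> off_lines L p \/ exists2 j, j != i & p = pvec (z j)].
Proof.
move=> fL; have [e [ge ez Le]] := frame_exists infK t_gt0 t_le4 gpz fL.
pose i' := widen_ord t_le4 i.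
have ei : e i' = pvec (z i) by exact: ez.
have [j ij] : exists j : 'I_4, i' != j.
  by have [E|E] := eqVneq i' ord0; [exists ord_max; rewrite E|exists ord0].
have [k [l [uq all]]] := ord4_pick ij.
exists (e j), (e k), (e l); split.
  split; first by rewrite -ei; exact: gp_gen4.
  move=> m; rewrite -(ez m (widen_ord t_le4 m)) //.
  have := all (widen_ord t_le4 m); rewrite !inE => /or4P[]/eqP->; [|exact: Or42|exact: Or43|exact: Or44].
  by apply: Or41; rewrite ei.
have key m : m \in [:: j; k; l] -> off_lines L (e m) \/ exists2 j, j != i & e m = pvec (z j).
  move=> mjkl; have [/Le|mt] := leqP t m; first by left.
  right; exists (Ordinal mt); last exact: ez.
  move: uq => /= /andP[+ _]; apply: contra => /eqP mi.
  by rewrite (_ : i' = m) //; apply/val_inj; rewrite /= -mi.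
by move=> p; rewrite !inE => /or3P[]/eqP->; apply: key; rewrite !inE eqxx ?orbT.
Qed.

Lemma two_lines (a b d x : V) : br a b d != 0 -> br a b x = 0 -> br a d x = 0 -> x != 0 ->
  ~ free2 a x.
Proof.
move=> h hb hd x0 fx; have fx' := free2C fx; case: (free2_scale fx' (a := br a b d / br x b d)).
have := cramer a b d x; rewrite -[br a x d]opprK -brC23 hd oppr0 scale0r addr0 hb scale0r addr0.
move=> E; have d0 : br x b d != 0.
  by apply: contraNneq x0 => d0; move/eqP: E; rewrite d0 scale0r scaler_eq0 (negbTE h).
apply: (scalerI d0); rewrite -E scalerA; congr (_ *: _).
by rewrite mulrC divfK.
Qed.

(* The conics of the pencil through a frame have no other base point. *)
Lemma pencil_base (a b c d x : V) : gen4 a b c d ->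
  free2 a x -> free2 b x -> free2 c x -> free2 d x ->
  br a b x * br c d x != 0 \/ br a c x * br b d x != 0.
Proof.
move=> [abc abd acd bcd] fa fb fc fd; have [_ x0] := free2_neq0 fa.
have [h1|] := eqVneq (br a b x * br c d x) 0; last by left.
right; apply/negP; move: h1 => /eqP; rewrite !mulf_eq0 => /orP[]/eqP h1 /orP[]/eqP h2.
- exact: two_lines abc h1 h2 x0 fa.
- apply: (two_lines (a := b) (b := a) (d := d)) _ _ h2 x0 fb.
    by rewrite brC12 oppr_eq0.
  by rewrite brC12 h1 oppr0.
- apply: (two_lines (a := c) (b := a) (d := d)) _ _ h1 x0 fc.
    by rewrite brC12 oppr_eq0.
  by rewrite brC12 h2 oppr0.
- apply: (two_lines (a := d) (b := c) (d := b)) _ _ _ x0 fd.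
  + by rewrite -br_rot brC12 oppr_eq0.
  + by rewrite brC12 h1 oppr0.
  + by rewrite brC12 h2 oppr0.
Qed.

End DelPezzoPoints.

(** * The fibres of the blow-up over the plane *)

Lemma form_comp_lf (K : fieldType) m n d (y : 'rV[K]_m.+1 -> 'rV[K]_n) c :
  (forall k, form d (fun x => y x 0 k)) -> form d (fun x => lf c (y x)).
Proof.
move=> fy; have /choice[g gP] k : exists g, wform (fun _ : 'I_m.+1 => tt) (fun=> d) g /\
    forall x, y x 0 k = g (x 0) by have [g ? ?] := fy k; exists g.
exists (fun v => \sum_k c k 0 * g k v).
  by apply: wform_sum => k; apply: wform_scale; case: (gP k).
move=> x; rewrite lfE; apply: eq_bigr => k _; rewrite mulrC.
by have [_ ->] := gP k.
Qed.

Lemma form_rowD (K : fieldType) m n d (y y' : 'rV[K]_m.+1 -> 'rV[K]_n) k :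
  form d (fun x => y x 0 k) -> form d (fun x => y' x 0 k) ->
  form d (fun x => (y x + y' x) 0 k).
Proof. by move=> fy fy'; apply: form_ext (form_add fy fy') _ => x; rewrite mxE. Qed.

Lemma form_rowZ (K : fieldType) m n d (h : 'rV[K]_m.+1 -> K) (y : 'rV[K]_n) k :
  form d h -> form d (fun x => (h x *: y) 0 k).
Proof.
by move=> fh; apply: form_ext (form_scale (y 0 k) fh) _ => x; rewrite mxE mulrC.
Qed.

Section BlowupPoints.
Variable K : fieldType.
Hypothesis infK : forall s : seq K, exists x, x \notin s.
Hypothesis char0 : forall n, n.+1%:R != 0 :> K.
Variables (t N : nat) (z : 'I_t -> projsp K 2) (phi : N.+1.-tuple (dhomog 3 K 3)).
Variable tau : 'rV[K]_3 -> 'rV[K]_3 -> 'rV[K]_3 -> 'rV[K]_N.+1.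
Hypotheses (t_gt0 : (0 < t)%N) (t_le4 : (t <= 4)%N).
Local Notation zv := (fun i => pvec (z i)).
Hypotheses (tauP : cubic_map zv tau) (gpz : gp zv)
  (phiE : forall x : 'rV[K]_3, \row_j meval (x 0) (tnth phi j) = tau x x x).
Local Notation V := 'rV[K]_3.
Implicit Types (u v w x : V) (y : 'rV[K]_N.+1).
Add Ring K_ring : (kring_theory K).

Local Notation off := (off z).
Local Notation frame := (frame z).

Lemma covered_lines (a b c d : V) (k1 k2 k3 : 'cV[K]_3) : covered z a b c d ->
  lf k1 a * lf k2 a * lf k3 a = 0 -> lf k1 b * lf k2 b * lf k3 b = 0 ->
  lf k1 c * lf k2 c * lf k3 c = 0 -> lf k1 d * lf k2 d * lf k3 d = 0 ->
  forall i, lf k1 (pvec (z i)) * lf k2 (pvec (z i)) * lf k3 (pvec (z i)) = 0.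
Proof. by move=> cov ha hb hc hd i; case: (cov i) => ->. Qed.

Lemma frame_free (a x b c d : V) : (forall p, p \in [:: b; c; d] ->
    off_lines [:: (a, x)] p \/ exists j, p = pvec (z j)) -> off x ->
  [/\ free2 b x, free2 c x & free2 d x].
Proof.
move=> h ox; suff key p : p \in [:: b; c; d] -> free2 p x.
  by split; apply: key; rewrite !inE eqxx ?orbT.
move=> /h[/(_ _ (mem_head _ _))/= hp|[j ->]]; last exact: ox.
by have [_ _ /free2C] := br_neq0_free hp.
Qed.

(** Two line pairs of the pencil through a frame meet only in the frame ([pencil_base]), so one of
    them misses x. The added frame points are chosen off the line from z_1 to x, which makes them
    different from x. *)
Lemma off_conic x : off x -> exists k1 k2 : 'cV[K]_3,
  [/\ lf k1 x != 0, lf k2 x != 0 & forall i, lf k1 (pvec (z i)) * lf k2 (pvec (z i)) = 0].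
Proof.
move=> ox; pose i0 := Ordinal t_gt0; pose a := pvec (z i0).
have fL : free_lines [:: (a, x)] by move=> l; rewrite inE => /eqP->; exact: ox.
have [b [c [d [[g4 cov] L]]]] := frame_at infK t_gt0 t_le4 gpz i0 fL.
have [|fb fc fd] := @frame_free a x b c d _ ox.
  by move=> p /L[|[j _ ->]]; [left|right; exists j].
have [|] := pencil_base g4 (ox i0) fb fc fd; rewrite mulf_eq0 negb_or => /andP[h1 h2].
  exists (brv a b), (brv c d); rewrite !lf_brv; split=> // i.
  by case: (cov i) => ->; rewrite !lf_brv ?brE ?mul0r ?mulr0.
exists (brv a c), (brv b d); rewrite !lf_brv; split=> // i.
by case: (cov i) => ->; rewrite !lf_brv ?brE ?mul0r ?mulr0.
Qed.

(** In a frame z_i, b, c, d, the lines bc and bd miss z_i and contain the three other points. *)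
Lemma exc_conic i : exists k1 k2 : 'cV[K]_3, [/\ lf k1 (pvec (z i)) != 0,
  lf k2 (pvec (z i)) != 0 &
  forall j, j != i -> lf k1 (pvec (z j)) * lf k2 (pvec (z j)) = 0].
Proof.
have [b [c [d [[g4 cov] _]]]] := frame_at infK t_gt0 t_le4 gpz i (fun l (lL : l \in [::]) => False_ind _ (notF lL)).
case: g4 => [abc abd acd bcd]; exists (brv b c), (brv b d).
rewrite !lf_brv !(br_rot (pvec (z i))); split=> // j ji.
have zji := gp_free2 gpz ji.
case: (cov j) => [E|->|->|->]; rewrite ?lf_brv ?brE ?mul0r ?mulr0 //.
by case: (free2_scale zji (a := 1)); rewrite scale1r -E.
Qed.

Lemma tau_off x : off x -> exists c, lf c (tau x x x) != 0.
Proof.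
move=> ox; have [k1 [k2 [h1 h2 hz]]] := off_conic ox.
have [k hk] := lf_neq0 (off_neq0 t_gt0 ox).
have [|c [cE _ _]] := three_lines char0 tauP (k1 := k1) (k2 := k2) (k3 := k).
  by move=> i; rewrite hz mul0r.
by exists c; rewrite cE !mulf_neq0.
Qed.

Lemma tau_off_neq0 x : off x -> tau x x x != 0.
Proof. by move=> /tau_off[c]; apply: contraNneq => ->; rewrite lf0. Qed.

Lemma exc_functional i u : exists c, forall w,
  br (pvec (z i)) u w != 0 -> lf c (tau (pvec (z i)) (pvec (z i)) w) != 0.
Proof.
have [k1 [k2 [h1 h2 hz]]] := exc_conic i.
have [|c [_ cE _]] := three_lines char0 tauP (k1 := k1) (k2 := k2) (k3 := brv (pvec (z i)) u).
  move=> j; have [->|ji] := eqVneq j i; last by rewrite hz // mul0r.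
  by rewrite lf_brv brE mulr0.
exists c => w hw; have := cE (pvec (z i)) w; rewrite !lf_brv brE !mulr0 !add0r => E.
have : 3%:R * lf c (tau (pvec (z i)) (pvec (z i)) w) != 0.
  by rewrite E !mulf_neq0.
by rewrite mulf_eq0 negb_or => /andP[].
Qed.

Lemma tau_exc_neq0 i w : free2 (pvec (z i)) w -> tau (pvec (z i)) (pvec (z i)) w != 0.
Proof.
move=> [u h]; have [c hc] := exc_functional i u.
have := hc w; rewrite brC23 oppr_eq0 => /(_ h).
by apply: contraNneq => ->; rewrite lf0.
Qed.

Local Notation dims := (fun b : bool => if b then N else 2%N).

Definition bvec x (y : 'rV[K]_N.+1) : vecs K dims :=
  fun b => if b return 'rV[K]_(if b then N else 2%N).+1 then y else x.

Lemma mpt_bvec x y : mpt (bvec x y) = pair_pt (Pt x) (Pt y).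
Proof. by apply: functional_extensionality_dep => -[]. Qed.

Lemma pair_pt_closed d (h : vecs K dims -> K) x y :
  mform d h -> blowup z phi `<=` [set w | h (pvecs w) = 0] -> x != 0 -> y != 0 ->
  blowup z phi (pair_pt (Pt x) (Pt y)) -> h (bvec x y) = 0.
Proof.
move=> fh sub x0 y0; rewrite -mpt_bvec => /sub /= /eqP.
by rewrite (mform_mpt fh) => [/eqP//|[]].
Qed.

(* A syzygy of the coordinates of the cubic map holds on the blow-up. *)
Lemma blowup_syzygy d (P : V -> K) (g2 g3 : V -> 'rV[K]_N.+1) c2 c3 x y :
  form d P -> (forall k, form d (fun x => g2 x 0 k)) -> (forall k, form d (fun x => g3 x 0 k)) ->
  (forall x, P x *: tau x x x = lf c2 (tau x x x) *: g2 x + lf c3 (tau x x x) *: g3 x) ->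
  x != 0 -> y != 0 -> blowup z phi (pair_pt (Pt x) (Pt y)) ->
  P x *: y = lf c2 y *: g2 x + lf c3 y *: g3 x.
Proof.
move=> fP f2 f3 rel x0 y0 bxy; apply/rowP => k; rewrite !mxE.
pose h (u : vecs K dims) : K := P (u false) * u true 0 k
  - (lf c2 (u true) * g2 (u false) 0 k + lf c3 (u true) * g3 (u false) 0 k).
have fh : mform (fun j => (d * (false == j) + 1 * (true == j))%N) h.
  apply: mform_sub.
    exact: (mform_mul (mform_form (n := dims) (i := false) fP)
      (mform_form (n := dims) (i := true) (form_coord K k))).
  apply: mform_add.
    apply: mform_deg (mform_mul (mform_form (n := dims) (i := true) (form_lf c2))
      (mform_form (n := dims) (i := false) (f2 k))) _ => j; exact: addnC.
  apply: mform_deg (mform_mul (mform_form (n := dims) (i := true) (form_lf c3))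
    (mform_form (n := dims) (i := false) (f3 k))) _ => j; exact: addnC.
suff sub : blowup z phi `<=` [set w | h (pvecs w) = 0].
  by apply/eqP; rewrite -subr_eq0; apply/eqP; exact: (pair_pt_closed fh sub x0 y0 bxy).
have cC := closed_mform fh.
rewrite /blowup [X in _ `<=` X](proj1 (closure_id _) cC); apply: closure_subset => w [_ wE].
have : pvec (w true) \in val (w true) by rewrite (val_pvec (w true)) memv_line.
rewrite wE phiE => /vlineP[k' yE]; rewrite /h /= /pvecs yE.
have := congr1 (fun A : 'rV_ _ => k' * A 0 k) (rel (pvec (w false))).
rewrite !mxE !lfZ => E; apply/eqP; rewrite subr_eq0; apply/eqP.
by rewrite mulrCA E mulrDr !mulrA.
Qed.

Lemma form_tau k : form 3 (fun x => tau x x x 0 k).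
Proof. by apply: form_ext (form_dhomog (tnth phi k)) _ => x; rewrite -phiE mxE. Qed.

Lemma proportional_Pt (a b : K) y y' : a != 0 -> y != 0 -> y' != 0 ->
  a *: y = b *: y' -> Pt y = Pt y'.
Proof.
move=> a0 y0 y0' E; have b0 : b != 0.
  by apply: contraNneq y0 => b0; move/eqP: E; rewrite b0 scale0r scaler_eq0 (negbTE a0).
by rewrite -(PtZ a0 y0) E PtZ.
Qed.

Lemma graph_point x y (w : plane_times K N) : off x -> w = pair_pt (Pt x) (Pt y) ->
  y != 0 -> Pt y = Pt (tau x x x) ->
  (forall i, w false <> z i) /\ val (w true) =
      <[\row_j meval (hcoord (w false : projsp K 2)) (tnth phi j)]>%VS.
Proof.
move=> ox -> y0 yE; split=> [i|]; first exact: (offP t_gt0).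
have x0 := off_neq0 t_gt0 ox; have [k k0 xE] := pvec_Pt x0.
rewrite /= yE (phiE (pvec (Pt x))) xE (tau_diagZ tauP) -(val_Pt (x := _ *: _)).
  by rewrite PtZ ?expf_neq0 // tau_off_neq0.
by rewrite scaler_eq0 negb_or expf_neq0 // tau_off_neq0.
Qed.

(** Outside Z some cubic c is nonzero at x, and the syzygy c(tau x x x) y = c(y) tau x x x, which
    passes to the closure of the graph, leaves a single point in the fibre. *)
Lemma blowup_off x p : off x ->
  blowup z phi (pair_pt (Pt x) p) <-> p = Pt (tau x x x).
Proof.
move=> ox; have x0 := off_neq0 t_gt0 ox; have t0 := tau_off_neq0 ox; split=> [bxp|->].
  have {}bxp : blowup z phi (pair_pt (Pt x) (Pt (pvec p))) by rewrite PtK.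
  have [c hc] := tau_off ox.
  have E : lf c (tau x x x) *: pvec p = lf c (pvec p) *: tau x x x + lf 0 (pvec p) *: 0.
    apply: (@blowup_syzygy 3 (fun x => lf c (tau x x x)) (fun x => tau x x x) (fun=> 0) c 0 x _ _ _ _ _ x0 (pvec_neq0 p) bxp).
    - exact: form_comp_lf form_tau.
    - exact: form_tau.
    - by move=> k; apply: form_ext (form_scale 0 (form_tau k)) _ => v; rewrite mul0r mxE.
    - by move=> v; rewrite scaler0 addr0.
  rewrite scaler0 addr0 in E.
  by rewrite -[LHS]PtK; exact: proportional_Pt hc (pvec_neq0 p) t0 E.
by apply: subset_closure; exact: graph_point ox erefl t0 erefl.
Qed.

(** Along z_i + s w the cubic map is s times a curve y with y 0 = 3 tau a a w, so this point is a
    limit of points of the graph. *)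
Lemma exc_in_blowup i w : free2 (pvec (z i)) w ->
  blowup z phi (pair_pt (z i) (Pt (tau (pvec (z i)) (pvec (z i)) w))).
Proof.
move=> fw; set a := pvec (z i); have t0 := tau_exc_neq0 fw.
have sA := subalg_polyfun K.
pose x (s : K) := a + s *: w.
pose y (s : K) := 3%:R *: tau a a w + (3%:R * s) *: tau a w w + s ^+ 2 *: tau w w w.
have xy s : tau (x s) (x s) (x s) = s *: y s.
  have aaa : tau a a a = 0 by exact: (tau_z tauP i).
  rewrite /x -[X in X + _]scale1r (tau_comb2 tauP) aaa scaler0 add0r /y.
  by apply: lf_inj => c; rewrite !(lfD, lfZ); kring K.
have rx : regular polyfun x by rewrite /x; regular_tac sA.
have ry : regular polyfun y by rewrite /y; regular_tac sA.
have y0 : y 0 = 3%:R *: tau a a w by rewrite /y mulr0 expr0n /= !scale0r !addr0.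
have := @curve_mproj K infK bool dims (blowup z phi) (fun s => bvec (x s) (y s)) 0
  (@closed_closure _ _).
rewrite !mpt_bvec /x scale0r addr0 y0 PtZ ?char0 // /a PtK; apply.
- by move=> [] k; [exact: ry|exact: rx].
- case; last exact: pvec_neq0.
  by rewrite /bvec ?y0 scaler_eq0 negb_or char0 tau_exc_neq0.
apply: genericW (genericI (generic_off_line gpz fw) (generic_neq 0)) _ => s [os s0].
have ys : y s != 0.
  by apply: contraNneq (tau_off_neq0 os) => ys; rewrite -/(x s) xy ys scaler0.
split; first by case=> //=; exact: (off_neq0 t_gt0 os).
rewrite mpt_bvec; apply: subset_closure; apply: (graph_point os erefl ys).
have := xy s; rewrite /x /a => ->; rewrite PtZ; [reflexivity|exact: s0|exact: ys].
Qed.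

(** For the converse, a syzygy that holds on the graph is specialized at a = z_i. Its right side
    becomes a multiple of tau a a w, where w has as coordinates the values at p of two cubics that
    vanish at z_i to first order in independent directions. *)
Lemma blowup_exc i p : blowup z phi (pair_pt (z i) p) <->
  exists2 w, free2 (pvec (z i)) w & p = Pt (tau (pvec (z i)) (pvec (z i)) w).
Proof.
split=> [bp|[w fw ->]]; last exact: exc_in_blowup.
set a := pvec (z i); have a0 : a != 0 := pvec_neq0 _.
have aaa : tau a a a = 0 by exact: (tau_z tauP i).
have {}bp : blowup z phi (pair_pt (Pt a) (Pt (pvec p))) by rewrite !PtK.
have [u [v D]] := free2_ex a0; have [k1 [k2 [h1 h2 hz]]] := exc_conic i.
pose l1 x := br x u v; pose l2 x := br a x v; pose l3 x := br a u x.
have Dx x : br a u v *: x = l1 x *: a + l2 x *: u + l3 x *: v by exact: cramer.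
have [|c2 [c2E _ _]] := three_lines char0 tauP (k1 := k1) (k2 := k2) (k3 := brv v a).
  move=> j; have [->|ji] := eqVneq j i; last by rewrite hz // mul0r.
  by rewrite lf_brv brE mulr0.
have [|c3 [c3E _ _]] := three_lines char0 tauP (k1 := k1) (k2 := k2) (k3 := brv a u).
  move=> j; have [->|ji] := eqVneq j i; last by rewrite hz // mul0r.
  by rewrite lf_brv brE mulr0.
(* Since tau a a a = 0, the expansion of D^3 tau x x x, with D = [a,u,v], has only terms divisible
   by l2 or l3, and it is l2 g2 + l3 g3. Multiplying by k1 k2 turns k1 k2 l2 and k1 k2 l3 into the
   cubics c2 and c3. *)
pose g2 x := (3%:R * l1 x ^+ 2) *: tau a a u + (3%:R * l1 x * l2 x) *: tau a u u
  + (6%:R * l1 x * l3 x) *: tau a u v + (l2 x ^+ 2) *: tau u u u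
  + (3%:R * l2 x * l3 x) *: tau u u v.
pose g3 x := (3%:R * l1 x ^+ 2) *: tau a a v + (3%:R * l1 x * l3 x) *: tau a v v
  + (l3 x ^+ 2) *: tau v v v + (3%:R * l2 x * l3 x) *: tau u v v.
pose P x := br a u v ^+ 3 * (lf k1 x * lf k2 x).
have f1 : form 1 l1 by apply: form_ext (form_lf (brv u v)) _ => x; rewrite lf_brv br_rot.
have f2 : form 1 l2 by apply: form_ext (form_lf (brv v a)) _ => x; rewrite lf_brv -br_rot.
have f3 : form 1 l3 by apply: form_ext (form_lf (brv a u)) _ => x; rewrite lf_brv.
have rel : P a *: pvec p = lf c2 (pvec p) *: g2 a + lf c3 (pvec p) *: g3 a.
  apply: (@blowup_syzygy 2 P g2 g3 c2 c3 a _ _ _ _ _ a0 (pvec_neq0 p) bp).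
  - exact: form_scale (form_mul (form_lf k1) (form_lf k2)).
  - have f22 := form_exp 2 f2; have f12 := form_mul (form_scale 3%:R f1) f2.
    have f13 := form_mul (form_scale 6%:R f1) f3.
    have f23 := form_mul (form_scale 3%:R f2) f3.
    have f11 := form_scale 3%:R (form_exp 2 f1).
    by move=> k; rewrite /g2; do 4 (apply: form_rowD; last exact: form_rowZ);
      exact: form_rowZ.
  - have f33 := form_exp 2 f3; have f13 := form_mul (form_scale 3%:R f1) f3.
    have f23 := form_mul (form_scale 3%:R f2) f3.
    have f11 := form_scale 3%:R (form_exp 2 f1).
    by move=> k; rewrite /g3; do 3 (apply: form_rowD; last exact: form_rowZ);
      exact: form_rowZ.
  - move=> x; rewrite c2E c3E !lf_brv.
    have -> : br v a x = l2 x by rewrite -br_rot.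
    rewrite -/(l3 x).
    have E := congr1 (fun x => tau x x x) (Dx x); rewrite (tau_diagZ tauP) in E.
    transitivity ((lf k1 x * lf k2 x) *: (br a u v ^+ 3 *: tau x x x)).
      by rewrite /P scalerA mulrC.
    rewrite E (tau_comb3 tauP) /g2 /g3; apply: lf_inj => c.
    by rewrite aaa !(lfD, lfZ) lf0; kring K.
have la1 : l1 a = br a u v by [].
have la2 : l2 a = 0 by rewrite /l2 brE.
have la3 : l3 a = 0 by rewrite /l3 brE.
pose w := lf c2 (pvec p) *: u + lf c3 (pvec p) *: v.
have E : P a *: pvec p = (3%:R * br a u v ^+ 2) *: tau a a w.
  rewrite rel /g2 /g3 la1 la2 la3 /w !(tauE tauP); apply: lf_inj => c.
  by rewrite !(lfD, lfZ); kring K.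
have Pa0 : P a != 0 by rewrite /P !mulf_neq0 ?expf_neq0.
have fw : free2 a w.
  have [//|[k wE]] := nfreeP w a0; move: E; rewrite wE !(tauE tauP) aaa !scaler0.
  by move/eqP; rewrite scaler_eq0 (negbTE Pa0) (negbTE (pvec_neq0 p)).
exists w => //; rewrite -[LHS]PtK.
exact: proportional_Pt Pa0 (pvec_neq0 p) (tau_exc_neq0 fw) E.
Qed.

End BlowupPoints.

(** * Embedded tangent spaces by curves and equations *)

Section TangentSpace.
Variable K : fieldType.
Hypothesis infK : forall s : seq K, exists x, x \notin s.

Add Ring K_ring : (kring_theory K).

Section ChainRule.
Variables (n : nat) (g : 'I_n -> {poly K}).

Definition has_chain_rule (f : mpoly n K) := exists G : {poly K},
  (forall s, G.[s] = meval (fun i => (g i).[s]) f) /\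
  (G^`()).[0] = \sum_i meval (fun j => (g j).[0]) (mderiv i f) * ((g i)^`()).[0].

Lemma chain_ruleD p q : has_chain_rule p -> has_chain_rule q -> has_chain_rule (p + q).
Proof.
move=> [P [PE dP]] [Q [QE dQ]]; exists (P + Q); split=> [s|].
  by rewrite hornerD mevalD PE QE.
rewrite derivD hornerD dP dQ -big_split /=; apply: eq_bigr => i _.
by rewrite mderivD mevalD mulrDl.
Qed.

Lemma chain_ruleM p q : has_chain_rule p -> has_chain_rule q -> has_chain_rule (p * q).
Proof.
move=> [P [PE dP]] [Q [QE dQ]]; exists (P * Q); split=> [s|].
  by rewrite hornerM mevalM PE QE.
rewrite derivM hornerD !hornerM dP dQ PE QE mulr_suml mulr_sumr -big_split /=.
apply: eq_bigr => i _; rewrite mderivM mevalD !mevalM mulrDl.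
by congr (_ + _); [rewrite mulrAC|rewrite mulrA].
Qed.

Lemma chain_ruleC c : has_chain_rule (mpolyC n c).
Proof.
exists c%:P; split=> [s|]; first by rewrite hornerC mevalC.
by rewrite derivC horner0 big1 // => i _; rewrite mderivC meval0 mul0r.
Qed.

Lemma chain_ruleU k : has_chain_rule (mpolyX K (mnm1 k)).
Proof.
exists (g k); split=> [s|]; first by rewrite mevalXU.
rewrite (bigD1 k) //= big1 => [|i ik].
  rewrite addr0 mderivX mnm1E eqxx scale1r (_ : mnm_sub _ _ = mnm0).
    by rewrite mpolyX0 meval1 mul1r.
  by apply/mnmP => l; rewrite mnmBE subnn mnm0E.
by rewrite mderivX mnm1E eq_sym (negbTE ik) scale0r meval0 mul0r.
Qed.

Lemma chain_rule f : has_chain_rule f.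
Proof.
rewrite (mpolyE f); elim: (msupp f) => [|m r IH].
  by rewrite big_nil -mpolyC0; exact: chain_ruleC.
rewrite big_cons; apply: chain_ruleD => //; rewrite -mul_mpolyC.
apply: chain_ruleM; first exact: chain_ruleC.
rewrite mpolyXE_id; elim: (index_enum _) => [|i s IHs].
  by rewrite big_nil -mpolyC1; exact: chain_ruleC.
rewrite big_cons; apply: chain_ruleM => //.
elim: (m i) => [|k IHk]; first by rewrite expr0 -mpolyC1; exact: chain_ruleC.
by rewrite exprS; apply: chain_ruleM => //; exact: chain_ruleU.
Qed.

End ChainRule.

Variables (n : nat) (X : set (projsp K n)).
Implicit Types (v y : 'rV[K]_n.+1) (p : projsp K n).

(** Lower bounds for tangent spaces: differentiating an equation of X along a polynomial curve in X
    shows that its velocity v is tangent. *)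
Lemma tangent_curve p y v (r : K -> 'rV[K]_n.+1) : regular polyfun r ->
  y != 0 -> p = Pt y ->
  generic (fun s => let ys := y + s *: v + s ^+ 2 *: r s in ys != 0 /\ X (Pt ys)) ->
  v \in tangent X p.
Proof.
move=> rr y0 -> gX; have [k k0 kE] := pvec_Pt y0.
suff : k *: v \in tangent X (Pt y).
  by move/(memvZ k^-1); rewrite scalerA mulVf // scale1r.
apply/tangentP => f hf fX.
have /choice[q qE] : forall i, exists q : {poly K}, forall s, r s 0 i = q.[s].
  exact: rr.
pose g i : {poly K} := (k * y 0 i)%:P + (k * v 0 i)%:P * 'X + k%:P * ('X ^+ 2 * q i).
have gs i s : (g i).[s] = (k *: (y + s *: v + s ^+ 2 *: r s)) 0 i.
  rewrite /g !(hornerD, hornerM, hornerC, hornerX, hornerXn) -qE -[RHS]/(co _ _) !coE.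
  by rewrite /co; kring K.
have g0 i : (g i).[0] = hcoord (Pt y) i.
  by rewrite gs hcoordE kE scale0r expr0n /= scale0r !addr0.
have dg i : ((g i)^`()).[0] = (k *: v) 0 i.
  rewrite /g !derivD derivC !derivM !derivC derivX ?derivXn !(hornerD, hornerM, hornerC, hornerX, hornerXn, hornerMn) !mxE.
  by rewrite /= ?(mul0r, mulr0, mul0rn, addr0, add0r, mulr1).
have [G [GE dG]] := chain_rule g f.
have G0 : G = 0.
  apply/eqP/negPn/negP => nG; have gG : generic (fun s => G.[s] != 0) by exists G.
  have [s [/negP Gs [ys0 Xs]]] := generic_ex infK (genericI gG gX); apply: Gs; rewrite GE.
  have [d wf] := proj1 (homogeneousP f) hf.
  have ff : form d (fun x : 'rV[K]_n.+1 => meval (x 0) f).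
    by exists (fun g : 'I_n.+1 -> K => meval g f) => //; exists f.
  rewrite (_ : meval _ f = k ^+ d * meval ((y + s *: v + s ^+ 2 *: r s) 0) f); last first.
    rewrite -(form_scaling k _ ff); apply: meval_eq => i; exact: gs.
  by rewrite mulf_eq0 -(form_Pt ff ys0) [X in _ || X](introT eqP (fX _ Xs)) orbT.
move: dG; rewrite G0 deriv0 horner0 => /esym dG; rewrite -[RHS]dG.
by apply: eq_bigr => i _; rewrite dg; congr (_ * _); apply: meval_eq => j; rewrite g0.
Qed.

(** Upper bounds for tangent spaces: when an equation of X is affine in s along p + s v, its slope
    is the derivative at p in the direction v, which a tangent vector annihilates. *)
Lemma tangent_form d (F : 'rV[K]_n.+1 -> K) p v a b : form d F ->
  (forall q, X q -> F (pvec q) = 0) -> v \in tangent X p ->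
  (forall s, F (pvec p + s *: v) = a + s * b) -> b = 0.
Proof.
move=> [h [f wf hE] FE] FX /tangentP vt Fab.
have hf : homogeneous f by apply/homogeneousP; exists d.
have tv := vt f hf (fun q Xq => etrans (esym (etrans (FE _) (hE _))) (FX q Xq)).
pose g i : {poly K} := (pvec p 0 i)%:P + (v 0 i)%:P * 'X.
have gs i s : (g i).[s] = (pvec p + s *: v) 0 i.
  by rewrite /g !hornerE !mxE mulrC.
have [G [GE dG]] := chain_rule g f.
have GE' : G = a%:P + b%:P * 'X.
  apply/eqP; rewrite -subr_eq0; apply/negPn/negP => nz.
  have [s] := poly_nonroot infK nz; rewrite !hornerE GE -[X in X - _](_ : a + s * b = _).
    by rewrite [b * s]mulrC subrr eqxx.
  by rewrite -Fab FE hE; apply: meval_eq => i; rewrite gs.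
move: dG; rewrite GE' derivD derivC add0r derivM derivC mul0r add0r derivX mulr1 hornerC => ->.
rewrite -[RHS]tv; apply: eq_bigr => i _; congr (_ * _).
  by apply: meval_eq => j; rewrite /g !hornerE.
by rewrite /g derivD derivC add0r derivM derivC mul0r add0r derivX mulr1 hornerC.
Qed.

End TangentSpace.

Lemma form_comp (K : fieldType) m n d (h : 'rV[K]_n.+1 -> K)
    (y : 'rV[K]_m.+1 -> 'rV[K]_n.+1) :
  form d h -> (forall i, form 1 (fun x => y x 0 i)) -> form d (fun x => h (y x)).
Proof.
move=> [g [f wf gE] hE] fy.
have /choice[q qP] i : exists q, wform (fun _ : 'I_m.+1 => tt) (fun=> 1%N) q /\
    forall x, y x 0 i = q (x 0) by have [q ? ?] := fy i; exists q.
exists (fun v => \sum_(l : 'I_(size (msupp f)))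
    mcoeff (nth mnm0 (msupp f) l) f * \prod_i q i v ^+ nth mnm0 (msupp f) l i).
  apply: wform_sum => l; apply: wform_scale.
  have lf' : nth mnm0 (msupp f) l \in msupp f by rewrite mem_nth.
  apply: wform_deg (wform_prod (fun i => wform_exp _ (proj1 (qP i)))) _ => -[].
  rewrite -(wf _ lf' tt); apply: eq_big => [i|i _]; first by rewrite eqxx.
  by rewrite muln1.
move=> x; rewrite hE gE mevalE (big_nth mnm0) big_mkord.
apply: eq_bigr => l _; congr (_ * _); apply: eq_bigr => i _.
by have [_ ->] := qP i.
Qed.

Lemma vspace_dim3 (K : fieldType) m (W : {vspace 'rV[K]_m}) w1 w2 w3 (c1 c2 c3 : 'cV[K]_m) :
  w1 \in W -> w2 \in W -> w3 \in W ->
  (forall a b c, a *: w1 + b *: w2 + c *: w3 = 0 -> [/\ a = 0, b = 0 & c = 0]) ->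
  (forall v, v \in W -> lf c1 v = 0 -> lf c2 v = 0 -> lf c3 v = 0 -> v = 0) ->
  \dim W = 3%N /\ forall v, v \in W -> exists a b c, v = a *: w1 + b *: w2 + c *: w3.
Proof.
move=> W1 W2 W3 ind inj.
pose f v : 'rV[K]_3 := \row_i lf (if i == e0 then c1 else if i == e1 then c2 else c3) v.
have lin : linear f by move=> a u v; apply/rowP => i; rewrite !mxE lfD lfZ.
pose L : {linear 'rV[K]_m -> 'rV[K]_3} := HB.pack f (GRing.isLinear.Build _ _ _ _ f lin).
have dW : (\dim W <= 3)%N.
  rewrite -(limg_ker_dim (linfun L) W) (_ : (W :&: lker (linfun L))%VS = 0%VS).
    by rewrite dimv0 add0n; apply: leq_trans (dimvS (subvf _)) _; rewrite dimvf /dim /= mul1n.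
  apply/eqP; rewrite -subv0; apply/subvP => v; rewrite memv_cap memv0 memv_ker lfunE /=.
  move=> /andP[vW /eqP/rowP fv]; apply/eqP/inj => //.
  - by have := fv e0; rewrite !mxE.
  - by have := fv e1; rewrite !mxE.
  - by have := fv e2; rewrite !mxE.
have fr : free [:: w1; w2; w3].
  rewrite !free_cons span_nil memv0 nil_free andbT !span_cons span_nil addv0.
  apply/and3P; split.
  - apply/negP => /memv_addP[_ /vlineP[b ->] [_ /vlineP[c ->] E]].
    have [|/eqP] := ind 1 (- b) (- c); last by rewrite oner_eq0.
    by rewrite scale1r E !scaleNr -addrA -opprD subrr.
  - apply/negP => /vlineP[c E]; have [|_ /eqP] := ind 0 1 (- c); last by rewrite oner_eq0.
    by rewrite scale0r add0r scale1r E scaleNr subrr.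
  - apply/eqP => E; have [|_ _ /eqP] := ind 0 0 1; last by rewrite oner_eq0.
    by rewrite E scaler0 !scale0r !addr0.
have sub : (<<[:: w1; w2; w3]>> <= W)%VS.
  by apply/span_subvP => w; rewrite !inE => /or3P[]/eqP->.
have /eqP dS := fr; have WE : <<[:: w1; w2; w3]>>%VS = W.
  by apply/eqP; rewrite eqEdim sub dS.
split=> [|v]; first by rewrite -WE dS.
rewrite -WE !span_cons span_nil addv0.
move=> /memv_addP[_ /vlineP[a ->] [_ /memv_addP[_ /vlineP[b ->] [_ /vlineP[c ->] ->]] ->]].
by exists a, b, c; rewrite addrA.
Qed.

(** * Points of the del Pezzo surface and their tangent spaces *)

Section DelPezzoTangent.
Variable K : fieldType.
Hypothesis infK : forall s : seq K, exists x, x \notin s.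
Hypothesis char0 : forall n, n.+1%:R != 0 :> K.
Variables (t N : nat) (z : 'I_t -> projsp K 2) (phi : N.+1.-tuple (dhomog 3 K 3)).
Variable tau : 'rV[K]_3 -> 'rV[K]_3 -> 'rV[K]_3 -> 'rV[K]_N.+1.
Hypotheses (t_gt0 : (0 < t)%N) (t_le4 : (t <= 4)%N).
Local Notation zv := (fun i => pvec (z i)).
Hypotheses (tauP : cubic_map zv tau) (gpz : gp zv)
  (phiE : forall x : 'rV[K]_3, \row_j meval (x 0) (tnth phi j) = tau x x x).
Local Notation V := 'rV[K]_3.
Implicit Types (u v w x : V) (y : 'rV[K]_N.+1).
Add Ring K_ring : (kring_theory K).

Local Notation off := (off z).
Local Notation frame := (frame z).
Local Notation X := (del_pezzo z phi).

Lemma exceptionalP i p : exceptional z phi i p <->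
  exists2 w, free2 (pvec (z i)) w & p = Pt (tau (pvec (z i)) (pvec (z i)) w).
Proof. exact: (blowup_exc infK char0 t_gt0 t_le4 tauP gpz phiE). Qed.

Lemma plane_point (q : projsp K 2) : (exists i, q = z i) \/ exists2 x, off x & q = Pt x.
Proof.
have [[i ->]|nz] := pselect (exists i, q = z i); first by left; exists i.
right; exists (pvec q); last by rewrite PtK.
by apply: not_off => [|i]; [exact: pvec_neq0|rewrite PtK => qi; apply: nz; exists i].
Qed.

Lemma del_pezzoP p : X p <-> (exists2 x, off x & p = Pt (tau x x x)) \/
  exists i w, free2 (pvec (z i)) w /\ p = Pt (tau (pvec (z i)) (pvec (z i)) w).
Proof.
split=> [[q]|[[x ox ->]|[i [w [fw ->]]]]].
- have [[i ->]|[x ox ->]] := plane_point q.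
    by move=> /exceptionalP[w fw ->]; right; exists i, w.
  by move=> /(blowup_off infK char0 t_gt0 t_le4 tauP gpz phiE _ ox) ->; left; exists x.
- by exists (Pt x); apply/(blowup_off infK char0 t_gt0 t_le4 tauP gpz phiE _ ox).
- by exists (z i); apply/exceptionalP; exists w.
Qed.

(** The conic of [off_conic] for x together with a line through z_i but not x is a cubic singular at
    z_i. As a linear form it kills tau a a w, but not tau x x x. *)
Lemma off_exc_neq x i w : off x -> free2 (pvec (z i)) w ->
  Pt (tau x x x) <> Pt (tau (pvec (z i)) (pvec (z i)) w).
Proof.
move=> ox fw; have [k1 [k2 [h1 h2 hz]]] := off_conic infK t_gt0 t_le4 gpz ox.
have [u hu] := ox i.
have [|c [cE cD _]] := three_lines char0 tauP (k1 := k1) (k2 := k2) (k3 := brv (pvec (z i)) u).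
  by move=> j; rewrite hz mul0r.
have := tau_off_neq0 infK char0 t_gt0 t_le4 tauP gpz ox.
have := tau_exc_neq0 infK char0 t_gt0 t_le4 tauP gpz fw.
move=> t1 t2 /(Pt_eqP t2 t1)[k E].
have t3 : 3%:R * lf c (tau (pvec (z i)) (pvec (z i)) w) = 0.
  by rewrite cD !lf_brv !brE (hz i) !mulr0 mul0r !addr0.
have k0 : k != 0 by apply: contraNneq t1 => k0; rewrite E k0 scale0r.
move: t3; rewrite E lfZ cE lf_brv => /eqP; apply/negP.
by rewrite !mulf_neq0 ?char0 // brC23 oppr_eq0.
Qed.

Lemma off_exceptionalP p : off_exceptional z phi p <-> exists2 x, off x & p = Pt (tau x x x).
Proof.
split=> [[/del_pezzoP[//|[i [w [fw pE]]]] ne]|[x ox ->]].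
  by case: (ne i); apply/exceptionalP; exists w.
split; first by apply/del_pezzoP; left; exists x.
by move=> i /exceptionalP[w fw]; exact: off_exc_neq.
Qed.

(** The products of a fixed conic through Z with the coordinates recover x from tau x x x up to a
    factor. *)
Lemma tau_inj x x' : off x -> off x' -> Pt (tau x x x) = Pt (tau x' x' x') -> Pt x = Pt x'.
Proof.
move=> ox ox'; have t1 := tau_off_neq0 infK char0 t_gt0 t_le4 tauP gpz ox.
have t2 := tau_off_neq0 infK char0 t_gt0 t_le4 tauP gpz ox'.
move=> /(Pt_eqP t1 t2)[k E].
have [k1 [k2 [h1 h2 hz]]] := off_conic infK t_gt0 t_le4 gpz ox'.
have E' : (lf k1 x' * lf k2 x') *: x' = (k * (lf k1 x * lf k2 x)) *: x.
  apply: lf_inj => l.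
  have [|c [cE _ _]] := three_lines char0 tauP (k1 := k1) (k2 := k2) (k3 := l).
    by move=> j; rewrite hz mul0r.
  by have := congr1 (lf c) E; rewrite lfZ !cE !lfZ mulrA.
apply/esym; exact: proportional_Pt (mulf_neq0 h1 h2) (off_neq0 t_gt0 ox') (off_neq0 t_gt0 ox) E'.
Qed.

Lemma blows_downP x q : off x -> blows_down z phi (Pt (tau x x x)) q <-> q = Pt x.
Proof.
move=> ox; split=> [|->].
  have [[i ->]|[x' ox' ->]] := plane_point q.
    by move=> /exceptionalP[w fw] /(off_exc_neq ox fw).
  move=> /(blowup_off infK char0 t_gt0 t_le4 tauP gpz phiE _ ox') E.
  by apply/esym/tau_inj.
exact/(blowup_off infK char0 t_gt0 t_le4 tauP gpz phiE _ ox).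
Qed.

(** Equations need be checked on tau x x x only: the exceptional points are limits along the curve y
    obtained by cancelling s in the image of z_i + s w. *)
Lemma form_on_X d (F : 'rV[K]_N.+1 -> K) q : form d F -> (forall x, F (tau x x x) = 0) ->
  X q -> F (pvec q) = 0.
Proof.
move=> fF F0 /del_pezzoP[[x ox ->]|[i [w [fw ->]]]].
  apply/eqP; rewrite (form_Pt fF) ?F0 //.
  exact: (tau_off_neq0 infK char0 t_gt0 t_le4 tauP gpz ox).
have sA := subalg_polyfun K; set a := pvec (z i).
pose y (s : K) := 3%:R *: tau a a w + (3%:R * s) *: tau a w w + s ^+ 2 *: tau w w w.
have xy s : tau (a + s *: w) (a + s *: w) (a + s *: w) = s *: y s.
  have aaa : tau a a a = 0 by exact: (tau_z tauP i).
  rewrite -[X in X + _]scale1r (tau_comb2 tauP) aaa scaler0 add0r /y.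
  by apply: lf_inj => c; rewrite !(lfD, lfZ); kring K.
have ry : regular polyfun y by rewrite /y; regular_tac sA.
have y0 : y 0 = 3%:R *: tau a a w by rewrite /y mulr0 expr0n /= !scale0r !addr0.
have t0 : tau a a w != 0 by exact: (tau_exc_neq0 infK char0 t_gt0 t_le4 tauP gpz fw).
have n3 : 3%:R != 0 :> K by exact: char0.
apply/eqP; rewrite -(PtZ n3 t0) -y0 (form_Pt fF); last by rewrite y0 scaler_eq0 negb_or n3.
apply/eqP; apply: (polyfun_eq0 infK (h := fun s => F (y s)) _ _ 0).
  exact: (form_subalg sA fF).
apply: genericW (generic_neq 0) _ => s s0.
have := F0 (a + s *: w); rewrite xy (form_scaling _ _ fF) => /eqP.
by rewrite mulf_eq0 expf_eq0 (negbTE s0) andbF => /eqP.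
Qed.

(** The curves tau (x + s a) have velocity 3 tau x x a, which gives one inclusion. For the other, a
    rational inverse [pi] of the map yields equations of X that kill any tangent vector on which
    [pi] is zero, so the tangent space injects into K^3. *)
Lemma tangent_off x : off x -> \dim (tangent X (Pt (tau x x x))) = 3%N /\
  forall v : 'rV[K]_N.+1, v \in tangent X (Pt (tau x x x)) <-> exists a, v = tau x x a.
Proof.
move=> ox; have t0 := tau_off_neq0 infK char0 t_gt0 t_le4 tauP gpz ox.
have [k1 [k2 [h1 h2 hz]]] := off_conic infK t_gt0 t_le4 gpz ox.
have sA := subalg_polyfun K; have n3 : 3%:R != 0 :> K by exact: char0.
have /choice[C CP] i : exists c, (forall x, lf c (tau x x x) = lf k1 x * lf k2 x * x 0 i) /\
    forall x w, 3%:R * lf c (tau x x w) = lf k1 w * lf k2 x * x 0 i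
      + lf k1 x * lf k2 w * x 0 i + lf k1 x * lf k2 x * w 0 i.
  have [|c [cE cD _]] := three_lines char0 tauP (k1 := k1) (k2 := k2) (k3 := delta_mx i 0).
    by move=> j; rewrite hz mul0r.
  by exists c; split=> [x'|x' w']; [rewrite cE|rewrite cD]; rewrite !lf_coord.
have lower a : tau x x a \in tangent X (Pt (tau x x x)).
  suff : 3%:R *: tau x x a \in tangent X (Pt (tau x x x)).
    by move/(memvZ (3%:R)^-1); rewrite scalerA mulVf // scale1r.
  apply: (tangent_curve infK (y := tau x x x)
    (r := fun s => 3%:R *: tau x a a + s *: tau a a a)) => //.
    by regular_tac sA.
  have gen : generic (fun s => off (x + s *: a)).
    apply: generic_off => [|i]; first by regular_tac sA.
    by exists 0; rewrite scale0r addr0.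
  apply: genericW gen _ => s os /=.
  rewrite (_ : _ + _ = tau (x + s *: a) (x + s *: a) (x + s *: a)); last first.
    rewrite -[X in tau (X + _)]scale1r -[X in tau _ (X + _)]scale1r
      -[X in tau _ _ (X + _)]scale1r (tau_comb2 tauP).
    by apply: lf_inj => c; rewrite !(lfD, lfZ); kring K.
  split; first exact: (tau_off_neq0 infK char0 t_gt0 t_le4 tauP gpz os).
  by apply/del_pezzoP; left; exists (x + s *: a).
have inj a : tau x x a = 0 -> a = 0.
  move=> ta; have E : (lf k1 x * lf k2 x) *: a = (- (lf k1 a * lf k2 x + lf k1 x * lf k2 a)) *: x.
    apply/rowP => i; rewrite !mxE.
    have := proj2 (CP i) x a; rewrite ta lf0 mulr0 -mulrDl => /esym/eqP.
    by rewrite addrC addr_eq0 mulNr => /eqP.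
  have h0 := mulf_neq0 h1 h2.
  have aE : a = ((lf k1 x * lf k2 x)^-1 * - (lf k1 a * lf k2 x + lf k1 x * lf k2 a)) *: x.
    by rewrite -scalerA -E scalerA mulVf // scale1r.
  move: ta; rewrite aE !(tauE tauP) => /eqP; rewrite scaler_eq0 (negbTE t0) orbF => /eqP ->.
  by rewrite scale0r.
(* The inverse of the cubic map: pi (tau x x x) = k1(x) k2(x) x. *)
pose pi (y : 'rV[K]_N.+1) : V := \row_i lf (C i) y.
have upper (v : 'rV[K]_N.+1) : v \in tangent X (Pt (tau x x x)) -> lf (C e0) v = 0 -> lf (C e1) v = 0 ->
    lf (C e2) v = 0 -> v = 0.
  move=> vT v0 v1 v2; apply/rowP => k; rewrite mxE.
  have piv : pi v = 0 by apply: row3P; rewrite /co !mxE.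
  (* On X the vector y is tau (pi y) divided by k1(pi y) k2(pi y), because (k1 k2)(x)^3 appears on
     both sides. In a direction v with pi v = 0 only the factor y_k changes, so F is affine in s. *)
  pose F y : K := co y k * (lf k1 (pi y) * lf k2 (pi y)) - co (tau (pi y) (pi y) (pi y)) k.
  have fpi i : form 1 (fun y => pi y 0 i).
    by apply: form_ext (form_lf (C i)) _ => y; rewrite mxE.
  have fF : form 3 F.
    apply: form_sub; last exact: (form_comp (form_tau phiE k) fpi).
    apply: form_mul (form_coord K k) _.
    by apply: (@form_mul _ _ 1 1); exact: (form_comp (form_lf _) fpi).
  have piE x' : pi (tau x' x' x') = (lf k1 x' * lf k2 x') *: x'.
    by apply/rowP => i; rewrite !mxE (proj1 (CP i)).
  have pip : exists2 k', k' != 0 & pi (pvec (Pt (tau x x x))) = k' *: x.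
    have [k' k0 ->] := pvec_Pt t0; exists (k' * (lf k1 x * lf k2 x)).
      by rewrite !mulf_neq0.
    by apply/rowP => i; rewrite !mxE lfZ (proj1 (CP i)) !mulrA.
  have [k' k0 pE] := pip.
  have := tangent_form infK (p := Pt (tau x x x)) (v := v) (a := F (pvec (Pt (tau x x x))))
    (b := co v k * (lf k1 (k' *: x) * lf k2 (k' *: x))) fF _ vT _.
  rewrite !lfZ => H; have /eqP : co v k * (k' * lf k1 x * (k' * lf k2 x)) = 0.
    apply: H => [q|s].
      apply: (form_on_X fF) => x'; rewrite /F piE (tau_diagZ tauP) !lfZ !coE; kring K.
    rewrite /F (_ : pi (_ + _) = k' *: x); last first.
      by rewrite -pE; apply/rowP => i; rewrite !mxE lfD lfZ; have /rowP/(_ i) := piv;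
        rewrite !mxE => ->; rewrite mulr0 addr0.
    rewrite pE !lfZ !coE; kring K.
  by rewrite mulf_eq0 => /orP[/eqP//|/negPn]; rewrite !mulf_neq0.
pose d (i : 'I_3) : V := delta_mx 0 i.
have [|dim3 mem] := vspace_dim3 (lower (d e0)) (lower (d e1)) (lower (d e2)) _ upper.
  move=> a b c E; have : tau x x (a *: d e0 + b *: d e1 + c *: d e2) = 0 by rewrite !(tauE tauP).
  move/inj => /rowP D; have := (D e0, D e1, D e2); rewrite !mxE /=.
  by rewrite !(mulr0, mulr1, addr0, add0r) => -[[-> ->] ->].
split=> // v; split=> [/mem[a [b [c ->]]]|[a ->]]; last exact: lower.
by exists (a *: d e0 + b *: d e1 + c *: d e2); rewrite !(tauE tauP).
Qed.

End DelPezzoTangent.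

(** * Tangent spaces at exceptional points *)

Section ExceptionalTangent.
Variable K : fieldType.
Hypothesis infK : forall s : seq K, exists x, x \notin s.
Hypothesis char0 : forall n, n.+1%:R != 0 :> K.
Variables (t N : nat) (z : 'I_t -> projsp K 2) (phi : N.+1.-tuple (dhomog 3 K 3)).
Variable tau : 'rV[K]_3 -> 'rV[K]_3 -> 'rV[K]_3 -> 'rV[K]_N.+1.
Hypotheses (t_gt0 : (0 < t)%N) (t_le4 : (t <= 4)%N).
Local Notation zv := (fun i => pvec (z i)).
Hypotheses (tauP : cubic_map zv tau) (gpz : gp zv)
  (phiE : forall x : 'rV[K]_3, \row_j meval (x 0) (tnth phi j) = tau x x x).
Local Notation V := 'rV[K]_3.
Implicit Types (u v w x : V) (y : 'rV[K]_N.+1).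
Add Ring K_ring : (kring_theory K).

Local Notation off := (off z).
Local Notation frame := (frame z).
Local Notation X := (del_pezzo z phi).

(* A frame at z i whose second axis is not the tangent direction w. *)
Lemma frame_dir i w : free2 (pvec (z i)) w -> exists u v d,
  frame (pvec (z i)) u v d /\ br (pvec (z i)) v w != 0.
Proof.
move=> fw; set a := pvec (z i).
have [b [c [d [[g4 cov] _]]]] := frame_at infK t_gt0 t_le4 gpz i (fun l (lL : l \in [::]) => False_ind _ (notF lL)).
have [abc abd acd bcd] := g4; have [hb|hb] := eqVneq (br a b w) 0; last first.
  exists c, b, d; split=> //; split.
    by split; [rewrite brC23 oppr_eq0|exact: acd|exact: abd|rewrite brC12 oppr_eq0].
  by move=> j; case: (cov j); [apply: Or41|apply: Or43|apply: Or42|apply: Or44].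
exists b, c, d; split=> //; apply/eqP => hc.
by have [_ w0] := free2_neq0 fw; exact: (two_lines abc hb hc w0 fw).
Qed.

(** The directions w + s b inside E_i give tau a a b, and the strict transform of the line z_i + s w
    gives tau a w w. The upper bound uses three cubics A, B, C through Z whose ratios are local
    coordinates of the blow-up near the given point. *)
Lemma tangent_exc i w : free2 (pvec (z i)) w ->
  let a := pvec (z i) in let T := tangent X (Pt (tau a a w)) in
  \dim T = 3%N /\ forall v : 'rV[K]_N.+1, v \in T <-> exists b k, v = tau a a b + k *: tau a w w.
Proof.
move=> fw a T; have t0 : tau a a w != 0 by exact: (tau_exc_neq0 infK char0 t_gt0 t_le4 tauP gpz fw).
have sA := subalg_polyfun K; have n3 : 3%:R != 0 :> K by exact: char0.
have n30 : (3%:R)^-1 != 0 :> K by rewrite invr_eq0.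
have aaa : tau a a a = 0 by exact: (tau_z tauP i).
have lower1 b : tau a a b \in T.
  apply: (tangent_curve infK (y := tau a a w) (r := fun=> 0)) => //; first by regular_tac sA.
  have gen : generic (fun s => free2 a (w + s *: b)).
    by apply: (generic_free2 (s0 := 0)); [regular_tac sA|rewrite scale0r addr0].
  apply: genericW gen _ => s fs /=; rewrite scaler0 addr0 -(tauZ3 tauP) -(tauD3 tauP).
  split; first exact: (tau_exc_neq0 infK char0 t_gt0 t_le4 tauP gpz fs).
  by apply/(del_pezzoP infK char0 t_gt0 t_le4 tauP gpz phiE); right; exists i, (w + s *: b).
have lower2 : tau a w w \in T.
  suff : 3%:R *: tau a w w \in T.
    by move/(memvZ (3%:R)^-1); rewrite scalerA mulVf // scale1r.
  apply: (tangent_curve infK (y := 3%:R *: tau a a w) (r := fun=> tau w w w)).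
  - by regular_tac sA.
  - by rewrite scaler_eq0 negb_or n3.
  - by rewrite PtZ.
  apply: genericW (genericI (generic_off_line gpz fw) (generic_neq 0)) _ => s [os s0] /=.
  set x := pvec (z i) + s *: w in os; set y := (X in X != 0).
  have xy : tau x x x = s *: y.
    rewrite /x -/a -[X in tau (X + _)]scale1r -[X in tau _ (X + _)]scale1r
      -[X in tau _ _ (X + _)]scale1r (tau_comb2 tauP) aaa scaler0 add0r /y.
    by apply: lf_inj => c; rewrite !(lfD, lfZ); kring K.
  have t1 := tau_off_neq0 infK char0 t_gt0 t_le4 tauP gpz os.
  have y0 : y != 0 by apply: contraNneq t1 => y0; rewrite xy y0 scaler0.
  split=> //; apply/(del_pezzoP infK char0 t_gt0 t_le4 tauP gpz phiE); left; exists x => //.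
  by rewrite xy PtZ.
have [u [v [d [[g4 cov] vw]]]] := frame_dir fw; rewrite -/a in g4 cov vw.
have [D0 aud avd uvd] := g4.
pose D := br a u v; pose m x := br u d x.
pose l1 x := br x u v; pose l2 x := br a x v; pose l3 x := br a u x.
have lz x : [/\ lf (brv u v) x = l1 x, lf (brv v a) x = l2 x, lf (brv a u) x = l3 x & lf (brv u d) x = m x].
  by rewrite !lf_brv; split=> //; [rewrite /l1 br_rot|rewrite /l2 -br_rot].
(* In the basis a, u, v with coordinates l1, l2, l3 up to the factor D, and with m the line ud, the
   cubics are A = l1 l2 m, B = l2^2 m and C = l1 l3 m. Thus B/A = l2/l1 and C/A = l3/l2 are the two
   coordinates of the blow-up. *)
have [|cA [cAE cAD _]] := three_lines char0 tauP (k1 := brv u v) (k2 := brv v a) (k3 := brv u d).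
  by move=> j; case: (cov j) => ->; rewrite !lf_brv ?brE ?(mul0r, mulr0).
have [|cB [cBE cBD _]] := three_lines char0 tauP (k1 := brv v a) (k2 := brv v a) (k3 := brv u d).
  by move=> j; case: (cov j) => ->; rewrite !lf_brv ?brE ?(mul0r, mulr0).
have [|cC [cCE cCD _]] := three_lines char0 tauP (k1 := brv u v) (k2 := brv a u) (k3 := brv u d).
  by move=> j; case: (cov j) => ->; rewrite !lf_brv ?brE ?(mul0r, mulr0).
have AE x : lf cA (tau x x x) = l1 x * l2 x * m x.
  by rewrite cAE; case: (lz x) => -> -> _ ->.
have BE x : lf cB (tau x x x) = l2 x * l2 x * m x.
  by rewrite cBE; case: (lz x) => _ -> _ ->.
have CE x : lf cC (tau x x x) = l1 x * l3 x * m x.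
  by rewrite cCE; case: (lz x) => -> _ -> ->.
have la2 : l2 a = 0 by rewrite /l2 brE.
have la1 : l1 a = D by [].
have ma : m a != 0 by rewrite /m br_rot.
have l2w : l2 w != 0 by rewrite /l2 brC23 oppr_eq0.
have Aw : 3%:R * lf cA (tau a a w) = D * l2 w * m a.
  rewrite cAD; case: (lz a) => -> -> _ ->; case: (lz w) => -> -> _ ->.
  by rewrite la1 la2; kring K.
have Bw : lf cB (tau a a w) = 0.
  apply: (mulfI n3); rewrite cBD mulr0; case: (lz a) => _ -> _ ->; case: (lz w) => _ -> _ ->.
  by rewrite la2; kring K.
have Bww : 3%:R * lf cB (tau a w w) = l2 w * l2 w * m a.
  rewrite -(tauC12 tauP) -(tauC23 tauP) cBD.
  case: (lz a) => _ -> _ ->; case: (lz w) => _ -> _ ->; rewrite la2; kring K.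
have Aw0 : lf cA (tau a a w) != 0.
  have : D * l2 w * m a != 0 by rewrite !mulf_neq0.
  by rewrite -Aw mulf_eq0 negb_or => /andP[].
have upper (y : 'rV[K]_N.+1) : y \in T -> lf cA y = 0 -> lf cB y = 0 -> lf cC y = 0 -> y = 0.
  move=> yT yA yB yC; apply/rowP => k; rewrite mxE.
  pose ga (al be ga : K) := al ^+ 2 * (al ^+ 2 * m a + be * ga * m v).
  pose Ph (al be ga : K) :=
    al ^+ 4 * (3%:R * (al * co (tau a a u) k + ga * co (tau a a v) k))
    + al ^+ 2 * be * (3%:R * (al ^+ 2 * co (tau a u u) k + 2%:R * al * ga * co (tau a u v) k
        + ga ^+ 2 * co (tau a v v) k))
    + be ^+ 2 * (al ^+ 3 * co (tau u u u) k + 3%:R * al ^+ 2 * ga * co (tau u u v) k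
        + 3%:R * al * ga ^+ 2 * co (tau u v v) k + ga ^+ 3 * co (tau v v v) k).
  (* The expansion of D^3 tau x x x, rewritten through A, B, C and cleared of denominators. It uses
     D m = l1 m(a) + l3 m(v), whence A^2 m(a) + B C m(v) = D l1 l2^2 m^3. *)
  pose F y := D ^+ 2 * (co y k * ga (lf cA y) (lf cB y) (lf cC y)) - Ph (lf cA y) (lf cB y) (lf cC y).
  have fA := form_lf cA; have fB := form_lf cB; have fC := form_lf cC.
  have fF : form 5 F.
    have fy : form 1 (fun y : 'rV[K]_N.+1 => co y k) by exact: form_coord.
    have fga : form 4 (fun y => ga (lf cA y) (lf cB y) (lf cC y)).
      apply: (@form_mul _ _ 2 2); first exact: (form_exp 2 fA).
      apply: form_add.
        by apply: form_ext (form_scale (m a) (form_exp 2 fA)) _ => y'; rewrite mulrC.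
      by apply: form_ext (form_scale (m v) (form_mul fB fC)) _ => y'; rewrite mulrC.
    have sc d' (h : 'rV[K]_N.+1 -> K) e : form d' h -> form d' (fun y => h y * e).
      by move=> fh; apply: form_ext (form_scale e fh) _ => y'; rewrite mulrC.
    have sc3 d' (h : 'rV[K]_N.+1 -> K) : form d' h -> form d' (fun y => 3%:R * h y).
      exact: form_scale.
    apply: form_sub.
      by apply: form_scale; exact: (form_mul fy fga).
    apply: form_add; first apply: form_add.
    - apply: (@form_mul _ _ 4 1); first exact: (form_exp 4 fA).
      by apply: form_scale; apply: form_add; apply: sc.
    - apply: (@form_mul _ _ 3 2).
        exact: (form_mul (form_exp 2 fA) fB).
      apply: form_scale; apply: form_add; [apply: form_add|]; apply: sc.
      + exact: (form_exp 2 fA).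
      + exact: (form_mul (form_scale 2%:R fA) fC).
      + exact: (form_exp 2 fC).
    - apply: (@form_mul _ _ 2 3); first exact: (form_exp 2 fB).
      apply: form_add; [apply: form_add; [apply: form_add|]|]; apply: sc.
      + exact: (form_exp 3 fA).
      + exact: (form_mul (form_scale 3%:R (form_exp 2 fA)) fC).
      + exact: (form_mul (form_scale 3%:R fA) (form_exp 2 fC)).
      + exact: (form_exp 3 fC).
  have FX q : X q -> F (pvec q) = 0.
    apply: (form_on_X infK char0 t_gt0 t_le4 tauP gpz phiE fF) => x.
    rewrite /F /Ph /ga AE BE CE.
    have Dm : l1 x * m a + l3 x * m v = D * m x.
      rewrite -(brZ3 (br a u v)) (cramer a u v x) !brE -/(l1 x) -/(l3 x).
      by rewrite mulr0 addr0.
    have Dt := congr1 (fun x => co (tau x x x) k) (cramer a u v x).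
    rewrite (tau_diagZ tauP) (tau_comb3 tauP) aaa !coE in Dt.
    move: Dt; rewrite -/(l1 x) -/(l2 x) -/(l3 x) -/D => Dt.
    transitivity (l1 x ^+ 2 * l2 x ^+ 2 * m x ^+ 2 * (l1 x * l2 x ^+ 2 * m x ^+ 2)
      * (D ^+ 2 * co (tau x x x) k * (l1 x * m a + l3 x * m v) - m x *
        (l1 x ^+ 3 * co (0 : 'rV[K]_N.+1) k + l2 x ^+ 3 * co (tau u u u) k
         + l3 x ^+ 3 * co (tau v v v) k + 3%:R * l1 x ^+ 2 * l2 x * co (tau a a u) k
         + 3%:R * l1 x ^+ 2 * l3 x * co (tau a a v) k
         + 3%:R * l1 x * l2 x ^+ 2 * co (tau a u u) k
         + 3%:R * l2 x ^+ 2 * l3 x * co (tau u u v) k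
         + 3%:R * l1 x * l3 x ^+ 2 * co (tau a v v) k
         + 3%:R * l2 x * l3 x ^+ 2 * co (tau u v v) k
         + 6%:R * l1 x * l2 x * l3 x * co (tau a u v) k))).
      by rewrite co0; kring K.
    by rewrite co0 Dm -Dt; kring K.
  have [k' k0 pE] := pvec_Pt t0.
  (* A, B, C vanish on y, so along the line in the direction y only the factor y_k varies and F is
     affine in s. Its slope is y_k times a nonzero constant. *)
  have := tangent_form infK (a := F (pvec (Pt (tau a a w))))
    (b := D ^+ 2 * (co y k * ga (k' * lf cA (tau a a w)) 0 (k' * lf cC (tau a a w)))) fF FX yT _.
  move=> H; have /eqP : D ^+ 2 * (co y k * ga (k' * lf cA (tau a a w)) 0 (k' * lf cC (tau a a w))) = 0.
    apply: H => s; rewrite /F pE !lfD !lfZ yA yB yC Bw !mulr0 !addr0 !coE; kring K.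
  have ng : D ^+ 2 * ga (k' * lf cA (tau a a w)) 0 (k' * lf cC (tau a a w)) != 0.
    by rewrite /ga !mul0r addr0 !(mulf_neq0, expf_neq0).
  by rewrite mulrCA mulf_eq0 (negbTE ng) orbF => /eqP.
have [u' hu'] : exists u', br a w u' != 0 by [].
have [|dim3 mem] := vspace_dim3 (lower1 u') (lower1 w) lower2 _ upper.
  move=> x1 x2 x3 E.
  have [k1 [k2 [h1 h2 hz]]] := exc_conic infK t_gt0 t_le4 gpz i.
  have [|c [_ cD _]] := three_lines char0 tauP (k1 := k1) (k2 := k2) (k3 := brv a w).
    move=> j; have [->|ji] := eqVneq j i; last by rewrite hz // mul0r.
    by rewrite lf_brv brE mulr0.
  have c1 : 3%:R * lf c (tau a a u') = lf k1 a * lf k2 a * br a w u'.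
    by rewrite cD !lf_brv !brE; kring K.
  have c2 : lf c (tau a a w) = 0.
    by apply: (mulfI n3); rewrite cD !lf_brv !brE; kring K.
  have c3 : lf c (tau a w w) = 0.
    by apply: (mulfI n3); rewrite -(tauC12 tauP) -(tauC23 tauP) cD !lf_brv !brE; kring K.
  have x10 : x1 = 0.
    have : x1 * (lf k1 a * lf k2 a * br a w u') = 0.
      have := congr1 (fun y => 3%:R * lf c y) E; rewrite !lfD !lfZ c2 c3 lf0 -c1 !mulr0 !addr0.
      by rewrite mulrCA.
    by move/eqP; rewrite mulf_eq0 => /orP[/eqP//|]; rewrite !mulf_eq0 (negbTE h1) (negbTE h2) (negbTE hu').
  have x30 : x3 = 0.
    have : x3 * (l2 w * l2 w * m a) = 0.
      have := congr1 (fun y => 3%:R * lf cB y) E; rewrite x10 scale0r add0r !lfD !lfZ Bw lf0 -Bww !mulr0 add0r.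
      by rewrite mulrCA.
    by move/eqP; rewrite mulf_eq0 => /orP[/eqP//|]; rewrite !mulf_eq0 (negbTE l2w) (negbTE ma).
  split=> //; move/eqP: E; rewrite x10 x30 !scale0r add0r addr0 scaler_eq0 (negbTE t0) orbF.
  by move/eqP.
split=> // y; split=> [/mem[b [b' [c ->]]]|[b [k ->]]].
  by exists (b *: u' + b' *: w), c; rewrite !(tauE tauP).
by rewrite memvD // memvZ.
Qed.

End ExceptionalTangent.

(** * Smoothness of X and degenerate pairs *)

Section DelPezzoDimension.
Variable K : fieldType.
Hypothesis infK : forall s : seq K, exists x, x \notin s.
Hypothesis char0 : forall n, n.+1%:R != 0 :> K.
Variables (t N : nat) (z : 'I_t -> projsp K 2) (phi : N.+1.-tuple (dhomog 3 K 3)).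
Variable tau : 'rV[K]_3 -> 'rV[K]_3 -> 'rV[K]_3 -> 'rV[K]_N.+1.
Hypotheses (t_gt0 : (0 < t)%N) (t_le4 : (t <= 4)%N).
Local Notation zv := (fun i => pvec (z i)).
Hypotheses (tauP : cubic_map zv tau) (gpz : gp zv)
  (phiE : forall x : 'rV[K]_3, \row_j meval (x 0) (tnth phi j) = tau x x x).
Local Notation V := 'rV[K]_3.
Implicit Types (u v w x : V) (y : 'rV[K]_N.+1).
Add Ring K_ring : (kring_theory K).

Local Notation off := (off z).
Local Notation X := (del_pezzo z phi).

(** A line pq that misses Z: coordinates adapted to it make the parametrizations below avoid Z under
    one polynomial condition. *)
Lemma transversal_points : exists q p, forall i, br (pvec (z i)) p q != 0.
Proof.
have /choice[r hr] i : exists r, free2 (pvec (z i)) r by exact: free2_ex (pvec_neq0 _).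
have [|q hq] := @avoid_lines K infK [seq (pvec (z i), r i) | i : 'I_t].
  by move=> l /codomP[i ->]; exact: hr.
have fq i : free2 (pvec (z i)) q.
  have hi : br (pvec (z i)) (r i) q != 0.
    by apply: (hq (pvec (z i), r i)); apply/codomP; exists i.
  by have [_] := br_neq0_free hi.
have [|p hp] := @avoid_lines K infK [seq (pvec (z i), q) | i : 'I_t].
  by move=> l /codomP[i ->]; exact: fq.
exists q, p => i; rewrite brC23 oppr_eq0.
by apply: (hp (pvec (z i), q)); apply/codomP; exists i.
Qed.

Lemma del_pezzo_sub_closed (C : set (projsp K N)) p (P : V -> Prop) : closed C ->
  (forall x, generic (fun s => off (x + s *: p) /\ P (x + s *: p))) ->
  (forall x, off x -> P x -> C (Pt (tau x x x))) -> X `<=` C.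
Proof.
move=> cC gP CP q Xq; apply: contrapT => /(closed_formP cC)[d [F [fF /eqP Fq FC]]].
apply: Fq; apply: (form_on_X infK char0 t_gt0 t_le4 tauP gpz phiE fF _ Xq) => x.
have sA := subalg_polyfun K.
have := polyfun_eq0 infK (h := fun s => F (tau (x + s *: p) (x + s *: p) (x + s *: p))).
move=> /(_ _ _ 0); rewrite scale0r addr0; apply.
  apply: (form_subalg sA fF); apply: (regular_tau tauP sA); regular_tac sA.
apply: genericW (gP x) _ => s [os Ps]; apply/eqP; rewrite -(form_Pt fF).
  by apply/eqP/FC/CP.
exact: (tau_off_neq0 infK char0 t_gt0 t_le4 tauP gpz os).
Qed.

(** An affine chart of the plane parametrizes a dense part of X. The lower bound comes from a point,
    the image of a line and X; a cubic containing that line, but not a chosen further point, makes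
    the last step strict. *)
Lemma del_pezzo_dim : has_dim X 2.
Proof.
have [q [p hpq]] := transversal_points.
have p0 : p != 0.
  by apply: contraNneq (hpq (Ordinal t_gt0)) => ->; rewrite -(scale0r 0) brZ2 mul0r.
have [f1 [f2 hB]] := free2_ex p0.
pose x (a b : K) : V := p + a *: f1 + b *: f2.
(* Nonzero exactly when x a b lies on no line z_i q, which keeps it outside Z. *)
pose h (a b : K) := \prod_i br (pvec (z i)) (x a b) q.
have off_h a b : h a b != 0 -> off (x a b).
  move=> hab i; exists q; apply: contraNneq hab => hi.
  by rewrite /h (bigD1 i) //= hi mul0r.
have h00 : h 0 0 != 0 by apply/prodf_neq0 => i _; rewrite /x !scale0r !addr0.
have nz a b : h a b != 0 -> tau (x a b) (x a b) (x a b) != 0.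
  by move=> /off_h; exact: (tau_off_neq0 infK char0 t_gt0 t_le4 tauP gpz).
pose G a b := tau (x a b) (x a b) (x a b).
have rx (Y : Type) (A : set (Y -> K)) f g : subalg A -> A f -> A g ->
    regular A (fun s => x (f s) (g s)) by move=> sA Af Ag; rewrite /x; regular_tac sA.
have rG (Y : Type) (A : set (Y -> K)) f g : subalg A -> A f -> A g ->
    regular A (fun s => G (f s) (g s)).
  by move=> sA Af Ag; apply: (regular_tau tauP sA); exact: rx.
have rh (Y : Type) (A : set (Y -> K)) f g : subalg A -> A f -> A g ->
    A (fun s => h (f s) (g s)).
  move=> sA Af Ag; apply: (subalg_prod sA) => i _; have := rx _ _ _ _ sA Af Ag.
  by move=> ?; regular_tac sA.
pose h2 (s : 'I_2 -> K) := h (s 0) (s 1).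
pose G2 (s : 'I_2 -> K) := G (s 0) (s 1).
pose J2 := param_image h2 (proj_param G2).
have sA2 := subalg_mpolyfun K 2; have sA1 := subalg_mpolyfun K 1.
have pG2 : regular mpolyfun G2 by apply: rG => //; exact: mpolyfun_var.
have ph2 : mpolyfun h2 by apply: rh => //; exact: mpolyfun_var.
have nz2 s : h2 s != 0 -> G2 s != 0 by exact: nz.
have J2X : J2 `<=` X.
  move=> _ [s hs ->]; apply/(del_pezzoP infK char0 t_gt0 t_le4 tauP gpz phiE); left.
  by exists (x (s 0) (s 1)) => //; exact: off_h.
have XJ2 : X `<=` closure J2.
  pose l v := br v f1 f2 / br p f1 f2.
  apply: (@del_pezzo_sub_closed _ p (fun v => l v != 0 /\ forall i, br (pvec (z i)) v q != 0)).
  - exact: closed_closure.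
  - move=> v; have sA := subalg_polyfun K.
    have g1 : generic (fun s => l (v + s *: p) != 0).
      have [l0|l0] := eqVneq (l v) 0.
        apply: (generic_neq0 (s0 := 1)); first by rewrite /l; regular_tac sA.
        by rewrite /l scale1r brD1 mulrDl -/(l v) l0 add0r divff // oner_neq0.
      apply: (generic_neq0 (s0 := 0)); first by rewrite /l; regular_tac sA.
      by rewrite scale0r addr0.
    have g2 : generic (fun s => forall i, br (pvec (z i)) (v + s *: p) q != 0).
      apply: generic_all => i; have [b0|b0] := eqVneq (br (pvec (z i)) v q) 0.
        apply: (generic_neq0 (s0 := 1)); first by regular_tac sA.
        by rewrite scale1r brD2 b0 add0r hpq.
      apply: (generic_neq0 (s0 := 0)); first by regular_tac sA.
      by rewrite scale0r addr0.
    apply: genericW (genericI g1 g2) _ => s [lv bv]; split=> // i.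
    by exists q; exact: bv.
  move=> v ov [lv bv]; apply: subset_closure.
  pose a := (l v)^-1 * (br p v f2 / br p f1 f2); pose b := (l v)^-1 * (br p f1 v / br p f1 f2).
  have vE : v = l v *: x a b.
    rewrite /x !scalerDr !scalerA /a /b !mulrA divff // !mul1r.
    apply: (scalerI hB); rewrite cramer /l !scalerDr !scalerA.
    by rewrite ![br p f1 f2 * (_ / _)]mulrC !divfK.
  have hab : h a b != 0.
    apply/prodf_neq0 => i _; have := bv i; rewrite vE brZ2 mulf_eq0 negb_or.
    by case/andP.
  exists (fun i : 'I_2 => if i == 0 then a else b); first exact: hab.
  rewrite /proj_param /G2 /G /= vE (tau_diagZ tauP) PtZ ?expf_neq0 //; first exact: nz.
apply: has_dimI; first exact: (@proj_param_chain_le K N 2 h2 G2 pG2 nz2).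
have [a1 [ha1 a10]] : exists a, h a 0 != 0 /\ a != 0.
  apply: (generic_ex infK); apply: genericI (generic_neq 0).
  apply: (generic_neq0 (h := h^~ 0) (s0 := 0) _ h00); apply: (rh _ _ id (fun=> 0) (subalg_polyfun K)).
    exact: polyfun_var.
  exact: (subalg_cst (subalg_polyfun K)).
have [b1 [hb1 b10]] : exists b, h 0 b != 0 /\ b != 0.
  apply: (generic_ex infK); apply: genericI (generic_neq 0).
  apply: (generic_neq0 (h := h 0) (s0 := 0) _ h00); apply: (rh _ _ (fun=> 0) id (subalg_polyfun K)).
    exact: (subalg_cst (subalg_polyfun K)).
  exact: polyfun_var.
pose h1 (s : 'I_1 -> K) := h (s 0) 0; pose G1 (s : 'I_1 -> K) := G (s 0) 0.
pose J1 := param_image h1 (proj_param G1).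
have [k1 [k2 [n1 n2 hz]]] := off_conic infK t_gt0 t_le4 gpz (off_h _ _ hb1).
have [|c [cE _ _]] := three_lines char0 tauP (k1 := k1) (k2 := k2) (k3 := brv p f1).
  by move=> j; rewrite hz mul0r.
exists (fun i => X `&` closure (nth set0 [:: [set Pt (G 0 0)]; J1; J2] i)).
have J1J2 : J1 `<=` J2.
  by move=> _ [s hs ->]; exists (fun i : 'I_2 => if i == 0 then s 0 else 0).
apply: irr_chain_closure => -[|[|[|//]]] _ //=.
- split; first exact: irreducible_set1.
  by move=> _ ->; apply: J2X; exists (fun=> 0).
- split; last exact: subset_trans J1J2 J2X.
  apply: (@proj_param_irreducible K N infK 1 h1 G1 _ _ _ (fun=> 0)) => //.
  + by apply: rh => //; [exact: mpolyfun_var|exact: (subalg_cst sA1)].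
  + by apply: rG => //; [exact: mpolyfun_var|exact: (subalg_cst sA1)].
  + by move=> s; exact: nz.
- split=> //.
  by apply: (@proj_param_irreducible K N infK 2 h2 G2 _ _ _ (fun=> 0)).
- split; first by move=> _ ->; exists (fun=> 0).
  exists [set Pt (G 0 0)]; split=> //; first exact: closed_point.
  move=> /(_ (Pt (G a1 0))) sub; have /sub/esym : J1 (Pt (G a1 0)) by exists (fun=> a1).
  move=> /(tau_inj infK char0 t_gt0 t_le4 tauP gpz (off_h _ _ h00) (off_h _ _ ha1)).
  have x0 := off_neq0 t_gt0 (off_h _ _ h00); have x1 := off_neq0 t_gt0 (off_h _ _ ha1).
  move=> /(Pt_eqP x0 x1)[k /(congr1 (fun v => br p v f2))].
  rewrite /x !scale0r !addr0 !brE mulr0 add0r => /eqP.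
  by rewrite mulf_eq0 (negbTE a10) (negbTE hB).
- split=> //; exists [set r | lf c (pvec r) = 0]; split.
  + exact: closed_form (form_lf c).
  + move=> _ [s hs ->] /=; apply/eqP; rewrite (form_Pt (form_lf c)); last exact: nz.
    by rewrite /G1 /G cE lf_brv /x scale0r addr0 !brE mulr0 addr0 mulr0.
  move=> /(_ (Pt (G 0 b1))) sub; have /sub/= /eqP : J2 (Pt (G 0 b1)).
    by exists (fun i : 'I_2 => if i == 0 then 0 else b1).
  rewrite (form_Pt (form_lf c)); last exact: nz.
  rewrite /G cE lf_brv; apply/negP; rewrite !mulf_neq0 //.
  by rewrite /x scale0r addr0 !brE add0r mulf_neq0.
Qed.

Lemma tangent_dim p : X p -> \dim (tangent X p) = 3%N.
Proof.
move=> /(del_pezzoP infK char0 t_gt0 t_le4 tauP gpz phiE)[[x ox ->]|[i [w [fw ->]]]].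
  exact: (proj1 (tangent_off infK char0 t_gt0 t_le4 tauP gpz phiE ox)).
exact: (proj1 (tangent_exc infK char0 t_gt0 t_le4 tauP gpz phiE fw)).
Qed.

Lemma smooth_del_pezzo : smooth_locus X = X.
Proof.
apply/seteqP; split=> [p []//|p Xp]; split=> //.
by rewrite tangent_dim //; exact: del_pezzo_dim.
Qed.

Definition degenerate (A : uset K N 2) := forall x y : 'rV[K]_N.+1, spans A x y ->
  exists v : 'rV[K]_N.+1, [/\ v != 0, v \in tangent X (Pt x) & v \in tangent X (Pt y)].

Lemma span_tangents A (x y : 'rV[K]_N.+1) : usets_in 2 X A -> spans A x y ->
  (exists v : 'rV[K]_N.+1, [/\ v != 0, v \in tangent X (Pt x) & v \in tangent X (Pt y)]) <->
  (\dim (\sum_(p <- val A) tangent X p)%VS < 6)%N.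
Proof.
move=> XA sA; have [Xx Xy] := proj1 (usets_inP X sA) XA.
have -> : (\sum_(p <- val A) tangent X p)%VS = (tangent X (Pt x) + tangent X (Pt y))%VS.
  have xy : Pt x \notin [fset Pt y]%fset by apply/fset1P; exact: (spans_neq sA).
  by have [_ _ ->] := sA; rewrite big_fsetU1 //= big_seq_fset1.
have E := dimv_sum_cap (tangent X (Pt x)) (tangent X (Pt y)).
rewrite !tangent_dim // in E.
set S := (_ + _)%VS in E *; set I := (_ :&: _)%VS in E *.
split=> [[v [v0 vx vy]]|lt6].
  have : (0 < \dim I)%N.
    rewrite lt0n dimv_eq0; apply: contraNneq v0 => I0.
    by rewrite -memv0 -I0 memv_cap vx.
  by move: (\dim S) (\dim I) E => m n; lia.
exists (vpick I); rewrite vpick0 -dimv_eq0.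
have : vpick I \in I by exact: memv_pick.
rewrite memv_cap => /andP[-> ->]; split=> //; rewrite -lt0n.
by move: (\dim S) (\dim I) E lt6 => m n; lia.
Qed.

(** Both tangent spaces have vector dimension 3, so their sum has dimension below 6 exactly when
    they intersect. Every point of X is smooth. *)
Lemma terraciniE : terracini 2 X =
  usets_in 2 X `&` closure [set A | usets_in 2 X A /\ degenerate A].
Proof.
rewrite /terracini smooth_del_pezzo; congr (_ `&` closure _).
apply/seteqP; split=> A [XA].
  move=> [d dX]; rewrite (has_dim_uniq dX del_pezzo_dim) => lt; split=> // x y sA.
  by apply/(span_tangents XA sA); move: lt; lia.
move=> dA; split=> //; exists 2%N; first exact: del_pezzo_dim.
have [x [y sA]] := spansP A; have /(span_tangents XA sA) := dA _ _ sA.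
by lia.
Qed.

Lemma degenerateP A (x y : 'rV[K]_N.+1) : spans A x y ->
  (exists v : 'rV[K]_N.+1, [/\ v != 0, v \in tangent X (Pt x) & v \in tangent X (Pt y)]) -> degenerate A.
Proof.
move=> sA [v [v0 vx vy]] x' y' sA'; exists v.
have := spans_points sA' (points_of_mpt sA); rewrite /mpt /pairv /=.
by case=> -[<- <-].
Qed.

End DelPezzoDimension.

(** * Pairs whose tangent spaces do not meet *)

Section Nondegenerate.
Variable K : fieldType.
Hypothesis infK : forall s : seq K, exists x, x \notin s.
Hypothesis char0 : forall n, n.+1%:R != 0 :> K.
Variables (t N : nat) (z : 'I_t -> projsp K 2) (phi : N.+1.-tuple (dhomog 3 K 3)).
Variable tau : 'rV[K]_3 -> 'rV[K]_3 -> 'rV[K]_3 -> 'rV[K]_N.+1.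
Hypotheses (t_gt0 : (0 < t)%N) (t_le4 : (t <= 4)%N).
Local Notation zv := (fun i => pvec (z i)).
Hypotheses (tauP : cubic_map zv tau) (gpz : gp zv)
  (phiE : forall x : 'rV[K]_3, \row_j meval (x 0) (tnth phi j) = tau x x x).
Local Notation V := 'rV[K]_3.
Implicit Types (u v w x : V) (y : 'rV[K]_N.+1).
Add Ring K_ring : (kring_theory K).

Local Notation off := (off z).
Local Notation frame := (frame z).
Local Notation X := (del_pezzo z phi).
Implicit Types (q : 'cV[K]_3 * 'cV[K]_3) (s : 'cV[K]_3 * 'cV[K]_3 -> K).

(** A conic is given as a pair of lines q; [qv] is its value and [qd] its derivative at x in the
    direction w. *)
Definition qv q x := lf q.1 x * lf q.2 x.
Definition qd q x w := lf q.1 w * lf q.2 x + lf q.1 x * lf q.2 w.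
Definition conic q := forall i, qv q (pvec (z i)) = 0.
(** Independence of two functionals on the conics through Z, tested on line pairs. A point x
    contributes the value at x; an exceptional point contributes the derivative at z_i in its
    direction. *)
Definition separates s s' :=
  exists q q', [/\ conic q, conic q' & s q * s' q' != s q' * s' q].

Lemma separates_eq0 s s' a b : separates s s' ->
  (forall q, conic q -> a * s q = b * s' q) -> a = 0 /\ b = 0.
Proof.
move=> [q [q' [cq cq' R]]] h; have R0 : s q * s' q' - s q' * s' q != 0 by rewrite subr_eq0.
have [h1 h2] := (h q cq, h q' cq').
split; apply: (mulIf R0); rewrite mul0r mulrBr !mulrA.
  by rewrite h1 h2; kring K.
by rewrite mulrAC -h2 [_ * s q' * s' q]mulrAC -h1; kring K.
Qed.

Lemma conic_cubic u v q : conic q -> exists c,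
  (forall x a, 3%:R * lf c (tau x x a) = br u v a * qv q x + br u v x * qd q x a).
Proof.
move=> cq; have [|c [_ cp _]] := three_lines char0 tauP (k1 := brv u v) (k2 := q.1) (k3 := q.2).
  by move=> i; rewrite -mulrA; have := cq i; rewrite /qv => ->; rewrite mulr0.
by exists c => x a; rewrite cp !lf_brv /qv /qd; kring K.
Qed.

Lemma three_eq0 c (y y' : 'rV[K]_N.+1) (k k' : K) :
  y = y' -> 3%:R * lf c y = k -> 3%:R * lf c y' = k' -> k = k'.
Proof. by move=> -> <-. Qed.

Lemma frame_lines (a b c d : V) (k1 k2 k3 : 'cV[K]_3) : covered z a b c d ->
  lf k1 a * lf k2 a * lf k3 a = 0 -> lf k1 b * lf k2 b * lf k3 b = 0 ->
  lf k1 c * lf k2 c * lf k3 c = 0 -> lf k1 d * lf k2 d * lf k3 d = 0 ->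
  exists e, forall x w, 3%:R * lf e (tau x x w) = lf k1 w * lf k2 x * lf k3 x
      + lf k1 x * lf k2 w * lf k3 x + lf k1 x * lf k2 x * lf k3 w.
Proof.
move=> cov h1 h2 h3 h4; have := covered_lines cov h1 h2 h3 h4.
by move=> /(three_lines char0 tauP)[e [_ h _]]; exists e.
Qed.

Lemma coveredCr a b c d : covered z a b c d -> covered z a c b d.
Proof.
move=> h i; case: (h i) => ->; [exact: Or41|exact: Or43|exact: Or42|exact: Or44].
Qed.

Lemma coveredCl a b c d : covered z a b c d -> covered z b a c d.
Proof.
move=> h i; case: (h i) => ->; [exact: Or42|exact: Or41|exact: Or43|exact: Or44].
Qed.

Lemma br_all0 a b c x : br a b c != 0 ->
  br a b x = 0 -> br a c x = 0 -> br b c x = 0 -> x = 0.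
Proof.
move=> h ab ac bc; apply: (scalerI h).
by rewrite cramer -br_rot bc brC23 ac ab oppr0 !scale0r scaler0 !addr0.
Qed.

(** The line xy times the conics through Z gives [x,y,a] = [x,y,b] = 0 by separation, so b = k x +
    k' y. For a frame e1, e2, e3, e4, the cubic of the lines e1e2, e3x, e4x is singular at x, and
    its value on tau y y b puts k x + 3 k' y on the line e1e2. The three sides of a triangle of the
    frame have no common point, hence k = k' = 0. *)
Lemma nondeg_off x (y a b : V) : off x -> off y -> free2 x y ->
  (forall i, br x y (pvec (z i)) != 0) -> separates (qv^~ x) (qv^~ y) ->
  tau x x a = tau y y b -> tau y y b = 0.
Proof.
move=> ox oy fxy hz sep E.
have [_ hb] : br x y a = 0 /\ br x y b = 0.
  apply: (separates_eq0 sep) => q /(conic_cubic x y)[c cE].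
  have := three_eq0 E (cE x a) (cE y b); rewrite br_uwu br_ww !mul0r !addr0.
  by [].
have [k [k' bE]] := br0_comb fxy hb.
have [|p2 [p3 [p4 [[[h123 _ _ _] cov] hp]]]] := frame_at infK t_gt0 t_le4 gpz (Ordinal t_gt0) (L := [:: (x, y)]).
  by move=> l; rewrite mem_seq1 => /eqP ->.
have {}hp p : p \in [:: p2; p3; p4] -> br x y p != 0.
  by move=> /hp[/(_ (x, y))|[j _ ->]]; [apply; rewrite mem_head|exact: hz].
have key e1 e2 e3 e4 : covered z e1 e2 e3 e4 -> br x y e3 != 0 -> br x y e4 != 0 ->
    br e1 e2 (k *: x + (3%:R * k') *: y) = 0.
  move=> cov' h3 h4.
  have [||||c cE] := frame_lines (k1 := brv e1 e2) (k2 := brv e3 x) (k3 := brv e4 x) cov';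
    rewrite ?lf_brv ?br_uwu ?br_ww ?mul0r ?mulr0 //; first by rewrite mul0r.
  have := three_eq0 E (cE x a) (cE y b); rewrite !lf_brv !br_ww bE !brE.
  move=> H; apply: (mulIf h3); apply: (mulIf h4); rewrite !mul0r.
  move: H; rewrite !(mulr0, mul0r, addr0) => H.
  by rewrite (br_rot e3 x y) (br_rot e4 x y) [RHS]H; kring K.
have z1 := hz (Ordinal t_gt0).
have [H2 H3 H4] : [/\ br x y p2 != 0, br x y p3 != 0 & br x y p4 != 0].
  by split; apply: hp; rewrite !inE eqxx ?orbT.
have p0 : k *: x + (3%:R * k') *: y = 0.
  apply: (br_all0 h123 (key _ _ _ _ cov H3 H4) (key _ _ _ _ (coveredCr cov) H2 H4)).
  by apply: (key _ _ _ _ (coveredCr (coveredCl cov))).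
have [w hw] := fxy.
have k0 : k = 0.
  apply: (mulIf hw); have := congr1 (fun v => br v y w) p0.
  by rewrite !brE mulr0 addr0 mul0r => ->; rewrite -(scale0r 0) brZ1 mul0r.
have k'0 : k' = 0.
  apply: (mulIf hw); apply: (mulfI (char0 2)); have := congr1 (fun v => br x v w) p0.
  rewrite !brE mulr0 add0r mulrA => ->; by rewrite -(scale0r 0) brZ2 !mul0r mulr0.
by rewrite bE k0 k'0 !(tauE tauP) !scale0r addr0.
Qed.

Lemma tau_zz_eq0 i a : ~ free2 (pvec (z i)) a -> tau (pvec (z i)) (pvec (z i)) a = 0.
Proof.
move=> na; have [//|[c ->]] := nfreeP a (pvec_neq0 (z i)).
by rewrite (tauE tauP) (tau_z tauP) scaler0.
Qed.

(** The line z_i y times the conics through Z gives k = 0 by separation. Then the cubics made of a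
    frame line through z_i and two lines through y, singular at y, put a on two lines through z_i;
    so a is a multiple of z_i and tau z_i z_i a = 0. *)
Lemma nondeg_exc i w (y a : V) k (b : V) : let zi := pvec (z i) in off y -> br zi w y != 0 ->
  (forall j, j != i -> br zi y (pvec (z j)) != 0) ->
  separates (fun q => qd q zi w) (qv^~ y) ->
  tau zi zi a + k *: tau zi w w = tau y y b -> tau y y b = 0.
Proof.
move=> zi oy hw hz sep E.
have [k0 _] : k * br zi y w = 0 /\ br zi y b = 0.
  apply: (separates_eq0 sep) => q cq; have [c cE] := conic_cubic zi y cq.
  have H1 : 3%:R * lf c (tau zi zi a + k *: tau zi w w) = k * br zi y w * qd q zi w.
    rewrite lfD lfZ mulrDr cE [qv _ _]cq mulrCA -(tauC12 tauP) -(tauC23 tauP) cE.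
    by rewrite br_uwu /qd; kring K.
  have := three_eq0 E H1 (cE y b); rewrite br_ww mul0r addr0.
  by [].
have {}k0 : k = 0.
  by move/eqP: k0; rewrite mulf_eq0 brC23 oppr_eq0 (negbTE hw) orbF => /eqP.
move: E; rewrite k0 scale0r addr0 => E; rewrite -E.
have [|p2 [p3 [p4 [[[h123 _ _ _] cov] hp]]]] := frame_at infK t_gt0 t_le4 gpz i (L := [:: (zi, y)]).
  by move=> l; rewrite mem_seq1 => /eqP -> /=; have [_ fzy _] := br_neq0_free hw.
have {}hp p : p \in [:: p2; p3; p4] -> br zi y p != 0.
  by move=> /hp[/(_ (zi, y))|[j ji ->]]; [apply; rewrite mem_head|exact: hz].
have key e2 e3 e4 : covered z zi e2 e3 e4 -> br zi y e3 != 0 -> br zi y e4 != 0 ->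
    br zi e2 a = 0.
  move=> cov' h3 h4.
  have [||||c cE] := frame_lines (k1 := brv zi e2) (k2 := brv e3 y) (k3 := brv e4 y) cov';
    rewrite ?lf_brv ?br_uwu ?br_ww ?mul0r ?mulr0 //; first by rewrite mul0r.
  have := three_eq0 E (cE zi a) (cE y b); rewrite !lf_brv !br_ww !br_uwu.
  have nz e : br zi y e != 0 -> br e y zi != 0 by move=> he; rewrite br_rot brC23 oppr_eq0.
  rewrite !(mulr0, mul0r, addr0) => /eqP; rewrite !mulf_eq0.
  by rewrite (negbTE (nz _ h3)) (negbTE (nz _ h4)) !orbF => /eqP.
have [H2 H3 H4] : [/\ br zi y p2 != 0, br zi y p3 != 0 & br zi y p4 != 0].
  by split; apply: hp; rewrite !inE eqxx ?orbT.
have [->|a0] := eqVneq a 0; first by rewrite -(scale0r 0) (tauE tauP) scale0r.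
apply: tau_zz_eq0; apply: two_lines h123 _ _ a0; first exact: key cov H3 H4.
exact: key (coveredCr cov) H2 H4.
Qed.

Lemma frame_pair i j : i != j -> exists c d, frame (pvec (z i)) (pvec (z j)) c d.
Proof.
move=> ij; have [|b [c [d [[g4 cov] _]]]] := frame_at infK t_gt0 t_le4 gpz i (L := [::]).
  by [].
have [zw hz] := gp_free2 gpz ij.
have [abc abd acd bcd] := g4.
case: (cov j) => jE; rewrite jE.
- by move: hz; rewrite jE br_uu eqxx.
- by exists c, d.
- exists b, d; split; last exact: coveredCr.
  by split=> //; [rewrite brC23 oppr_eq0|rewrite brC12 oppr_eq0].
- exists b, c; split.
    by split=> //; [rewrite brC23 oppr_eq0|rewrite brC23 oppr_eq0|rewrite -br_rot].
  by move=> m; case: (cov m) => ->; [exact: Or41|exact: Or43|exact: Or44|exact: Or42].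
Qed.

(** The line z_i z_j times the conics through Z gives k = k' = 0. The cubics made of any line z_i u
    and two frame lines through z_j are singular at z_j, which leaves no room for a independent of
    z_i. *)
Lemma nondeg_exc2 i j w w' (a b : V) k k' : let zi := pvec (z i) in let zj := pvec (z j) in
  i != j -> br zi zj w != 0 -> br zi zj w' != 0 ->
  separates (fun q => qd q zi w) (fun q => qd q zj w') ->
  tau zi zi a + k *: tau zi w w = tau zj zj b + k' *: tau zj w' w' ->
  tau zi zi a + k *: tau zi w w = 0.
Proof.
move=> zi zj ij hw hw' sep E.
have [k0 k'0] : k * br zi zj w = 0 /\ k' * br zi zj w' = 0.
  apply: (separates_eq0 sep) => q cq; have [c cE] := conic_cubic zi zj cq.
  have H1 : 3%:R * lf c (tau zi zi a + k *: tau zi w w) = k * br zi zj w * qd q zi w.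
    rewrite lfD lfZ mulrDr cE [qv _ _]cq mulrCA -(tauC12 tauP) -(tauC23 tauP) cE.
    by rewrite br_uwu /qd; kring K.
  have H2 : 3%:R * lf c (tau zj zj b + k' *: tau zj w' w') = k' * br zi zj w' * qd q zj w'.
    rewrite lfD lfZ mulrDr cE [qv _ _]cq mulrCA -(tauC12 tauP) -(tauC23 tauP) cE.
    by rewrite br_ww /qd; kring K.
  exact: three_eq0 E H1 H2.
move/eqP: k0; rewrite mulf_eq0 (negbTE hw) orbF => /eqP k0.
move/eqP: k'0; rewrite mulf_eq0 (negbTE hw') orbF => /eqP k'0.
move: E; rewrite k0 k'0 !scale0r !addr0 => E.
have [c [d [[ijc ijd _ _] cov]]] := frame_pair ij.
apply: tau_zz_eq0 => -[u]; rewrite brC23 oppr_eq0 => /eqP; apply.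
have [||||e eE] := frame_lines (k1 := brv zi u) (k2 := brv zj c) (k3 := brv zj d) cov;
    rewrite ?lf_brv ?br_uwu ?br_ww ?mul0r ?mulr0 //; first by rewrite mul0r.
have := three_eq0 E (eE zi a) (eE zj b); rewrite !lf_brv !br_uwu (br_rot zi zj c) (br_rot zi zj d).
rewrite !(mulr0, mul0r, addr0) => /eqP; rewrite !mulf_eq0 (negbTE ijc) (negbTE ijd) !orbF.
by move/eqP.
Qed.

End Nondegenerate.
Arguments qv {K}.
Arguments qd {K}.

(** * Pencils of conics through four general points *)

Section QuadraticForms.
Variable K : fieldType.
Hypothesis char0 : forall n, n.+1%:R != 0 :> K.
Local Notation V := 'rV[K]_3.
Implicit Types (a b c d u v w x y : V) (F Q : V -> K) (P : V -> V -> K).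
Add Ring K_ring : (kring_theory K).

Definition quadratic Q P := [/\ forall k u u' v, P (k *: u + u') v = k * P u v + P u' v,
  forall u v, P v u = P u v & forall x, P x x = 2%:R * Q x].

Lemma quadratic_comb Q P Q' P' k k' : quadratic Q P -> quadratic Q' P' ->
  quadratic (fun x => k * Q x + k' * Q' x) (fun x y => k * P x y + k' * P' x y).
Proof.
move=> [l s D] [l' s' D']; split=> [r u u' v|u v|x].
- by rewrite l l'; kring K.
- by rewrite s s'.
- by rewrite D D'; kring K.
Qed.

Lemma quadratic_prod (k1 k2 : 'cV[K]_3) : quadratic (fun x => lf k1 x * lf k2 x)
  (fun x w => lf k1 w * lf k2 x + lf k1 x * lf k2 w).
Proof. by split=> *; rewrite ?lfD ?lfZ; kring K. Qed.

Lemma form2_quadratic F : form 2 F -> exists P, quadratic F P.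
Proof.
move=> [g [f wf gE] FE].
suff [Q [P [qP QE]]] : exists Q P, quadratic Q P /\ forall x, Q x =
    \sum_(m <- msupp f) mcoeff m f * \prod_i x 0 i ^+ m i.
  by exists P; case: qP => l s D; split=> // x; rewrite FE gE mevalE -QE.
have : forall m, m \in msupp f -> (\sum_(i < 3) m i)%N = 2%N.
  by move=> m /wf/(_ tt) wm; apply: etrans wm; apply: eq_bigl.
elim: (msupp f) => [_|m s IH hs].
  exists (fun=> 0), (fun _ _ => 0); split=> [|x]; last by rewrite big_nil.
  by split=> *; rewrite ?mulr0 ?addr0.
have [m' ms|Q [P [qP QE]]] := IH; first by apply: hs; rewrite inE ms orbT.
have m2 := hs m (mem_head _ _).
have [i [m1 [/(mono_split K)[j [m4 [m40 jE]]] iE]]] := mono_split K m2.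
have := quadratic_comb (mcoeff m f) 1 (quadratic_prod (delta_mx i 0) (delta_mx j 0)) qP.
set Q' := (fun x => _ + _); set P' := (fun x y => _ + _) => qP'.
exists Q', P'; split=> // x.
rewrite big_cons /Q' QE mul1r !lf_coord; congr (_ * _ + _).
rewrite iE jE big1 ?mulr1 ?mulrA // => l _.
by move/eqP: m40; rewrite sum_nat_eq0 => /forallP/(_ l)/eqP->; rewrite expr0.
Qed.

Section Quadratic.
Variables (Q : V -> K) (P : V -> V -> K).
Hypothesis qP : quadratic Q P.

Lemma quadC u v : P v u = P u v. Proof. by case: qP. Qed.

Lemma quadD u u' v : P (u + u') v = P u v + P u' v.
Proof. by case: qP => l _ _; rewrite -[u]scale1r l mul1r scale1r. Qed.

Lemma quadZ k u v : P (k *: u) v = k * P u v.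
Proof.
have P0 : P 0 v = 0.
  by have := quadD 0 0 v; rewrite addr0 => /(congr1 (fun z => z - P 0 v)); rewrite addrK subrr.
by case: qP => l _ _; rewrite -[k *: u]addr0 l P0 addr0.
Qed.

Lemma quadDr u v v' : P u (v + v') = P u v + P u v'.
Proof. by rewrite -quadC quadD ![P _ u]quadC. Qed.

Lemma quadZr k u v : P u (k *: v) = k * P u v.
Proof. by rewrite -quadC quadZ quadC. Qed.

Lemma quad_diag x : P x x = 2%:R * Q x. Proof. by case: qP. Qed.

Lemma quad3 (k l m : K) u v w : Q (k *: u + l *: v + m *: w) =
  k ^+ 2 * Q u + l ^+ 2 * Q v + m ^+ 2 * Q w + k * l * P u v + k * m * P u w + l * m * P v w.
Proof.
apply: (mulfI (char0 1)); rewrite -quad_diag !(quadD, quadDr, quadZ, quadZr).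
rewrite (quadC u v) (quadC u w) (quadC v w) !quad_diag; kring K.
Qed.

Lemma quad2 (k l : K) u v : Q (k *: u + l *: v) = k ^+ 2 * Q u + l ^+ 2 * Q v + k * l * P u v.
Proof. by have := quad3 k l 0 u v 0; rewrite scale0r addr0 => ->; kring K. Qed.

Variables a b c d : V.
Hypotheses (g4 : gen4 a b c d) (Qa : Q a = 0) (Qb : Q b = 0) (Qc : Q c = 0) (Qd : Q d = 0).

(** A conic through a, b, c is determined by P a b, P a c, P b c. Passing through d is one linear
    relation among these with nonzero coefficients, so when two of them vanish all three do. *)
Lemma pencil_polar : P a b = 0 /\ P a c = 0 \/ P a b = 0 /\ P b c = 0 \/ P a c = 0 /\ P b c = 0 ->
  forall x, Q x = 0.
Proof.
have [abc abd acd bcd] := g4.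
have E k l m : Q (k *: a + l *: b + m *: c) = k * l * P a b + k * m * P a c + l * m * P b c.
  by rewrite quad3 Qa Qb Qc; kring K.
have [k [l [m dE]]] := cramer_coord d abc.
have k0 : k != 0.
  by apply: contraNneq bcd => k0; rewrite dE k0 !brE !mulr0 !mul0r !addr0.
have l0 : l != 0.
  by apply: contraNneq acd => l0; rewrite dE l0 !brE !mulr0 !mul0r !addr0.
have m0 : m != 0.
  by apply: contraNneq abd => m0; rewrite dE m0 !brE !mulr0 !mul0r !addr0.
move=> h x; suff [h1 h2 h3] : [/\ P a b = 0, P a c = 0 & P b c = 0].
  by have [k' [l' [m' ->]]] := cramer_coord x abc; rewrite E h1 h2 h3 !mulr0 !addr0.
have := Qd; rewrite dE E.
case: h => [[h1 h2]|[[h1 h2]|[h1 h2]]]; rewrite h1 h2 !mulr0 ?addr0 ?add0r => /eqP;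
  rewrite !mulf_eq0 ?(negbTE k0) ?(negbTE l0) ?(negbTE m0) /= => /eqP ->; split=> //.
Qed.

(** A member of the pencil is smooth at the base point a: if its polar at a vanished on w and y, it
    would vanish on the basis a, w, y and [pencil_polar] would apply. *)
Lemma pencil_smooth w y : (exists x, Q x != 0) -> P a w = 0 -> br a w y != 0 -> P a y != 0.
Proof.
move=> [x xQ] aw h; apply: contraNneq xQ => ay.
have aP u : P a u = 0.
  have [k [l [m ->]]] := cramer_coord u h.
  by rewrite !quadDr !quadZr quad_diag Qa aw ay !mulr0 !addr0.
by apply/eqP/pencil_polar; left.
Qed.

(** If e among a, b, c is off the line xy, the polar of e vanishes on the basis x, y, e, hence
    identically, and [pencil_polar] gives Q = 0. Not all three lie on that line. This guarantees
    below a base point and one of two given points for which the polar is nonzero. *)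
Lemma pencil_two_nodes x y : (exists u, Q u != 0) -> free2 x y ->
  (forall e, e \in [:: a; b; c] -> P e x = 0 /\ P e y = 0) -> False.
Proof.
move=> [u uQ] fxy h; have [abc _ _ _] := g4; apply: (negP uQ); apply/eqP.
have key e v : e \in [:: a; b; c] -> Q e = 0 -> br x y e != 0 -> P e v = 0.
  move=> ein Qe hbr; have [k [l [m ->]]] := cramer_coord v hbr; have [ex ey] := h e ein.
  by rewrite !quadDr !quadZr quad_diag Qe ex ey !mulr0 !addr0.
have [ha|ha] := eqVneq (br x y a) 0; last first.
  by apply: pencil_polar; left; split; apply: key ha => //; rewrite mem_head.
have [hb|hb] := eqVneq (br x y b) 0; last first.
  have hP v : P b v = 0 by apply: key hb => //; rewrite !inE eqxx orbT.
  by apply: pencil_polar; right; left; split; rewrite // -quadC.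
have [hc|hc] := eqVneq (br x y c) 0; last first.
  have hP v : P c v = 0 by apply: key hc => //; rewrite !inE eqxx !orbT.
  by apply: pencil_polar; right; right; split; rewrite -quadC.
have [w hw] := fxy; case/negP: hw; apply/eqP.
have [k [l [m ->]]] := cramer_coord w abc.
by rewrite !brE ha hb hc !mulr0 !addr0.
Qed.

End Quadratic.

(** The line pairs ab, cd and ac, bd generate the pencil of conics through the four points; [polar1]
    and [polar2] are their polar forms. *)
Definition pencil1 a b c d x := br a b x * br c d x.
Definition pencil2 a b c d x := br a c x * br b d x.
Definition polar1 a b c d x w := br a b w * br c d x + br a b x * br c d w.
Definition polar2 a b c d x w := br a c w * br b d x + br a c x * br b d w.

Lemma quadratic_br a b c d : quadratic (fun x => br a b x * br c d x)
  (fun x w => br a b w * br c d x + br a b x * br c d w).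
Proof.
by have := quadratic_prod (brv a b) (brv c d); case=> l s D; split=> *;
  rewrite -?lf_brv ?l ?D // s.
Qed.

Lemma pencil_quadratic a b c d k l : quadratic
  (fun x => k * pencil1 a b c d x + l * pencil2 a b c d x)
  (fun x y => k * polar1 a b c d x y + l * polar2 a b c d x y).
Proof. exact: quadratic_comb (quadratic_br _ _ _ _) (quadratic_br _ _ _ _). Qed.

Lemma pencil_base0 a b c d k l x : [\/ x = a, x = b, x = c | x = d] ->
  k * pencil1 a b c d x + l * pencil2 a b c d x = 0.
Proof.
by case=> ->; rewrite /pencil1 /pencil2 ?br_uwu ?br_ww !(mul0r, mulr0) addr0.
Qed.

Section Pencil.
Variables a b c d : V.
Hypothesis g4 : gen4 a b c d.

Lemma pencil_corners : [/\ polar1 a b c d a b = 0, polar2 a b c d a c = 0,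
  polar1 a b c d a c != 0 & polar2 a b c d a b != 0].
Proof.
have [abc abd acd bcd] := g4.
have abc' : br a c b != 0 by rewrite brC23 oppr_eq0.
have acd' : br c d a != 0 by rewrite br_rot.
have abd' : br b d a != 0 by rewrite br_rot.
rewrite /polar1 /polar2 !br_ww !br_uwu !(mul0r, mulr0) !addr0.
by split=> //; exact: mulf_neq0.
Qed.

Lemma pencil_neq0 k l : (k != 0) || (l != 0) ->
  exists x, k * pencil1 a b c d x + l * pencil2 a b c d x != 0.
Proof.
move=> kl; apply: contrapT => h.
have Q0 x : k * pencil1 a b c d x + l * pencil2 a b c d x = 0.
  by apply: contrapT => /eqP hx; apply: h; exists x.
have qP := pencil_quadratic a b c d k l.
have P0 u v : k * polar1 a b c d u v + l * polar2 a b c d u v = 0.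
  have := quad2 qP 1 1 u v; rewrite !Q0 !mulr0 !add0r !mul1r.
  by move=> <-.
have [E1 E2 n1 n2] := pencil_corners.
case/orP: kl => /negP; apply; apply/eqP.
  by have := P0 a c; rewrite E2 mulr0 addr0 => /eqP; rewrite mulf_eq0 (negbTE n1) orbF => /eqP.
by have := P0 a b; rewrite E1 mulr0 add0r => /eqP; rewrite mulf_eq0 (negbTE n2) orbF => /eqP.
Qed.

(** The coefficients are chosen to match P a c and P a b; the difference is then zero by
    [pencil_polar]. *)
Lemma pencil_comb Q P : quadratic Q P -> Q a = 0 -> Q b = 0 -> Q c = 0 -> Q d = 0 ->
  exists k l, forall x, Q x = k * pencil1 a b c d x + l * pencil2 a b c d x.
Proof.
move=> qP Qa Qb Qc Qd; have [E1 E2 n1 n2] := pencil_corners.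
pose k := P a c / polar1 a b c d a c; pose l := P a b / polar2 a b c d a b.
exists k, l => x; have qP' := quadratic_comb 1 (-1) qP (pencil_quadratic a b c d k l).
apply/eqP; rewrite -subr_eq0; apply/eqP.
have B y : [\/ y = a, y = b, y = c | y = d] -> Q y = 0 ->
    1 * Q y + -1 * (k * pencil1 a b c d y + l * pencil2 a b c d y) = 0.
  by move=> hy ->; rewrite pencil_base0 // !mulr0 addr0.
have := pencil_polar qP' g4 (B a (Or41 _ _ _ erefl) Qa) (B b (Or42 _ _ _ erefl) Qb)
  (B c (Or43 _ _ _ erefl) Qc) (B d (Or44 _ _ _ erefl) Qd).
rewrite E1 E2 !mulr0 addr0 add0r /k /l !divfK // => /(_ _ x) <-.
  by rewrite mul1r mulN1r.
by left; rewrite !mul1r !mulN1r !subrr.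
Qed.

End Pencil.
End QuadraticForms.

(** * At most three points: conics separate *)

Section Degenerate.
Variable K : fieldType.
Hypothesis infK : forall s : seq K, exists x, x \notin s.
Hypothesis char0 : forall n, n.+1%:R != 0 :> K.
Variables (t N : nat) (z : 'I_t -> projsp K 2) (phi : N.+1.-tuple (dhomog 3 K 3)).
Variable tau : 'rV[K]_3 -> 'rV[K]_3 -> 'rV[K]_3 -> 'rV[K]_N.+1.
Hypotheses (t_gt0 : (0 < t)%N) (t_le4 : (t <= 4)%N).
Local Notation zv := (fun i => pvec (z i)).
Hypotheses (tauP : cubic_map zv tau) (gpz : gp zv)
  (phiE : forall x : 'rV[K]_3, \row_j meval (x 0) (tnth phi j) = tau x x x).
Local Notation V := 'rV[K]_3.
Implicit Types (u v w x : V) (y : 'rV[K]_N.+1).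
Add Ring K_ring : (kring_theory K).

Local Notation off := (off z).
Local Notation frame := (frame z).
Local Notation X := (del_pezzo z phi).
Local Notation conic := (conic z).
Local Notation separates := (separates z).
Local Notation degenerate := (degenerate z phi).

Lemma neq_free2 u v : u != 0 -> v != 0 -> Pt u <> Pt v -> free2 u v.
Proof.
move=> u0 v0 uv; have [//|[c vE]] := nfreeP v u0; case: uv.
by rewrite vE PtZ //; apply: contraNneq v0 => c0; rewrite vE c0 scale0r.
Qed.

Lemma free2_Pt u v : free2 u v -> Pt u <> Pt v.
Proof.
move=> fuv; have [u0 v0] := free2_neq0 fuv.
by move=> /(Pt_eqP u0 v0)[c]; exact: free2_scale fuv.
Qed.

(** For t <= 3 a triangle already contains Z, and the conics through its vertices form a net instead
    of a pencil. *)
Lemma frame3_at i L : (t <= 3)%N -> free_lines L -> exists b c,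
  [/\ br (pvec (z i)) b c != 0,
      forall j, [\/ pvec (z j) = pvec (z i), pvec (z j) = b | pvec (z j) = c] &
      forall p, p \in [:: b; c] -> off_lines L p \/ exists2 j, j != i & p = pvec (z j)].
Proof.
move=> t3 fL; have [e [[_ _ ge] ez Le]] := frame_exists infK t_gt0 t_le4 gpz fL.
pose i' := widen_ord t_le4 i; have ei : e i' = pvec (z i) by exact: ez.
have i3 : (i' < 3)%N by apply: leq_trans t3; exact: (ltn_ord i).
have [j [k [nijk h3]]] : exists j k : 'I_4, [/\ i' != j, i' != k & j != k] /\
    forall m : 'I_4, (m < 3)%N -> [\/ m = i', m = j | m = k].
  pose o0 : 'I_4 := Ordinal (isT : (0 < 4)%N); pose o1 : 'I_4 := Ordinal (isT : (1 < 4)%N).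
  pose o2 : 'I_4 := Ordinal (isT : (2 < 4)%N).
  move: (i') i3 => [[|[|[|m]]] hm] // _; [exists o1, o2|exists o0, o2|exists o0, o1].
  - split=> // -[[|[|[|l]]] hl] // _; [apply: Or31|apply: Or32|apply: Or33]; exact: val_inj.
  - split=> // -[[|[|[|l]]] hl] // _; [apply: Or32|apply: Or31|apply: Or33]; exact: val_inj.
  - split=> // -[[|[|[|l]]] hl] // _; [apply: Or32|apply: Or33|apply: Or31]; exact: val_inj.
have [ij ik jk] := nijk.
exists (e j), (e k); split; first by rewrite -ei; exact: ge.
  move=> m; rewrite -(ez m (widen_ord t_le4 m)) // -ei.
  have m3 : (widen_ord t_le4 m < 3)%N by apply: leq_trans t3; exact: (ltn_ord m).
  by case: (h3 _ m3) => ->; [exact: Or31|exact: Or32|exact: Or33].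
have key m : i' != m -> off_lines L (e m) \/ exists2 j, j != i & e m = pvec (z j).
  move=> im; have [/Le|mt] := leqP t m; first by left.
  right; exists (Ordinal mt); last exact: ez.
  by apply: contraNneq im => mi; apply/eqP/val_inj; rewrite /= -mi.
by move=> p; rewrite !inE => /orP[]/eqP->; apply: key.
Qed.

Lemma conic3 (a b c u v u' v' : V) :
  (forall j, [\/ pvec (z j) = a, pvec (z j) = b | pvec (z j) = c]) ->
  br u v a * br u' v' a = 0 -> br u v b * br u' v' b = 0 -> br u v c * br u' v' c = 0 ->
  conic (brv u v, brv u' v').
Proof. by move=> h ha hb hc j; rewrite /qv !lf_brv; case: (h j) => ->. Qed.

Lemma separatesI s s' q q' : conic q -> conic q' -> s q = 0 -> s' q != 0 -> s q' != 0 ->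
  s' q' = 0 -> separates s s'.
Proof.
move=> cq cq' s0 n1 n2 s'0; exists q, q'; split=> //.
by rewrite s0 s'0 mul0r eq_sym mulf_neq0.
Qed.

(** Some side of the triangle misses x. With the line joining the opposite vertex to v it forms a
    conic through Z that contains v and not x; exchanging x and v gives the other witness. *)
Lemma separates_off x (v : V) : (t <= 3)%N -> off x -> off v -> free2 x v ->
  (forall i, br x v (pvec (z i)) != 0) -> separates (qv^~ x) (qv^~ v).
Proof.
move=> t3 ox ov fxv hz.
have [|b [c [abc cov hp]]] := frame3_at (Ordinal t_gt0) t3 (L := [:: (x, v)]).
  by move=> l; rewrite mem_seq1 => /eqP ->.
set a := pvec _ in abc cov hp; have ha : br x v a != 0 by exact: hz.
have {}hp p : p \in [:: b; c] -> br x v p != 0.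
  by move=> /hp[/(_ (x, v))|[j _ ->]]; [apply; rewrite mem_head|exact: hz].
have [hb hc] : br x v b != 0 /\ br x v c != 0 by split; apply: hp; rewrite !inE eqxx ?orbT.
have key x' v' : (forall p, br x v p != 0 -> br x' v' p != 0) -> x' != 0 ->
    exists q, [/\ conic q, qv q x' != 0 & qv q v' = 0].
  move=> hx x0.
  have nz e : br x v e != 0 -> br e v' x' != 0.
    by move=> /hx; rewrite brC23 oppr_eq0 -br_rot.
  have [h1|h1] := eqVneq (br b c x') 0; last first.
    exists (brv a v', brv b c); split; rewrite /qv ?lf_brv ?br_ww ?mul0r //; last first.
      by rewrite mulf_neq0 // nz.
    by apply: (conic3 cov); rewrite ?br_ww ?br_uwu ?br_uu ?mulr0 ?mul0r.
  have [h2|h2] := eqVneq (br a c x') 0; last first.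
    exists (brv b v', brv a c); split; rewrite /qv ?lf_brv ?br_ww ?mul0r //; last first.
      by rewrite mulf_neq0 // nz.
    by apply: (conic3 cov); rewrite ?br_ww ?br_uwu ?br_uu ?mulr0 ?mul0r.
  have [h3|h3] := eqVneq (br a b x') 0; last first.
    exists (brv c v', brv a b); split; rewrite /qv ?lf_brv ?br_ww ?mul0r //; last first.
      by rewrite mulf_neq0 // nz.
    by apply: (conic3 cov); rewrite ?br_ww ?br_uwu ?br_uu ?mulr0 ?mul0r.
  by move: x0; rewrite (br_all0 abc h3 h2 h1) eqxx.
have [q [cq n1 n2]] := key v x (fun p => ltac:(by rewrite [br v x p]brC12 oppr_eq0)) (off_neq0 t_gt0 ov).
have [q' [cq' n1' n2']] := key x v (fun p h => h) (off_neq0 t_gt0 ox).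
exact: separatesI cq cq' n2 n1 n1' n2'.
Qed.

(** The two sides through z_i form a conic singular at z_i and not containing v. The other witness
    consists of one of these sides, transversal to w, and the line from v to the vertex outside
    it. *)
Lemma separates_exc i w (v : V) : let zi := pvec (z i) in (t <= 3)%N -> br zi w v != 0 ->
  (forall j, j != i -> br zi v (pvec (z j)) != 0) ->
  separates (fun q => qd q zi w) (qv^~ v).
Proof.
move=> a t3 hw hz; have [fw fv _] := br_neq0_free hw.
have [|b [c [abc cov hp]]] := frame3_at i t3 (L := [:: (a, v)]).
  by move=> l; rewrite mem_seq1 => /eqP ->.
have {}hp p : p \in [:: b; c] -> br p v a != 0.
  rewrite br_rot brC23 oppr_eq0.
  by move=> /hp[/(_ (a, v))|[j ji ->]]; [apply; rewrite mem_head|exact: hz].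
have [hb hc] : br b v a != 0 /\ br c v a != 0 by split; apply: hp; rewrite !inE eqxx ?orbT.
have [hb' hc'] : br a b v != 0 /\ br a c v != 0.
  by rewrite -(br_rot a b v) -(br_rot a c v).
have cq : conic (brv a b, brv a c).
  by apply: (conic3 cov); rewrite ?br_ww ?br_uwu ?br_uu ?mulr0 ?mul0r.
have [q [cq' n1 n2]] : exists q, [/\ conic q, qd q a w != 0 & qv q v = 0].
  have [h1|h1] := eqVneq (br a c w) 0; last first.
    exists (brv b v, brv a c); split; rewrite /qv /qd ?lf_brv ?br_uwu ?br_ww ?mul0r //.
      by apply: (conic3 cov); rewrite ?br_ww ?br_uwu ?br_uu ?mulr0 ?mul0r.
    by rewrite mulr0 add0r mulf_neq0.
  have [h2|h2] := eqVneq (br a b w) 0; last first.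
    exists (brv c v, brv a b); split; rewrite /qv /qd ?lf_brv ?br_uwu ?br_ww ?mul0r //.
      by apply: (conic3 cov); rewrite ?br_ww ?br_uwu ?br_uu ?mulr0 ?mul0r.
    by rewrite mulr0 add0r mulf_neq0.
  by case: (two_lines abc h2 h1 _ fw); have [] := free2_neq0 fw.
apply: separatesI cq cq' _ _ n1 n2.
  by rewrite /qd !lf_brv !br_uwu mulr0 mul0r addr0.
by rewrite /qv !lf_brv mulf_neq0.
Qed.

(** Two line pairs of a triangle suffice: the one singular at z_i and the one singular at z_j. *)
Lemma separates_exc2 i j w w' : let zi := pvec (z i) in let zj := pvec (z j) in
  (t <= 3)%N -> i != j -> br zi zj w != 0 -> br zi zj w' != 0 ->
  separates (fun q => qd q zi w) (fun q => qd q zj w').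
Proof.
move=> a b t3 ij hw hw'.
have [c [abc cov]] : exists c, br a b c != 0 /\
    forall m, [\/ pvec (z m) = a, pvec (z m) = b | pvec (z m) = c].
  have [|b' [c [abc cov _]]] := frame3_at i t3 (L := [::]); first by [].
  have fab : free2 a b by exact: (gp_free2 gpz ij).
  case: (cov j) => jE.
  - by case: fab => u; rewrite /b jE br_uu eqxx.
  - by exists c; rewrite /b jE.
  - exists b'; rewrite /b jE brC23 oppr_eq0; split=> // m.
    by case: (cov m) => ->; [exact: Or31|exact: Or33|exact: Or32].
apply: (@separatesI _ _ (brv a b, brv a c) (brv a b, brv b c)).
- by apply: (conic3 cov); rewrite ?br_ww ?br_uwu ?br_uu ?mulr0 ?mul0r.
- by apply: (conic3 cov); rewrite ?br_ww ?br_uwu ?br_uu ?mulr0 ?mul0r.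
- by rewrite /qd !lf_brv !br_uwu mulr0 mul0r addr0.
- by rewrite /qd !lf_brv br_ww mul0r addr0 mulf_neq0 // brC23 oppr_eq0.
- by rewrite /qd !lf_brv br_uwu mul0r addr0 mulf_neq0 // br_rot.
- by rewrite /qd !lf_brv br_ww br_uwu mul0r mulr0 addr0.
Qed.

End Degenerate.

(** * Pairs on lines and conics, and pairs on an exceptional curve, are degenerate *)

Section MpolyZeros.
Variable K : fieldType.
Hypothesis infK : forall s : seq K, exists x, x \notin s.
Hypothesis char0 : forall n, n.+1%:R != 0 :> K.

Lemma polyfun_poly_eq0 (p : {poly K}) : (forall s, p.[s] = 0) -> p = 0.
Proof.
move=> h; apply: contrapT => /eqP /(poly_nonroot infK)[s]; by rewrite h eqxx.
Qed.

Lemma mderiv_eq0 n (f : mpoly n K) i : (forall x, meval x f = 0) ->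
  forall x, meval x (mderiv i f) = 0.
Proof.
move=> h x; pose g j : {poly K} := (x j)%:P + (j == i)%:R *: 'X.
have [G [GE]] := chain_rule g f.
have -> : G = 0 by apply: polyfun_poly_eq0 => s; rewrite GE h.
rewrite deriv0 horner0 (bigD1 i) //= big1 => [|j /negbTE ji].
  rewrite /g eqxx scale1r derivD derivC derivX add0r hornerC mulr1 addr0 => /esym.
  by under meval_eq => j do rewrite hornerD hornerC hornerZ hornerX mulr0 addr0.
by rewrite /g ji scale0r addr0 derivC horner0 mulr0.
Qed.

(** All derivatives of f vanish as functions too, and in characteristic 0 they recover the
    coefficients. It turns a nonzero section counted by [h0_ideal] into a conic with a point outside
    it. *)
Lemma meval_eq0 n (f : mpoly n K) : (forall x, meval x f = 0) -> f = 0.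
Proof.
move=> h; apply/mpolyP => m; rewrite mcoeff0.
have [d] := ubnP (mdeg m); elim: d f h m => // d IH f h m dm.
have [[i mi]|m0] := pselect (exists i, m i != 0%N).
  pose m' := mnm_sub m (mnm1 i).
  have mE : m = mnm_add m' (mnm1 i).
    apply/mnmP => j; rewrite mnmDE mnmBE mnm1E.
    by case: (eqVneq i j) => [<-|_]; rewrite ?subn0 ?addn0 // subnK // lt0n.
  have dm' : (mdeg m' < d)%N by move: dm; rewrite mE mdegD mdeg1 addn1 ltnS.
  have /eqP := IH _ (mderiv_eq0 i h) m' dm'; rewrite mcoeff_deriv -mE -mulr_natr mulf_eq0.
  by rewrite (negbTE (char0 _)) orbF => /eqP.
have -> : m = mnm0.
  by apply/mnmP => j; rewrite mnm0E; apply: contrapT => /eqP mj; apply: m0; exists j.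
have [m0s|/memN_msupp_eq0 //] := boolP (mnm0 \in msupp f).
have := h (fun=> 0); rewrite mevalE (bigD1_seq mnm0 m0s (msupp_uniq f)) /=.
rewrite big1 => [|j _]; last by rewrite mnm0E expr0.
rewrite big1 ?mulr1 ?addr0 // => m' nm'.
have [j mj] : exists j, m' j != 0%N.
  apply: contrapT => nj; case/negP: nm'; apply/eqP/mnmP => j; rewrite mnm0E.
  by apply: contrapT => /eqP mj; apply: nj; exists j.
by rewrite (bigD1 j) //= expr0n (negbTE mj) mul0r mulr0.
Qed.

End MpolyZeros.

Section DegeneratePairs.
Variable K : fieldType.
Hypothesis infK : forall s : seq K, exists x, x \notin s.
Hypothesis char0 : forall n, n.+1%:R != 0 :> K.
Variables (t N : nat) (z : 'I_t -> projsp K 2) (phi : N.+1.-tuple (dhomog 3 K 3)).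
Variable tau : 'rV[K]_3 -> 'rV[K]_3 -> 'rV[K]_3 -> 'rV[K]_N.+1.
Hypotheses (t_gt0 : (0 < t)%N) (t_le4 : (t <= 4)%N).
Local Notation zv := (fun i => pvec (z i)).
Hypotheses (tauP : cubic_map zv tau) (gpz : gp zv)
  (phiE : forall x : 'rV[K]_3, \row_j meval (x 0) (tnth phi j) = tau x x x).
Local Notation V := 'rV[K]_3.
Implicit Types (u v w x : V) (y : 'rV[K]_N.+1).
Add Ring K_ring : (kring_theory K).

Local Notation off := (off z).
Local Notation X := (del_pezzo z phi).
Local Notation degenerate := (degenerate z phi).

Definition on_conic (Q : V -> K) x (x' : V) := [/\ form 2 Q, exists u, Q u != 0,
  forall i, Q (pvec (z i)) = 0, Q x = 0 & Q x' = 0].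

Lemma h0_conic x (x' : V) : x != 0 -> x' != 0 ->
  (0 < h0_ideal 2 (Pt x :: Pt x' :: codom z))%N <-> exists Q, on_conic Q x x'.
Proof.
move=> x0 x'0; rewrite /h0_ideal lt0n dimv_eq0; split=> [|[Q [fQ [u Qu] Qz Qx Qx']]].
  rewrite -vpick0; set f := vpick _ => f0; have /forms_throughP ff : f \in _ := memv_pick _.
  clearbody f; have E p : meval (pvec p 0) f = meval (hcoord p) f by [].
  have fQ := form_dhomog f; exists (fun u => meval (u 0) f); split=> //.
  - apply: contrapT => h; case/negP: f0; apply/eqP/val_inj => /=.
    apply: (meval_eq0 infK char0) => v; apply: contrapT => /eqP fv; apply: h.
    exists (\row_i v i); rewrite (_ : (\row_i v i) 0 = v) //.
    by apply/funext => i; rewrite mxE.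
  - move=> i; have zin : z i \in Pt x :: Pt x' :: codom z.
      rewrite in_cons; apply/orP; right.
      rewrite in_cons; apply/orP; right.
      exact: codom_f.
    by rewrite E; exact: ff zin.
  - have H : (meval (pvec (Pt x) 0) f == 0) = (meval (x 0) f == 0) by exact: form_Pt fQ x0.
    by apply/eqP; rewrite -H E; apply/eqP; exact: (ff (Pt x) (mem_head _ _)).
  - have x'in : Pt x' \in Pt x :: Pt x' :: codom z by rewrite in_cons mem_head orbT.
    have H : (meval (pvec (Pt x') 0) f == 0) = (meval (x' 0) f == 0) by exact: form_Pt fQ x'0.
    by apply/eqP; rewrite -H E; apply/eqP; exact: (ff (Pt x') x'in).
have [f fE] := dhomog_form fQ.
have : f \in forms_through 2 (Pt x :: Pt x' :: codom z).
  apply/forms_throughP => p; have -> : meval (hcoord p) f = Q (pvec p) by rewrite fE.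
  move=> hp; apply/eqP.
  move: hp; rewrite in_cons => /predU1P[->|]; first by rewrite (form_Pt fQ) // Qx.
  rewrite in_cons => /predU1P[->|]; first by rewrite (form_Pt fQ) // Qx'.
  by move=> /codomP[i ->]; apply/eqP/Qz.
apply: contraTneq => ->; rewrite memv0; apply: contraNneq Qu => f0.
by rewrite fE f0 meval0.
Qed.

Lemma spans_off x (x' : V) : off x -> off x' -> free2 x x' ->
  exists A, spans A (tau x x x) (tau x' x' x').
Proof.
move=> ox ox' fx; apply: spans_ex.
- exact: (tau_off_neq0 infK char0 t_gt0 t_le4 tauP gpz ox).
- exact: (tau_off_neq0 infK char0 t_gt0 t_le4 tauP gpz ox').
- by move=> /(tau_inj infK char0 t_gt0 t_le4 tauP gpz ox ox'); exact: free2_Pt.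
Qed.

Lemma spans_free x (x' : V) A : off x -> off x' -> spans A (tau x x x) (tau x' x' x') ->
  free2 x x'.
Proof.
move=> ox ox' sA; have [x0 x'0] := (off_neq0 t_gt0 ox, off_neq0 t_gt0 ox').
apply: neq_free2 => // /(Pt_eqP x0 x'0)[c x'E]; case: (spans_neq sA).
rewrite x'E (tau_diagZ tauP) PtZ ?expf_neq0 //.
  by apply: contraNneq x'0 => c0; rewrite x'E c0 scale0r.
exact: (tau_off_neq0 infK char0 t_gt0 t_le4 tauP gpz ox).
Qed.

Lemma spans_off_points (A : uset K N 2) p1 p2 :
  val A = [fset p1; p2]%fset ->
  off_exceptional z phi p1 /\ off_exceptional z phi p2 ->
  exists x x', [/\ off x, off x', spans A (tau x x x) (tau x' x' x') &
    forall x1 x2 : projsp K 2, blows_down z phi p1 x1 /\ blows_down z phi p2 x2 <-> x1 = Pt x /\ x2 = Pt x'].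
Proof.
move=> AE []; have oP := off_exceptionalP infK char0 t_gt0 t_le4 tauP gpz phiE.
move=> /oP[x ox p1E] /oP[x' ox' p2E]; exists x, x'.
have sA : spans A (tau x x x) (tau x' x' x').
  rewrite p1E p2E in AE; have nz := tau_off_neq0 infK char0 t_gt0 t_le4 tauP gpz.
  exact: (Spans (nz _ ox) (nz _ ox') AE).
split; [exact: ox|exact: ox'|exact: sA|].
have bP := blows_downP infK char0 t_gt0 t_le4 tauP gpz phiE.
by move=> q1 q2; rewrite p1E p2E; split=> -[]; [move=> /(bP _ _ ox)-> /(bP _ _ ox')->
  |move=> -> ->; split; [apply/(bP _ _ ox)|apply/(bP _ _ ox')]].
Qed.

(** The common shape of Y_i and U after passing to representatives in the plane. *)
Definition off_pair (P : V -> V -> Prop) (A : uset K N 2) := exists x x',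
  [/\ off x, off x', spans A (tau x x x) (tau x' x' x') & P x x'].

Lemma off_pairE (P : V -> V -> Prop) (R : projsp K 2 -> projsp K 2 -> Prop) (A : uset K N 2) :
  (forall x x', off x -> off x' -> free2 x x' -> (R (Pt x) (Pt x') <-> P x x')) ->
  (exists p1 p2 (x1 x2 : projsp K 2), [/\ val A = [fset p1; p2]%fset,
     off_exceptional z phi p1 /\ off_exceptional z phi p2,
     blows_down z phi p1 x1 /\ blows_down z phi p2 x2 & R x1 x2]) <-> off_pair P A.
Proof.
move=> RP; split=> [[p1 [p2 [x1 [x2 [AE op bp hR]]]]]|[x [x' [ox ox' sA hP]]]].
  have [x [x' [ox ox' sA bE]]] := spans_off_points AE op.
  exists x, x'; split; [exact: ox|exact: ox'|exact: sA|].
  apply/RP; [exact: ox|exact: ox'|exact: (spans_free ox ox' sA)|].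
  by have [<- <-] := proj1 (bE x1 x2) bp.
have bP := blows_downP infK char0 t_gt0 t_le4 tauP gpz phiE.
have oP := off_exceptionalP infK char0 t_gt0 t_le4 tauP gpz phiE.
exists (Pt (tau x x x)), (Pt (tau x' x' x')), (Pt x), (Pt x'); split.
- by case: sA.
- by split; apply/oP; [exists x|exists x'].
- by split; [apply/(bP _ _ ox)|apply/(bP _ _ ox')].
- apply/RP; [exact: ox|exact: ox'|exact: (spans_free ox ox' sA)|exact: hP].
Qed.

Lemma YsetP i A : Yset z phi i A <-> off_pair (fun x x' => br x x' (pvec (z i)) = 0) A.
Proof.
apply: off_pairE => x x' ox ox' fx.
rewrite !val_Pt ?(off_neq0 t_gt0 ox) ?(off_neq0 t_gt0 ox') // val_pvec -memvE; split.
  move=> /memv_addP[_ /vlineP[a ->] [_ /vlineP[b ->] ->]].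
  by rewrite !brE !mulr0 addr0.
move=> /(br0_comb fx)[a [b ->]].
by apply: memv_add; rewrite memvZ ?memv_line.
Qed.

Lemma UsetP A : Uset z phi A <-> off_pair (fun x x' => exists Q, on_conic Q x x') A.
Proof.
apply: off_pairE => x x' ox ox' fx.
by apply: h0_conic; [exact: (off_neq0 t_gt0 ox)|exact: (off_neq0 t_gt0 ox')].
Qed.

Lemma off_pair_in P A : off_pair P A -> usets_in 2 X A.
Proof.
move=> [x [x' [ox ox' sA _]]]; apply/(usets_inP X sA).
by split; apply/(del_pezzoP infK char0 t_gt0 t_le4 tauP gpz phiE); left; [exists x|exists x'].
Qed.

(** With z_i = a x + b x', the expansion of tau z_i z_i z_i = 0 is a vector tau x x u plus a vector
    tau x' x' u', so up to sign they are one vector in both tangent spaces. Geometrically, a line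
    through z_i becomes a plane conic, two tangent lines of which meet. *)
Lemma Y_degenerate i A : Yset z phi i A -> degenerate A.
Proof.
move=> /YsetP[x [x' [ox ox' sA hbr]]]; apply: (degenerateP sA).
have fx := spans_free ox ox' sA; have [a [b zE]] := br0_comb fx hbr.
have a0 : a != 0.
  apply/negP => /eqP a0; case: (free2_scale (free2C (ox' i)) (a := b)).
  by rewrite zE a0 scale0r add0r.
have b0 : b != 0.
  apply/negP => /eqP b0; case: (free2_scale (free2C (ox i)) (a := a)).
  by rewrite zE b0 scale0r addr0.
have [q1 [q2 [n1 n2 cq]]] := off_conic infK t_gt0 t_le4 gpz ox.
exists (tau x x (a ^+ 3 *: x + (3%:R * a ^+ 2 * b) *: x')); split.
- have [u hu] := fx.
  have [c cE] := conic_cubic char0 tauP x u (q := (q1, q2)) cq.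
  apply/negP => /eqP v0; have := cE x (a ^+ 3 *: x + (3%:R * a ^+ 2 * b) *: x').
  rewrite v0 lf0 mulr0 !brE mulr0 mul0r addr0 add0r => /esym/eqP; apply/negP.
  have n3 : (3%:R : K) != 0 by exact: char0 2.
  have h : br x u x' != 0 by rewrite brC23 oppr_eq0.
  by rewrite /qv /= !mulf_neq0 // expf_neq0.
- apply/(proj2 (tangent_off infK char0 t_gt0 t_le4 tauP gpz phiE ox)).
  by exists (a ^+ 3 *: x + (3%:R * a ^+ 2 * b) *: x').
- apply/(proj2 (tangent_off infK char0 t_gt0 t_le4 tauP gpz phiE ox')).
  exists (- ((3%:R * a * b ^+ 2) *: x + b ^+ 3 *: x')).
  have := tau_z tauP i; rewrite zE (tau_comb2 tauP) => E.
  set w := _ + b ^+ 3 *: x'; have -> : tau x' x' (- w) = - tau x' x' w.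
    by rewrite -scaleN1r (tauZ3 tauP) scaleN1r.
  apply/eqP; rewrite -subr_eq0 opprK; apply/eqP; rewrite -[RHS]E /w !(tauE tauP).
  by rewrite -[tau x' x' x](tauC23 tauP) (tauC12 tauP) !addrA.
Qed.

(** Two subspaces of dimension 3 inside a proper subspace of K^(N+1), where N + 1 <= 6, must
    intersect. *)
Lemma hyperplane_degenerate A (x x' u : 'rV[K]_N.+1) c : (N <= 5)%N ->
  usets_in 2 X A -> spans A x x' ->
  (forall v : 'rV[K]_N.+1, v \in tangent X (Pt x) -> lf c v = 0) ->
  (forall v : 'rV[K]_N.+1, v \in tangent X (Pt x') -> lf c v = 0) ->
  lf c u != 0 -> degenerate A.
Proof.
move=> N5 XA sA h h' cu; apply: (degenerateP sA).
apply/(span_tangents infK char0 t_gt0 t_le4 tauP gpz phiE XA sA).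
have AE : (\sum_(p <- val A) tangent X p)%VS = (tangent X (Pt x) + tangent X (Pt x'))%VS.
  have xx' : Pt x \notin [fset Pt x']%fset by apply/fset1P; exact: (spans_neq sA).
  by have [_ _ ->] := sA; rewrite big_fsetU1 //= big_seq_fset1.
rewrite AE; set W := (_ + _)%VS; rewrite ltnNge; apply/negP => W6.
have : u \in W.
  suff -> : W = fullv by exact: memvf.
  apply/eqP; rewrite eqEdim subvf /=.
  apply: leq_trans W6; rewrite dimvf /dim /=.
  by rewrite mul1n ltnS.
move=> /memv_addP[v /h hv [v' /h' hv' uE]]; case/negP: cu.
by rewrite uE lfD hv hv' addr0.
Qed.

(** The line xx' together with the conic Q is a cubic singular at x and at x'. It is a hyperplane
    section of X containing both tangent planes, and the hyperplane is proper because the cubic is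
    nonzero somewhere. *)
Lemma U_degenerate A : (N <= 5)%N -> Uset z phi A -> degenerate A.
Proof.
move=> N5 UA; have /UsetP/off_pair_in XA := UA.
move: UA => /UsetP[x [x' [ox ox' sA [Q [fQ [u Qu] Qz Qx Qx']]]]].
have fx := spans_free ox ox' sA.
have [P qP] := form2_quadratic fQ.
have [|i|c cE] := (let: And3 _ _ h := tauP in h) (fun w => br x x' w * Q w).
- by apply: form_ext (form_mul (form_lf (brv x x')) fQ) _ => w; rewrite lf_brv.
- by rewrite Qz mulr0.
have tangent0 v : off v -> br x x' v = 0 -> Q v = 0 -> forall y' : 'rV[K]_N.+1,
    y' \in tangent X (Pt (tau v v v)) -> lf c y' = 0.
  move=> ov hv Qv y' /(proj2 (tangent_off infK char0 t_gt0 t_le4 tauP gpz phiE ov))[a ->].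
  have E s : s * br x x' a * (s * P v a + s ^+ 2 * Q a) = 3%:R * s * lf c (tau v v a)
      + 3%:R * s ^+ 2 * lf c (tau v a a) + s ^+ 3 * lf c (tau a a a).
    have := cE (1 *: v + s *: a); rewrite (tau_comb2 tauP) !lfD !lfZ -(cE v) Qv !brE hv.
    rewrite (quad2 char0 qP) Qv => H.
    by apply: etrans (etrans H _); kring K.
  (* The values of E at 1, -1, 2 and -2 isolate the coefficient of s: the combination below is 12
     times it, that is 36 times c(tau v v a). The left side of E has no term linear in s. *)
  have n36 : (36%:R : K) != 0 by exact: char0 35.
  apply: (mulfI n36); rewrite mulr0.
  have -> : 36%:R * lf c (tau v v a) =
      8%:R * (1 * br x x' a * (1 * P v a + 1 ^+ 2 * Q a)
        - (-1) * br x x' a * ((-1) * P v a + (-1) ^+ 2 * Q a))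
      - (2%:R * br x x' a * (2%:R * P v a + 2%:R ^+ 2 * Q a)
        - (-2%:R) * br x x' a * ((-2%:R) * P v a + (-2%:R) ^+ 2 * Q a)).
    by rewrite !E; kring K.
  by kring K.
have [w hw] := fx; have sA1 := subalg_polyfun K.
have rg : regular polyfun (fun s => u + s *: w) by regular_tac sA1.
have g1 : generic (fun s => Q (u + s *: w) != 0).
  by apply: (generic_neq0 (s0 := 0)); [exact: (form_subalg sA1 fQ)|rewrite scale0r addr0].
have g2 : generic (fun s => br x x' (u + s *: w) != 0).
  have pb : polyfun (fun s => br x x' (u + s *: w)) by regular_tac sA1.
  have [hu|hu] := eqVneq (br x x' u) 0.
    by apply: (generic_neq0 (s0 := 1) pb); rewrite scale1r brD3 hu add0r.
  by apply: (generic_neq0 (s0 := 0) pb); rewrite scale0r addr0.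
have [s [n1 n2]] := generic_ex infK (genericI g1 g2).
apply: (hyperplane_degenerate N5 XA sA (c := c) (u := tau (u + s *: w) (u + s *: w) (u + s *: w))).
- by apply: tangent0; rewrite ?br_uwu.
- by apply: tangent0; rewrite ?br_ww.
- by rewrite -cE mulf_neq0.
Qed.

(** E_i is a line in projective space, contained in the tangent plane at each of its points. *)
Lemma E_degenerate i A : usets_in 2 (exceptional z phi i) A -> degenerate A /\ usets_in 2 X A.
Proof.
move=> EA; have [y1 [y2 sA]] := spansP A; have [E1 E2] := proj1 (usets_inP _ sA) EA.
have [w fw p1] := proj1 (exceptionalP infK char0 t_gt0 t_le4 tauP gpz phiE i _) E1.
have [w' fw' p2] := proj1 (exceptionalP infK char0 t_gt0 t_le4 tauP gpz phiE i _) E2.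
split.
  apply: (degenerateP sA); exists (tau (pvec (z i)) (pvec (z i)) w).
  rewrite p1 p2; split.
  - exact: (tau_exc_neq0 infK char0 t_gt0 t_le4 tauP gpz fw).
  - apply/(proj2 (tangent_exc infK char0 t_gt0 t_le4 tauP gpz phiE fw)).
    by exists w, 0; rewrite scale0r addr0.
  - apply/(proj2 (tangent_exc infK char0 t_gt0 t_le4 tauP gpz phiE fw')).
    by exists w, 0; rewrite scale0r addr0.
apply/(usets_inP X sA); rewrite p1 p2.
by split; apply/(del_pezzoP infK char0 t_gt0 t_le4 tauP gpz phiE); right; exists i;
  [exists w|exists w'].
Qed.

End DegeneratePairs.

(** * Degenerate pairs with exceptional points as limits of pairs on lines *)

Section LimitPairs.
Variable K : fieldType.
Hypothesis infK : forall s : seq K, exists x, x \notin s.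
Hypothesis char0 : forall n, n.+1%:R != 0 :> K.
Variables (t N : nat) (z : 'I_t -> projsp K 2) (phi : N.+1.-tuple (dhomog 3 K 3)).
Variable tau : 'rV[K]_3 -> 'rV[K]_3 -> 'rV[K]_3 -> 'rV[K]_N.+1.
Hypotheses (t_gt0 : (0 < t)%N) (t_le4 : (t <= 4)%N).
Local Notation zv := (fun i => pvec (z i)).
Hypotheses (tauP : cubic_map zv tau) (gpz : gp zv)
  (phiE : forall x : 'rV[K]_3, \row_j meval (x 0) (tnth phi j) = tau x x x).
Local Notation V := 'rV[K]_3.
Implicit Types (u v w x : V) (y : 'rV[K]_N.+1).
Add Ring K_ring : (kring_theory K).

Local Notation off := (off z).
Local Notation frame := (frame z).
Local Notation X := (del_pezzo z phi).
Local Notation conic := (conic z).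
Local Notation separates := (separates z).
Local Notation tau3 x := (tau x x x).

(** The point p is the limit at s = 0 of the images of x s. The curve u is the image freed of a
    common factor, so that it is defined and nonzero at s = 0. *)
Definition approaches (x : K -> V) (p : projsp K N) := exists u : K -> 'rV[K]_N.+1,
  [/\ regular polyfun u, u 0 != 0, p = Pt (u 0) & generic (fun s =>
    [/\ off (x s), u s != 0 & Pt (u s) = Pt (tau3 (x s))])].

Lemma approaches_off (x : K -> V) : regular polyfun x -> off (x 0) -> approaches x (Pt (tau3 (x 0))).
Proof.
move=> rx ox; exists (fun s => tau3 (x s)).
have nz := tau_off_neq0 infK char0 t_gt0 t_le4 tauP gpz.
split; [exact: (regular_tau tauP (subalg_polyfun K))|exact: (nz _ ox)|by []|].
have go : generic (fun s => off (x s)).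
  by apply: (generic_off rx) => i; exists 0; exact: (ox i).
apply: genericW go _ => s os.
by split=> //; exact: (nz _ os).
Qed.

(** A curve reaching z_i with direction w 0 tends to the corresponding point of E_i: its image is
    divisible by r s, and the quotient at s = 0 is a multiple of tau a a (w 0). *)
Lemma approaches_exc i (k r : K -> K) (w : K -> V) : polyfun k -> k 0 != 0 ->
  polyfun r -> r 0 = 0 -> r 1 != 0 -> regular polyfun w -> free2 (pvec (z i)) (w 0) ->
  approaches (fun s => k s *: pvec (z i) + r s *: w s)
    (Pt (tau (pvec (z i)) (pvec (z i)) (w 0))).
Proof.
set a := pvec (z i) => pk k0 pr r0 r1 rw fw; have sA := subalg_polyfun K.
have nz := tau_off_neq0 infK char0 t_gt0 t_le4 tauP gpz.
pose u s := (3%:R * k s ^+ 2) *: tau a a (w s) + (3%:R * k s * r s) *: tau a (w s) (w s)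
  + r s ^+ 2 *: tau3 (w s).
have uE s : tau3 (k s *: a + r s *: w s) = r s *: u s.
  rewrite (tau_comb2 tauP) (tau_z tauP) scaler0 add0r !scalerDr !scalerA.
  by congr (_ *: _ + _ *: _ + _ *: _); kring K.
have u0 : u 0 = (3%:R * k 0 ^+ 2) *: tau a a (w 0).
  by rewrite /u r0 mulr0 expr0n !scale0r !addr0.
have n3 : 3%:R * k 0 ^+ 2 != 0 :> K by rewrite mulf_neq0 ?expf_neq0 // (char0 2).
have e0 := tau_exc_neq0 infK char0 t_gt0 t_le4 tauP gpz fw.
exists u; split.
- have rt1 : regular polyfun (fun s => tau a a (w s)).
    by apply: (regular_tau tauP sA) => //; exact: regular_cst.
  have rt2 : regular polyfun (fun s => tau a (w s) (w s)).
    by apply: (regular_tau tauP sA) => //; exact: regular_cst.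
  have rt3 : regular polyfun (fun s => tau3 (w s)) by exact: (regular_tau tauP sA).
  by rewrite /u; regular_tac sA.
- by rewrite u0 scaler_eq0 negb_or n3.
- by rewrite u0 PtZ.
have rx : regular polyfun (fun s => k s *: a + r s *: w s) by regular_tac sA.
have gr : generic (fun s => r s != 0) by exact: generic_neq0 pr r1.
have gw := generic_free2 rw fw.
have go : generic (fun s => forall j, j != i -> free2 (pvec (z j)) (k s *: a + r s *: w s)).
  apply: generic_all => j; have [->|ji] := eqVneq j i; first by exact: genericT.
  have g0 : free2 (pvec (z j)) (k 0 *: a + r 0 *: w 0).
    rewrite r0 scale0r addr0 -[k 0 *: a]add0r -(scale0r (pvec (z j))).
    by apply: free2_comb => //; exact: (gp_free2 gpz ji).
  by apply: genericW (generic_free2 rx g0) _ => s h _.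
apply: genericW (genericI gr (genericI gw go)) _ => s [rs [ws os]].
have ox : off (k s *: a + r s *: w s).
  move=> j; have [->|/os//] := eqVneq j i; exact: free2_comb ws rs.
have us : u s != 0.
  by apply: contraNneq (nz _ ox) => us; rewrite uE us scaler0.
by split=> //; rewrite uE PtZ.
Qed.

(** A 2 by 2 minor that is nonzero at s = 0 stays nonzero for general s and keeps the two points
    distinct there. *)
Lemma curve_usets (C : set (uset K N 2)) A (u v : K -> 'rV[K]_N.+1) : closed C ->
  regular polyfun u -> regular polyfun v -> spans A (u 0) (v 0) ->
  generic (fun s => forall A', spans A' (u s) (v s) -> C A') -> C A.
Proof.
move=> cC ru rv sA gC; have sA1 := subalg_polyfun K; have [u0 v0 _] := sA.
apply: contrapT => nCA; have [d [h [mh h0 hC]]] := closed_pairsP cC nCA sA.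
have [k [l minor]] : exists k l, co (u 0) k * co (v 0) l - co (u 0) l * co (v 0) k != 0.
  have [k uk] := rV0Pn _ u0; rewrite -/(co _ _) in uk; pose e := co (v 0) k / co (u 0) k.
  have : v 0 - e *: u 0 != 0.
    apply/negP; rewrite subr_eq0 => /eqP vE; case: (spans_neq sA).
    by apply/(Pt_eqP u0 v0); exists e.
  case/rV0Pn => l hl; exists k, l; apply: contraNneq hl => H.
  have ek : e * co (u 0) k = co (v 0) k by rewrite divfK.
  rewrite -/(co _ _) !coE; apply/eqP/(mulfI uk); rewrite mulr0 -[RHS]H -ek; kring K.
have gm : generic (fun s => co (u s) k * co (v s) l - co (u s) l * co (v s) k != 0).
  apply: (generic_neq0 (s0 := 0)) minor.
  by apply: (subalg_sub sA1); apply: (subalg_mul sA1); first [exact: ru|exact: rv].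
have gh : generic (fun s => h (pairv (u s) (v s)) != 0).
  apply: (generic_neq0 (s0 := 0)) h0; apply: (mform_subalg (u := fun s => pairv (u s) (v s)) sA1 mh).
  by move=> i m; case: (ord2P i) => ->; rewrite /pairv /=; [exact: ru|exact: rv].
have [s [Cs [ms hs]]] := generic_ex infK (genericI gC (genericI gm gh)).
have us : u s != 0 by apply: contraNneq ms => ->; rewrite !coE; apply/eqP; kring K.
have vs : v s != 0 by apply: contraNneq ms => ->; rewrite !coE; apply/eqP; kring K.
have uv : Pt (u s) <> Pt (v s).
  move=> /(Pt_eqP us vs)[e vE]; case/negP: ms; apply/eqP.
  by rewrite vE !coE; kring K.
have [A' sA'] := spans_ex us vs uv.
by case/negP: hs; apply/eqP; apply: (hC _ _ _ sA'); exact: Cs.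
Qed.

Lemma closure_pair (C : set (uset K N 2)) A (x x' : K -> V) p q : closed C ->
  approaches x p -> approaches x' q -> val A = [fset p; q]%fset ->
  generic (fun s => off (x s) -> off (x' s) -> forall A',
    spans A' (tau3 (x s)) (tau3 (x' s)) -> C A') -> C A.
Proof.
move=> cC [u [ru u0 pE gu]] [v [rv v0 qE gv]] AE gC; rewrite pE qE in AE.
apply: (curve_usets cC ru rv (Spans u0 v0 AE)).
apply: genericW (genericI (genericI gu gv) gC) _ => s [[[ox _ uP] [ox' _ vP]] Cs] A' sA'.
apply: (Cs ox ox'); have [_ _ A'E] := sA'; rewrite uP vP in A'E.
have nz := tau_off_neq0 infK char0 t_gt0 t_le4 tauP gpz.
exact: (Spans (nz _ ox) (nz _ ox') A'E).
Qed.

Lemma closure_Y i A (x x' : K -> V) p q :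
  approaches x p -> approaches x' q -> val A = [fset p; q]%fset ->
  (forall s, br (x s) (x' s) (pvec (z i)) = 0) -> closure (Yset z phi i) A.
Proof.
move=> hx hx' AE h; apply: (closure_pair (@closed_closure _ _) hx hx' AE).
apply: genericT => s ox ox' A' sA'; apply: subset_closure.
by apply/(YsetP infK char0 t_gt0 t_le4 tauP gpz phiE); exists (x s), (x' s).
Qed.

Lemma closure_U A (x x' : K -> V) p q :
  approaches x p -> approaches x' q -> val A = [fset p; q]%fset ->
  generic (fun s => exists Q, on_conic z Q (x s) (x' s)) -> closure (Uset z phi) A.
Proof.
move=> hx hx' AE h; apply: (closure_pair (@closed_closure _ _) hx hx' AE).
apply: genericW h _ => s hQ ox ox' A' sA'; apply: subset_closure.
by apply/(UsetP infK char0 t_gt0 t_le4 tauP gpz phiE); exists (x s), (x' s).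
Qed.

Lemma regular_line (u w : V) : regular polyfun (fun s => u + s *: w).
Proof. by have sA := subalg_polyfun K; regular_tac sA. Qed.

Lemma approaches_line i w : free2 (pvec (z i)) w ->
  approaches (fun s => 1 *: pvec (z i) + s *: w) (Pt (tau (pvec (z i)) (pvec (z i)) w)).
Proof.
move=> fw; have sA := subalg_polyfun K.
apply: (approaches_exc (k := fun=> 1) (r := id) (w := fun=> w)) => //.
- exact: (subalg_cst sA).
- exact: oner_neq0.
- exact: polyfun_var.
- exact: oner_neq0.
- exact: regular_cst.
Qed.

(** As v lies in the direction w from z_i, the first point can leave z_i along the line z_i v while
    v stays fixed. *)
Lemma exc_off_line i w (v : V) A : let zi := pvec (z i) in free2 zi w -> off v ->
  br zi w v = 0 -> val A = [fset Pt (tau zi zi w); Pt (tau3 v)]%fset ->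
  closure (Yset z phi i) A.
Proof.
move=> zi fw ov hw AE; have sA := subalg_polyfun K.
apply: (closure_Y (approaches_line fw) (approaches_off (x := fun=> v) (regular_cst sA v) ov) AE).
by move=> s; rewrite !brE mulr0 add0r br_rot hw mulr0.
Qed.

(** With v = k z_i + l z_j, the points z_i + s w and v + s k w = k (z_i + s w) + l z_j stay
    collinear with z_j. *)
Lemma exc_off_chord i j w (v : V) A : let zi := pvec (z i) in i != j -> free2 zi w -> off v ->
  br zi v (pvec (z j)) = 0 -> val A = [fset Pt (tau zi zi w); Pt (tau3 v)]%fset ->
  closure (Yset z phi j) A.
Proof.
move=> zi ij fw ov hv AE; have fij := gp_free2 gpz ij.
have [|k [l vE]] := br0_comb (x := v) fij; first by rewrite brC23 hv oppr0.
have rx := regular_line v (k *: w).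
have := approaches_off rx; rewrite scale0r addr0 => /(_ ov) h2.
apply: (closure_Y (approaches_line fw) h2 AE) => s.
by rewrite vE !brE -/zi [br w zi _]brC12; kring K.
Qed.

(** Here w = k z_i + l z_j. Correcting the first curve to second order gives z_i + s (w + l s w') =
    (1 + s k) z_i + s l (z_j + s w'), collinear with z_i and the second curve. *)
Lemma exc_exc_chord i j w w' A : let zi := pvec (z i) in let zj := pvec (z j) in i != j ->
  free2 zi w -> free2 zj w' -> br zi zj w = 0 ->
  val A = [fset Pt (tau zi zi w); Pt (tau zj zj w')]%fset -> closure (Yset z phi i) A.
Proof.
move=> zi zj ij fw fw' hw AE; have sA := subalg_polyfun K.
have [k [l wE]] := br0_comb (gp_free2 gpz ij) hw.
have h1 : approaches (fun s => 1 *: zi + s *: (w + (l * s) *: w')) (Pt (tau zi zi w)).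
  have := approaches_exc (i := i) (k := fun=> 1) (r := id) (w := fun s => w + (l * s) *: w').
  rewrite mulr0 scale0r addr0; apply=> //; [|exact: oner_neq0| |exact: oner_neq0|].
  - exact: (subalg_cst sA).
  - exact: polyfun_var.
  - have p : polyfun (fun s => l * s).
      by apply: (subalg_mul sA); [exact: (subalg_cst sA)|exact: polyfun_var].
    by regular_tac sA.
apply: (closure_Y h1 (approaches_line fw') AE) => s.
rewrite wE -/zi -/zj !brE [br w' zj zi]br_rot [br zj w' zi]br_rot [br zi zj w']brC23.
kring K.
Qed.

(** Modulo z_i, the direction w' is m w + l z_j, and m z_i + s (m w + l z_j) = m (z_i + s w) + s l
    z_j is collinear with z_j and z_i + s w. *)
Lemma exc_same_generic i j w w' A : let zi := pvec (z i) in let zj := pvec (z j) in i != j ->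
  br zi zj w != 0 -> free2 zi w' -> 
  val A = [fset Pt (tau zi zi w); Pt (tau zi zi w')]%fset -> closure (Yset z phi j) A.
Proof.
move=> zi zj ij hw fw' AE; have sA := subalg_polyfun K.
have [_ fw _] := br_neq0_free hw.
have [k [l [m wE]]] := cramer_coord w' hw.
have E : tau zi zi w' = tau zi zi (m *: w + l *: zj).
  by rewrite wE -addrA (tauD3 tauP) (tauZ3 tauP) (tau_z tauP) scaler0 add0r addrC.
have fE : free2 zi (m *: w + l *: zj).
  have [u hu] := fw'; exists u; move: hu; rewrite wE !brE.
  by apply: contraNneq => H; apply/eqP; rewrite -[RHS]H; kring K.
rewrite E in AE.
have [m0|m0] := eqVneq m 0; last first.
  have h2 : approaches (fun s => m *: zi + s *: (m *: w + l *: zj))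
      (Pt (tau zi zi (m *: w + l *: zj))).
    apply: (approaches_exc (k := fun=> m) (r := id) (w := fun=> m *: w + l *: zj)) => //.
    - exact: (subalg_cst sA).
    - exact: polyfun_var.
    - exact: oner_neq0.
    - exact: regular_cst.
  apply: (closure_Y (approaches_line fw) h2 AE) => s.
  by rewrite /zi /zj /br !coE; kring K.
(* w' is the direction of zj: the second curve has to be of higher order *)
have p2 : polyfun (fun s : K => s ^+ 2) by apply: (subalg_exp sA); exact: polyfun_var.
have h1 : approaches (fun s => 1 *: zi + (s ^+ 2) *: w) (Pt (tau zi zi w)).
  apply: (approaches_exc (k := fun=> 1) (r := fun s => s ^+ 2) (w := fun=> w)) => //.
  - exact: (subalg_cst sA).
  - exact: oner_neq0.
  - by rewrite expr0n.
  - by rewrite expr1n oner_neq0.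
  - exact: regular_cst.
have h2 : approaches (fun s => 1 *: zi + s *: (s *: w + (m *: w + l *: zj)))
    (Pt (tau zi zi (m *: w + l *: zj))).
  have := approaches_exc (i := i) (k := fun=> 1) (r := id)
    (w := fun s => s *: w + (m *: w + l *: zj)).
  rewrite scale0r add0r; apply=> //; [|exact: oner_neq0| |exact: oner_neq0|].
  - exact: (subalg_cst sA).
  - exact: polyfun_var.
  - by have p := polyfun_var K; regular_tac sA.
apply: (closure_Y h1 h2 AE) => s.
by rewrite m0 /zi /zj /br !coE; kring K.
Qed.

(** Of two distinct points of E_i at most one is the direction of z_j, so one of the two orders
    satisfies [exc_same_generic]. This is why E_i^(2) is no component once t >= 2. *)
Lemma exc_same i j A : i != j -> usets_in 2 (exceptional z phi i) A -> closure (Yset z phi j) A.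
Proof.
move=> ij EA; have [y1 [y2 sA]] := spansP A; have [E1 E2] := proj1 (usets_inP _ sA) EA.
have [w fw p1] := proj1 (exceptionalP infK char0 t_gt0 t_le4 tauP gpz phiE i _) E1.
have [w' fw' p2] := proj1 (exceptionalP infK char0 t_gt0 t_le4 tauP gpz phiE i _) E2.
have [_ _ AE] := sA; rewrite p1 p2 in AE.
have [hw|hw] := eqVneq (br (pvec (z i)) (pvec (z j)) w) 0; last exact: exc_same_generic ij hw fw' AE.
have [hw'|hw'] := eqVneq (br (pvec (z i)) (pvec (z j)) w') 0; last first.
  by rewrite fsetUC in AE; exact: exc_same_generic ij hw' fw AE.
case: (spans_neq sA); rewrite p1 p2; have fij := gp_free2 gpz ij.
have [k [l wE]] := br0_comb fij hw; have [k' [l' wE']] := br0_comb fij hw'.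
have e0 := tau_exc_neq0 infK char0 t_gt0 t_le4 tauP gpz.
have E (m n : K) u : u = m *: pvec (z i) + n *: pvec (z j) -> free2 (pvec (z i)) u ->
    Pt (tau (pvec (z i)) (pvec (z i)) u) = Pt (tau (pvec (z i)) (pvec (z i)) (pvec (z j))).
  move=> -> fu; rewrite (tauD3 tauP) !(tauZ3 tauP) (tau_z tauP) scaler0 add0r PtZ //.
    by have [v + ] := fu; apply: contraNneq => ->; rewrite !brE mulr0 mul0r addr0.
  exact: e0 fij.
by rewrite (E _ _ _ wE fw) (E _ _ _ wE' fw').
Qed.

End LimitPairs.

(** * Degenerate pairs with exceptional points as limits of pairs on conics *)

Section LimitConics.
Variable K : fieldType.
Hypothesis infK : forall s : seq K, exists x, x \notin s.
Hypothesis char0 : forall n, n.+1%:R != 0 :> K.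
Variables (t N : nat) (z : 'I_t -> projsp K 2) (phi : N.+1.-tuple (dhomog 3 K 3)).
Variable tau : 'rV[K]_3 -> 'rV[K]_3 -> 'rV[K]_3 -> 'rV[K]_N.+1.
Hypotheses (t_gt0 : (0 < t)%N) (t_le4 : (t <= 4)%N).
Local Notation zv := (fun i => pvec (z i)).
Hypotheses (tauP : cubic_map zv tau) (gpz : gp zv)
  (phiE : forall x : 'rV[K]_3, \row_j meval (x 0) (tnth phi j) = tau x x x).
Local Notation V := 'rV[K]_3.
Implicit Types (u v w x : V) (y : 'rV[K]_N.+1).
Add Ring K_ring : (kring_theory K).

Local Notation off := (off z).
Local Notation frame := (frame z).
Local Notation X := (del_pezzo z phi).
Local Notation conic := (conic z).
Local Notation separates := (separates z).
Local Notation approaches := (approaches z tau).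
Local Notation tau3 x := (tau x x x).

Definition member (a b c d : V) (k l : K) x := k * pencil1 a b c d x + l * pencil2 a b c d x.
Definition member_polar (a b c d : V) (k l : K) u w :=
  k * polar1 a b c d u w + l * polar2 a b c d u w.

Lemma memberP a b c d k l : quadratic (member a b c d k l) (member_polar a b c d k l).
Proof. exact: pencil_quadratic. Qed.

Lemma regular_member (Y : Type) (A : set (Y -> K)) (k l : Y -> K) (x : Y -> V) a b c d :
  subalg A -> A k -> A l -> regular A x -> A (fun s => member a b c d (k s) (l s) (x s)).
Proof. by move=> sA Ak Al rx; rewrite /member /pencil1 /pencil2; regular_tac sA. Qed.

Lemma regular_member_polar (Y : Type) (A : set (Y -> K)) (k l : Y -> K) (u w : Y -> V) a b c d :
  subalg A -> A k -> A l -> regular A u -> regular A w ->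
  A (fun s => member_polar a b c d (k s) (l s) (u s) (w s)).
Proof. by move=> sA Ak Al ru rw; rewrite /member_polar /polar1 /polar2; regular_tac sA. Qed.

Lemma form_member a b c d k l : form 2 (member a b c d k l).
Proof.
have fb u v : form 1 (br u v) by apply: form_ext (form_lf (brv u v)) _ => w; rewrite lf_brv.
by apply: form_add; apply: form_scale; exact: form_mul (fb _ _) (fb _ _).
Qed.

Lemma member_on_conic a b c d k l u w : frame a b c d -> (k != 0) || (l != 0) ->
  member a b c d k l u = 0 -> member a b c d k l w = 0 ->
  exists Q, on_conic z Q u w.
Proof.
move=> [g4 cov] kl hu hw; exists (member a b c d k l); split=> //.
- exact: form_member.
- exact: pencil_neq0 g4 _ _ kl.
- by move=> i; apply: pencil_base0; exact: cov.
Qed.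

Lemma frame_conics a b c d : frame a b c d ->
  conic (brv a b, brv c d) /\ conic (brv a c, brv b d).
Proof.
by move=> [_ cov]; split=> i; rewrite /qv /= !lf_brv; case: (cov i) => ->;
  rewrite ?br_uwu ?br_ww ?mul0r ?mulr0.
Qed.

Lemma nseparates a b c d s s' : frame a b c d -> ~ separates s s' ->
  s (brv a b, brv c d) * s' (brv a c, brv b d) = s (brv a c, brv b d) * s' (brv a b, brv c d).
Proof.
move=> /frame_conics[c1 c2] ns; apply: contrapT => /eqP h; apply: ns.
by exists (brv a b, brv c d), (brv a c, brv b d).
Qed.

Lemma qv_pencil a b c d x : qv (brv a b, brv c d) x = pencil1 a b c d x.
Proof. by rewrite /qv /= !lf_brv. Qed.

Lemma qd_pencil a b c d u w : qd (brv a b, brv c d) u w = polar1 a b c d u w.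
Proof. by rewrite /qd /= !lf_brv. Qed.

Lemma member_base a b c d k l x : [\/ x = a, x = b, x = c | x = d] -> member a b c d k l x = 0.
Proof. exact: pencil_base0. Qed.

(* The conic of the pencil through a + s w is [member _ _ _ _ (k s) (l s)]; its second
   intersection with the line joining a to a point e of the plane is rational in s. *)
Section Tangent.
Variables (a b c d w : V).
Hypotheses (fr : frame a b c d) (fw : free2 a w).
Let k s := polar2 a b c d a w + s * pencil2 a b c d w.
Let l s := - (polar1 a b c d a w + s * pencil1 a b c d w).
Let Q s := member a b c d (k s) (l s).
Let P s := member_polar a b c d (k s) (l s).

Definition second_point (s : K) (e : V) := Q s e *: a + (- P s a e) *: e.

Let pk : polyfun k.
Proof. by have sA := subalg_polyfun K; have p := polyfun_var K; rewrite /k; regular_tac sA. Qed.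
Let pl : polyfun l.
Proof. by have sA := subalg_polyfun K; have p := polyfun_var K; rewrite /l; regular_tac sA. Qed.

Lemma regular_Q (e : K -> V) : regular polyfun e -> polyfun (fun s => Q s (e s)).
Proof. by move=> re; exact: regular_member (subalg_polyfun K) pk pl re. Qed.

Lemma regular_P (e : K -> V) : regular polyfun e -> polyfun (fun s => P s a (e s)).
Proof.
by move=> re; apply: regular_member_polar (subalg_polyfun K) pk pl _ re; exact: (regular_cst (subalg_polyfun K) a).
Qed.

Lemma kl0 : (k 0 != 0) || (l 0 != 0).
Proof.
have [[abc abd acd bcd] _] := fr; have [_ w0] := free2_neq0 fw.
rewrite /k /l !mul0r !addr0 oppr_eq0 /polar1 /polar2 !br_uwu !mul0r !addr0.
rewrite !mulf_eq0.
rewrite (br_rot a c d) (br_rot a b d) (negbTE acd) (negbTE abd) !orbF -negb_and.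
by apply/negP => /andP[/eqP h2 /eqP h1]; exact: two_lines abc h1 h2 w0 fw.
Qed.

Lemma second_pointP : generic (fun s => forall e, exists R,
  on_conic z R (1 *: a + s *: w) (second_point s e)).
Proof.
have gkl : generic (fun s => (k s != 0) || (l s != 0)).
  by case/orP: kl0 => h; [apply: genericW (generic_neq0 pk h) _|apply: genericW (generic_neq0 pl h) _];
    move=> s ->; rewrite ?orbT.
apply: genericW gkl _ => s kl e; apply: member_on_conic fr kl _ _.
  rewrite /member /k /l /pencil1 /pencil2 /polar1 /polar2 !brE; kring K.
rewrite /second_point (quad2 char0 (memberP a b c d (k s) (l s))) -/(P s _ _) -/(Q s _).
rewrite -/(Q s e) {2}/Q member_base; last exact: Or41.
by kring K.
Qed.

Lemma second_point_neq0 e : br a w e != 0 -> P 0 a e != 0.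
Proof.
move=> h; have [g4 cov] := fr; have B := @member_base a b c d (k 0) (l 0).
apply: (pencil_smooth char0 (memberP a b c d (k 0) (l 0)) g4 (B a _) (B b _) (B c _) (B d _) _ _ h).
- exact: Or41. - exact: Or42. - exact: Or43. - exact: Or44.
- exact: pencil_neq0 g4 _ _ kl0.
- by rewrite /member_polar /k /l; kring K.
Qed.

End Tangent.

(** Failure of separation says that the member of the pencil with direction w at z_i passes through
    v. Let the first point be z_i + s w, and the second the other intersection of the line z_i v
    with the member through the first; it tends to v. *)
Lemma exc_off_conic i w (v : V) A : let zi := pvec (z i) in br zi w v != 0 -> off v ->
  ~ separates (fun q => qd q zi w) (qv^~ v) ->
  val A = [fset Pt (tau zi zi w); Pt (tau3 v)]%fset -> closure (Uset z phi) A.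
Proof.
move=> zi hw ov ns AE; have [fw _ _] := br_neq0_free hw.
have [|b [c [d [fr _]]]] := frame_at infK t_gt0 t_le4 gpz i (L := [::]); first by [].
have sA := subalg_polyfun K; have rv : regular polyfun (fun=> v) by exact: (regular_cst sA v).
have h0 := second_point_neq0 fr fw hw.
pose y s := second_point zi b c d w s v.
have ry : regular polyfun y.
  have pQ := regular_Q zi b c d w rv; have pP := regular_P zi b c d w rv.
  by rewrite /y /second_point; regular_tac sA.
have yE : y 0 = - member_polar zi b c d (polar2 zi b c d zi w + 0 * pencil2 zi b c d w)
    (- (polar1 zi b c d zi w + 0 * pencil1 zi b c d w)) zi v *: v.
  rewrite /y /second_point (_ : member _ _ _ _ _ _ v = 0) ?scale0r ?add0r //.
  have H : polar1 zi b c d zi w * pencil2 zi b c d v = polar2 zi b c d zi w * pencil1 zi b c d v.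
    by have := nseparates fr ns; rewrite !qv_pencil !qd_pencil.
  by rewrite /member !mul0r !addr0 mulNr H; kring K.
have := approaches_off infK char0 t_gt0 t_le4 tauP gpz ry.
rewrite yE => /(_ (offZ _ ov)); rewrite oppr_eq0 => /(_ h0).
rewrite (tau_diagZ tauP) PtZ; last 2 first.
- by rewrite expf_neq0 // oppr_eq0.
- exact: (tau_off_neq0 infK char0 t_gt0 t_le4 tauP gpz ov).
move=> hy; have hx := approaches_line infK char0 t_gt0 t_le4 tauP gpz fw.
apply: (closure_U infK char0 t_gt0 t_le4 tauP gpz phiE hx hy AE).
by apply: genericW (second_pointP fr fw) _ => s; apply.
Qed.

(** As before, but the line is drawn from z_i to the moving point z_j + s w'. The second
    intersection leaves z_j in the direction w' because the conic vanishes at that moving point to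
    second order in s. *)
Lemma exc_exc_conic i j w w' A : let zi := pvec (z i) in let zj := pvec (z j) in i != j ->
  br zi zj w != 0 -> free2 zj w' -> ~ separates (fun q => qd q zi w) (fun q => qd q zj w') ->
  val A = [fset Pt (tau zi zi w); Pt (tau zj zj w')]%fset -> closure (Uset z phi) A.
Proof.
move=> zi zj ij hw fw' ns AE; have [_ fw _] := br_neq0_free hw.
have [|b [c [d [fr _]]]] := frame_at infK t_gt0 t_le4 gpz i (L := [::]); first by [].
have sA := subalg_polyfun K; have pv := polyfun_var K.
have re : regular polyfun (fun s => zj + s *: w') by exact: regular_line.
have hw' : br zi w zj != 0 by rewrite brC23 oppr_eq0.
have h0 := second_point_neq0 fr fw hw'.
pose k s := polar2 zi b c d zi w + s * pencil2 zi b c d w.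
pose l s := - (polar1 zi b c d zi w + s * pencil1 zi b c d w).
pose m s := - member_polar zi b c d (k s) (l s) zi (zj + s *: w').
(* The value of the moving conic at z_j + s w' divided by s^2; its linear coefficient is zero at s =
   0 by the failure of separation. *)
pose e s := pencil2 zi b c d w * polar1 zi b c d zj w' - pencil1 zi b c d w * polar2 zi b c d zj w'
  + member zi b c d (k s) (l s) w'.
have yE s : second_point zi b c d w s (zj + s *: w') = m s *: zj + s *: (m s *: w' + (s * e s) *: zi).
  rewrite /second_point -/(k s) -/(l s) -/(m s).
  have -> : member zi b c d (k s) (l s) (zj + s *: w') = s ^+ 2 * e s.
    have := quad2 char0 (memberP zi b c d (k s) (l s)) 1 s zj w'; rewrite scale1r => ->.
    rewrite member_base; last by case: fr => _; apply.
    have H : polar1 zi b c d zi w * polar2 zi b c d zj w' = polar2 zi b c d zi w * polar1 zi b c d zj w'.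
      by have := nseparates fr ns; rewrite !qd_pencil.
    have E : member_polar zi b c d (k s) (l s) zj w' = s * (pencil2 zi b c d w * polar1 zi b c d zj w'
        - pencil1 zi b c d w * polar2 zi b c d zj w').
      apply: (addIr (polar1 zi b c d zi w * polar2 zi b c d zj w')); rewrite {2}H.
      by rewrite /member_polar /k /l; kring K.
    by rewrite E /e; kring K.
  by apply: row3P; rewrite !coE; kring K.
have pk : polyfun k by rewrite /k; regular_tac sA.
have pl : polyfun l by rewrite /l; regular_tac sA.
have pm : polyfun m.
  by apply: (subalg_opp sA); apply: regular_member_polar => //; exact: regular_cst.
have pe : polyfun e.
  apply: (subalg_add sA); first exact: (subalg_cst sA).
  by apply: regular_member => //; exact: regular_cst.
have m0 : m 0 != 0 by rewrite /m scale0r addr0 oppr_eq0.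
have hy := approaches_exc infK char0 t_gt0 t_le4 tauP gpz (i := j) (k := m) (r := id)
  (w := fun s => m s *: w' + (s * e s) *: zi) pm m0 pv erefl (oner_neq0 _).
have {hy} := hy _ _; rewrite mul0r scale0r addr0 (tauZ3 tauP) PtZ //; last first.
  exact: (tau_exc_neq0 infK char0 t_gt0 t_le4 tauP gpz fw').
move=> hy; have {}hy : approaches (fun s => second_point zi b c d w s (zj + s *: w')) (Pt (tau zj zj w')).
  have -> : (fun s => second_point zi b c d w s (zj + s *: w')) =
    (fun s => m s *: zj + s *: (m s *: w' + (s * e s) *: zi)) by apply/funext => s; exact: yE.
  apply: hy; first by regular_tac sA.
  by have := free2_comb 0 fw' m0; rewrite scale0r add0r.
have hx := approaches_line infK char0 t_gt0 t_le4 tauP gpz fw.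
apply: (closure_U infK char0 t_gt0 t_le4 tauP gpz phiE hx hy AE).
by apply: genericW (second_pointP fr fw) _ => s; apply.
Qed.

End LimitConics.

(** * The equations for the Terracini locus *)

Section TerraciniLocus.
Variable K : fieldType.
Hypothesis infK : forall s : seq K, exists x, x \notin s.
Hypothesis char0 : forall n, n.+1%:R != 0 :> K.
Variables (t N : nat) (z : 'I_t -> projsp K 2) (phi : N.+1.-tuple (dhomog 3 K 3)).
Variable tau : 'rV[K]_3 -> 'rV[K]_3 -> 'rV[K]_3 -> 'rV[K]_N.+1.
Hypotheses (t_gt0 : (0 < t)%N) (t_le4 : (t <= 4)%N).
Local Notation zv := (fun i => pvec (z i)).
Hypotheses (tauP : cubic_map zv tau) (gpz : gp zv)
  (phiE : forall x : 'rV[K]_3, \row_j meval (x 0) (tnth phi j) = tau x x x).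
Local Notation V := 'rV[K]_3.
Implicit Types (u v w x : V) (y : 'rV[K]_N.+1).
Add Ring K_ring : (kring_theory K).

Local Notation off := (off z).
Local Notation X := (del_pezzo z phi).
Local Notation separates := (separates z).
Local Notation degenerate := (degenerate z phi).
Local Notation tau3 x := (tau x x x).
Local Notation Yset i := (Yset z phi i).
Local Notation Uset := (Uset z phi).
Local Notation E i := (exceptional z phi i).

Definition limit_pair A := (exists i, closure (Yset i) A) \/ (t = 4%N /\ closure Uset A) \/
  (t = 1%N /\ exists i, usets_in 2 (E i) A).

Lemma nseparates_t4 (P : Prop) : (t <= 3)%N \/ t = 4%N.
Proof. by move: t_le4; rewrite leq_eqVlt => /predU1P[|]; [right|left]. Qed.

(** If no z_i lies on the line of the two points, [nondeg_off] forbids separation by conics. This is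
    impossible for t <= 3, and for t = 4 the member of the pencil through x then contains x'. *)
Lemma off_off_limit x (x' : V) A : off x -> off x' -> spans A (tau3 x) (tau3 x') ->
  degenerate A -> limit_pair A.
Proof.
move=> ox ox' sA dA; have fx := spans_free infK char0 t_gt0 t_le4 tauP gpz ox ox' sA.
have [[i hi]|nY] := pselect (exists i, br x x' (pvec (z i)) = 0).
  left; exists i; apply: subset_closure.
  by apply/(YsetP infK char0 t_gt0 t_le4 tauP gpz phiE); exists x, x'.
have hz i : br x x' (pvec (z i)) != 0 by apply/eqP => hi; apply: nY; exists i.
have ns : ~ separates (qv^~ x) (qv^~ x').
  move=> sep; have [v [v0 + +]] := dA _ _ sA.
  move=> /(proj2 (tangent_off infK char0 t_gt0 t_le4 tauP gpz phiE ox))[a vE].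
  move=> /(proj2 (tangent_off infK char0 t_gt0 t_le4 tauP gpz phiE ox'))[b vE'].
  case/negP: v0; rewrite vE'; apply/eqP.
  by apply: (nondeg_off infK char0 t_gt0 t_le4 tauP gpz ox ox' fx hz sep (a := a)); rewrite -vE -vE'.
have [t3|t4] := nseparates_t4 True.
  by case: ns; exact: (separates_off infK t_gt0 t_le4 gpz).
right; left; split=> //; apply: subset_closure.
apply/(UsetP infK char0 t_gt0 t_le4 tauP gpz phiE); exists x, x'; split=> //.
have [|b [c [d [fr hp]]]] := frame_at infK t_gt0 t_le4 gpz (Ordinal t_gt0)
  (L := [:: (pvec (z (Ordinal t_gt0)), x)]).
  by move=> l; rewrite mem_seq1 => /eqP ->; exact: ox.
set a := pvec _ in fr hp.
have [fb fc fd] : [/\ free2 b x, free2 c x & free2 d x].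
  apply: (frame_free (z := z) (a := a) _ ox) => p /hp[hL|[j _ pE]]; first by left.
  by right; exists j.
have kl := pencil_base (proj1 fr) (ox _) fb fc fd.
(* These coefficients give the member of the pencil through x; they are not both zero because x is
   not a base point. *)
apply: (member_on_conic char0 fr (k := - pencil2 a b c d x) (l := pencil1 a b c d x)).
- by rewrite oppr_eq0 orbC; apply/orP.
- by rewrite /member; kring K.
have H : pencil1 a b c d x * pencil2 a b c d x' = pencil2 a b c d x * pencil1 a b c d x'.
  by have := nseparates fr ns; rewrite !qv_pencil.
by rewrite /member H; kring K.
Qed.

Lemma exc_off_limit i w (x' : V) A : let zi := pvec (z i) in free2 zi w -> off x' ->
  spans A (tau zi zi w) (tau3 x') -> degenerate A -> limit_pair A.
Proof.
move=> zi fw ox' sA dA; have [_ _ AE] := sA.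
have [hw|hw] := eqVneq (br zi w x') 0.
  left; exists i; exact: (exc_off_line infK char0 t_gt0 t_le4 tauP gpz phiE fw ox' hw AE).
have [[j [ij hj]]|nY] := pselect (exists j, i != j /\ br zi x' (pvec (z j)) = 0).
  left; exists j; exact: (exc_off_chord infK char0 t_gt0 t_le4 tauP gpz phiE ij fw ox' hj AE).
have hz j : j != i -> br zi x' (pvec (z j)) != 0.
  by move=> ji; apply/eqP => hj; apply: nY; exists j; rewrite eq_sym.
have ns : ~ separates (fun q => qd q zi w) (qv^~ x').
  move=> sep; have [v [v0 + +]] := dA _ _ sA.
  move=> /(proj2 (tangent_exc infK char0 t_gt0 t_le4 tauP gpz phiE fw))[a [k vE]].
  move=> /(proj2 (tangent_off infK char0 t_gt0 t_le4 tauP gpz phiE ox'))[b vE'].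
  case/negP: v0; rewrite vE'; apply/eqP.
  apply: (nondeg_exc infK char0 t_gt0 t_le4 tauP gpz ox' hw hz sep (a := a) (k := k)).
  by rewrite -vE -vE'.
have [t3|t4] := nseparates_t4 True.
  by case: ns; exact: (separates_exc infK t_gt0 t_le4 gpz).
right; left; split=> //.
exact: (exc_off_conic infK char0 t_gt0 t_le4 tauP gpz phiE hw ox' ns AE).
Qed.

Lemma exc_exc_limit i j w w' A : let zi := pvec (z i) in let zj := pvec (z j) in
  free2 zi w -> free2 zj w' ->
  spans A (tau zi zi w) (tau zj zj w') -> degenerate A -> limit_pair A.
Proof.
move=> zi zj fw fw' sA dA; have [_ _ AE] := sA.
have [ij|ij] := eqVneq i j.
  have EA : usets_in 2 (E i) A.
    apply/(usets_inP _ sA); split; apply/(exceptionalP infK char0 t_gt0 t_le4 tauP gpz phiE).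
      by exists w.
    by exists w'; rewrite ?ij.
  have [t1|t1] := eqVneq t 1%N; first by right; right; split=> //; exists i.
  have [j' ij'] : exists j', i != j'.
    have t2 : (1 < t)%N by rewrite ltn_neqAle eq_sym t1.
    have [i0|i0] := eqVneq i (Ordinal t_gt0); last by exists (Ordinal t_gt0).
    by exists (Ordinal t2); rewrite i0.
  by left; exists j'; exact: (exc_same infK char0 t_gt0 t_le4 tauP gpz phiE ij').
have [hw|hw] := eqVneq (br zi zj w) 0.
  left; exists i; exact: (exc_exc_chord infK char0 t_gt0 t_le4 tauP gpz phiE ij fw fw' hw AE).
have [hw'|hw'] := eqVneq (br zi zj w') 0.
  left; exists j; rewrite eq_sym in ij; rewrite fsetUC in AE.
  have hw2 : br zj zi w' = 0 by rewrite brC12 hw' oppr0.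
  exact: (exc_exc_chord infK char0 t_gt0 t_le4 tauP gpz phiE ij fw' fw hw2 AE).
have ns : ~ separates (fun q => qd q zi w) (fun q => qd q zj w').
  move=> sep; have [v [v0 + +]] := dA _ _ sA.
  move=> /(proj2 (tangent_exc infK char0 t_gt0 t_le4 tauP gpz phiE fw))[a [k vE]].
  move=> /(proj2 (tangent_exc infK char0 t_gt0 t_le4 tauP gpz phiE fw'))[b [k' vE']].
  case/negP: v0; rewrite vE; apply/eqP.
  apply: (nondeg_exc2 infK char0 t_gt0 t_le4 tauP gpz ij hw hw' sep (b := b) (k' := k')).
  by rewrite -vE -vE'.
have [t3|t4] := nseparates_t4 True.
  by case: ns; exact: (separates_exc2 infK t_gt0 t_le4 gpz).
right; left; split=> //.
exact: (exc_exc_conic infK char0 t_gt0 t_le4 tauP gpz phiE ij hw fw' ns AE).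
Qed.

Lemma degenerate_limit A : usets_in 2 X A -> degenerate A -> limit_pair A.
Proof.
move=> XA; have [y1 [y2 sA]] := spansP A; have [X1 X2] := proj1 (usets_inP X sA) XA.
have [n1 n2 AE] := sA.
have nzo := tau_off_neq0 infK char0 t_gt0 t_le4 tauP gpz.
have nze := tau_exc_neq0 infK char0 t_gt0 t_le4 tauP gpz.
have xP := del_pezzoP infK char0 t_gt0 t_le4 tauP gpz phiE.
case/xP: X1 => [[x ox p1]|[i [w [fw p1]]]]; case/xP: X2 => [[x' ox' p2]|[j [w' [fw' p2]]]];
  rewrite p1 p2 in AE.
- exact: (off_off_limit ox ox' (Spans (nzo _ ox) (nzo _ ox') AE)).
- rewrite fsetUC in AE; exact: (exc_off_limit fw' ox (Spans (nze _ _ fw') (nzo _ ox) AE)).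
- exact: (exc_off_limit fw ox' (Spans (nze _ _ fw) (nzo _ ox') AE)).
- exact: (exc_exc_limit fw fw' (Spans (nze _ _ fw) (nze _ _ fw') AE)).
Qed.

(** E_i is the projective line spanned by tau a a u and tau a a v0, so the linear forms that kill
    both vectors cut it out. *)
Lemma closed_exceptional i : closed (E i).
Proof.
set a := pvec (z i); have [u [v0 huv]] := free2_ex (pvec_neq0 (z i)).
pose M := col_mx (tau a a u) (tau a a v0).
pose I := [set c : 'cV[K]_N.+1 | M *m c = 0].
suff -> : E i = \bigcap_(c in I) [set p | lf c (pvec p) = 0].
  by apply: closed_bigI => c _; exact: closed_form (form_lf c).
have eP := exceptionalP infK char0 t_gt0 t_le4 tauP gpz phiE i.
have lfM c (v : 'rV[K]_N.+1) : lf c v = (v *m c) 0 0.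
  by rewrite lfE mxE; apply: eq_bigr => k _; rewrite mulrC.
apply/seteqP; split=> p.
  move=> /eP[w fw ->] c Ic; apply/eqP; rewrite (form_Pt (form_lf c)); last first.
    exact: (tau_exc_neq0 infK char0 t_gt0 t_le4 tauP gpz fw).
  have [k [l [m ->]]] := cramer_coord w huv.
  rewrite -addrA (tauD3 tauP) (tauZ3 tauP) (tau_z tauP) scaler0 add0r (tauD3 tauP) !(tauZ3 tauP).
  have := Ic; rewrite /I /= mul_col_mx -(col_mx0 K 1 1 1) => /eq_col_mx[h1 h2].
  by rewrite lfD !lfZ !lfM h1 h2 !mxE !mulr0 addr0.
move=> hp; have /submxP[D pE] : (pvec p <= M)%MS.
  rewrite submxE; apply/eqP/matrixP => i0 k; rewrite [i0]ord1 [RHS]mxE.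
  have := hp (col k (cokermx M)); rewrite /I /= colE mulmxA mulmx_coker mul0mx => /(_ erefl).
  by rewrite /lf mulmxA -colE mxE.
apply/eP; move: pE; rewrite -[D]hsubmxK mul_row_col [lsubmx D]mx11_scalar [rsubmx D]mx11_scalar.
rewrite !mul_scalar_mx; set k := _ 0 0; set l := _ 0 0 => pE.
have vE : pvec p = tau a a (k *: u + l *: v0) by rewrite (tauD3 tauP) !(tauZ3 tauP).
exists (k *: u + l *: v0); last by rewrite -vE PtK.
have [k0|k0] := eqVneq k 0.
  have l0 : l != 0.
    by apply: contraNneq (pvec_neq0 p) => l0; rewrite pE k0 l0 !scale0r addr0.
  rewrite k0 scale0r add0r; have [_ fav _] := br_neq0_free huv; have := free2_comb 0 fav l0.
  by rewrite scale0r add0r.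
exists v0; rewrite !brE mulr0 addr0 mulf_neq0 //.
Qed.

Definition degenerate_pairs : set (uset K N 2) := [set A | usets_in 2 X A /\ degenerate A].

Lemma Y_degenerate_pairs i : Yset i `<=` degenerate_pairs.
Proof.
move=> A YA; split; last exact: (Y_degenerate infK char0 t_gt0 t_le4 tauP gpz phiE YA).
have YP := YsetP infK char0 t_gt0 t_le4 tauP gpz phiE.
exact: (off_pair_in infK char0 t_gt0 t_le4 tauP gpz phiE (proj1 (YP _ _) YA)).
Qed.

Lemma U_degenerate_pairs : (N <= 5)%N -> Uset `<=` degenerate_pairs.
Proof.
move=> N5 A UA; split; last exact: (U_degenerate infK char0 t_gt0 t_le4 tauP gpz phiE N5 UA).
have UP := UsetP infK char0 t_gt0 t_le4 tauP gpz phiE.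
exact: (off_pair_in infK char0 t_gt0 t_le4 tauP gpz phiE (proj1 (UP _) UA)).
Qed.

Lemma closure_min (T : topologicalType) (D C : set T) :
  closed C -> D `<=` C -> closure D `<=` C.
Proof. by move=> cC DC; rewrite closureE => y; apply; split. Qed.

Lemma closed_limit_Y : closed (\bigcup_i closure (Yset i)).
Proof.
by apply: closed_bigcup => [|i _]; [exact: finite_finset|exact: closed_closure].
Qed.

Local Notation Ter := (terracini 2 X).
Local Notation terE := (terraciniE infK char0 t_gt0 t_le4 tauP gpz phiE).

Lemma terracini1 i : t = 1%N -> Ter = closure2 z phi (Yset i) `|` usets_in 2 (E i).
Proof.
move=> t1; have iE j : j = i.
  apply/val_inj; have := ltn_ord i; have := ltn_ord j.
  by rewrite /= {2 4}t1 !ltnS !leqn0 => /eqP-> /eqP->.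
rewrite terE -/degenerate_pairs; apply/seteqP; split=> A.
  move=> [XA]; have : closure degenerate_pairs `<=` closure (Yset i) `|` usets_in 2 (E i).
    apply: closure_min.
      by apply: closedU; [exact: closed_closure|by apply: closed_usets_in; exact: closed_exceptional].
    move=> B [XB dB]; case: (degenerate_limit XB dB) => [[j]|[[t4 _]|[_ [j]]]].
    - by rewrite (iE j); left.
    - by rewrite t1 in t4.
    - by rewrite (iE j); right.
  by move=> h /h[]; [left|right].
case=> [[XA YA]|EA].
  by split=> //; apply: (closure_subset (@Y_degenerate_pairs i)).
have [dA XA] := E_degenerate infK char0 t_gt0 t_le4 tauP gpz phiE EA.
by split=> //; apply: subset_closure.
Qed.

Lemma terracini23 : (2 <= t <= 3)%N -> Ter = \bigcup_i closure2 z phi (Yset i).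
Proof.
move=> t23; rewrite terE -/degenerate_pairs; apply/seteqP; split=> A.
  move=> [XA]; have : closure degenerate_pairs `<=` \bigcup_i closure (Yset i).
    apply: (closure_min closed_limit_Y) => B [XB dB].
    case: (degenerate_limit XB dB) => [[j Yj]|[[t4 _]|[t1 _]]]; first by exists j.
      by rewrite t4 in t23.
    by rewrite t1 in t23.
  by move=> h /h[i _ YA]; exists i.
move=> [i _ [XA YA]]; split=> //.
by apply: (closure_subset (@Y_degenerate_pairs i)).
Qed.

Lemma terracini4 : t = 4%N -> (N <= 5)%N ->
  Ter = (\bigcup_i closure2 z phi (Yset i)) `|` closure2 z phi Uset.
Proof.
move=> t4 N5; rewrite terE -/degenerate_pairs; apply/seteqP; split=> A.
  move=> [XA]; have : closure degenerate_pairs `<=`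
      (\bigcup_i closure (Yset i)) `|` closure Uset.
    apply: closure_min => [|B].
      by apply: closedU; [exact: closed_limit_Y|exact: closed_closure].
    move=>  [XB dB]; case: (degenerate_limit XB dB) => [[j Yj]|[[_ UB]|[t1 _]]].
    - by left; exists j.
    - by right.
    - by rewrite t4 in t1.
  by move=> h /h[[i _ YA]|UA]; [left; exists i|right].
case=> [[i _ [XA YA]]|[XA UA]]; split=> //.
  by apply: (closure_subset (@Y_degenerate_pairs i)).
by apply: (closure_subset (U_degenerate_pairs N5)).
Qed.

End TerraciniLocus.

(** * The components of pairs on lines through a point of Z *)

Section LineComponents.
Variable K : fieldType.
Hypothesis infK : forall s : seq K, exists x, x \notin s.
Hypothesis char0 : forall n, n.+1%:R != 0 :> K.
Variables (t N : nat) (z : 'I_t -> projsp K 2) (phi : N.+1.-tuple (dhomog 3 K 3)).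
Variable tau : 'rV[K]_3 -> 'rV[K]_3 -> 'rV[K]_3 -> 'rV[K]_N.+1.
Hypotheses (t_gt0 : (0 < t)%N) (t_le4 : (t <= 4)%N).
Local Notation zv := (fun i => pvec (z i)).
Hypotheses (tauP : cubic_map zv tau) (gpz : gp zv)
  (phiE : forall x : 'rV[K]_3, \row_j meval (x 0) (tnth phi j) = tau x x x).
Local Notation V := 'rV[K]_3.
Implicit Types (u v w x : V) (y : 'rV[K]_N.+1).
Add Ring K_ring : (kring_theory K).

Local Notation off := (off z).
Local Notation X := (del_pezzo z phi).
Local Notation tau3 x := (tau x x x).
Local Notation Yset i := (Yset z phi i).

Lemma bipoly_regular (F : K -> K -> K) :
  (forall Y (A : set (Y -> K)) f g, subalg A -> A f -> A g -> A (fun s => F (f s) (g s))) ->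
  bipoly F.
Proof. by move=> h d f g pf pg; apply: h => //; exact: subalg_mpolyfun. Qed.

(** In the basis z_i, p, q, the value of c selects a line through z_i and a a point on it. The cubic
    made of the line c = 0 and a conic missing a point of the line c = 1 serves as the hyperplane of
    [ruled_pairs_dim]. *)
Lemma component_Y i : irreducible_set (closure2 z phi (Yset i)) /\
  has_dim (closure2 z phi (Yset i)) 3.
Proof.
have [q [p hpq]] := transversal_points infK z.
set a0 := pvec (z i); have hB : br a0 p q != 0 by exact: hpq.
pose x (a c : K) : V := a *: a0 + p + c *: q.
pose h (a c : K) := \prod_j br (pvec (z j)) (x a c) q.
pose G a c := tau3 (x a c).
have rx (Y : Type) (A : set (Y -> K)) f g : subalg A -> A f -> A g ->
    regular A (fun s => x (f s) (g s)) by move=> sA Af Ag; rewrite /x; regular_tac sA.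
have ph : bipoly h.
  apply: bipoly_regular => Y A f g sA Af Ag; apply: (subalg_prod sA) => j _.
  by have r := rx _ _ _ _ sA Af Ag; regular_tac sA.
have pG k : bipoly (fun a c => G a c 0 k).
  by apply: bipoly_regular => Y A f g sA Af Ag; apply: (regular_tau tauP sA); exact: rx.
have hj a c j : h a c != 0 -> br (pvec (z j)) (x a c) q != 0.
  by move=> hac; apply: contraNneq hac => hj; rewrite /h (bigD1 j) //= hj mul0r.
have off_h a c : h a c != 0 -> off (x a c) by move=> /hj hac j; exists q.
have nzo := tau_off_neq0 infK char0 t_gt0 t_le4 tauP gpz.
have nz a c : h a c != 0 -> G a c != 0 by move=> /off_h; exact: nzo.
have xp a c : br a0 (x a c) q = br a0 p q by rewrite /x !brE !mulr0 add0r addr0.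
have xa a c : br (x a c) p q = a * br a0 p q by rewrite /x !brE !mulr0 !addr0.
have xq a c : br a0 p (x a c) = c * br a0 p q by rewrite /x !brE !mulr0 !add0r.
have injx a b c k : x b c = k *: x a c -> a = b.
  move=> E; have := congr1 (fun v => br a0 v q) E; rewrite brZ2 !xp => /esym H.
  have k1 : k = 1 by apply: (mulIf hB); rewrite mul1r.
  have := congr1 (fun v => br v p q) E; rewrite k1 scale1r !xa => /(mulIf hB)-> //.
have injG a b c : h a c != 0 -> h b c != 0 -> a != b -> Pt (G a c) <> Pt (G b c).
  move=> ha hb /eqP ab; have [oa ob] := (off_h _ _ ha, off_h _ _ hb).
  move=> /(tau_inj infK char0 t_gt0 t_le4 tauP gpz oa ob).
  move=> /(Pt_eqP (off_neq0 t_gt0 oa) (off_neq0 t_gt0 ob))[k].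
  by move=> /injx.
have h0c c : h 0 c != 0.
  by apply/prodf_neq0 => j _; rewrite /x !brE mulr0 mul0r add0r addr0 hpq.
have [k1 [k2 [n1 n2 cq]]] := off_conic infK t_gt0 t_le4 gpz (off_h _ _ (h0c 1)).
have [|l [lE _ _]] := three_lines char0 tauP (k1 := brv a0 p) (k2 := k1) (k3 := k2).
  by move=> j; rewrite -mulrA cq mulr0.
have l0 a : lf l (G a 0) = 0 by rewrite /G lE lf_brv xq !mul0r.
have l1 : lf l (G 0 1) != 0 by rewrite /G lE lf_brv xq mul1r !mulf_neq0.
have YP := YsetP infK char0 t_gt0 t_le4 tauP gpz phiE.
have opX := off_pair_in infK char0 t_gt0 t_le4 tauP gpz phiE.
apply: (ruled_pairs_dim infK ph pG nz injG (h0c 0) (h0c 1) l0 l1) => A.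
  move=> [a [b [c [ha hb ab sA]]]]; have YA : Yset i A.
    apply/YP; exists (x a c), (x b c); split=> //; [exact: off_h|exact: off_h|].
    by rewrite -/a0 /x /br !coE; kring K.
  split; last exact: subset_closure.
  exact: (opX _ _ (proj1 (YP _ _) YA)).
move=> [_]; apply: (closure_min (@closed_closure _ _)) => {}A.
move=> /YP[y [y' [oy oy' sA hy]]].
have fy := spans_free infK char0 t_gt0 t_le4 tauP gpz oy oy' sA.
have [k [m yE']] : exists k m, y' = k *: y + m *: a0.
  have [|k [m E]] := br0_comb (u := a0) (x := y') (oy i); first by rewrite -br_rot.
  by exists m, k; rewrite E addrC.
have k0 : k != 0.
  apply/negP => /eqP k0; apply: (free2_scale (oy' i) (a := m)).
  by rewrite yE' k0 scale0r add0r.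
have gen (v : V) (r : K) : r != 0 -> generic (fun s => forall j, br (pvec (z j)) (v + s *: (r *: p)) q != 0).
  move=> r0; apply: generic_all => j; have sA1 := subalg_polyfun K; have pv := polyfun_var K.
  have pb : polyfun (fun s => br (pvec (z j)) (v + s *: (r *: p)) q) by regular_tac sA1.
  have [bv|bv] := eqVneq (br (pvec (z j)) v q) 0.
    by apply: (generic_neq0 (s0 := 1) pb); rewrite scale1r !brE bv add0r mulf_neq0.
  by apply: (generic_neq0 (s0 := 0) pb); rewrite scale0r addr0.
have apo := approaches_off infK char0 t_gt0 t_le4 tauP gpz.
(* A pair outside the parametrized family is moved by s p and s k p. As y' = k y + m z_i, the moved
   points stay collinear with z_i, and for general s they lie in the family. *)
have := apo _ (regular_line y (1 *: p)); rewrite scale0r addr0 => /(_ oy) hx1.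
have := apo _ (regular_line y' (k *: p)); rewrite scale0r addr0 => /(_ oy') hx2.
have [_ _ AE] := sA.
apply: (closure_pair infK char0 t_gt0 t_le4 tauP gpz (@closed_closure _ _) hx1 hx2 AE).
apply: genericW (genericI (gen y 1 (oner_neq0 _)) (gen y' k k0)) _ => s [g1 g2] o1 o2 A' sA'.
apply: subset_closure; move: g1 g2 o1 o2 sA'; rewrite scale1r.
set v := y + s *: p; set v' := y' + _ => g1 g2 o1 o2 sA'.
have vE' : v' = k *: v + m *: a0 by rewrite /v' yE' /v; apply: row3P; rewrite !coE; kring K.
have [e1 [e2 [e3 vE]]] := cramer_coord v hB.
have e20 : e2 != 0.
  by apply: contraNneq (g1 i) => e20; rewrite vE e20 -/a0 !brE !mulr0 !mul0r !addr0.
have v_x : v = e2 *: x (e1 / e2) (e3 / e2).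
  by rewrite vE /x !scalerDr !scalerA ![e2 * (_ / _)]mulrC !divfK.
have v'_x : v' = (k * e2) *: x ((k * e1 + m) / (k * e2)) (e3 / e2).
  rewrite vE' vE /x !scalerDr !scalerA ![k * e2 * (_ / _)]mulrC divfK ?mulf_neq0 //.
  rewrite [e3 / e2 * _]mulrCA divfK //; apply: row3P; rewrite !coE; kring K.
have ke2 : k * e2 != 0 by rewrite mulf_neq0.
have h1 : h (e1 / e2) (e3 / e2) != 0.
  apply/prodf_neq0 => j _; have := g1 j; rewrite v_x brZ2 mulf_eq0 negb_or.
  by case/andP.
have h2 : h ((k * e1 + m) / (k * e2)) (e3 / e2) != 0.
  apply/prodf_neq0 => j _; have := g2 j; rewrite v'_x brZ2 mulf_eq0 negb_or.
  by case/andP.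
exists (e1 / e2), ((k * e1 + m) / (k * e2)), (e3 / e2).
have [_ _ AE'] := sA'; have sne := spans_neq sA'.
rewrite v_x v'_x !(tau_diagZ tauP) -/(G _ _) -/(G _ _) in AE' sne.
rewrite !PtZ ?expf_neq0 ?nz // in AE' sne.
split=> //; last exact: (Spans (nz _ _ h1) (nz _ _ h2) AE').
by apply/negP => /eqP E; apply: sne; rewrite E.
Qed.

(** The two cubics made of k1, k2 and the lines z_j u, z_j v compute the projection from z_j. The
    closed condition [cross] = 0 says that both points have the same projection or that k1 k2
    vanishes at one of them. At points of E_j the same forms compute the direction, so distinct
    directions are told apart as well. *)
Lemma separating_set j (k1 k2 : 'cV[K]_3) :
  (forall i, i != j -> lf k1 (pvec (z i)) * lf k2 (pvec (z i)) = 0) ->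
  exists C : set (uset K N 2), [/\ closed C, Yset j `<=` C,
    forall A x (x' : V), spans A (tau3 x) (tau3 x') -> br (pvec (z j)) x x' != 0 ->
      lf k1 x * lf k2 x != 0 -> lf k1 x' * lf k2 x' != 0 -> ~ C A &
    forall A w w', lf k1 (pvec (z j)) * lf k2 (pvec (z j)) != 0 -> br (pvec (z j)) w w' != 0 ->
      spans A (tau (pvec (z j)) (pvec (z j)) w) (tau (pvec (z j)) (pvec (z j)) w') -> ~ C A].
Proof.
set a := pvec (z j) => hk; have [u [v huv]] := free2_ex (pvec_neq0 (z j)).
have hz w : forall i, lf (brv a w) (pvec (z i)) * lf k1 (pvec (z i)) * lf k2 (pvec (z i)) = 0.
  move=> i; rewrite lf_brv; have [->|ij] := eqVneq i j; first by rewrite br_uwu !mul0r.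
  by rewrite -mulrA hk // mulr0.
have [c1 [E1 P1 _]] := three_lines char0 tauP (hz u).
have [c2 [E2 P2 _]] := three_lines char0 tauP (hz v).
pose cross (y y' : 'rV[K]_N.+1) := lf c1 y * lf c2 y' - lf c2 y * lf c1 y'.
have crossZ k k' y y' : cross (k *: y) (k' *: y') = k * k' * cross y y'.
  by rewrite /cross !lfZ; kring K.
have crossC y y' : cross y' y = - cross y y' by rewrite /cross; kring K.
pose C := [set A : uset K N 2 | exists y y', spans A y y' /\ cross y y' = 0].
have CP A y y' : spans A y y' -> C A <-> cross y y' = 0.
  move=> sA; split=> [[x [x' [sA' h]]]|h]; last by exists y, y'.
  have [y0 y'0 _] := sA; have [x0 x'0 _] := sA'.
  have := spans_points sA' (points_of_mpt sA); rewrite /mpt /pairv /=.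
  case=> -[/esym/(Pt_eqP _ _)+ /esym/(Pt_eqP _ _)].
    by move=> /(_ x0 y0)[k ->] /(_ x'0 y'0)[k' ->]; rewrite crossZ h mulr0.
  by move=> /(_ x'0 y0)[k ->] /(_ x0 y'0)[k' ->]; rewrite crossZ crossC h oppr0 mulr0.
have cross_off x (x' : V) : cross (tau3 x) (tau3 x') =
    (lf k1 x * lf k2 x) * (lf k1 x' * lf k2 x') * (br a u v * br a x x').
  rewrite /cross !E1 !E2 !lf_brv.
  have -> : br a u v * br a x x' = br a u x * br a v x' - br a v x * br a u x'.
    by rewrite /br; kring K.
  by kring K.
exists C; split.
- have m (c : 'cV[K]_N.+1) i := mform_form (n := fun _ : 'I_2 => N) (i := i) (form_lf c).
  have mh : mform (fun _ : 'I_2 => 1%N) (fun w : vecs K (fun _ : 'I_2 => N) => cross (w 0) (w 1)).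
    by apply: mform_sub; [apply: mform_deg (mform_mul (m c1 0) (m c2 1)) _
      |apply: mform_deg (mform_mul (m c2 0) (m c1 1)) _] => i; case: (ord2P i) => ->.
  by apply: (closed_pairs mh) => A y y' /CP.
- move=> A /(YsetP infK char0 t_gt0 t_le4 tauP gpz phiE)[x [x' [ox ox' sA hx]]].
  by apply/(CP _ _ _ sA); rewrite cross_off -(br_rot a x) /a hx !mulr0.
- move=> A x x' sA hx h h' /(CP _ _ _ sA)/eqP; apply/negP.
  by rewrite cross_off (mulf_neq0 (mulf_neq0 h h') (mulf_neq0 huv hx)).
- move=> A w w' ha hw sA /(CP _ _ _ sA) H; move/eqP: hw; apply.
  have e (c : 'cV[K]_N.+1) r : (forall x w, 3%:R * lf c (tau x x w) = lf (brv a r) w * lf k1 x * lf k2 x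
      + lf (brv a r) x * lf k1 w * lf k2 x + lf (brv a r) x * lf k1 x * lf k2 w) ->
      forall w, 3%:R * lf c (tau a a w) = br a r w * (lf k1 a * lf k2 a).
    by move=> h w0; rewrite h !lf_brv br_uwu; kring K.
  have n9 : br a u v * ((lf k1 a * lf k2 a) * (lf k1 a * lf k2 a)) != 0.
    exact: (mulf_neq0 huv (mulf_neq0 ha ha)).
  apply: (mulIf n9); rewrite mul0r.
  have -> : br a w w' * (br a u v * (lf k1 a * lf k2 a * (lf k1 a * lf k2 a))) =
    (br a u w * (lf k1 a * lf k2 a)) * (br a v w' * (lf k1 a * lf k2 a))
    - (br a v w * (lf k1 a * lf k2 a)) * (br a u w' * (lf k1 a * lf k2 a)).
    by rewrite /br; kring K.
  rewrite -!(e _ _ P1) -!(e _ _ P2).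
  by transitivity (3%:R * 3%:R * cross (tau a a w) (tau a a w')); [rewrite /cross; kring K|rewrite H mulr0].
Qed.

End LineComponents.

(** * The component of pairs on conics through four points *)

Section ConicComponent.
Variable K : fieldType.
Hypothesis infK : forall s : seq K, exists x, x \notin s.
Hypothesis char0 : forall n, n.+1%:R != 0 :> K.
Variables (t N : nat) (z : 'I_t -> projsp K 2) (phi : N.+1.-tuple (dhomog 3 K 3)).
Variable tau : 'rV[K]_3 -> 'rV[K]_3 -> 'rV[K]_3 -> 'rV[K]_N.+1.
Hypotheses (t_gt0 : (0 < t)%N) (t_le4 : (t <= 4)%N).
Local Notation zv := (fun i => pvec (z i)).
Hypotheses (tauP : cubic_map zv tau) (gpz : gp zv)
  (phiE : forall x : 'rV[K]_3, \row_j meval (x 0) (tnth phi j) = tau x x x).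
Local Notation V := 'rV[K]_3.
Implicit Types (u v w x : V) (y : 'rV[K]_N.+1).
Add Ring K_ring : (kring_theory K).

Local Notation off := (off z).
Local Notation frame := (frame z).
Local Notation X := (del_pezzo z phi).
Local Notation tau3 x := (tau x x x).
Local Notation Yset i := (Yset z phi i).
Local Notation Uset := (Uset z phi).
Hypothesis t4 : t = 4%N.

Lemma eq_neq0 (k l : K) : k = l -> l != 0 -> k != 0.
Proof. by move=> ->. Qed.

Lemma frame4 : exists a b c d, frame a b c d /\
  forall e, e \in [:: a; b; c; d] -> exists i, e = pvec (z i).
Proof.
have [|e [ge ez _]] := frame_exists infK t_gt0 t_le4 gpz (L := [::]); first by [].
have eP j : exists i, e j = pvec (z i).
  have jt : (j < t)%N by rewrite t4 ltn_ord.
  by exists (Ordinal jt); exact: ez.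
pose o0 : 'I_4 := Ordinal (isT : (0 < 4)%N); pose o1 : 'I_4 := Ordinal (isT : (1 < 4)%N).
pose o2 : 'I_4 := Ordinal (isT : (2 < 4)%N); pose o3 : 'I_4 := Ordinal (isT : (3 < 4)%N).
exists (e o0), (e o1), (e o2), (e o3); split; last first.
  by move=> v; rewrite !inE => /or4P[]/eqP->; exact: eP.
split; first exact: gp_gen4.
move=> i; rewrite -(ez i (widen_ord t_le4 i)) //.
case: (widen_ord t_le4 i) => -[|[|[|[|//]]]] hm; [apply: Or41|apply: Or42|apply: Or43|apply: Or44];
  by congr e; exact: val_inj.
Qed.

Section Frame.
Variables a b c d : V.
Hypotheses (fr : frame a b c d) (frz : forall e, e \in [:: a; b; c; d] -> exists i, e = pvec (z i)).
Variables al be ga : K.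
Hypotheses (dE : d = al *: a + be *: b + ga *: c) (al0 : al != 0) (be0 : be != 0) (ga0 : ga != 0).

(* In the coordinates given by [pt], d is the point (1 : 1 : 1). *)
Definition pt (r0 r1 r2 : K) : V := (r0 * al) *: a + (r1 * be) *: b + (r2 * ga) *: c.
Definition conic_eq (k l r0 r1 r2 : K) := k * (r2 * (r1 - r0)) + l * (r1 * (r2 - r0)).

Let abc : br a b c != 0. Proof. by case: fr => -[]. Qed.
Let M := al * be * ga * br a b c ^+ 2.
Let M0 : M != 0. Proof. by rewrite /M !mulf_neq0 ?expf_neq0. Qed.

Lemma pencil1_pt r0 r1 r2 : pencil1 a b c d (pt r0 r1 r2) = M * (r2 * (r1 - r0)).
Proof.
rewrite /pencil1 /pt dE /M; have Ec : br c b a = - br a b c by rewrite /br; kring K.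
have Ed : br c a b = br a b c by rewrite /br; kring K.
by rewrite !brE Ec Ed; kring K.
Qed.

Lemma pencil2_pt r0 r1 r2 : pencil2 a b c d (pt r0 r1 r2) = M * (r1 * (r2 - r0)).
Proof.
rewrite /pencil2 /pt dE /M; have Ec : br b c a = br a b c by rewrite /br; kring K.
have Ed : br b a c = - br a b c by rewrite /br; kring K.
have Ee : br a c b = - br a b c by rewrite /br; kring K.
by rewrite !brE Ec Ed Ee; kring K.
Qed.

Lemma member_pt k l r0 r1 r2 : member a b c d k l (pt r0 r1 r2) = M * conic_eq k l r0 r1 r2.
Proof. by rewrite /member pencil1_pt pencil2_pt /conic_eq; kring K. Qed.

Lemma pt_ex x : exists r0 r1 r2, x = pt r0 r1 r2.
Proof.
have [k [l [m xE]]] := cramer_coord x abc.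
by exists (k / al), (l / be), (m / ga); rewrite /pt !divfK.
Qed.

Lemma br_pt r0 r1 r2 s0 s1 s2 m0 m1 m2 :
  br (pt r0 r1 r2) (pt s0 s1 s2) (pt m0 m1 m2) = al * be * ga * br a b c *
  (r0 * (s1 * m2 - s2 * m1) - r1 * (s0 * m2 - s2 * m0) + r2 * (s0 * m1 - s1 * m0)).
Proof. by rewrite /pt /br !coE; kring K. Qed.

Lemma base_pt : [/\ a = al^-1 *: pt 1 0 0, b = be^-1 *: pt 0 1 0, c = ga^-1 *: pt 0 0 1 &
  d = pt 1 1 1].
Proof.
rewrite /pt !mul1r !mul0r !scale0r !addr0 !add0r !scalerA !mulVf // !scale1r.
by split.
Qed.

Let Vn0 : (al^-1 != 0) * (be^-1 != 0) * (ga^-1 != 0).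
Proof. by rewrite !invr_eq0. Qed.

Lemma off_pt r0 r1 r2 : r0 != 0 -> r1 != 0 -> r2 != 0 -> r0 != r1 -> off (pt r0 r1 r2).
Proof.
move=> n0 n1 n2 n01 i; have [_ cov] := fr; have [aE bE cE dE'] := base_pt.
have nz : al * be * ga * br a b c != 0 by rewrite !mulf_neq0.
have n10 : r1 - r0 != 0 by rewrite subr_eq0 eq_sym.
case: (cov i) => ->; [rewrite aE; exists (pt 0 1 0)|rewrite bE; exists (pt 1 0 0)|
  rewrite cE; exists (pt 1 0 0)|rewrite dE'; exists (pt 0 0 1)];
  rewrite ?brZ1 br_pt ?mulf_neq0 ?Vn0 //.
- by apply: (@eq_neq0 _ (- r2)); [kring K|rewrite oppr_eq0].
- by apply: (@eq_neq0 _ r2); [kring K|].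
- by apply: (@eq_neq0 _ (- r1)); [kring K|rewrite oppr_eq0].
- by apply: (@eq_neq0 _ (r1 - r0)); [kring K|].
Qed.

Lemma off_pt_inv r0 r1 r2 : off (pt r0 r1 r2) ->
  [/\ r0 = 0 -> r1 = 0 -> False, r0 = 0 -> r2 = 0 -> False, r1 = 0 -> r2 = 0 -> False &
      r0 = r1 -> r0 = r2 -> False].
Proof.
move=> o; have fe e : e \in [:: a; b; c; d] -> free2 e (pt r0 r1 r2).
  by move=> /frz[i ->]; exact: o.
have nf u v (s : K) : u = s *: v -> free2 v u -> False by move=> E f; exact: free2_scale f E.
split=> [h h'|h h'|h h'|h h'].
- apply: (nf _ c (r2 * ga)); last by apply: fe; rewrite !inE eqxx !orbT.
  by rewrite /pt h h' !mul0r !scale0r !add0r.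
- apply: (nf _ b (r1 * be)); last by apply: fe; rewrite !inE eqxx !orbT.
  by rewrite /pt h h' !mul0r !scale0r addr0 add0r.
- apply: (nf _ a (r0 * al)); last by apply: fe; rewrite !inE eqxx.
  by rewrite /pt h h' !mul0r !scale0r !addr0.
- apply: (nf _ d r0); last by apply: fe; rewrite !inE eqxx !orbT.
  by rewrite /pt -h -h' dE !scalerDr !scalerA.
Qed.

(** Up to a common factor these coordinates are 1/r, 1/(r+1), 1/(r+s): the line of the points (r :
    r+1 : r+s) through (1 : 1 : 1) under the standard Cremona inversion, which exchanges such lines
    with the conics through the frame. *)
Definition Ucurve (r s : K) : V := pt ((r + 1) * (r + s)) (r * (r + s)) (r * (r + 1)).
Definition Udom (r s : K) := r * (r + 1) * (r + s).

Lemma Udom_neq0 r s : Udom r s != 0 -> [/\ r != 0, r + 1 != 0 & r + s != 0].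
Proof. by rewrite !mulf_eq0 !negb_or => /andP[/andP[]]. Qed.

Lemma off_Ucurve r s : Udom r s != 0 -> off (Ucurve r s).
Proof.
move=> /Udom_neq0[n0 n1 n2]; apply: off_pt; try exact: mulf_neq0.
by rewrite -subr_eq0; apply: (@eq_neq0 _ (r + s)); [kring K|].
Qed.

Lemma Ucurve_conic r s : conic_eq (- s) 1 ((r + 1) * (r + s)) (r * (r + s)) (r * (r + 1)) = 0.
Proof. by rewrite /conic_eq; kring K. Qed.

Lemma Ucurve_member r s : member a b c d (- s) 1 (Ucurve r s) = 0.
Proof. by rewrite member_pt Ucurve_conic mulr0. Qed.

Lemma Ucurve_inj r r' s k : Udom r s != 0 -> Udom r' s != 0 ->
  Ucurve r' s = k *: Ucurve r s -> r = r'.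
Proof.
move=> /Udom_neq0[n0 n1 n2] /Udom_neq0[n0' n1' n2'] E.
have := congr1 (fun v => br (Ucurve r s) v (pt 0 0 1)) E.
rewrite brZ2 br_uu mulr0 br_pt => /eqP; rewrite mulf_eq0 => /orP[|].
  by rewrite !mulf_eq0 (negbTE al0) (negbTE be0) (negbTE ga0) (negbTE abc).
rewrite (_ : _ - _ + _ = (r + s) * (r' + s) * (r' - r)); last by kring K.
by rewrite !mulf_eq0 (negbTE n2) (negbTE n2') /= subr_eq0 => /eqP.
Qed.

(** The points off the triangle abc and off the line cd, where the parameter r of [Ucurve] can be
    recovered by division. *)
Definition Unice (r0 r1 r2 : K) := [&& r0 != 0, r1 != 0, r2 != 0 & r0 != r1].

Lemma Unice_Ucurve k l r0 r1 r2 : (k != 0) || (l != 0) -> Unice r0 r1 r2 ->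
  conic_eq k l r0 r1 r2 = 0 ->
  exists r m, [/\ m != 0, Udom r (- k / l) != 0 & pt r0 r1 r2 = m *: Ucurve r (- k / l)].
Proof.
move=> kl /and4P[n0 n1 n2 n01] E.
have n10 : r0 - r1 != 0 by rewrite subr_eq0.
have l0 : l != 0.
  move: kl; rewrite orbC; case: eqVneq => //= l0 k0; move/eqP: E.
  by rewrite /conic_eq l0 mul0r addr0 !mulf_eq0 (negbTE k0) (negbTE n2) -opprB oppr_eq0 (negbTE n10).
(* The first two coordinates of [Ucurve] are in the ratio r + 1 : r, and the member given by k, l is
   the one with s = - k / l. *)
pose r := r1 / (r0 - r1); set s := - k / l.
have r1E : r * (r0 - r1) = r1 by rewrite divfK.
have rE1 : (r + 1) * (r0 - r1) = r0 by rewrite mulrDl r1E mul1r addrC subrK.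
have rEs : (r + s) * (r0 - r1) * r2 = r0 * r1.
  apply: (mulfI l0).
  have -> : l * ((r + s) * (r0 - r1) * r2) = l * r2 * (r * (r0 - r1)) + (s * l) * (r0 - r1) * r2.
    kring K.
  by rewrite r1E /s divfK // -[RHS]addr0 -E /conic_eq; kring K.
have rn : r != 0 by rewrite mulf_neq0 // invr_eq0.
have r1n : r + 1 != 0 by apply: contraNneq n0 => h; rewrite -rE1 h mul0r.
have rsn : r + s != 0.
  apply/negP => /eqP h; move/eqP: rEs; rewrite h !mul0r eq_sym mulf_eq0 (negbTE n0) (negbTE n1).
  by [].
exists r, ((r0 - r1) ^+ 2 * r2 / (r0 * r1)); split; last 2 first.
- exact: (mulf_neq0 (mulf_neq0 rn r1n) rsn).
- have nn : r0 * r1 != 0 by rewrite mulf_neq0.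
  apply: (scalerI nn); rewrite scalerA [r0 * r1 * _]mulrC divfK //.
  rewrite /Ucurve; set D := r0 - r1.
  have F0 : D ^+ 2 * r2 * ((r + 1) * (r + s)) = r0 * r1 * r0.
    transitivity (((r + 1) * D) * ((r + s) * D * r2)); first by kring K.
    by rewrite rE1 rEs; kring K.
  have F1 : D ^+ 2 * r2 * (r * (r + s)) = r0 * r1 * r1.
    transitivity ((r * D) * ((r + s) * D * r2)); first by kring K.
    by rewrite r1E rEs; kring K.
  have F2 : D ^+ 2 * r2 * (r * (r + 1)) = r0 * r1 * r2.
    transitivity ((r * D) * ((r + 1) * D) * r2); first by kring K.
    by rewrite r1E rE1; kring K.
  by rewrite /pt !scalerDr !scalerA !mulrA -F0 -F1 -F2 !mulrA.
- by rewrite mulf_neq0 ?invr_eq0 ?mulf_neq0 // expf_neq0.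
Qed.

Let G r s := tau3 (Ucurve r s).

Lemma frame_free4 x : off x -> [/\ free2 a x, free2 b x, free2 c x & free2 d x].
Proof.
move=> ox; have fe e : e \in [:: a; b; c; d] -> free2 e x by move=> /frz[i ->]; exact: ox.
by split; apply: fe; rewrite !inE eqxx ?orbT.
Qed.

Lemma Unice_member k l r0 r1 r2 q0 q1 q2 :
  off (pt q0 q1 q2) -> k = M * (r1 * (r2 - r0)) -> l = - (M * (r2 * (r1 - r0))) ->
  [/\ r0 != 0, r1 != 0 & r2 != 0] -> [/\ r1 - r0 != 0, r2 - r0 != 0 & r2 - r1 != 0] ->
  conic_eq k l q0 q1 q2 = 0 -> Unice q0 q1 q2.
Proof.
move=> /off_pt_inv[o01 o02 o12 oo] kE lE [n0 n1 n2] [n10 n20 n21] E.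
have k0 : k != 0 by rewrite kE !mulf_neq0.
have l0 : l != 0 by rewrite lE oppr_eq0 !mulf_neq0.
have kl : k + l != 0.
  by apply: (@eq_neq0 _ (M * (r0 * (r2 - r1)))); [rewrite kE lE; kring K|rewrite !mulf_neq0].
have two (k1 k2 k3 : K) : k1 != 0 -> k1 * k2 * k3 = 0 -> k2 = 0 \/ k3 = 0.
  by move=> n /eqP; rewrite !mulf_eq0 (negbTE n) /= => /orP[]/eqP; [left|right].
apply/and4P; split; apply/negP => /eqP h; move: E; rewrite /conic_eq h.
- have -> : k * (q2 * (q1 - 0)) + l * (q1 * (q2 - 0)) = (k + l) * q1 * q2 by kring K.
  by move=> /(two _ _ _ kl)[]; [exact: o01 h|exact: o02 h].
- have -> : k * (q2 * (0 - q0)) + l * (0 * (q2 - q0)) = - (k * q2 * q0) by kring K.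
  by move=> /eqP; rewrite oppr_eq0 => /eqP/(two _ _ _ k0)[h'|h']; [exact: o12 h h'|exact: o01 h' h].
- have -> : k * (0 * (q1 - q0)) + l * (q1 * (0 - q0)) = - (l * q1 * q0) by kring K.
  by move=> /eqP; rewrite oppr_eq0 => /eqP/(two _ _ _ l0)[h'|h']; [exact: o12 h' h|exact: o02 h' h].
- have -> : k * (q2 * (q1 - q1)) + l * (q1 * (q2 - q1)) = l * q1 * (q2 - q1) by kring K.
  move=> /(two _ _ _ l0)[h'|/eqP]; first exact: (o01 (etrans h h') h').
  by rewrite subr_eq0 => /eqP h'; exact: (oo h (etrans h (esym h'))).
Qed.

Lemma br_lines r0 r1 r2 : let x := pt r0 r1 r2 in
  [/\ br b c x = al * br a b c * r0, br a c x = - be * br a b c * r1 & br a b x = ga * br a b c * r2] /\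
  [/\ br c d x = al * be * br a b c * (r1 - r0), br b d x = - al * ga * br a b c * (r2 - r0) &
      br a d x = be * ga * br a b c * (r2 - r1)].
Proof. by rewrite /= /pt dE /br !coE; split; split; kring K. Qed.

Lemma spans_Ucurve A r r' s m m' : Udom r s != 0 -> Udom r' s != 0 -> m != 0 -> m' != 0 ->
  spans A (tau3 (m *: Ucurve r s)) (tau3 (m' *: Ucurve r' s)) -> ruled_pairs Udom G A.
Proof.
move=> h h' m0 m'0 sA; have [_ _ AE] := sA; have sne := spans_neq sA.
have nzo := tau_off_neq0 infK char0 t_gt0 t_le4 tauP gpz.
have nz r1 s1 : Udom r1 s1 != 0 -> G r1 s1 != 0 by move=> /off_Ucurve; exact: nzo.
rewrite !(tau_diagZ tauP) -!/(G _ _) in AE sne.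
rewrite !PtZ ?expf_neq0 ?nz // in AE sne.
exists r, r', s; split=> //; last exact: (Spans (nz _ _ h) (nz _ _ h') AE).
by apply/negP => /eqP E; apply: sne; rewrite E.
Qed.

(** Move x to X s in a general direction and take the member of the pencil through X s. Its second
    intersection Y s with the line from the base point e to x' tends to x', because the polar of e
    is nonzero at x'. For general s the pair X s, Y s belongs to the parametrized family. *)
Lemma U_limit A x (x' : V) e k l : off x -> off x' -> spans A (tau3 x) (tau3 x') ->
  (k != 0) || (l != 0) -> member a b c d k l x = 0 -> member a b c d k l x' = 0 ->
  e \in [:: a; b; c] -> member_polar a b c d k l e x' != 0 -> closure (ruled_pairs Udom G) A.
Proof.
move=> ox ox' sA kl hx hx' he hP; have [[g4 cov] sA1] := (fr, subalg_polyfun K).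
have [abc' abd acd bcd] := g4.
have [|g hg] := @avoid_lines K infK [:: (a, b); (a, c); (b, c); (a, d); (b, d); (c, d)].
  have [f1 f2 f3] := br_neq0_free abc'; have [f4 f5 f6] := br_neq0_free bcd.
  have [_ f7 _] := br_neq0_free abd.
  by move=> p; rewrite !inE => /or4P[/eqP->|/eqP->|/eqP->|/or3P[]/eqP->].
pose X s := x + s *: g; have rX : regular polyfun X by exact: regular_line.
pose ks s := pencil2 a b c d (X s); pose ls s := - pencil1 a b c d (X s).
have pk : polyfun ks by rewrite /ks /pencil2; regular_tac sA1.
have pl : polyfun ls by rewrite /ls /pencil1; regular_tac sA1.
pose P s := member_polar a b c d (ks s) (ls s) e x'.
pose Q s := member a b c d (ks s) (ls s) x'.
pose Y s := Q s *: e + (- P s) *: x'.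
have pP : polyfun P by apply: regular_member_polar => //; exact: regular_cst.
have pQ : polyfun Q by apply: regular_member => //; exact: regular_cst.
have rY : regular polyfun Y by rewrite /Y; regular_tac sA1.
have X0 : X 0 = x by rewrite /X scale0r addr0.
have [m [kE lE]] : exists m, k = m * ks 0 /\ l = m * ls 0.
  rewrite /ks /ls X0; have [fa fb fc fd] := frame_free4 ox.
  move: hx; rewrite /member => hx.
  case: (pencil_base g4 fa fb fc fd) => [p1|p2]; rewrite -/(pencil1 a b c d x) -/(pencil2 a b c d x).
    rewrite -/(pencil1 a b c d x) in p1; exists (- l / pencil1 a b c d x); split.
      apply: (mulIf p1); rewrite mulrAC divfK //; apply/eqP; rewrite -subr_eq0; apply/eqP.
      by rewrite -[RHS]hx; kring K.
    by rewrite mulrN divfK // opprK.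
  rewrite -/(pencil2 a b c d x) in p2; exists (k / pencil2 a b c d x); split; first by rewrite divfK.
  apply: (mulIf p2); rewrite mulrAC divfK //; apply/eqP; rewrite -subr_eq0; apply/eqP.
  by rewrite -[RHS]hx; kring K.
have m0 : m != 0.
  by apply/negP => /eqP m0; move: kl; rewrite kE lE m0 !mul0r eqxx.
have Q0 : Q 0 = 0.
  by apply: (mulfI m0); rewrite mulr0 -[RHS]hx' /Q /member kE lE; kring K.
have P0 : P 0 != 0.
  have E : member_polar a b c d k l e x' = m * P 0 by rewrite /P /member_polar kE lE; kring K.
  by apply: contraNneq hP => P0; rewrite E P0 mulr0.
have apo := approaches_off infK char0 t_gt0 t_le4 tauP gpz.
have nzo := tau_off_neq0 infK char0 t_gt0 t_le4 tauP gpz.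
have := apo _ rX; rewrite X0 => /(_ ox) h1.
have := apo _ rY; have -> : Y 0 = - P 0 *: x' by rewrite /Y Q0 scale0r add0r.
have nP0 : - P 0 != 0 by rewrite oppr_eq0.
move=> /(_ (offZ nP0 ox')); rewrite (tau_diagZ tauP) PtZ ?expf_neq0 ?nzo // => h2.
have [_ _ AE] := sA.
apply: (closure_pair infK char0 t_gt0 t_le4 tauP gpz (@closed_closure _ _) h1 h2 AE).
have gen u v : (u, v) \in [:: (a, b); (a, c); (b, c); (a, d); (b, d); (c, d)] ->
    generic (fun s => br u v (X s) != 0).
  move=> /hg /= guv; have pb : polyfun (fun s => br u v (X s)) by regular_tac sA1.
  have [bx|bx] := eqVneq (br u v x) 0.
    by apply: (generic_neq0 (s0 := 1) pb); rewrite /X scale1r brD3 bx add0r.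
  by apply: (generic_neq0 (s0 := 0) pb); rewrite X0.
have g1 := gen a b (mem_head _ _).
have g2 : generic (fun s => br a c (X s) != 0) by apply: gen; rewrite !inE eqxx !orbT.
have g3 : generic (fun s => br b c (X s) != 0) by apply: gen; rewrite !inE eqxx !orbT.
have g4' : generic (fun s => br a d (X s) != 0) by apply: gen; rewrite !inE eqxx !orbT.
have g5 : generic (fun s => br b d (X s) != 0) by apply: gen; rewrite !inE eqxx !orbT.
have g6 : generic (fun s => br c d (X s) != 0) by apply: gen; rewrite !inE eqxx !orbT.
apply: genericW (genericI (genericI g1 (genericI g2 g3)) (genericI g4' (genericI g5 g6))) _.
move=> s [[b1 [b2 b3]] [b4 [b5 b6]]] o1 o2 A' sA'; apply: subset_closure.
have [r0 [r1 [r2 XE]]] := pt_ex (X s); have [q0 [q1 [q2 YE]]] := pt_ex (Y s).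
have [[E3 E2 E1] [E6 E5 E4]] := br_lines r0 r1 r2.
rewrite XE in b1 b2 b3 b4 b5 b6.
have nzr (k1 k2 : K) : k1 * k2 != 0 -> k2 != 0 by apply: contraNneq => ->; rewrite mulr0.
have n0 : r0 != 0 by move: b3; rewrite E3; exact: nzr.
have n1 : r1 != 0 by move: b2; rewrite E2; exact: nzr.
have n2 : r2 != 0 by move: b1; rewrite E1; exact: nzr.
have n10 : r1 - r0 != 0 by move: b6; rewrite E6; exact: nzr.
have n20 : r2 - r0 != 0 by move: b5; rewrite E5; exact: nzr.
have n21 : r2 - r1 != 0 by move: b4; rewrite E4; exact: nzr.
have ksE : ks s = M * (r1 * (r2 - r0)) by rewrite /ks XE pencil2_pt.
have lsE : ls s = - (M * (r2 * (r1 - r0))) by rewrite /ls XE pencil1_pt.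
have kl' : (ks s != 0) || (ls s != 0) by rewrite ksE !mulf_neq0.
have cX : conic_eq (ks s) (ls s) r0 r1 r2 = 0 by rewrite ksE lsE /conic_eq; kring K.
have cY : conic_eq (ks s) (ls s) q0 q1 q2 = 0.
  apply: (mulfI M0); rewrite mulr0 -member_pt -YE /Y (quad2 char0 (memberP a b c d _ _)).
  rewrite member_base; last first.
    by move: he; rewrite !inE => /or3P[]/eqP->; [exact: Or41|exact: Or42|exact: Or43].
  by rewrite -/(P s) -/(Q s); kring K.
have nX : Unice r0 r1 r2 by apply/and4P; split=> //; rewrite -subr_eq0 -opprB oppr_eq0.
have nY : Unice q0 q1 q2.
  by apply: (Unice_member _ ksE lsE _ _ cY) => //; rewrite -YE.
have [r [mx [mx0 hr rE]]] := Unice_Ucurve kl' nX cX.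
have [r' [my [my0 hr' rE']]] := Unice_Ucurve kl' nY cY.
rewrite XE YE rE rE' in sA'.
exact: spans_Ucurve hr hr' mx0 my0 sA'.
Qed.

(** Pairs of U outside the family are reached by [U_limit], moving either point; [pencil_two_nodes]
    provides the base point from which to project. *)
Lemma component_U : irreducible_set (closure2 z phi Uset) /\
  has_dim (closure2 z phi Uset) 3.
Proof.
have nzo := tau_off_neq0 infK char0 t_gt0 t_le4 tauP gpz.
have rx (W : Type) (A : set (W -> K)) f g : subalg A -> A f -> A g ->
    regular A (fun s => Ucurve (f s) (g s)).
  move=> sA Af Ag; have A1 := subalg_cst sA (1 : K); rewrite /Ucurve /pt.
  have p1 : A (fun s => f s + 1) by exact: (subalg_add sA).
  have p2 : A (fun s => f s + g s) by exact: (subalg_add sA).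
  by regular_tac sA.
have ph : bipoly Udom.
  apply: bipoly_regular => W A f g sA Af Ag; have A1 := subalg_cst sA (1 : K).
  apply: (subalg_mul sA); last exact: (subalg_add sA).
  by apply: (subalg_mul sA) => //; exact: (subalg_add sA).
have pG k : bipoly (fun r s => G r s 0 k).
  by apply: bipoly_regular => W A f g sA Af Ag; apply: (regular_tau tauP sA); exact: rx.
have nz r s : Udom r s != 0 -> G r s != 0 by move=> /off_Ucurve; exact: nzo.
have injG r r' s : Udom r s != 0 -> Udom r' s != 0 -> r != r' -> Pt (G r s) <> Pt (G r' s).
  move=> h h' /eqP rr'; have [o o'] := (off_Ucurve h, off_Ucurve h').
  move=> /(tau_inj infK char0 t_gt0 t_le4 tauP gpz o o').
  move=> /(Pt_eqP (off_neq0 t_gt0 o) (off_neq0 t_gt0 o'))[k].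
  by move=> /(Ucurve_inj h h').
have h10 : Udom 1 0 != 0.
  by apply: (@eq_neq0 _ 2%:R); [rewrite /Udom; kring K|exact: char0 1].
have h11 : Udom 1 1 != 0.
  by apply: (@eq_neq0 _ 4%:R); [rewrite /Udom; kring K|exact: char0 3].
(* The member with s = 0 is the line pair ac, bd. A cubic containing it is the hyperplane that
   singles out this curve. *)
have [|l [lE _ _]] := three_lines char0 tauP (k1 := brv a c) (k2 := brv b d) (k3 := brv a c).
  move=> j; rewrite !lf_brv; have [_ cov] := fr.
  by case: (cov j) => ->; rewrite ?br_uwu ?br_ww ?mulr0 ?mul0r.
have l0 r : lf l (G r 0) = 0.
  rewrite lE !lf_brv -/(pencil2 a b c d _) pencil2_pt; kring K.
have l1 : lf l (G 1 1) != 0.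
  rewrite lE !lf_brv; have : pencil2 a b c d (Ucurve 1 1) != 0.
    rewrite pencil2_pt mulf_neq0 //; apply: (@eq_neq0 _ (- 4%:R)); first by kring K.
    by rewrite oppr_eq0; exact: char0 3.
  by rewrite /pencil2 mulf_eq0 negb_or => /andP[u1 u2]; rewrite !mulf_neq0.
have UP := UsetP infK char0 t_gt0 t_le4 tauP gpz phiE.
apply: (ruled_pairs_dim infK ph pG nz injG h10 h11 l0 l1) => A.
  move=> [r [r' [s [h h' _ sA]]]]; have UA : Uset A.
    apply/UP; exists (Ucurve r s), (Ucurve r' s); split=> //; [exact: off_Ucurve|exact: off_Ucurve|].
    by apply: (member_on_conic char0 fr (k := - s) (l := 1)); rewrite ?Ucurve_member ?oner_neq0 ?orbT.
  split; last exact: subset_closure.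
  exact: (off_pair_in infK char0 t_gt0 t_le4 tauP gpz phiE (proj1 (UP _) UA)).
move=> [_]; apply: (closure_min (@closed_closure _ _)) => {}A.
move=> /UP[x [x' [ox ox' sA [Q [fQ [u Qu] Qz Qx Qx']]]]].
have [P qP] := form2_quadratic fQ.
have Qe e : e \in [:: a; b; c; d] -> Q e = 0 by move=> /frz[i ->].
have [g4 _] := fr; have [k [l' QE]] := pencil_comb char0 g4 qP (Qe a (mem_head _ _))
  (Qe b ltac:(by rewrite !inE eqxx !orbT)) (Qe c ltac:(by rewrite !inE eqxx !orbT))
  (Qe d ltac:(by rewrite !inE eqxx !orbT)).
have kl : (k != 0) || (l' != 0).
  rewrite -negb_and; apply: contraNN Qu => /andP[/eqP k0 /eqP l'0].
  by rewrite QE k0 l'0 !mul0r addr0.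
have mx : member a b c d k l' x = 0 by rewrite /member -QE.
have mx' : member a b c d k l' x' = 0 by rewrite /member -QE.
have fx := spans_free infK char0 t_gt0 t_le4 tauP gpz ox ox' sA.
have B := @member_base K a b c d k l'.
apply: contrapT => nA.
apply: (pencil_two_nodes char0 (memberP a b c d k l') g4 (B a (Or41 _ _ _ erefl))
  (B b (Or42 _ _ _ erefl)) (B c (Or43 _ _ _ erefl)) (B d (Or44 _ _ _ erefl)) _ fx).
  exact: (pencil_neq0 char0 g4 kl).
move=> e he; split; apply: contrapT => /eqP hP; apply: nA.
  exact: U_limit ox' ox (spansC sA) kl mx' mx he hP.
exact: U_limit ox ox' sA kl mx mx' he hP.
Qed.

(** An explicit pair on the conic s = 2 that is collinear with no base point and off the lines ab
    and cd, so that each separating set excludes it. *)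
Lemma U_not_Y : exists2 A, Uset A & forall j, ~ closure (Yset j) A.
Proof.
pose x := Ucurve 1 2%:R; pose x' := Ucurve 2%:R 2%:R.
have hx : Udom 1 2%:R != 0.
  by apply: (@eq_neq0 _ 6%:R); [rewrite /Udom; kring K|exact: char0 5].
have hx' : Udom 2%:R 2%:R != 0.
  by apply: (@eq_neq0 _ 24%:R); [rewrite /Udom; kring K|exact: char0 23].
have [ox ox'] := (off_Ucurve hx, off_Ucurve hx').
have [aE bE cE dE'] := base_pt.
have nz : al * be * ga * br a b c != 0 by rewrite !mulf_neq0.
have hbr e : e \in [:: a; b; c; d] -> br e x x' != 0.
  rewrite !inE => /or4P[]/eqP->; [rewrite aE|rewrite bE|rewrite cE|rewrite dE'];
    rewrite ?brZ1 br_pt ?mulf_neq0 ?Vn0 //.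
  - by apply: (@eq_neq0 _ 2%:R); [kring K|exact: char0 1].
  - by apply: (@eq_neq0 _ (- 12%:R)); [kring K|rewrite oppr_eq0; exact: char0 11].
  - by apply: (@eq_neq0 _ 12%:R); [kring K|exact: char0 11].
  - by apply: (@eq_neq0 _ 2%:R); [kring K|exact: char0 1].
have [_ _ fx] := br_neq0_free (hbr a (mem_head _ _)).
have [A sA] := spans_off infK char0 t_gt0 t_le4 tauP gpz ox ox' fx.
have UA : Uset A.
  apply/(UsetP infK char0 t_gt0 t_le4 tauP gpz phiE); exists x, x'; split=> //.
  by apply: (member_on_conic char0 fr (k := - 2%:R) (l := 1)); rewrite ?Ucurve_member ?oner_neq0 ?orbT.
exists A => // j; have [c1 _] := frame_conics fr; have [_ cov] := fr.
have [C [cC YC nC _]] := separating_set infK char0 t_gt0 t_le4 tauP gpz phiE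
  (j := j) (k1 := brv a b) (k2 := brv c d) (fun i _ => c1 i).
have q1 : lf (brv a b) x * lf (brv c d) x != 0.
  rewrite !lf_brv -/(pencil1 a b c d x) pencil1_pt mulf_neq0 //.
  by apply: (@eq_neq0 _ (- 6%:R)); [kring K|rewrite oppr_eq0; exact: char0 5].
have q2 : lf (brv a b) x' * lf (brv c d) x' != 0.
  rewrite !lf_brv -/(pencil1 a b c d x') pencil1_pt mulf_neq0 //.
  by apply: (@eq_neq0 _ (- 24%:R)); [kring K|rewrite oppr_eq0; exact: char0 23].
have hj : br (pvec (z j)) x x' != 0.
  by apply: hbr; case: (cov j) => ->; rewrite !inE eqxx ?orbT.
by move=> /(closure_min cC YC); exact: nC sA hj q1 q2.
Qed.

End Frame.

Lemma conic_component : [/\ irreducible_set (closure2 z phi Uset),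
  has_dim (closure2 z phi Uset) 3 & exists2 A, Uset A & forall j, ~ closure (Yset j) A].
Proof.
have [a [b [c [d [fr frz]]]]] := frame4; have [[abc abd acd bcd] _] := fr.
have [k [l [m dE]]] := cramer_coord d abc.
have k0 : k != 0.
  by apply: contraNneq bcd => k0; rewrite dE k0 !brE !mulr0 !mul0r !addr0.
have l0 : l != 0.
  by apply: contraNneq acd => l0; rewrite dE l0 !brE !mulr0 !mul0r !addr0.
have m0 : m != 0.
  by apply: contraNneq abd => m0; rewrite dE m0 !brE !mulr0 !mul0r !addr0.
have [irr dim] := component_U fr frz dE k0 l0 m0.
by split=> //; exact: (U_not_Y fr dE k0 l0 m0).
Qed.

End ConicComponent.

(** * Irreducible components of the Terracini locus *)

Lemma card_eq_finType (I : finType) : ([set: I] #= `I_#|I|)%card.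
Proof.
have <- : (fun i : I => enum_rank i : nat) @` setT = `I_#|I|.
  apply/seteqP; split=> [_ [i _ <-] /=|k /= hk]; first exact: ltn_ord.
  by exists (enum_val (Ordinal hk)) => //; rewrite enum_valK.
rewrite card_eq_sym; apply: inj_card_eq => i j _ _ /= /val_inj.
exact: enum_rank_inj.
Qed.

Lemma card_range (I : finType) (T : Type) (F : I -> T) : injective F ->
  (range F #= `I_#|I|)%card.
Proof.
move=> injF; apply: card_eq_trans (card_eq_finType I).
by apply: inj_card_eq => i j _ _; exact: injF.
Qed.

(** Putting the irreducible set B on top of a longest chain of A lengthens it. So inclusion in one
    direction need not be refuted by a second separating set when both sets have the same
    dimension. *)
Lemma has_dim_proper (T : topologicalType) (A B : set T) d : irreducible_set B ->
  A = B `&` closure A -> ~ (B `<=` A) -> has_dim A d -> ~ has_dim B d.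
Proof.
move=> irrB AE nBA dA dB; have [c [hc lc]] := proj2 (dA d) (leqnn _).
suff : (d.+1 <= d)%N by rewrite ltnn.
apply/dB; exists (fun k => if (k <= d)%N then c k else B).
have cA k : (k <= d)%N -> c k `<=` A by move=> /hc[_ ->] y [].
have AB : A `<=` B by rewrite AE => y [].
split=> [k _|k kd].
  case: ifP => [kd|_].
    have [irr cE] := hc k kd; split=> //; apply/seteqP; split=> y.
      by move=> cy; split; [exact/AB/(cA k kd)|exact: subset_closure].
    move=> [By cy]; rewrite cE; split=> //; rewrite AE; split=> //.
    by apply: closure_subset cy; exact: cA.
  by split=> //; apply/seteqP; split=> y; [move=> By; split=> //; exact: subset_closure|case].
rewrite -ltnS kd; case: ifP => [k1d|/negbT]; first exact: lc.
rewrite -ltnNge ltnS => dk; have kE : k = d by apply/eqP; rewrite eqn_leq dk andbT -ltnS.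
split; first by apply: subset_trans AB; apply: cA; rewrite kE.
by move=> BC; apply: nBA => y /BC; apply: cA; rewrite kE.
Qed.

Section Components.
Variable K : fieldType.
Hypothesis infK : forall s : seq K, exists x, x \notin s.
Hypothesis char0 : forall n, n.+1%:R != 0 :> K.
Variables (t N : nat) (z : 'I_t -> projsp K 2) (phi : N.+1.-tuple (dhomog 3 K 3)).
Variable tau : 'rV[K]_3 -> 'rV[K]_3 -> 'rV[K]_3 -> 'rV[K]_N.+1.
Hypotheses (t_gt0 : (0 < t)%N) (t_le4 : (t <= 4)%N).
Local Notation zv := (fun i => pvec (z i)).
Hypotheses (tauP : cubic_map zv tau) (gpz : gp zv)
  (phiE : forall x : 'rV[K]_3, \row_j meval (x 0) (tnth phi j) = tau x x x).
Local Notation V := 'rV[K]_3.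
Implicit Types (u v w x : V) (y : 'rV[K]_N.+1).
Add Ring K_ring : (kring_theory K).

Local Notation off := (off z).
Local Notation X := (del_pezzo z phi).
Local Notation tau3 x := (tau x x x).
Local Notation Yset i := (Yset z phi i).
Local Notation Uset := (Uset z phi).
Local Notation E i := (exceptional z phi i).
Local Notation Ter := (terracini 2 X).

Lemma Y_line_pair i w (P : V -> Prop) : free2 (pvec (z i)) w ->
  generic (fun s => P (pvec (z i) + s *: w)) -> exists A s1 s2,
  let x s := pvec (z i) + s *: w in
  [/\ Yset i A, spans A (tau3 (x s1)) (tau3 (x s2)), s2 - s1 != 0,
      off (x s1) /\ off (x s2) & P (x s1) /\ P (x s2)].
Proof.
move=> fw gP; have go := generic_off_line gpz fw; set a := pvec (z i) in fw gP go *.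
have [s1 [o1 P1]] := generic_ex infK (genericI go gP).
have [s2 [[o2 P2] s12]] := generic_ex infK (genericI (genericI go gP) (generic_neq s1)).
have s120 : s2 - s1 != 0 by rewrite subr_eq0.
have fx : free2 (a + s1 *: w) (a + s2 *: w).
  have [u hu] := fw; exists u.
  have -> : br (a + s1 *: w) (a + s2 *: w) u = (s2 - s1) * br a w u by rewrite /br !coE; kring K.
  exact: mulf_neq0.
have [A sA] := spans_off infK char0 t_gt0 t_le4 tauP gpz o1 o2 fx.
exists A, s1, s2; split=> //.
apply/(YsetP infK char0 t_gt0 t_le4 tauP gpz phiE); exists (a + s1 *: w), (a + s2 *: w).
by split=> //; rewrite -/a /br !coE; kring K.
Qed.

(** Two general points on a general line through z_i are not collinear with z_j, and the separating
    set of z_j excludes their pair. *)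
Lemma Y_not_Y i j : i != j -> ~ (closure2 z phi (Yset i) `<=` closure2 z phi (Yset j)).
Proof.
move=> ij; have [k1 [k2 [n1 n2 hk]]] := exc_conic infK t_gt0 t_le4 gpz j.
have [u hu] := gp_free2 gpz ij; have sA1 := subalg_polyfun K.
set a := pvec (z i) in hu; set b := pvec (z j) in n1 n2 hu.
have gk (k : 'cV[K]_3) (v v' : V) : lf k v != 0 \/ lf k v' != 0 -> generic (fun r => lf k (v + r *: v') != 0).
  move=> h; have pb : polyfun (fun r => lf k (v + r *: v')) by regular_tac sA1.
  have [v0|v0] := eqVneq (lf k v) 0.
    apply: (generic_neq0 (s0 := 1) pb); rewrite scale1r lfD v0 add0r.
    by case: h => //; rewrite v0 eqxx.
  by apply: (generic_neq0 (s0 := 0) pb); rewrite scale0r addr0.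
(* The direction w is taken close to z_j, where k1 and k2 are nonzero, but off the line z_i z_j. *)
have [r [r0 [w1 w2]]] := generic_ex infK (genericI (generic_neq 0)
  (genericI (gk k1 b u (or_introl n1)) (gk k2 b u (or_introl n2)))).
set w := b + r *: u in w1 w2.
have hw : br a b w != 0 by rewrite /w brD3 br_ww add0r brZ3 mulf_neq0.
have [_ fw _] := br_neq0_free hw.
have gP : generic (fun s => lf k1 (a + s *: w) != 0 /\ lf k2 (a + s *: w) != 0).
  by apply: genericI; apply: gk; right.
have [A [s1 [s2 [YA sA s12 [o1 o2] [[p1 p2] [q1 q2]]]]]] :=
  Y_line_pair (P := fun v => lf k1 v != 0 /\ lf k2 v != 0) fw gP.
have [C [cC YC nC _]] := separating_set infK char0 t_gt0 t_le4 tauP gpz phiE hk.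
have YP := YsetP infK char0 t_gt0 t_le4 tauP gpz phiE.
have XA := off_pair_in infK char0 t_gt0 t_le4 tauP gpz phiE (proj1 (YP _ _) YA).
move=> /(_ A)[]; first by split=> //; exact: subset_closure.
move=> _ /(closure_min cC YC); apply: (nC _ _ _ sA); rewrite ?mulf_neq0 //.
have -> : br b (a + s1 *: w) (a + s2 *: w) = (s1 - s2) * br a b w by rewrite /br !coE; kring K.
by rewrite mulf_neq0 // -opprB oppr_eq0.
Qed.

Lemma closure2_relative (S : set (uset K N 2)) (S' : set (uset K N 2)) :
  closure2 z phi S `<=` S' -> S' `<=` usets_in 2 X ->
  closure2 z phi S = S' `&` closure (closure2 z phi S).
Proof.
move=> SS' S'X; apply/seteqP; split=> A.
  by move=> SA; split; [exact: SS'|exact: subset_closure].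
move=> [S'A cA]; split; first exact: S'X.
by apply: (closure_min (@closed_closure _ S)) cA => B [].
Qed.

Lemma Ter_X : Ter `<=` usets_in 2 X.
Proof.
by move=> A; rewrite (terraciniE infK char0 t_gt0 t_le4 tauP gpz phiE) => -[].
Qed.

Local Notation cY := (component_Y infK char0 t_gt0 t_le4 tauP gpz phiE).

Lemma components23 : (2 <= t <= 3)%N -> irr_component Ter = range (fun i => closure2 z phi (Yset i)).
Proof.
move=> t23; have TE := terracini23 infK char0 t_gt0 t_le4 tauP gpz phiE t23.
apply: irr_component_finite => //.
- by move=> i; exact: (proj1 (cY i)).
- move=> i; apply: closure2_relative; last exact: Ter_X.
  by rewrite TE => A hA; exists i.
- by move=> i j sub; apply: contrapT => /eqP ij; exact: Y_not_Y ij sub.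
Qed.

Lemma closure2_inj : injective (fun i => closure2 z phi (Yset i)).
Proof.
move=> i j /= Eij; apply: contrapT => /eqP ij; apply: (Y_not_Y ij).
by rewrite Eij.
Qed.

Definition component4 (o : option 'I_t) : set (uset K N 2) :=
  if o is Some i then closure2 z phi (Yset i) else closure2 z phi Uset.

Lemma components4 : t = 4%N -> (N <= 5)%N -> [/\ irr_component Ter = range component4,
  injective component4 & forall o, has_dim (component4 o) 3].
Proof.
move=> t4 N5; have TE := terracini4 infK char0 t_gt0 t_le4 tauP gpz phiE t4 N5.
have [irrU dimU [A UA nA]] := conic_component infK char0 t_gt0 t_le4 tauP gpz phiE t4.
have UX : closure2 z phi Uset A.
  split; last exact: subset_closure.
  have UP := UsetP infK char0 t_gt0 t_le4 tauP gpz phiE.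
  exact: (off_pair_in infK char0 t_gt0 t_le4 tauP gpz phiE (proj1 (UP _) UA)).
have irr o : irreducible_set (component4 o) by case: o => [i|//]; exact: (proj1 (cY i)).
have dim o : has_dim (component4 o) 3 by case: o => [i|//]; exact: (proj2 (cY i)).
have sub o : component4 o `<=` Ter.
  by rewrite TE; case: o => [i|] B hB; [left; exists i|right].
have rel o : component4 o = Ter `&` closure (component4 o).
  by case: o (sub o) => [i|] h; apply: closure2_relative => //; exact: Ter_X.
have nincl i : ~ (component4 None `<=` component4 (Some i)).
  by move=> /(_ A UX)[_]; exact: nA.
(* An irreducible set of dimension 3 is not properly contained, as a closed subset, in
   another one. *)
have ninclY i : ~ (component4 (Some i) `<=` component4 None).
  move=> h; apply: (has_dim_proper irrU _ (nincl i) (proj2 (cY i)) dimU).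
  by apply: closure2_relative => // B [].
split=> //; last first.
  move=> [i|] [j|] //= H; first by congr Some; exact: closure2_inj H.
    by case: (nincl i); rewrite /= H.
  by case: (nincl j); rewrite /= H.
apply: irr_component_finite => //.
  rewrite TE; apply/seteqP; split=> B.
    by case=> [[i _ Bi]|Bu]; [exists (Some i)|exists None].
  by move=> [[i|] _ Bo]; [left; exists i|right].
move=> [i|] [j|] // h; [|by case: (ninclY i)|by case: (nincl j)].
by congr Some; apply: contrapT => /eqP ij; exact: Y_not_Y ij h.
Qed.

(** E_i is a line, and k |-> tau a a (u + k v) parametrizes all of it except one point. Pairs
    involving the missing point are limits, obtained by moving the directions along u. *)
Lemma component_E i : irreducible_set (usets_in 2 (E i)) /\ has_dim (usets_in 2 (E i)) 2.
Proof.
set a := pvec (z i); have [u [v huv]] := free2_ex (pvec_neq0 (z i)); rewrite -/a in huv.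
have [fu _ _] := br_neq0_free huv; have sA1 := subalg_polyfun K; have pv := polyfun_var K.
pose G k := tau a a (u + k *: v).
have nze := tau_exc_neq0 infK char0 t_gt0 t_le4 tauP gpz.
have eP := exceptionalP infK char0 t_gt0 t_le4 tauP gpz phiE i.
have fG k : free2 a (u + k *: v) by exists v; rewrite !brE mulr0 addr0.
have rG : regular polyfun G.
  by apply: (regular_tau tauP sA1); regular_tac sA1.
have nz k : (1 : K) != 0 -> G k != 0 by move=> _; exact: nze.
have injG k l : (1 : K) != 0 -> (1 : K) != 0 -> k != l -> Pt (G k) <> Pt (G l).
  move=> one0 _ kl /(Pt_eqP (nz k one0) (nz l one0))[m].
  rewrite -(tauZ3 tauP) => H; have H0 : tau a a ((1 - m) *: u + (l - m * k) *: v) = 0.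
    rewrite (_ : _ + _ = u + l *: v + (-1) *: (m *: (u + k *: v))).
      by rewrite (tauD3 tauP) (tauZ3 tauP) -H scaleN1r subrr.
    by apply: row3P; rewrite !coE; kring K.
  have nf : ~ free2 a ((1 - m) *: u + (l - m * k) *: v) by move=> /nze; rewrite H0 eqxx.
  have h1 : 1 - m = 0.
    apply: contrapT => /eqP h; apply: nf; exists v; by rewrite !brE mulr0 addr0 mulf_neq0.
  have h2 : l - m * k = 0.
    apply: contrapT => /eqP h; apply: nf; exists u; rewrite !brE mulr0 add0r mulf_neq0 //.
    by rewrite brC23 oppr_eq0.
  case/negP: kl; apply/eqP; move/eqP: h1; rewrite subr_eq0 => /eqP m1.
  by move/eqP: h2; rewrite -m1 mul1r subr_eq0 => /eqP.
apply: (curve_pairs_dim infK (h := fun=> 1) (a0 := 0) (subalg_cst sA1 1) rG nz injG (oner_neq0 K)) => A.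
  by move=> [k [l [_ _ _ sA]]]; apply/(usets_inP _ sA); split; apply/eP;
    [exact: (ex_intro2 _ _ _ (fG k) erefl)|exact: (ex_intro2 _ _ _ (fG l) erefl)].
move=> EA; have [y1 [y2 sA]] := spansP A; have [E1 E2] := proj1 (usets_inP _ sA) EA.
have [w fw p1] := proj1 (eP _) E1; have [w' fw' p2] := proj1 (eP _) E2.
have [_ _ AE] := sA; rewrite p1 p2 in AE.
pose x s := w + s *: u; pose x' s := w' + s *: u.
have rx : regular polyfun x by exact: regular_line.
have rx' : regular polyfun x' by exact: regular_line.
have rt (y : K -> V) : regular polyfun y -> regular polyfun (fun s => tau a a (y s)).
  by move=> ry; apply: (regular_tau tauP sA1) => //; exact: (regular_cst sA1 a).
have sA0 : spans A (tau a a (x 0)) (tau a a (x' 0)).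
  rewrite /x /x' scale0r !addr0; exact: (Spans (nze _ _ fw) (nze _ _ fw') AE).
apply: (curve_usets infK (@closed_closure _ _) (rt _ rx) (rt _ rx') sA0).
have gen (m : V) : generic (fun s => br a (m + s *: u) v != 0).
  have pb : polyfun (fun s => br a (m + s *: u) v) by regular_tac sA1.
  have [b0|b0] := eqVneq (br a m v) 0.
    by apply: (generic_neq0 (s0 := 1) pb); rewrite scale1r brD2 b0 add0r.
  by apply: (generic_neq0 (s0 := 0) pb); rewrite scale0r addr0.
apply: genericW (genericI (gen w) (gen w')) _ => s [g1 g2] A' sA'; apply: subset_closure.
have key (m : V) : br a m v != 0 -> exists k, Pt (tau a a m) = Pt (G k).
  move=> hm; have [e1 [e2 [e3 mE]]] := cramer_coord m huv.
  have e20 : e2 != 0.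
    by apply: contraNneq hm => e20; rewrite mE e20 !brE !mulr0 !mul0r !addr0.
  exists (e3 / e2); have -> : tau a a m = e2 *: G (e3 / e2).
    rewrite /G -(tauZ3 tauP) scalerDr scalerA [e2 * _]mulrC divfK // mE -addrA (tauD3 tauP).
    by rewrite (tauZ3 tauP) (tau_z tauP) scaler0 add0r.
  by rewrite PtZ // nz ?oner_neq0.
have [k kE] := key _ g1; have [l lE] := key _ g2.
have [_ _ AE'] := sA'; have sne := spans_neq sA'; rewrite kE lE in AE' sne.
exists k, l; split; try exact: oner_neq0.
  by apply/negP => /eqP kl; apply: sne; rewrite kl.
exact: (Spans (nz k (oner_neq0 K)) (nz l (oner_neq0 K)) AE').
Qed.

(** The pair of two independent directions lies outside the separating set of z_i, hence outside the
    closure of Y_i; a pair of Y_i contains no exceptional point. *)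
Lemma components1 i : t = 1%N ->
  irr_component Ter = [set closure2 z phi (Yset i); usets_in 2 (E i)].
Proof.
move=> t1; have TE := terracini1 infK char0 t_gt0 t_le4 tauP gpz phiE i t1.
have [k1 [k2 [n1 n2 hk]]] := exc_conic infK t_gt0 t_le4 gpz i.
have [C [cC YC _ nC]] := separating_set infK char0 t_gt0 t_le4 tauP gpz phiE hk.
have [u [v huv]] := free2_ex (pvec_neq0 (z i)); have [fu fv _] := br_neq0_free huv.
have nze := tau_exc_neq0 infK char0 t_gt0 t_le4 tauP gpz.
have cE := closed_exceptional infK char0 t_gt0 t_le4 tauP gpz phiE (i := i).
have cEE := closed_usets_in cE.
have EX : usets_in 2 (E i) `<=` usets_in 2 X.
  by move=> A EA; have [] := E_degenerate infK char0 t_gt0 t_le4 tauP gpz phiE EA.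
have nE : ~ (usets_in 2 (E i) `<=` closure2 z phi (Yset i)).
  have huv' : Pt (tau (pvec (z i)) (pvec (z i)) u) <> Pt (tau (pvec (z i)) (pvec (z i)) v).
    move=> /(Pt_eqP (nze _ _ fu) (nze _ _ fv))[m H].
    have f : free2 (pvec (z i)) (v + - m *: u).
      by exists u; rewrite !brE mulr0 addr0 brC23 oppr_eq0.
    by have := nze _ _ f; rewrite (tauD3 tauP) (tauZ3 tauP) scaleNr -H subrr eqxx.
  have [A sA] := spans_ex (nze _ _ fu) (nze _ _ fv) huv'.
  move=> /(_ A)[].
    apply/(usets_inP _ sA); split; apply/(exceptionalP infK char0 t_gt0 t_le4 tauP gpz phiE).
      by exists u.
    by exists v.
  move=> _ /(closure_min cC YC); apply: (nC _ _ _ _ _ sA) => //.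
  exact: mulf_neq0.
have nY : ~ (closure2 z phi (Yset i) `<=` usets_in 2 (E i)).
  have [A [s1 [s2 [YA sA _ [o1 o2] _]]]] := Y_line_pair (P := fun=> True) fu (genericT (fun=> Logic.I)).
  have YP := YsetP infK char0 t_gt0 t_le4 tauP gpz phiE.
  have XA := off_pair_in infK char0 t_gt0 t_le4 tauP gpz phiE (proj1 (YP _ _) YA).
  move=> /(_ A (conj XA (subset_closure YA))) /(usets_inP _ sA)[/(exceptionalP infK char0 t_gt0 t_le4 tauP gpz phiE)[w fw H] _].
  exact: (off_exc_neq infK char0 t_gt0 t_le4 tauP gpz o1 fw H).
pose F (b : bool) := if b then closure2 z phi (Yset i) else usets_in 2 (E i).
have -> : [set closure2 z phi (Yset i); usets_in 2 (E i)] = range F.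
  by apply/seteqP; split=> [B [->|->]|_ [[|] _ <-]]; [exists true|exists false|left|right].
apply: irr_component_finite.
- by rewrite TE; apply/seteqP; split=> [A [hA|hA]|A [[|] _ hA]]; [exists true|exists false|left|right].
- by case; [exact: (proj1 (cY i))|exact: (proj1 (component_E i))].
- case; first by apply: closure2_relative; [rewrite TE => A; left|exact: Ter_X].
  rewrite /F -(proj1 (closure_id _) cEE); apply/seteqP; split=> [A EA|A [] //].
  by split=> //; rewrite TE; right.
- by case; case.
Qed.

End Components.

(** * General points *)

Lemma mform_br (K : fieldType) (I : finType) (i j k : I) :
  exists d, mform d (fun u : vecs K (fun _ : I => 2%N) => br (u i) (u j) (u k)).
Proof.
pose c m e : mform _ (fun u : vecs K (fun _ : I => 2%N) => u m 0 e) :=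
  @mform_coord K I (fun _ : I => 2%N) m e.
eexists; apply: mform_add; first apply: mform_sub.
- exact: mform_mul (c i e0) (mform_sub (mform_mul (c j e1) (c k e2)) (mform_mul (c j e2) (c k e1))).
- exact: mform_mul (c i e1) (mform_sub (mform_mul (c j e0) (c k e2)) (mform_mul (c j e2) (c k e0))).
- exact: mform_mul (c i e2) (mform_sub (mform_mul (c j e0) (c k e1)) (mform_mul (c j e1) (c k e0))).
Qed.

Section GeneralPoints.
Variables (K : fieldType) (t : nat).
Hypothesis infK : forall s : seq K, exists x, x \notin s.

(** The meaning of general. Distinctness of the points comes from the injectivity of z; for t <= 2
    this set is the whole product. *)
Definition no_three_collinear : set (mproj K (fun _ : 'I_t => 2%N)) := [set z |
  forall i j k, i != j -> i != k -> j != k -> br (pvec (z i)) (pvec (z j)) (pvec (z k)) != 0].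

Lemma open_no_three_collinear : open no_three_collinear.
Proof.
pose F (s : 'I_t * 'I_t * 'I_t) : set (mproj K (fun _ : 'I_t => 2%N)) :=
  if [&& s.1.1 != s.1.2, s.1.1 != s.2 & s.1.2 != s.2]
  then [set z | br (pvec (z s.1.1)) (pvec (z s.1.2)) (pvec (z s.2)) = 0] else set0.
have -> : no_three_collinear = ~` (\bigcup_s F s).
  apply/seteqP; split=> z.
    move=> hz [[[i j] k] _]; rewrite /F /=; case: ifP => // /and3P[ij ik jk] /eqP.
    by apply/negP; exact: hz.
  move=> hz i j k ij ik jk; apply/negP => /eqP h; apply: hz; exists (i, j, k) => //.
  by rewrite /F /= ij ik jk.
apply: closed_openC; apply: closed_bigcup => [|[[i j] k] _]; first exact: finite_finset.
rewrite /F /=; case: ifP => _; last exact: closed0.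
have [d mb] := mform_br K i j k; exact: closed_mform mb.
Qed.

Lemma no_three_collinear_ex : (t <= 4)%N -> no_three_collinear !=set0.
Proof.
move=> t4; have x0 : const_mx 1 != 0 :> 'rV[K]_3 by exact: const1_neq0.
have g1 : gp (fun _ : 'I_1 => const_mx 1 : 'rV[K]_3).
  by split=> [//|i j|i j k]; rewrite !ord1 eqxx.
have [//|e [[e0 _ eB] _ _]] := @frame_exists K infK 1 _ [::] isT isT g1.
exists (fun i => Pt (e (widen_ord t4 i))) => i j k ij ik jk.
have [m m0 ->] := pvec_Pt (e0 (widen_ord t4 i)).
have [m' m'0 ->] := pvec_Pt (e0 (widen_ord t4 j)).
have [m'' m''0 ->] := pvec_Pt (e0 (widen_ord t4 k)).
by rewrite brZ1 brZ2 brZ3 !mulf_neq0 // eB.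
Qed.

Lemma gp_no_three_collinear (z : mproj K (fun _ : 'I_t => 2%N)) :
  no_three_collinear z -> injective z -> gp (fun i => pvec (z i)).
Proof.
move=> hz injz; split=> [i|i j ij|]; [exact: pvec_neq0| |exact: hz].
apply: neq_free2; [exact: pvec_neq0|exact: pvec_neq0|].
by rewrite !PtK => /injz /eqP; apply/negP.
Qed.

End GeneralPoints.

Lemma char0_infinite (K : fieldType) : (forall n, n.+1%:R != 0 :> K) ->
  forall s : seq K, exists x, x \notin s.
Proof.
move=> char0 s.
have inj (m n : nat) : (m <= n)%N -> m%:R = n%:R :> K -> m = n.
  move=> mn /esym/eqP; rewrite -subr_eq0 -natrB // => h; apply/eqP; rewrite eqn_leq mn /=.
  by rewrite -subn_eq0; case: (n - m)%N h => // k; rewrite (negbTE (char0 k)).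
pose r := [seq (i%:R : K) | i <- iota 0 (size s).+1].
have ur : uniq r.
  rewrite map_inj_uniq ?iota_uniq // => m n E.
  by have [mn|/ltnW nm] := leqP m n; [exact: inj|apply/esym/inj].
apply: contrapT => h; have : {subset r <= s}.
  by move=> x _; apply: contrapT => /negP xs; apply: h; exists x.
by move=> /(uniq_leq_size ur); rewrite size_map size_iota ltnn.
Qed.

Theorem proposition5p8 (K : closedFieldType) (charK : [pchar K] =i pred0)
    (t : nat) (t_range : (1 <= t <= 4)%N) :
  exists O : set (mproj K (fun _ : 'I_t => 2%N)),
    [/\ open O, O !=set0 &
    forall z : mproj K (fun _ : 'I_t => 2%N), O z -> injective z ->
    forall phi : ((9 - t).+1).-tuple (dhomog 3 K 3),
      basis_of (forms_through 3 (codom z)) phi ->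
    let X := del_pezzo z phi in
    let E := exceptional z phi in
    let Ybar i := closure2 z phi (Yset z phi i) in
    let Ubar := closure2 z phi (Uset z phi) in
    let Ter := terracini 2 X in
    [/\ (forall i : 'I_t, t = 1%N ->
           Ter = Ybar i `|` usets_in 2 (E i) /\
           exists C D, [/\ irr_component Ter = [set C; D],
                           has_dim C 3 & has_dim D 2]),
        (t = 2%N \/ t = 3%N ->
           [/\ Ter = \bigcup_i Ybar i,
               (irr_component Ter #= `I_t)%card &
               forall C, irr_component Ter C -> has_dim C 3]) &
        (t = 4%N ->
           [/\ Ter = (\bigcup_i Ybar i) `|` Ubar,
               (irr_component Ter #= `I_5)%card &
               forall C, irr_component Ter C -> has_dim C 3])]].
Proof.
have char0 n : n.+1%:R != 0 :> K by rewrite (proj1 (pcharf0P K) charK).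
have infK := char0_infinite char0.
have /andP[t_gt0 t_le4] := t_range.
exists (@no_three_collinear K t); split.
- exact: open_no_three_collinear.
- exact: no_three_collinear_ex.
move=> z hz injz phi bphi X E Ybar Ubar Ter.
have gpz := gp_no_three_collinear hz injz.
have [tau tauP phiE] := cubic_map_exists char0 bphi.
have cY i := component_Y infK char0 t_gt0 t_le4 tauP gpz phiE i.
split.
- move=> i t1; split; first exact: (terracini1 infK char0 t_gt0 t_le4 tauP gpz phiE i t1).
  exists (Ybar i), (usets_in 2 (E i)); split.
  + exact: (components1 infK char0 t_gt0 t_le4 tauP gpz phiE i t1).
  + exact: (proj2 (cY i)).
  + exact: (proj2 (component_E infK char0 t_gt0 t_le4 tauP gpz phiE i)).
- move=> t23; have {}t23 : (2 <= t <= 3)%N by case: t23 => ->.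
  have TE := terracini23 infK char0 t_gt0 t_le4 tauP gpz phiE t23.
  have CE := components23 infK char0 t_gt0 t_le4 tauP gpz phiE t23.
  split=> //; rewrite CE.
    have := card_range (closure2_inj infK char0 t_gt0 t_le4 tauP gpz phiE).
    by rewrite card_ord.
  by move=> _ [i _ <-]; exact: (proj2 (cY i)).
(* For t = 4 the surface spans P^5, where two planes in a common hyperplane meet. *)
- move=> t4; have N5 : (9 - t <= 5)%N by rewrite t4.
  have TE := terracini4 infK char0 t_gt0 t_le4 tauP gpz phiE t4 N5.
  have [CE inj dim] := components4 infK char0 t_gt0 t_le4 tauP gpz phiE t4 N5.
  split=> //; rewrite CE; last by move=> _ [o _ <-]; exact: dim.
  have c5 : #|{: option 'I_t}| = 5%N by rewrite card_option card_ord t4.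
  by have := card_range inj; rewrite c5.
Qed.
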